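(* Let $R\in C_b(\mathbb{R}_T)$ be such that for every $t\in[0,T]$, $R(t,\cdot)$ is the distribution function of a probability measure $\gamma(t)$, with $\gamma\in C([0,T],M_1(\mathbb{R}))$. Suppose $R$ is a generalized solution of $R_t=(A(R)R_x)_x+h\,A(R)R_x$ with $R(0,\cdot)=F_{\rho_0}$, where $A$ and $\rho_0$ satisfy Assumption 2 below and $h$ is a function on $\mathbb{R}_T$ with $\int_{\mathbb{R}_T}h^2(t,x)\,\mathrm{d}\gamma(t)\,\mathrm{d}t<\infty$. If in addition $\int_{\mathbb{R}_T}|x|^{1+\iota}\,\mathrm{d}\gamma(t)\,\mathrm{d}t<\infty$ for some $\iota\in(0,1)$, then for all $\frac65\le q\le\frac32$: $R_t,R_{xx}\in L^q(\mathbb{R}_T)$, $R_x\in L^3(\mathbb{R}_T)$, $\int_{\mathbb{R}_T}\frac{R_{xx}^2}{R_x}\,\mathrm{d}m<\infty$, $\int_{\mathbb{R}_T}\frac{R_t^2}{R_x}\,\mathrm{d}m<\infty$, and $\int_{\mathbb{R}_T}|x|^{1+\iota}R_x\,\mathrm{d}m<\infty$.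
   Context: $T>0$, $\mathbb{R}_T=[0,T]\times\mathbb{R}$, $m$ Lebesgue measure on $\mathbb{R}_T$; $M_1(\mathbb{R})$ probability measures on $\mathbb{R}$ with the topology of weak convergence; $F_\alpha$ the distribution function of $\alpha$; $(\alpha,f)=\int f\,\mathrm{d}\alpha$. $\overline{\mathcal S}$ = infinitely differentiable $g$ on $\mathbb{R}_T$ with each $g(t,\cdot)$ Schwartz. Derivatives are weak; $\frac00=0$. Assumption 2: $A:[0,1]\to(0,\infty)$ is strictly positive, continuously differentiable with Lipschitz derivative; $\rho_0\in M_1(\mathbb{R})$ has a continuously differentiable density $\theta$ with $\theta\in L^3(\mathbb{R})$, $\frac{F_{\rho_0}^2}{\theta}\mathbf 1_{(-\infty,0]},\frac{(1-F_{\rho_0})^2}{\theta}\mathbf 1_{(0,\infty)},\frac{(\theta')^2}{\theta}\in L^1(\mathbb{R})$, $\int|x|\,\mathrm{d}\rho_0<\infty$. Generalized solution: for all $g\in\overline{\mathcal S}$ and $t\in[0,T]$, $(\gamma(t),g(t,\cdot))-(\gamma(0),g(0,\cdot))-\int_0^t(\gamma(s),g_t(s,\cdot)+A(R(s,\cdot))g_{xx}(s,\cdot))\,\mathrm{d}s=-\int_0^t(\gamma(s),h(s,\cdot)A(R(s,\cdot))g_x(s,\cdot))\,\mathrm{d}s$. *)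

(* Defs.v *)
From HB Require Import structures.
From mathcomp Require Import all_boot all_order all_algebra.
From mathcomp Require Import all_classical all_reals all_analysis.
Set Implicit Arguments. Unset Strict Implicit. Unset Printing Implicit Defensive.
Import Order.TTheory GRing.Theory Num.Theory.
Import numFieldNormedType.Exports.
Local Open Scope classical_set_scope.
Local Open Scope ring_scope.

Definition p_leb (R : realType) := (@lebesgue_measure R).
Arguments p_leb R : clear implicits.
Definition p_m2 (R : realType) := (p_leb R \x p_leb R)%E.
Arguments p_m2 R : clear implicits.

Definition p_RT (R : realType) (T : R) : set (R * R) := [set p | 0 <= p.1 <= T].
Definition p_RTo (R : realType) (T : R) : set (R * R) := [set p | 0 < p.1 < T].

Definition p_dt (R : realType) (g : R * R -> R) : R * R -> R :=
  fun p => derive1 (fun s => g (s, p.2)) p.1.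
Definition p_dx (R : realType) (g : R * R -> R) : R * R -> R :=
  fun p => derive1 (fun y => g (p.1, y)) p.2.
Definition p_dpart (R : realType) (b : bool) (g : R * R -> R) :=
  if b then p_dt g else p_dx g.
Definition p_iterd (R : realType) (w : seq bool) (g : R * R -> R) :=
  foldr (@p_dpart R) g w.

Definition p_smooth2 (R : realType) (g : R * R -> R) :=
  forall w : seq bool, continuous (p_iterd w g) /\
    forall p : R * R, derivable (fun s => p_iterd w g (s, p.2)) p.1 1 /\
                      derivable (fun y => p_iterd w g (p.1, y)) p.2 1.

Definition p_Sbar (R : realType) (T : R) (g : R * R -> R) :=
  p_smooth2 g /\
  forall t, 0 <= t <= T -> forall m n : nat, exists C : R, forall x : R,
    `|x ^+ m * p_iterd (nseq n false) g (t, x)| <= C.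

Definition p_distfun (R : realType) (mu : probability R R) (x : R) : R :=
  fine (mu [set y | y <= x]).

Definition p_pairing (R : realType) (mu : probability R R) (f : R -> R) : \bar R :=
  (\int[mu]_x (f x)%:E)%E.

Definition p_weak_cont (R : realType) (T : R) (gamma : R -> probability R R) :=
  forall f : R -> R, continuous f -> (exists M : R, forall x, `|f x| <= M) ->
    {within [set t | 0 <= t <= T],
      continuous (fun t => fine (p_pairing (gamma t) f))}.

Definition p_ratio (R : realType) (a b : R) : \bar R :=
  if b == 0 then (if a == 0 then 0%E else +oo%E) else (a / b)%:E.

Definition p_assumption2 (R : realType) (A : R -> R) (rho0 : probability R R)
    (theta : R -> R) :=
  (forall y, 0 <= y <= 1 -> 0 < A y) /\
  (exists A' : R -> R,
     (forall y, 0 <= y <= 1 ->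
        (fun z => (A z - A y) / (z - y)) @ within [set z | 0 <= z <= 1 /\ z != y] (nbhs y)
          --> A' y) /\
     exists L : R, forall y z, 0 <= y <= 1 -> 0 <= z <= 1 ->
        `|A' y - A' z| <= L * `|y - z|) /\
  (forall B, measurable B -> rho0 B = (\int[p_leb R]_(x in B) (theta x)%:E)%E) /\
  (forall x, derivable theta x 1) /\ continuous ((derive1 theta)) /\
  (\int[p_leb R]_x (`|theta x| `^ 3%:R)%:E < +oo)%E /\
  (\int[p_leb R]_(x in [set x : R | (x <= 0)%R]) p_ratio (p_distfun rho0 x ^+ 2)%R (theta x) < +oo)%E /\
  (\int[p_leb R]_(x in [set x : R | (0 < x)%R]) p_ratio ((1 - p_distfun rho0 x) ^+ 2)%R (theta x) < +oo)%E /\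
  (\int[p_leb R]_x p_ratio ((derive1 theta) x ^+ 2)%R (theta x) < +oo)%E /\
  (\int[rho0]_x (`|x|)%:E < +oo)%E.

Definition p_gen_solution (R : realType) (T : R) (A : R -> R) (U : R * R -> R)
    (gamma : R -> probability R R) (h : R * R -> R) :=
  forall g, p_Sbar T g -> forall t, 0 <= t <= T ->
    (p_pairing (gamma t) (fun x => g (t, x)) - p_pairing (gamma 0%R) (fun x => g (0%R, x))
     - \int[p_leb R]_(s in [set s : R | (0 <= s <= t)%R])
          p_pairing (gamma s) (fun x => p_dt g (s, x) + A (U (s, x)) * p_dx (p_dx g) (s, x))%R
     = - \int[p_leb R]_(s in [set s : R | (0 <= s <= t)%R])
          p_pairing (gamma s) (fun x => h (s, x) * A (U (s, x)) * p_dx g (s, x))%R)%E.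

Definition p_testfun (R : realType) (T : R) (phi : R * R -> R) :=
  p_smooth2 phi /\ exists K : set (R * R),
    compact K /\ K `<=` p_RTo T /\ forall p, ~ K p -> phi p = 0.

Definition p_locint (R : realType) (T : R) (f : R * R -> R) :=
  measurable_fun (p_RTo T) f /\
  forall K : set (R * R), compact K -> K `<=` p_RTo T ->
    (\int[p_m2 R]_(p in K) (`|f p|)%:E < +oo)%E.

Definition p_weak_dt (R : realType) (T : R) (f G : R * R -> R) :=
  p_locint T f /\ p_locint T G /\ forall phi, p_testfun T phi ->
    (\int[p_m2 R]_(p in p_RTo T) (f p * p_dt phi p)%R%:E
       = - \int[p_m2 R]_(p in p_RTo T) (G p * phi p)%R%:E)%E.
Definition p_weak_dx (R : realType) (T : R) (f G : R * R -> R) :=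
  p_locint T f /\ p_locint T G /\ forall phi, p_testfun T phi ->
    (\int[p_m2 R]_(p in p_RTo T) (f p * p_dx phi p)%R%:E
       = - \int[p_m2 R]_(p in p_RTo T) (G p * phi p)%R%:E)%E.

Definition p_inLq (R : realType) (T : R) (q : R) (G : R * R -> R) :=
  measurable_fun (p_RTo T) G /\
  (\int[p_m2 R]_(p in p_RTo T) (`|G p| `^ q)%:E < +oo)%E.

(* Main.v *)
Require Import Defs.
From HB Require Import structures.
From mathcomp Require Import all_boot all_order all_algebra.
From mathcomp Require Import all_classical all_reals all_analysis.
From mathcomp Require Import measurable_realfun ring lra.
Set Implicit Arguments. Unset Strict Implicit. Unset Printing Implicit Defensive.
Import Order.TTheory GRing.Theory Num.Theory.
Import numFieldNormedType.Exports.
Local Open Scope classical_set_scope.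
Local Open Scope ring_scope.

(* Mollify gamma(t) at scale 1/b with the kernel (b/2)/cosh^2(b x): since these kernels are Schwartz
   functions, the mollified densities P satisfy an evolution equation P_t = (W + F)_x, where W comes
   from A(R) and F from h. Integrating the convex function u |-> (u+d) ln((u+d)/d) - u of P over space
   bounds the time integral of the regularized Fisher information int (P_x)^2/(P+d), uniformly in b and d.
   The error made in replacing W by A(R) P_x is cubic in the density; it is absorbed because R is
   uniformly continuous, so that windows of a fixed small length carry uniformly little mass. The
   entropy is bounded below at time T by the first moment, and above at time 0 by int theta^2.

   For almost every t, the limit b -> oo, d -> 0 along a subsequence gives a density p(t,.) = R_x(t,.)
   in L^3 with (int psi_x p)^2 <= K(t) int psi^2 p and K integrable. The map psi |-> - int psi_x p is
   therefore bounded in terms of sqrt(p) psi in L^2, which by duality yields z in L^2 with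
   R_xx = sqrt(p) z. Testing with A(R) phi then gives R_t = A(R) R_xx + A'(R) p^2 + h A(R) p, which is
   again sqrt(p) times a function of L^2, and the L^q bounds follow from Young's inequality. *)

(** * Schwartz kernels built from tanh and log cosh *)

(** The obstacle is criticality. Since A depends on R, the commutator W - A(R) P_x is governed by
    the oscillation of R over one mollification length, hence by the density itself; its square
    divided by P has the size of the cubed density, which scales exactly like the Fisher
    information. Powers of b cancel (b^2 from differentiating the kernel, b^-2 from the
    oscillation), so no choice of scale makes the error small. The only small parameter is the mass
    eta of windows of length l: it enters the bound on the integral of P^3 as the coefficient 2 (eta
    + d l) eta of the information. The subsequence along which the information stays bounded depends
    on t, so no joint limit of the derivatives P_x is available. What survives at each time is an
    inequality between integrals of p against smooth functions; these inequalities are glued over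
    time by one representation theorem on the plane. The mollified densities are only absolutely
    continuous in time, which is why the entropy is estimated through a convexity inequality along
    the curve and not by differentiating it. *)

Section Kernels.
Context {R : realType}.
Implicit Types (a b x : R) (P : {poly R}).

(* [th] and [lch] are tanh and log cosh. Writing derivatives as polynomials in [th] makes the family
   [ker a P] for fixed [a] closed under differentiation (see [dker]). *)
Definition ch x : R := (expR x + expR (- x)) / 2.
Definition th x : R := (expR x - expR (- x)) / (expR x + expR (- x)).
Definition lch x : R := ln (ch x).
Definition ker a P x : R := P.[th x] * expR (- (a * lch x)).
Definition dker a P : {poly R} := (1 - 'X^2) * P^`() - a *: ('X * P).

Lemma expRN_prod x : expR x * expR (- x) = 1.
Proof. by rewrite -expRD subrr expR0. Qed.

Lemma ch_gt0 x : 0 < ch x.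
Proof. by rewrite /ch; have := expR_gt0 x; have := expR_gt0 (- x); lra. Qed.

Lemma ch_ge1 x : 1 <= ch x.
Proof.
rewrite /ch; have := expR_gt0 x; have := expR_gt0 (- x).
have := expRN_prod x; set u := expR x; set v := expR (- x) => uv v0 u0.
have : 0 <= (u - v) ^+ 2 by apply: sqr_ge0.
nra.
Qed.

Lemma lch_ge0 x : 0 <= lch x.
Proof. by rewrite /lch ln_ge0// ch_ge1. Qed.

Lemma is_derive_ch x : is_derive x 1 ch (ch x * th x).
Proof.
have -> : ch = (fun x => 2^-1 * (expR x + (expR \o -%R) x)).
  by apply/funext => y; rewrite /ch /= mulrC.
have h : is_derive x 1 (expR \o -%R) (expR (- x) * -1).
  by apply: is_derive1_comp.
apply: is_derive_eq.
rewrite /GRing.scale /= /th /ch; have := expR_gt0 x; have := expR_gt0 (- x).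
by move=> ? ?; field; lra.
Qed.

Lemma is_derive_lch x : is_derive x 1 lch (th x).
Proof.
have h1 := is_derive_ch x.
have h2 : is_derive (ch x) 1 (@ln R) (ch x)^-1 by apply: is_derive1_ln; exact: ch_gt0.
have -> : th x = (ch x)^-1 * (ch x * th x).
  by rewrite mulrA mulVf ?mul1r// gt_eqF// ch_gt0.
exact: is_derive1_comp.
Qed.

Lemma th_sqr_lt1 x : th x ^+ 2 < 1.
Proof.
rewrite /th expr_div_n ltr_pdivrMr; last first.
  by apply: exprn_gt0; have := expR_gt0 x; have := expR_gt0 (- x); lra.
have := expR_gt0 x; have := expR_gt0 (- x); nra.
Qed.

Lemma th_norm_lt1 x : `|th x| < 1.
Proof. by rewrite -(@ltr_pXn2r _ 2)// ?nnegrE// expr1n real_normK ?num_real// th_sqr_lt1. Qed.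

Lemma th_gt_lt x : -1 < th x < 1.
Proof. by have := th_norm_lt1 x; rewrite ltr_norml. Qed.

Lemma is_derive_th x : is_derive x 1 th (1 - th x ^+ 2).
Proof.
have -> : th = (fun x => (expR x - (expR \o -%R) x) * (fun y => (expR y + (expR \o -%R) y)^-1) x).
  by apply/funext => y; rewrite /th /=.
have h : is_derive x 1 (expR \o -%R) (expR (- x) * -1).
  by apply: is_derive1_comp.
have D0 : expR x + (expR \o -%R) x != 0.
  by rewrite /= gt_eqF// addr_gt0// expR_gt0.
have hV : is_derive x 1 (fun y => (expR y + (expR \o -%R) y)^-1)
   (- (expR x + expR (- x)) ^- 2 *: (expR x + expR (- x) * -1)).
  exact: is_deriveV.
apply: is_derive_eq; rewrite /GRing.scale/=.
rewrite -/(th x) /th; rewrite /= in D0.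
by field.
Qed.

Lemma is_derive_ker a P x : is_derive x 1 (ker a P) (ker a (dker a P) x).
Proof.
have h1 : is_derive x 1 (horner P \o th) (P^`().[th x] * (1 - th x ^+ 2)).
  by have ht := is_derive_th x; exact: is_derive1_comp.
have h2 : is_derive x 1 (fun x => - (a * lch x)) (- (a *: th x)).
  have hl := is_derive_lch x.
  exact: (is_deriveN (is_deriveZ a hl)).
have h3 : is_derive x 1 (expR \o (fun x => - (a * lch x)))
   (expR (- (a * lch x)) * - (a *: th x)).
  exact: is_derive1_comp.
have -> : ker a P = (horner P \o th) * (expR \o (fun x => - (a * lch x))) by [].
apply: is_derive_eq; rewrite /GRing.scale /= /ker /dker !hornerE /=; ring.
Qed.

Lemma lch_ge x : `|x| - ln 2 <= lch x.
Proof.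
rewrite /lch -[X in X - _]expRK -ln_div ?posrE ?expR_gt0 ?ltr0n//.
rewrite ler_ln ?posrE ?ch_gt0 ?divr_gt0 ?expR_gt0 ?ltr0n//.
by rewrite /ch; have := expR_gt0 x; have := expR_gt0 (- x); case: (ger0P x) => _; lra.
Qed.

Lemma lch_le x : lch x <= `|x|.
Proof.
rewrite /lch -[leRHS]expRK ler_ln ?posrE ?expR_gt0 ?ch_gt0//.
rewrite /ch; have := expR_gt0 x; have := expR_gt0 (- x).
have h1 : expR x <= expR `|x| by rewrite ler_expR ler_norm.
have h2 : expR (- x) <= expR `|x| by rewrite ler_expR -normrN ler_norm.
lra.
Qed.

Lemma poly_bound P : exists C : R, forall x, `|P.[th x]| <= C.
Proof.
exists (\sum_(i < size P) `|P`_i|) => x.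
rewrite horner_coef (le_trans (ler_norm_sum _ _ _))// ler_sum// => i _.
by rewrite normrM ler_piMr// normrX exprn_ile1// ltW// th_norm_lt1.
Qed.

Lemma pow_le_expR (m : nat) (u : R) : 0 <= u -> u ^+ m <= m`!%:R * expR u.
Proof.
move=> u0; case: m => [|m].
  by rewrite expr0 fact0 mul1r -expR0 ler_expR.
have := expR_ge1Dxn m u0; rewrite -lerBrDl => h.
rewrite mulrC -ler_pdivrMr ?ltr0n ?fact_gt0//; lra.
Qed.

Lemma pow_expR_bound (c : R) (m : nat) : 0 < c ->
  exists C : R, forall x, `|x| ^+ m * expR (- (c * `|x|)) <= C.
Proof.
move=> c0; exists (m`!%:R / c ^+ m) => x.
rewrite expRN ler_pdivrMr ?expR_gt0// mulrAC ler_pdivlMr ?exprn_gt0//.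
by rewrite -exprMn mulrC mulrC [`|x| * c]mulrC pow_le_expR// mulr_ge0// ltW.
Qed.

Lemma ker_bound a P : 0 < a -> forall m : nat, exists C : R, forall x, `|x ^+ m * ker a P x| <= C.
Proof.
move=> a0 m; have [C hC] := poly_bound P.
have [D hD] := pow_expR_bound m a0.
exists (C * (D * expR (a * ln 2))) => x.
rewrite /ker normrM normrX normrM mulrCA.
apply: ler_pM; rewrite ?mulr_ge0 ?hC// ?exprn_ge0//.
rewrite [`|expR _|]ger0_norm ?expR_ge0//.
apply: le_trans (_ : `|x| ^+ m * (expR (- (a * `|x|)) * expR (a * ln 2)) <= _).
  rewrite ler_wpM2l ?exprn_ge0// -expRD ler_expR.
  have : a * (`|x| - ln 2) <= a * lch x by rewrite ler_wpM2l ?lch_ge// ltW.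
  rewrite mulrBr; lra.
by rewrite mulrA ler_wpM2r ?expR_ge0.
Qed.

Lemma is_derive_derive1 (f : R -> R) x d : is_derive x 1 f d -> derive1 f x = d.
Proof. by move=> h; rewrite derive1E derive_val. Qed.

Lemma derivable_is_derive1 (f : R -> R) x : derivable f x 1 -> is_derive x 1 f (derive1 f x).
Proof. by move=> h; rewrite derive1E; exact: derivableP. Qed.

Lemma is_derive_cont (f f' : R -> R) : (forall x, is_derive x 1 f (f' x)) -> continuous f.
Proof.
move=> h x; apply: differentiable_continuous.
by apply/derivable1_diffP; have [] := h x.
Qed.

Lemma is_derive_aff (f f' : R -> R) (b x y : R) :
  (forall u : R, is_derive u 1 f (f' u)) ->
  is_derive y 1 (fun y : R => f (b * (x - y))) (- b * f' (b * (x - y))).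
Proof.
move=> h.
have h1 : is_derive y 1 (fun y => b * (x - y)) (- b).
  have : is_derive y 1 (b *: (cst x - id)) (- b).
    by apply: is_derive_eq; rewrite /GRing.scale /=; ring.
  by [].
have := h (b * (x - y)) => h2.
rewrite mulrC.
exact: (@is_derive1_comp _ f (fun y => b * (x - y)) y).
Qed.

(** The test functions inserted in the equation: [x] is the point at which the mollification is
    evaluated, [q.2] the variable of integration. Independence of time kills the term g_t. *)
Definition kt a P b x : R * R -> R := fun q => ker a P (b * (x - q.2)).

Lemma is_derive_kt a P b x (s y : R) :
  is_derive y 1 (fun y : R => kt a P b x (s, y)) (kt a (- b *: dker a P) b x (s, y)).
Proof.
have h := @is_derive_aff (ker a P) (ker a (dker a P)) b x y (is_derive_ker a P).
have -> : kt a (- b *: dker a P) b x (s, y) = - b * ker a (dker a P) (b * (x - y)).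
  by rewrite /kt /ker hornerZ mulrA.
exact: h.
Qed.

Lemma p_dx_kt a P b x : p_dx (kt a P b x) = kt a (- b *: dker a P) b x.
Proof.
apply/funext => -[s y]; rewrite /p_dx /=.
exact/is_derive_derive1/is_derive_kt.
Qed.

Lemma p_dt_kt a P b x : p_dt (kt a P b x) = kt a 0 b x.
Proof.
apply/funext => -[s y]; rewrite /p_dt /kt/=.
apply: is_derive_derive1; apply: is_derive_eq.
by rewrite /ker horner0 mul0r.
Qed.

Lemma kt0 a b x q : kt a 0 b x q = 0.
Proof. by rewrite /kt /ker horner0 mul0r. Qed.

(** Only the existence of [Q] matters, since the decay bounds hold for every polynomial; a time
    derivative gives the polynomial 0. *)
Lemma p_iterd_kt (w : seq bool) a P b x : exists Q, p_iterd w (kt a P b x) = kt a Q b x.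
Proof.
elim: w => [|c w [Q IH]] /=; first by exists P.
rewrite IH; case: c => /=; [rewrite p_dt_kt|rewrite p_dx_kt]; by eexists.
Qed.

Lemma continuous_ker a P : continuous (ker a P).
Proof. exact: (is_derive_cont (is_derive_ker a P)). Qed.

Lemma continuous_kt a P b x : continuous (kt a P b x).
Proof.
move=> q; rewrite /kt.
apply: (@continuous_comp _ _ _ (fun q : R * R => b * (x - q.2)) (ker a P)); last exact: continuous_ker.
apply: cvgM; first exact: cvg_cst.
apply: cvgB; first exact: cvg_cst.
exact: cvg_snd.
Qed.

Lemma smooth_kt a P b x : p_smooth2 (kt a P b x).
Proof.
move=> w; have [Q ->] := p_iterd_kt w a P b x; split; first exact: continuous_kt.
move=> [s y]; split => /=.
  rewrite /kt/=; exact: derivable_cst.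
by have [] := is_derive_kt a Q b x s y.
Qed.

Lemma Sbar_kt T a P b x : 0 < a -> 0 < b -> p_Sbar T (kt a P b x).
Proof.
move=> a0 b0; split; first exact: smooth_kt.
move=> t _ m n; have [Q ->] := p_iterd_kt (nseq n false) a P b x.
have [C hC] := ker_bound Q a0 0.
have [D hD] := ker_bound Q a0 m.
have C0 : 0 <= C by exact: le_trans (hC 0).
have D0 : 0 <= D by exact: le_trans (hD 0).
exists (2 ^+ m * (`|x| ^+ m * C + D / b ^+ m)) => y; rewrite /kt /=.
set u := b * (x - y).
have yE : y = x - u / b by rewrite /u; field; rewrite gt_eqF.
(* The weight y^m is split into a power of x, constant here, and a power of u, absorbed by
   [ker_bound]; 2^m comes from |y| <= 2 max(|x|, |u|/b). *)
have h1 : `|y| ^+ m <= 2 ^+ m * (`|x| ^+ m + (`|u| / b) ^+ m).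
  have ub : 0 <= `|u| / b by rewrite divr_ge0// ltW.
  have h : `|y| <= 2 * Num.max `|x| (`|u| / b).
    rewrite yE (le_trans (ler_normB _ _))// normrM normfV (gtr0_norm b0).
    have := le_max `|x| `|x| (`|u| / b); rewrite lexx /= => h1.
    have := le_max (`|u| / b) `|x| (`|u| / b); rewrite lexx orbT => h2.
    by rewrite mulr2n mulrDl !mul1r lerD.
  apply: (le_trans (lerXn2r m _ _ h)); rewrite ?nnegrE ?mulr_ge0 ?le_max ?normr_ge0//.
  rewrite exprMn ler_wpM2l ?exprn_ge0//.
  by case: (leP `|x| (`|u| / b)) => _; rewrite ?lerDl ?lerDr exprn_ge0.
rewrite normrM normrX.
apply: (le_trans (ler_wpM2r (normr_ge0 _) h1)).
rewrite -mulrA ler_wpM2l ?exprn_ge0// mulrDl lerD//.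
  rewrite ler_wpM2l ?exprn_ge0//.
  by have := hC u; rewrite expr0 mul1r.
rewrite exprMn mulrAC exprVn ler_pM2r ?invr_gt0 ?exprn_gt0//.
by have := hD u; rewrite normrM normrX.
Qed.

End Kernels.

(** * Real-valued integrals *)

Section RealIntegrals.
Context d (T : measurableType d) {R : realType}.
Variable mu : {measure set T -> \bar R}.
Implicit Types (f g k w : T -> R) (D : set T).

(** A real-valued integral takes the default value 0 when the extended one is infinite, so
    integrability is carried along as a separate fact. *)
Definition intg D f := mu.-integrable D (EFin \o f).

Lemma intg_meas D f : intg D f -> measurable_fun D f.
Proof. by move=> /integrableP[/measurable_EFinP]. Qed.

Lemma intgP D f : measurable_fun D f -> (\int[mu]_(x in D) (`|f x|)%:E < +oo)%E -> intg D f.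
Proof. by move=> mf h; apply/integrableP; split; [exact/measurable_EFinP|]. Qed.

Lemma intg_lty D f : intg D f -> (\int[mu]_(x in D) (`|f x|)%:E < +oo)%E.
Proof. by move=> /integrableP[]. Qed.

Lemma intg_le D f g : measurable D -> measurable_fun D f -> intg D g ->
  (forall x, D x -> `|f x| <= g x) -> intg D f.
Proof.
move=> mD mf ig h; apply: le_integrable ig => //; first exact/measurable_EFinP.
by move=> x Dx; rewrite /= lee_fin (le_trans (h x Dx))// ler_norm.
Qed.

Lemma intgD D f g : measurable D -> intg D f -> intg D g -> intg D (fun x => f x + g x).
Proof. by move=> mD hf hg; exact: (integrableD mD hf hg). Qed.

Lemma intgB D f g : measurable D -> intg D f -> intg D g -> intg D (fun x => f x - g x).
Proof. by move=> mD hf hg; exact: (integrableB mD hf hg). Qed.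

Lemma intgZ D f (c : R) : measurable D -> intg D f -> intg D (fun x => c * f x).
Proof. by move=> mD hf; exact: (integrableZl mD c hf). Qed.

Lemma intg_norm D f : measurable D -> intg D f -> intg D (fun x => `|f x|).
Proof. by move=> mD hf; exact: (integrable_norm hf). Qed.

Lemma intgS E D f : measurable E -> measurable D -> D `<=` E -> intg E f -> intg D f.
Proof. by move=> mE mD h; exact: integrableS. Qed.

Lemma intgM D f g (C : R) : measurable D -> intg D f -> measurable_fun D g ->
  (forall x, D x -> `|g x| <= C) -> intg D (fun x => f x * g x).
Proof.
move=> mD hf mg hg; apply: (@intg_le _ _ (fun x => C * `|f x|)) => //.
- by apply: measurable_funM => //; exact: intg_meas.
- by apply: intgZ => //; exact: intg_norm.
- by move=> x Dx; rewrite normrM mulrC ler_wpM2r ?hg.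
Qed.

Lemma EFin_Rint D f : measurable D -> intg D f ->
  (\int[mu]_(x in D) f x)%:E = (\int[mu]_(x in D) (f x)%:E)%E.
Proof. by move=> mD h; rewrite /Rintegral fineK//; exact: integrable_fin_num. Qed.

Lemma intg_ge0P D f : measurable D -> measurable_fun D f -> (forall x, D x -> 0 <= f x) ->
  (\int[mu]_(x in D) (f x)%:E < +oo)%E -> intg D f.
Proof.
move=> mD mf f0 h; apply: intgP => //.
rewrite (_ : (\int[mu]_(x in D) _)%E = (\int[mu]_(x in D) (f x)%:E)%E)//.
by apply: eq_integral => x /set_mem Dx; rewrite ger0_norm ?f0.
Qed.

Lemma Rint_ge0_le D f (C : R) : measurable D -> measurable_fun D f -> (forall x, D x -> 0 <= f x) ->
  (\int[mu]_(x in D) (f x)%:E <= C%:E)%E -> intg D f /\ \int[mu]_(x in D) f x <= C.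
Proof.
move=> mD mf f0 h.
have hi : intg D f by apply: intg_ge0P => //; exact: le_lt_trans h (ltry _).
by split => //; rewrite -lee_fin EFin_Rint.
Qed.

(** Discriminant of a nonnegative quadratic in [l]; it stands behind all Cauchy-Schwarz inequalities
    below, including the approximate one for near minimizers. *)
Lemma quad_disc (m0 m1 m2 : R) : 0 <= m0 ->
  (forall l : R, 0 <= m2 - 2 * l * m1 + l ^+ 2 * m0) -> m1 ^+ 2 <= m0 * m2.
Proof.
rewrite le_eqVlt => /orP[/eqP<-|m0p] h.
  rewrite mul0r.
  have [->|m1n] := eqVneq m1 0; first by rewrite expr0n.
  (* Without its quadratic term the form is affine in [l]; this [l] makes it equal to -1. *)
  have := h ((m2 + 1) / (2 * m1)); rewrite mulr0 addr0.
  have -> : 2 * ((m2 + 1) / (2 * m1)) * m1 = m2 + 1 by field.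
  lra.
have := h (m1 / m0).
have -> : m2 - 2 * (m1 / m0) * m1 + (m1 / m0) ^+ 2 * m0 = m2 - m1 ^+ 2 / m0.
  by field; rewrite gt_eqF.
by rewrite subr_ge0 ler_pdivrMr// mulrC.
Qed.

(** The nonnegative quadratic in [l] is the integral of (k - l)^2 w. *)
Lemma weighted_CS D k w : measurable D -> measurable_fun D k -> (forall x, D x -> 0 <= w x) ->
  intg D w -> intg D (fun x => k x ^+ 2 * w x) ->
  intg D (fun x => k x * w x) /\
  (\int[mu]_(x in D) (k x * w x)) ^+ 2 <=
    (\int[mu]_(x in D) w x) * (\int[mu]_(x in D) (k x ^+ 2 * w x)).
Proof.
move=> mD mk w0 iw ikw.
have mw := intg_meas iw.
have ik : intg D (fun x => k x * w x).
  apply: (@intg_le _ _ (fun x => w x + k x ^+ 2 * w x)) => //.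
  - exact: measurable_funM.
  - exact: intgD.
  - move=> x Dx; rewrite normrM (ger0_norm (w0 _ Dx)) -{2}[w x]mul1r -mulrDl.
    rewrite ler_wpM2r ?w0// -[k x ^+ 2]real_normK ?num_real//.
    by have := normr_ge0 (k x); nra.
split => //; apply: quad_disc; first exact: Rintegral_ge0.
move=> l.
have -> : (\int[mu]_(x in D) (k x ^+ 2 * w x)) - 2 * l * (\int[mu]_(x in D) (k x * w x)) +
   l ^+ 2 * (\int[mu]_(x in D) w x) = \int[mu]_(x in D) ((k x - l) ^+ 2 * w x).
  rewrite -RintegralZl// -RintegralZl//.
  rewrite -RintegralB//; last exact: intgZ.
  rewrite -RintegralD//; last 2 first.
  - by apply: intgB => //; exact: intgZ.
  - exact: intgZ.
  by apply: eq_Rintegral => x _; ring.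
by apply: Rintegral_ge0 => x Dx; rewrite mulr_ge0 ?sqr_ge0 ?w0.
Qed.

(** The cube lies above its tangent at the mean [s]: k^3 - 3 s^2 k + 2 s^3 = (k - s)^2 (k + 2 s). *)
Lemma Jensen_cube D k (V : R) : measurable D -> 0 < V -> mu D = V%:E ->
  (forall x, D x -> 0 <= k x) -> intg D k -> intg D (fun x => k x ^+ 3) ->
  (\int[mu]_(x in D) k x) ^+ 3 <= V ^+ 2 * \int[mu]_(x in D) (k x ^+ 3).
Proof.
move=> mD V0 muD k0 ik ik3.
set s := (\int[mu]_(x in D) k x) / V.
have s0 : 0 <= s by apply: divr_ge0; [exact: Rintegral_ge0|exact: ltW].
have i1 : intg D (cst 1).
  by apply: measurable_bounded_integrable => //; rewrite ?muD ?ltry//; exact: bounded_cst.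
have h : \int[mu]_(x in D) (3 * s ^+ 2 * k x - 2 * s ^+ 3 * cst 1 x) <= \int[mu]_(x in D) (k x ^+ 3).
  apply: le_Rintegral => //.
    by apply: intgB => //; exact: intgZ.
  move=> x Dx /=; rewrite mulr1.
  have kx := k0 x Dx.
  have : 0 <= (k x - s) ^+ 2 * (k x + 2 * s) by rewrite mulr_ge0 ?sqr_ge0// addr_ge0// mulr_ge0.
  nra.
rewrite RintegralB// in h; [|exact: intgZ..].
rewrite RintegralZl// RintegralZl// Rintegral_cst// muD /= mul1r in h.
have e : \int[mu]_(x in D) k x = s * V by rewrite /s divfK// gt_eqF.
rewrite e in h *; rewrite exprMn.
have -> : s ^+ 3 * V ^+ 3 = V ^+ 2 * (s ^+ 3 * V) by ring.
rewrite ler_wpM2l ?sqr_ge0//; apply: le_trans h.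
by rewrite le_eqVlt; apply/orP; left; apply/eqP; ring.
Qed.

Lemma Rdominated D (f_ : nat -> T -> R) f g : measurable D ->
  (forall n, measurable_fun D (f_ n)) -> measurable_fun D f ->
  (forall x, D x -> f_ n x @[n --> \oo] --> f x) -> intg D g ->
  (forall n x, D x -> `|f_ n x| <= g x) ->
  intg D f /\ \int[mu]_(x in D) f_ n x @[n --> \oo] --> \int[mu]_(x in D) f x.
Proof.
move=> mD mf_ mf cf ig hg.
have i_ n : intg D (f_ n) by apply: (intg_le _ _ ig) => // x; exact: hg.
have m1 n : measurable_fun D (EFin \o f_ n) by exact/measurable_EFinP.
have m2 : measurable_fun D (EFin \o f) by exact/measurable_EFinP.
have c1 : {ae mu, forall x, D x -> (EFin \o f_ n) x @[n --> \oo] --> (EFin \o f) x}.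
  by apply: aeW => x Dx; apply: cvg_EFin; [exact: nearW|exact: cf].
have b1 : {ae mu, forall x n, D x -> (`|(EFin \o f_ n) x| <= (EFin \o g) x)%E}.
  by apply: aeW => x n Dx; rewrite lee_fin hg.
have [ifi _ H] := dominated_convergence mD m1 m2 c1 ig b1.
split => //.
move: H; rewrite /= -(EFin_Rint mD ifi) => /fine_cvg /=.
by [].
Qed.

End RealIntegrals.

Ltac mfun := repeat first [ exact: measurable_cst | assumption | exact: measurable_id
  | apply: measurable_funD | apply: measurable_funB | apply: measurable_funM | apply: measurable_funX
  | apply: measurableT_comp => // | apply: continuous_measurable_fun ].

(** * Fundamental theorem of calculus on segments and on the line *)

Section Line.
Context {R : realType}.
Local Notation leb := (@lebesgue_measure R).

Lemma cvg_eventually (u : nat -> R) (l : R) (N : nat) :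
  (forall n, (N <= n)%N -> u n = l) -> u n @[n --> \oo] --> l.
Proof.
move=> h; apply/cvgrPdist_lt => e e0; exists N => // n /= nN.
by rewrite h// subrr normr0.
Qed.

Lemma derive_LRcont (f f' : R -> R) (a b : R) : (forall x : R, is_derive x 1 f (f' x)) ->
  derivable_oo_LRcontinuous f a b.
Proof.
move=> h; have cf := is_derive_cont h; split.
- by move=> x _; have [] := h x.
- by apply: cvg_at_right_filter; exact: cf.
- by apply: cvg_at_left_filter; exact: cf.
Qed.

Lemma FTC_seg (f f' : R -> R) (a b : R) : (forall x : R, is_derive x 1 f (f' x)) -> continuous f' ->
  a <= b -> intg leb `[a, b] f' /\ \int[leb]_(x in `[a, b]) f' x = f b - f a.
Proof.
move=> h cf'; rewrite le_eqVlt => /orP[/eqP<-|ab].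
  split; last by rewrite set_itv1 Rintegral_set1 subrr.
  apply: continuous_compact_integrable; first exact: segment_compact.
  exact: continuous_subspaceT.
have i : intg leb `[a, b] f'.
  apply: continuous_compact_integrable; first exact: segment_compact.
  exact: continuous_subspaceT.
split => //; rewrite /Rintegral (@continuous_FTC2 _ f' f)//.
- exact: continuous_subspaceT.
- exact: derive_LRcont.
- by move=> x _; exact: is_derive_derive1.
Qed.

(** Nonnegativity of f' allows monotone convergence along [-n, n], so integrability is a
    consequence; [int_line] is the signed version and assumes it. *)
Lemma int_line_ge0 (f f' : R -> R) (lp lm : R) : (forall x : R, is_derive x 1 f (f' x)) ->
  continuous f' -> (forall x, 0 <= f' x) ->
  f n%:R @[n --> \oo] --> lp -> f (- n%:R) @[n --> \oo] --> lm ->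
  (\int[leb]_x (f' x)%:E = (lp - lm)%:E)%E.
Proof.
move=> h cf' f0 hp hm.
have mf' : measurable_fun setT (EFin \o f').
  by apply/measurable_EFinP; exact: continuous_measurable_fun.
pose A (n : nat) : set R := `[- n%:R, n%:R]%classic.
have hA : \bigcup_n A n = setT.
  apply/seteqP; split => // x _; exists (Num.bound `|x|) => //=.
  by rewrite /A /= in_itv /= -ler_norml; apply: ltW; exact: archi_boundP.
have := @ge0_nondecreasing_set_cvg_integral _ (measurableTypeR R) _ A (EFin \o f') leb.
have nd : nondecreasing_seq A.
  move=> m n mn; apply/subsetPset => x; rewrite /A /= !in_itv /= -!ler_norml => hx.
  by rewrite (le_trans hx)// ler_nat.
move=> /(_ nd (fun n => measurable_itv _)).
rewrite hA => H.
have {}H := H (fun n => measurable_funTS mf') (fun n x _ => f0 x).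
have H2 : (f n%:R - f (- n%:R))%:E @[n --> \oo] --> (\int[leb]_x (f' x)%:E)%E.
  rewrite (_ : (fun n => _) = (fun i => (\int[leb]_(x in A i) (EFin \o f') x)%E))//.
  apply/funext => n.
  have [i e] := @FTC_seg f f' (- n%:R) n%:R h cf' (ge0_cp (ler0n _ n)).2.
  by rewrite -e EFin_Rint.
apply/esym; apply: (cvg_unique _ _ H2) => //.
by apply: cvg_EFin; [exact: nearW|apply: cvgB].
Qed.

Lemma int_line (f f' : R -> R) (lp lm : R) : (forall x : R, is_derive x 1 f (f' x)) ->
  continuous f' -> intg leb setT f' ->
  f n%:R @[n --> \oo] --> lp -> f (- n%:R) @[n --> \oo] --> lm ->
  \int[leb]_x f' x = lp - lm.
Proof.
move=> h cf' fi hp hm.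
pose A (n : nat) : set R := `[- n%:R, n%:R]%classic.
have mf' : measurable_fun setT f' by exact: intg_meas fi.
have mA n : measurable (A n) by exact: measurable_itv.
have [|||||_ H] := @Rdominated _ _ R leb setT (fun n => f' \_ (A n)) f' (fun x => `|f' x|) measurableT.
- by move=> n; exact: ((measurable_restrictT f' (mA n)).1 (measurable_funTS mf')).
- by [].
- move=> x _; apply: (@cvg_eventually _ _ (Num.bound `|x|)) => m nm; rewrite /patch ifT//; apply/mem_set.
  rewrite /A /= in_itv /= -ler_norml; apply: ltW; apply: lt_le_trans (archi_boundP (normr_ge0 x)) _.
  by rewrite ler_nat.
- exact: intg_norm.
- by move=> n x _; rewrite /patch; case: ifP => //; rewrite normr0.
have H2 : f n%:R - f (- n%:R) @[n --> \oo] --> \int[leb]_x f' x.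
  apply: cvg_trans H; apply: near_eq_cvg; near=> n.
  have [i e] := @FTC_seg f f' (- n%:R) n%:R h cf' (ge0_cp (ler0n _ n)).2.
  by rewrite -e [RHS]Rintegral_mkcond.
by have := cvg_unique _ H2 (cvgB hp hm); apply; exact: norm_hausdorff.
Unshelve. all: by end_near.
Qed.

End Line.

(** * The mollifier om and its convolutions *)

Section Omega.
Context {R : realType}.
Local Notation leb := (@lebesgue_measure R).
Implicit Types (b u x y : R).

(* The mollifier 1/cosh^2 at scale 1/b, chosen because its derivatives are bounded by multiples of
   itself; [om1], [om2] are its derivatives and [omI], below, a primitive. *)
Definition om b u : R := b / 2 * (1 - th (b * u) ^+ 2).
Definition om1 b u : R := - b ^+ 2 * (th (b * u) * (1 - th (b * u) ^+ 2)).
Definition om2 b u : R := b ^+ 3 * ((3 * th (b * u) ^+ 2 - 1) * (1 - th (b * u) ^+ 2)).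

Lemma is_derive_lin b u : is_derive u 1 (fun u : R => b * u) b.
Proof.
have : is_derive u 1 (b *: (id : R -> R)) b.
  by apply: is_derive_eq; rewrite /GRing.scale /= mulr1.
by [].
Qed.

Lemma is_derive_thb b u : is_derive u 1 (fun u : R => th (b * u)) (b * (1 - th (b * u) ^+ 2)).
Proof.
have h1 := is_derive_lin b u; have h2 := is_derive_th (b * u).
rewrite mulrC; exact: (@is_derive1_comp _ th (fun u => b * u) u).
Qed.

Lemma is_derive_om b u : is_derive u 1 (om b) (om1 b u).
Proof.
have h := is_derive_thb b u.
have -> : om b = (b / 2) *: (cst 1 - (fun u : R => th (b * u)) ^+ 2).
  by apply/funext => v; rewrite /om /= !fctE.
apply: is_derive_eq; by rewrite /GRing.scale /= /om1; field.
Qed.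

Lemma is_derive_om1 b u : is_derive u 1 (om1 b) (om2 b u).
Proof.
have h := is_derive_thb b u.
have -> : om1 b = (- b ^+ 2) *: ((fun u : R => th (b * u)) * (cst 1 - (fun u : R => th (b * u)) ^+ 2)).
  by apply/funext => v; rewrite /om1 /= !fctE.
apply: is_derive_eq; rewrite /GRing.scale /= !fctE /om2; ring.
Qed.

Lemma continuous_om b : continuous (om b).
Proof. exact: (is_derive_cont (is_derive_om b)). Qed.

Lemma continuous_om1 b : continuous (om1 b).
Proof. exact: (is_derive_cont (is_derive_om1 b)). Qed.

Lemma continuous_thb b : continuous (fun u : R => th (b * u)).
Proof. exact: (is_derive_cont (is_derive_thb b)). Qed.

Lemma continuous_om2 b : continuous (om2 b).
Proof.
move=> u.
have h2 : (th (b * v) * th (b * v)) @[v --> u] --> (th (b * u) * th (b * u)).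
  by apply: cvgM; exact: continuous_thb.
have -> : om2 b = (fun v => b ^+ 3 * ((3 * (th (b * v) * th (b * v)) - 1) * (1 - th (b * v) * th (b * v)))).
  by apply/funext => v; rewrite /om2 expr2.
apply: cvgM; first exact: cvg_cst.
apply: cvgM; apply: cvgB => //; try exact: cvg_cst.
by apply: cvgM => //; exact: cvg_cst.
Qed.

Lemma sech_th u : 1 - th u ^+ 2 = (ch u) ^- 2.
Proof.
rewrite /th /ch; have := expR_gt0 u; have := expR_gt0 (- u); have := expRN_prod u.
set p := expR u; set q := expR (- u) => pq q0 p0.
have -> : ((p + q) / 2) ^- 2 = 4 * (p * q) / (p + q) ^+ 2.
  by rewrite pq; field; rewrite gt_eqF//; lra.
by field; rewrite gt_eqF//; lra.
Qed.

Lemma expR_lch u : expR (- (2 * lch u)) = 1 - th u ^+ 2.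
Proof.
rewrite sech_th expRN; congr (_^-1).
by rewrite expRM_natl /lch lnK// posrE ch_gt0.
Qed.

(** 1 - th^2 equals exp(-2 lch), so the mollifier belongs to the admissible kernel family, with a =
    2. *)
Lemma om_kt b x : (fun q : R * R => om b (x - q.2)) = kt 2 (b / 2)%:P b x.
Proof. by apply/funext => q; rewrite /om /kt /ker hornerC expR_lch. Qed.

Lemma om_gt0 b u : 0 < b -> 0 < om b u.
Proof. by move=> b0; rewrite /om mulr_gt0 ?divr_gt0// subr_gt0 th_sqr_lt1. Qed.

Lemma om_le b u : 0 < b -> om b u <= b.
Proof.
move=> b0; rewrite /om; have := sqr_ge0 (th (b * u)) => h.
have : b / 2 * (1 - th (b * u) ^+ 2) <= b / 2 * 1 by rewrite ler_wpM2l ?divr_ge0 ?(ltW b0)//; lra.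
lra.
Qed.

Lemma om1_le b u : 0 < b -> `|om1 b u| <= 2 * b * om b u.
Proof.
move=> b0; have t1 := th_norm_lt1 (b * u); have t2 := th_sqr_lt1 (b * u).
have t3 : 0 <= 1 - th (b * u) ^+ 2 by rewrite subr_ge0 ltW.
rewrite /om1 /om normrM normrN (ger0_norm (sqr_ge0 b)) normrM (ger0_norm t3).
have -> : 2 * b * (b / 2 * (1 - th (b * u) ^+ 2)) = b ^+ 2 * (1 * (1 - th (b * u) ^+ 2)) by field.
by rewrite ler_wpM2l ?sqr_ge0// ler_wpM2r// ltW.
Qed.

Lemma om2_le b u : 0 < b -> `|om2 b u| <= 4 * b ^+ 2 * om b u.
Proof.
move=> b0; have t2 := th_sqr_lt1 (b * u); have t3 := sqr_ge0 (th (b * u)).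
have t4 : 0 <= 1 - th (b * u) ^+ 2 by rewrite subr_ge0 ltW.
have b3 : 0 <= b ^+ 3 by rewrite exprn_ge0// ltW.
rewrite /om2 /om normrM (ger0_norm b3) normrM (ger0_norm t4).
have -> : 4 * b ^+ 2 * (b / 2 * (1 - th (b * u) ^+ 2)) = b ^+ 3 * (2 * (1 - th (b * u) ^+ 2)) by field.
rewrite ler_wpM2l// ler_wpM2r//.
by rewrite ler_norml; apply/andP; split; lra.
Qed.

Lemma om1_bd b u : 0 < b -> `|om1 b u| <= 2 * b ^+ 2.
Proof.
move=> b0; apply: (le_trans (om1_le u b0)).
by have := om_le u b0; nra.
Qed.

Lemma om2_bd b u : 0 < b -> `|om2 b u| <= 4 * b ^+ 3.
Proof.
move=> b0; apply: (le_trans (om2_le u b0)).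
have -> : 4 * b ^+ 3 = 4 * b ^+ 2 * b by ring.
by rewrite ler_wpM2l ?om_le// mulr_ge0// sqr_ge0.
Qed.

Lemma om_le_exp b u : 0 < b -> om b u <= 2 * b * expR (- (2 * b * `|u|)).
Proof.
move=> b0; rewrite /om sech_th.
have h : expR `|b * u| / 2 <= ch (b * u).
  rewrite /ch; have := expR_gt0 (b * u); have := expR_gt0 (- (b * u)).
  by case: (ger0P (b * u)) => _; lra.
have e0 := expR_gt0 `|b * u|.
have h2 : (expR `|b * u| / 2) ^+ 2 <= ch (b * u) ^+ 2.
  by rewrite ler_pXn2r// nnegrE ?divr_ge0 ?(ltW e0) ?(ltW (ch_gt0 _)).
have h3 : ch (b * u) ^- 2 <= (expR `|b * u| / 2) ^- 2.
  by rewrite lef_pV2// posrE exprn_gt0// ?ch_gt0// divr_gt0.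
apply: (le_trans (ler_wpM2l _ h3)); first by rewrite divr_ge0// ltW.
have -> : - (2 * b * `|u|) = 2 * - `|b * u| by rewrite normrM (gtr0_norm b0); ring.
rewrite expRM_natl expRN exprVn expr_div_n invf_div.
rewrite le_eqVlt; apply/orP; left; apply/eqP; field; rewrite gt_eqF//.
Qed.

(** Within distance 1/b of its centre the kernel keeps a fixed fraction of its height b/2; this
    recovers the mass of the measure from the mollified density in [mass_le_dens]. *)
Lemma om_ge b u : 0 < b -> `|u| <= b^-1 -> b / 2 * expR (- 2) <= om b u.
Proof.
move=> b0 hu; rewrite /om sech_th ler_wpM2l ?divr_ge0 ?(ltW b0)//.
have h : ch (b * u) <= expR 1.
  have hb : `|b * u| <= 1 by rewrite normrM (gtr0_norm b0) mulrC -ler_pdivlMr// mul1r.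
  have h1 : expR (b * u) <= expR 1 by rewrite ler_expR (le_trans (ler_norm _)).
  have h2 : expR (- (b * u)) <= expR 1 by rewrite ler_expR (le_trans (ler_norm _))// normrN.
  by rewrite /ch; lra.
have e2 : expR 2 = expR 1 ^+ 2 :> R by rewrite -expRM_natl mulr1.
rewrite expRN e2 lef_pV2 ?posrE ?exprn_gt0 ?ch_gt0 ?expR_gt0//.
by rewrite ler_pXn2r// nnegrE ?(ltW (expR_gt0 _)) ?(ltW (ch_gt0 _)).
Qed.

(** Far weaker than the true decay, but free of b and enough for the limits at infinity. *)
Lemma om_le_inv b u : 0 < b -> u != 0 -> om b u <= `|u|^-1.
Proof.
move=> b0 u0; apply: (le_trans (om_le_exp u b0)).
have n0 : 0 < `|u| by rewrite normr_gt0.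
rewrite -[leRHS]div1r ler_pdivlMr// expRN mulrAC ler_pdivrMr ?expR_gt0// mul1r.
have := expR_ge1Dx (2 * b * `|u|); lra.
Qed.

Lemma cvg_inv_nat (u : nat -> R) y (C : R) : (forall n, n%:R != y -> `|u n| <= C * `|n%:R - y|^-1) ->
  u n @[n --> \oo] --> (0 : R).
Proof.
move=> h; apply/cvgrPdist_le => e e0.
exists (Num.bound (`|y| + (`|C| + 1) / e)) => // n /= hn.
have C0 : 0 < `|C| + 1 by rewrite ltr_wpDl.
have h1 : `|y| + (`|C| + 1) / e < n%:R.
  apply: lt_le_trans (archi_boundP _) _; last by rewrite ler_nat.
  by rewrite addr_ge0// divr_ge0// ltW.
have h2 : (`|C| + 1) / e < n%:R - y by have := ler_norm y; lra.
have h3 : 0 < n%:R - y by apply: lt_trans h2; rewrite divr_gt0.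
rewrite sub0r normrN (le_trans (h n _))//; first by apply: contraTneq h3 => ->; rewrite subrr ltxx.
rewrite (gtr0_norm h3) ler_pdivrMr//.
have : (`|C| + 1) <= e * (n%:R - y) by rewrite mulrC -ler_pdivrMr// ltW.
have := ler_norm C; lra.
Qed.

Lemma cvg_om b y : 0 < b -> om b (n%:R - y) @[n --> \oo] --> (0 : R).
Proof.
move=> b0; apply: (@cvg_inv_nat _ y 1) => n ny; rewrite mul1r ger0_norm ?(ltW (om_gt0 _ b0))//.
by rewrite om_le_inv// subr_eq0.
Qed.

Lemma th_odd u : th (- u) = - th u.
Proof. by rewrite /th opprK (addrC (expR (- u)) (expR u)) -mulNr opprB. Qed.

Lemma om_even b u : om b (- u) = om b u.
Proof. by rewrite /om mulrN th_odd sqrrN. Qed.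

Lemma om1_odd b u : om1 b (- u) = - om1 b u.
Proof. by rewrite /om1 mulrN th_odd sqrrN; ring. Qed.

Lemma cvg_omN b y : 0 < b -> om b (- n%:R - y) @[n --> \oo] --> (0 : R).
Proof.
move=> b0; have := @cvg_om b (- y) b0.
rewrite (_ : (fun n : nat => om b (- n%:R - y)) = (fun n => om b (n%:R - - y)))//.
by apply/funext => n; rewrite -om_even opprD !opprK.
Qed.

Lemma cvg_om1 b y : 0 < b -> om1 b (n%:R - y) @[n --> \oo] --> (0 : R).
Proof.
move=> b0; apply: (@cvg_inv_nat _ y (2 * b)) => n ny; apply: (le_trans (om1_le _ b0)).
by rewrite ler_wpM2l ?mulr_ge0 ?(ltW b0)// om_le_inv// subr_eq0.
Qed.

Lemma cvg_om1N b y : 0 < b -> om1 b (- n%:R - y) @[n --> \oo] --> (0 : R).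
Proof.
move=> b0; have E : (fun n : nat => om1 b (- n%:R - y)) = - (fun n : nat => om1 b (n%:R - - y)).
  by apply/funext => n /=; rewrite !fctE -om1_odd opprD !opprK.
by rewrite E -oppr0; apply: cvgN; exact: cvg_om1.
Qed.

Lemma th_lim u : 0 < u -> `|1 - th u| <= u^-1.
Proof.
move=> u0; have [t1 t2] := andP (th_gt_lt u).
rewrite ger0_norm ?subr_ge0 ?(ltW t2)// -[leRHS]div1r ler_pdivlMr//.
rewrite /th; have := expR_gt0 u; have := expR_gt0 (- u); have := expRN_prod u.
have := expR_ge1Dx (2 * u).
rewrite expRM_natl.
set p := expR u; set q := expR (- u) => hp pq q0 p0.
have -> : 1 - (p - q) / (p + q) = 2 * q / (p + q) by field; rewrite gt_eqF//; lra.
rewrite mulrAC ler_pdivrMr; last lra.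
have h : 2 * u * q <= p ^+ 2 * q by rewrite ler_wpM2r ?ltW//; lra.
have -> : 2 * q * u = 2 * u * q by ring.
apply: (le_trans h); have -> : p ^+ 2 * q = p by rewrite expr2 -mulrA pq mulr1.
lra.
Qed.

Lemma cvg_thb b y : 0 < b -> th (b * (n%:R - y)) @[n --> \oo] --> (1 : R).
Proof.
move=> b0; apply/cvgrPdist_le => e e0.
exists (Num.bound (`|y| + (b * e)^-1)) => // n /= hn.
have be : 0 < (b * e)^-1 by rewrite invr_gt0 mulr_gt0.
have h1 : `|y| + (b * e)^-1 < n%:R.
  apply: lt_le_trans (archi_boundP _) _; last by rewrite ler_nat.
  by rewrite addr_ge0// ltW.
have h2 : (b * e)^-1 < n%:R - y by have := ler_norm y; lra.
have h3 : e^-1 < b * (n%:R - y).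
  by rewrite mulrC -ltr_pdivrMr// -invfM mulrC.
have h4 : 0 < b * (n%:R - y) by apply: lt_trans h3; rewrite invr_gt0.
apply: (le_trans (th_lim h4)); rewrite -[leRHS]invrK lef_pV2 ?posrE ?invr_gt0//; exact: ltW.
Qed.

Lemma cvg_thbN b y : 0 < b -> th (b * (- n%:R - y)) @[n --> \oo] --> (- 1 : R).
Proof.
move=> b0; have E : (fun n : nat => th (b * (- n%:R - y))) = - (fun n : nat => th (b * (n%:R - - y))).
  by apply/funext => n; rewrite !fctE -th_odd; congr th; ring.
by rewrite E; apply: cvgN; exact: cvg_thb.
Qed.

Lemma is_derive_shift (f f' : R -> R) y x : (forall u : R, is_derive u 1 f (f' u)) ->
  is_derive x 1 (fun x : R => f (x - y)) (f' (x - y)).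
Proof.
move=> h; have h1 : is_derive x 1 (fun x : R => x - y) 1.
  have : is_derive x 1 ((id : R -> R) - cst y) 1.
    by apply: is_derive_eq; rewrite subr0.
  by [].
have h2 := h (x - y); rewrite -[f' _]mulr1.
exact: (@is_derive1_comp _ f (fun x => x - y) x).
Qed.

Lemma continuous_shift (f : R -> R) y : continuous f -> continuous (fun x : R => f (x - y)).
Proof.
move=> cf x; apply: (@continuous_comp _ _ _ (fun x : R => x - y) f); last exact: cf.
by apply: cvgB; [exact: cvg_id|exact: cvg_cst].
Qed.

Lemma continuous_reflect (f : R -> R) x : continuous f -> continuous (fun y : R => f (x - y)).
Proof.
move=> cf y; apply: (@continuous_comp _ _ _ (fun y : R => x - y) f); last exact: cf.
by apply: cvgB; [exact: cvg_cst|exact: cvg_id].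
Qed.

Definition omI b u : R := th (b * u) / 2.

Lemma is_derive_omI b u : is_derive u 1 (omI b) (om b u).
Proof.
have h := is_derive_thb b u.
have -> : omI b = 2^-1 *: (fun u : R => th (b * u)).
  by apply/funext => v; rewrite /omI /= mulrC.
by apply: is_derive_eq; rewrite /GRing.scale /= /om; field.
Qed.

Lemma int_om b y : 0 < b -> (\int[leb]_x (om b (x - y))%:E = 1%:E)%E.
Proof.
move=> b0.
have -> : 1 = 1 / 2 - (- 1 / 2) :> R by field.
apply: (@int_line_ge0 _ (fun x => omI b (x - y)) (fun x => om b (x - y))).
- by move=> x; apply: is_derive_shift; exact: is_derive_omI.
- by apply: continuous_shift; exact: continuous_om.
- by move=> x; exact/ltW/om_gt0.
- by rewrite /omI; apply: cvgM; [exact: cvg_thb|exact: cvg_cst].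
- by rewrite /omI; apply: cvgM; [exact: cvg_thbN|exact: cvg_cst].
Qed.

End Omega.

Section Convolution.
Context {R : realType}.
Variable gam : probability R R.
Local Notation leb := (@lebesgue_measure R).
Implicit Types (k ph : R -> R).

(** The measure k gam smoothed with [ph]: k = 1 gives the densities, k = A(R) and k = h A(R) give
    the two parts of the flux. *)
Definition conv k ph (x : R) : R := \int[gam]_y (k y * ph (x - y)).

Lemma intg_conv k ph (C : R) x : intg gam setT k -> continuous ph -> (forall u, `|ph u| <= C) ->
  intg gam setT (fun y => k y * ph (x - y)).
Proof.
move=> ik cp hC; apply: (@intgM _ _ _ _ _ _ _ C) => //.
by apply: continuous_measurable_fun; exact: continuous_reflect.
Qed.

Lemma intg_cst (c : R) : intg gam setT (cst c).
Proof.
exact: finite_measure_integrable_cst.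
Qed.

(** C' |k| dominates the differentiated integrand for all z at once, so any interval around x will
    do. *)
Lemma is_derive_conv k ph (ph' : R -> R) (C C' x : R) : intg gam setT k ->
  (forall u : R, is_derive u 1 ph (ph' u)) ->
  (forall u, `|ph u| <= C) -> (forall u, `|ph' u| <= C') ->
  is_derive x 1 (conv k ph) (conv k ph' x).
Proof.
move=> ik dp hC hC'.
have cp := is_derive_cont dp.
have dk (z y : R) : is_derive z 1 (fun z : R => k y * ph (z - y)) (k y * ph' (z - y)).
  have h := is_derive_shift y z dp.
  exact: (is_deriveZ (k y) h).
have xI : x \in `](x - 1), (x + 1)[ by rewrite in_itv /=; apply/andP; split; lra.
have H1 (z : R) : z \in `](x - 1), (x + 1)[ -> gam.-integrable setT (EFin \o (fun y => k y * ph (z - y))).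
  by move=> _; exact: intg_conv.
have H2 (z y : R) : z \in `](x - 1), (x + 1)[ -> setT y -> derivable (fun z : R => k y * ph (z - y)) z 1.
  by move=> _ _; have [] := dk z y.
have H3 (y : R) : 0 <= C' * `|k y| by rewrite mulr_ge0// (le_trans _ (hC' 0)).
have H4 : gam.-integrable setT (EFin \o (fun y => C' * `|k y|)).
  by apply: intgZ => //; exact: intg_norm.
have H5 (z y : R) : z \in `](x - 1), (x + 1)[ -> setT y ->
    `|partial1of2 (fun z y : R => k y * ph (z - y)) z y| <= C' * `|k y|.
  move=> _ _; rewrite /partial1of2 (is_derive_derive1 (dk z y)) normrM mulrC.
  by rewrite ler_wpM2r.
apply: (@DeriveDef).
  exact: (derivable_under_integral measurableT xI H1 H2 H3 H4 H5).
rewrite -derive1E (differentiation_under_integral measurableT xI H1 H2 H3 H4 H5).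
apply: eq_Rintegral => y _.
by rewrite /partial1of2 (is_derive_derive1 (dk x y)).
Qed.

Lemma conv_cvg k ph (C : R) (u : nat -> R) : intg gam setT k -> continuous ph ->
  (forall v, `|ph v| <= C) ->
  (forall y, ph (u n - y) @[n --> \oo] --> (0 : R)) -> conv k ph (u n) @[n --> \oo] --> (0 : R).
Proof.
move=> ik cp hC h.
have [|||||_] := @Rdominated _ _ R gam setT (fun n y => k y * ph (u n - y)) (cst 0) (fun y => C * `|k y|) measurableT.
- by move=> n; exact: intg_meas (intg_conv _ ik cp hC).
- exact: measurable_cst.
- move=> y _; rewrite /= -(mulr0 (k y)); apply: cvgM; [exact: cvg_cst|exact: h].
- by apply: intgZ => //; exact: intg_norm.
- by move=> n y _; rewrite normrM mulrC ler_wpM2r.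
by rewrite Rintegral_cst// mul0r.
Qed.

Lemma tonelli_conv (k : R -> R) b : 0 < b -> measurable_fun setT k -> (forall y, 0 <= k y) ->
  (\int[leb]_x \int[gam]_y (k y * om b (x - y))%:E = \int[gam]_y (k y)%:E)%E.
Proof.
move=> b0 mk k0.
have mf : measurable_fun setT (fun xy : measurableTypeR R * R => (k xy.2 * om b (xy.1 - xy.2))%:E).
  apply/measurable_EFinP; apply: measurable_funM.
    by apply: measurableT_comp => //; exact: measurable_snd.
  apply: measurableT_comp; first by apply: continuous_measurable_fun; exact: continuous_om.
  by apply: measurable_funB; [exact: measurable_fst|exact: measurable_snd].
have f0 (xy : measurableTypeR R * R) : (0 <= (k xy.2 * om b (xy.1 - xy.2))%:E)%E.
  by rewrite lee_fin mulr_ge0// ltW// om_gt0.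
rewrite (@fubini_tonelli _ _ _ _ R leb gam (fun xy => (k xy.2 * om b (xy.1 - xy.2))%:E) mf f0) /=.
apply: eq_integral => y _.
under eq_integral => x _ do rewrite EFinM.
rewrite ge0_integralZl_EFin//.
- by rewrite int_om// mule1.
- by move=> x _; rewrite lee_fin ltW// om_gt0.
- by apply/measurable_EFinP; apply: continuous_measurable_fun; apply: continuous_shift; exact: continuous_om.
Qed.

End Convolution.

(** * Mollified densities at a fixed time *)

Section DistributionFunction.
Context {R : realType}.
Variable gam : probability R R.
Implicit Types (x y : R).

Lemma distfunE x : (p_distfun gam x)%:E = gam [set y | y <= x].
Proof.
rewrite /p_distfun fineK//; apply: fin_num_measure.
by rewrite -set_itvNyc; exact: measurable_itv.
Qed.

Lemma distfun_itv x y : x <= y ->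
  gam `]x, y]%classic = (p_distfun gam y - p_distfun gam x)%:E.
Proof.
move=> xy; rewrite EFinB !distfunE.
have mx : measurable [set z : R | z <= x] by rewrite -set_itvNyc; exact: measurable_itv.
have my : measurable [set z : R | z <= y] by rewrite -set_itvNyc; exact: measurable_itv.
have -> : `]x, y]%classic = [set z : R | z <= y] `\` [set z | z <= x].
  apply/seteqP; split => z /=; rewrite in_itv /=.
    by move=> /andP[xz ->]; split => //; apply/negP; rewrite -ltNge.
  by move=> [-> /negP]; rewrite -ltNge => ->.
rewrite measureD//; last by apply: le_lt_trans (probability_le1 gam my) _; exact: ltry.
congr (_ - _)%E; congr (gam _); apply/seteqP; split => z /=; first by move=> [].
by move=> zx; split => //; exact: le_trans xy.
Qed.

Lemma distfun_nd x y : x <= y -> p_distfun gam x <= p_distfun gam y.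
Proof. by move=> xy; rewrite -subr_ge0 -lee_fin -distfun_itv// measure_ge0. Qed.

Lemma distfun_ge0 x : 0 <= p_distfun gam x.
Proof. by rewrite -lee_fin distfunE measure_ge0. Qed.

Lemma distfun_le1 x : p_distfun gam x <= 1.
Proof.
rewrite -lee_fin distfunE; apply: probability_le1.
by rewrite -set_itvNyc; exact: measurable_itv.
Qed.

Lemma measurable_distfun : measurable_fun setT (p_distfun gam).
Proof.
by apply: nondecreasing_measurable => // x y xy; exact: distfun_nd.
Qed.

Lemma Rint1 : \int[gam]_y (cst 1 y) = 1 :> R.
Proof. transitivity (1 * fine (gam setT) : R); first exact: Rintegral_cst.
by rewrite probability_setT mulr1. Qed.

End DistributionFunction.

Section FixedTime.
Context {R : realType}.
Variable gam : probability R R.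
Local Notation leb := (@lebesgue_measure R).
Local Notation U := (p_distfun gam).
Variables (b : R) (b0 : 0 < b).
Implicit Types (x y z : R).

(* The mollified density, its derivative, and the mollified distribution function minus 1/2. *)
Definition dens x : R := conv gam (cst 1) (om b) x.
Definition ddens x : R := conv gam (cst 1) (om1 b) x.
Definition cdens x : R := conv gam (cst 1) (omI b) x.

Lemma om_bd u : `|om b u| <= b.
Proof. by rewrite ger0_norm ?(ltW (om_gt0 u b0))// om_le. Qed.

Lemma omI_bd u : `|omI b u| <= 1.
Proof.
rewrite /omI normrM normfV (ger0_norm (ler0n _ 2)).
have := th_norm_lt1 (b * u); lra.
Qed.

Lemma is_derive_dens x : is_derive x 1 dens (ddens x).
Proof.
apply: (is_derive_conv (C := b) (C' := 2 * b ^+ 2)).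
- exact: intg_cst.
- exact: is_derive_om.
- exact: om_bd.
- by move=> u; exact: om1_bd.
Qed.

Lemma is_derive_ddens x : is_derive x 1 ddens (conv gam (cst 1) (om2 b) x).
Proof.
apply: (is_derive_conv (C := 2 * b ^+ 2) (C' := 4 * b ^+ 3)).
- exact: intg_cst.
- exact: is_derive_om1.
- by move=> u; exact: om1_bd.
- by move=> u; exact: om2_bd.
Qed.

Lemma is_derive_cdens x : is_derive x 1 cdens (dens x).
Proof.
apply: (is_derive_conv (C := 1) (C' := b)).
- exact: intg_cst.
- exact: is_derive_omI.
- exact: omI_bd.
- exact: om_bd.
Qed.

Lemma continuous_dens : continuous dens.
Proof. exact: is_derive_cont is_derive_dens. Qed.

Lemma continuous_ddens : continuous ddens.
Proof. exact: is_derive_cont is_derive_ddens. Qed.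

Lemma intg_om x : intg gam setT (fun y => om b (x - y)).
Proof.
have := @intg_conv _ gam (cst 1) (om b) b x (intg_cst _ _) (@continuous_om _ _) om_bd.
by rewrite (_ : (fun y => cst 1 y * om b (x - y)) = (fun y => om b (x - y)))//; apply/funext => y; rewrite mul1r.
Qed.

Lemma intg_om1 x : intg gam setT (fun y => om1 b (x - y)).
Proof.
have := @intg_conv _ gam (cst 1) (om1 b) (2 * b ^+ 2) x (intg_cst _ _) (@continuous_om1 _ _) (fun u => om1_bd u b0).
by rewrite (_ : (fun y => cst 1 y * om1 b (x - y)) = (fun y => om1 b (x - y)))//; apply/funext => y; rewrite mul1r.
Qed.

Lemma densE x : dens x = \int[gam]_y om b (x - y).
Proof. by rewrite /dens /conv; apply: eq_Rintegral => y _; rewrite mul1r. Qed.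

Lemma ddensE x : ddens x = \int[gam]_y om1 b (x - y).
Proof. by rewrite /ddens /conv; apply: eq_Rintegral => y _; rewrite mul1r. Qed.

Lemma dens_ge0 x : 0 <= dens x.
Proof. by rewrite densE; apply: Rintegral_ge0 => y _; exact/ltW/om_gt0. Qed.

Lemma dens_le x : dens x <= b.
Proof.
rewrite densE -[leRHS]mulr1 -(Rint1 gam) -RintegralZl//; last exact: intg_cst.
apply: le_Rintegral => //; first exact: intg_om.
  by apply: intgZ => //; exact: intg_cst.
by move=> y _; rewrite /= mulr1 om_le.
Qed.

Lemma ddens_le x : `|ddens x| <= 2 * b * dens x.
Proof.
rewrite ddensE densE -RintegralZl//; last exact: intg_om.
apply: (le_trans (le_normr_Rintegral _ _)) => //; first exact: intg_om1.
apply: le_Rintegral => //; first by apply: intg_norm => //; exact: intg_om1.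
  by apply: intgZ => //; exact: intg_om.
by move=> y _; exact: om1_le.
Qed.

Lemma int_dens : (\int[leb]_x (dens x)%:E = 1%:E)%E.
Proof.
rewrite -(Rint1 gam) EFin_Rint//; last exact: intg_cst.
rewrite -(@tonelli_conv _ gam (cst 1) b b0 (measurable_cst _) (fun _ => ler01)).
apply: eq_integral => x _; rewrite /dens /conv EFin_Rint//.
by apply: (@intg_conv _ _ _ _ b) => //; [exact: intg_cst|exact: continuous_om|exact: om_bd].
Qed.

Lemma intg_dens : intg leb setT dens.
Proof.
apply: intg_ge0P => //; first by apply: continuous_measurable_fun; exact: continuous_dens.
  by move=> x _; exact: dens_ge0.
by rewrite int_dens ltry.
Qed.

Lemma Rint_dens : \int[leb]_x dens x = 1.
Proof. by rewrite /Rintegral int_dens. Qed.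

Lemma int_dens_seg (u v : R) : u <= v ->
  intg leb `[u, v] dens /\ \int[leb]_(x in `[u, v]) dens x = cdens v - cdens u.
Proof. by move=> uv; apply: FTC_seg => //; [exact: is_derive_cdens|exact: continuous_dens]. Qed.

Lemma intg_omI x : intg gam setT (fun y => omI b (x - y)).
Proof.
have := @intg_conv _ gam (cst 1) (omI b) 1 x (intg_cst _ _) (is_derive_cont (is_derive_omI b)) omI_bd.
by rewrite (_ : (fun y => cst 1 y * omI b (x - y)) = (fun y => omI b (x - y)))//; apply/funext => y; rewrite mul1r.
Qed.

Lemma cdensB (u v : R) : cdens v - cdens u = \int[gam]_y (omI b (v - y) - omI b (u - y)).
Proof.
rewrite RintegralB//; [|exact: intg_omI..].
by congr (_ - _); rewrite /cdens /conv; apply: eq_Rintegral => y _; rewrite mul1r.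
Qed.

Lemma omI_nd (u v : R) : u <= v -> omI b u <= omI b v.
Proof.
move=> uv; rewrite -subr_ge0.
have [_ <-] := FTC_seg (is_derive_omI b) (@continuous_om _ b) uv.
by apply: Rintegral_ge0 => y _; exact/ltW/om_gt0.
Qed.

(** Mass sitting at y with |x - y| <= r keeps, after mollification, at least the fraction e^-2
    within distance 1/b of y (length 2/b times the height (b/2) e^-2 of [om_ge]), hence inside the
    enlarged window. *)
Lemma mass_le_dens x (r : R) : 0 <= r ->
  U (x + r) - U (x - r) <= expR 2 * \int[leb]_(z in `[x - (r + b^-1), x + (r + b^-1)]) dens z.
Proof.
move=> r0; have bV : 0 < b^-1 by rewrite invr_gt0.
have le1 : x - (r + b^-1) <= x + (r + b^-1) by lra.
have [_ ->] := int_dens_seg le1.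
rewrite cdensB.
have h1 : expR (- 2) <= omI b b^-1 - omI b (- b^-1).
  have le2 : - b^-1 <= b^-1 by lra.
  have [i <-] := FTC_seg (is_derive_omI b) (@continuous_om _ b) le2.
  have ic : intg leb `[- b^-1, b^-1] (cst (b / 2 * expR (- 2))).
    apply: continuous_compact_integrable; first exact: segment_compact.
    by apply: continuous_subspaceT => z; exact: cvg_cst.
  have : \int[leb]_(z in `[- b^-1, b^-1]) cst (b / 2 * expR (- 2)) z <= \int[leb]_(z in `[- b^-1, b^-1]) om b z.
    apply: le_Rintegral => // z /=; rewrite in_itv /= => /andP[h1 h2].
    by apply: om_ge => //; rewrite ler_norml h1 h2.
  rewrite Rintegral_cst//= lebesgue_measure_itv /= lte_fin.
  case: ifPn; last by rewrite -leNgt; lra.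
  move=> _; rewrite -EFinD /= => h; apply: le_trans h.
  by rewrite le_eqVlt; apply/orP; left; apply/eqP; field; rewrite gt_eqF.
have e2 : expR 2 * expR (- 2) = 1 :> R by rewrite expRN_prod.
have mI : measurable (`]x - r, x + r]%classic : set R) by exact: measurable_itv.
have iD : intg gam setT (fun y => omI b (x + (r + b^-1) - y) - omI b (x - (r + b^-1) - y)).
  by apply: intgB => //; exact: intg_omI.
have D0 y : 0 <= omI b (x + (r + b^-1) - y) - omI b (x - (r + b^-1) - y).
  by rewrite subr_ge0; apply: omI_nd; lra.
have -> : U (x + r) - U (x - r) = expR 2 * (expR (- 2) * (U (x + r) - U (x - r))) by rewrite mulrA e2 mul1r.
rewrite ler_wpM2l ?expR_ge0//.
rewrite -lee_fin EFin_Rint// EFinM -distfun_itv; last lra.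
rewrite -integral_cst//.
set I : set R := `]x - r, x + r]%classic.
apply: (@le_trans _ _ (\int[gam]_(y in I) (omI b (x + (r + b^-1) - y) - omI b (x - (r + b^-1) - y))%:E)%E).
  apply: ge0_le_integral => //.
  - by move=> y _; rewrite lee_fin expR_ge0.
  - by apply: measurable_funTS; exact: measurable_int iD.
  move=> y; rewrite /I /= in_itv /= => /andP[h2 h3]; rewrite lee_fin (le_trans h1)//.
  by apply: lerB; apply: omI_nd; lra.
apply: ge0_subset_integral => //; first exact: measurable_int iD.
by move=> y _; rewrite lee_fin.
Qed.

(** The mollified measure is an average, with weight [om], of translates of gam, and every translate
    of the window has mass at most eta. *)
Lemma window_dens (l eta : R) x : 0 <= l -> (forall z, U (z + l) - U z <= eta) ->
  \int[leb]_(z in `[x, x + l]) dens z <= eta.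
Proof.
move=> l0 hU; have le1 : x <= x + l by lra.
have [_ ->] := int_dens_seg le1; rewrite cdensB.
have iD : intg gam setT (fun y => omI b (x + l - y) - omI b (x - y)).
  by apply: intgB => //; exact: intg_omI.
rewrite -lee_fin EFin_Rint//.
(* The difference of primitives becomes an integral over the shift r, so that Tonelli lets gam
   measure the translated window. *)
have E y : (omI b (x + l - y) - omI b (x - y))%:E =
    (\int[leb]_r (if (x - r < y) && (y <= x + l - r) then om b r else 0)%:E)%E.
  have le2 : x - y <= x + l - y by lra.
  have [i <-] := FTC_seg (is_derive_omI b) (@continuous_om _ b) le2.
  rewrite EFin_Rint// -integral_itv_obnd_cbnd; last first.
    apply/measurable_EFinP; apply: measurable_funTS.
    by apply: continuous_measurable_fun; exact: continuous_om.
  rewrite integral_mkcond; apply: eq_integral => r _; rewrite /patch mem_setE in_itv /=.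
  have -> : (x - y < r <= x + l - y) = ((x - r < y) && (y <= x + l - r)).
    by congr andb; apply/idP/idP; lra.
  by case: ifP.
under eq_integral => y _ do rewrite E.
have mf : measurable_fun setT (fun yr : R * measurableTypeR R =>
   (if (x - yr.2 < yr.1) && (yr.1 <= x + l - yr.2) then om b yr.2 else 0)%:E).
  apply/measurable_EFinP; apply: measurable_fun_if => //.
  - apply: measurable_and.
      by apply: measurable_fun_ltr => //; apply: measurable_funB => //; exact: measurable_snd.
    by apply: measurable_fun_ler => //; apply: measurable_funB => //; exact: measurable_snd.
  - apply: measurable_funTS; apply: measurableT_comp; last exact: measurable_snd.
    by apply: continuous_measurable_fun; exact: continuous_om.
have f0 (yr : R * measurableTypeR R) :
   (0 <= (if (x - yr.2 < yr.1) && (yr.1 <= x + l - yr.2) then om b yr.2 else 0)%:E)%E.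
  by rewrite lee_fin; case: ifP => // _; exact/ltW/om_gt0.
rewrite (@fubini_tonelli _ _ _ _ R gam leb _ mf f0) /=.
apply: (@le_trans _ _ (\int[leb]_r (eta%:E * (om b r)%:E))%E); last first.
  rewrite ge0_integralZl_EFin//.
  - have -> : (\int[leb]_r (om b r)%:E = 1%:E)%E.
      by rewrite -(int_om 0 b0); apply: eq_integral => r _; rewrite subr0.
    by rewrite mule1.
  - by move=> r _; rewrite lee_fin; exact/ltW/om_gt0.
  - by apply/measurable_EFinP; apply: continuous_measurable_fun; exact: continuous_om.
  - by apply: le_trans (hU 0); rewrite subr_ge0 distfun_nd// lerDl.
apply: ge0_le_integral => //.
- by move=> r _; apply: integral_ge0 => y _; exact: (f0 (y, r)).
- exact: (measurable_fun_fubini_tonelli_G _ mf f0).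
- apply: measurable_funeM; apply/measurable_EFinP.
  by apply: continuous_measurable_fun; exact: continuous_om.
move=> r _.
pose I : set R := `]x - r, x + l - r]%classic.
rewrite (_ : (\int[gam]_y _)%E = (\int[gam]_(y in I) (om b r)%:E)%E); last first.
  rewrite [RHS]integral_mkcond; apply: eq_integral => y _; rewrite /patch /I mem_setE in_itv /=.
  by case: ifP.
have gI : gam I = (U (x + l - r) - U (x - r))%:E by apply: distfun_itv; lra.
rewrite integral_cst; last exact: measurable_itv.
rewrite -[X in (_ * X <= _)%E]/(gam I) gI -!EFinM lee_fin mulrC ler_wpM2r ?(ltW (om_gt0 _ b0))//.
by have := hU (x - r); rewrite addrAC.
Qed.

End FixedTime.

(** * Bounds on the mollified density by its Fisher information *)

Lemma sqr_le_of_le_sum (R : realType) (p e E k : R) : 0 <= p -> p <= e + E -> E ^+ 2 <= k ->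
  p ^+ 2 <= 2 * e ^+ 2 + 2 * k.
Proof. by move=> p0 h1 h2; have := sqr_ge0 (e - E); nra. Qed.

Section CubeBound.
Context {R : realType}.
Variable gam : probability R R.
Local Notation leb := (@lebesgue_measure R).
Local Notation U := (p_distfun gam).
Variables (b d : R) (b0 : 0 < b) (d0 : 0 < d).
Local Notation P := (dens gam b).
Local Notation P1 := (ddens gam b).
Implicit Types (x y z : R).

(* The density of the Fisher information, regularized by d. *)
Definition fdens x : R := P1 x ^+ 2 / (P x + d).

Let Pd x : 0 < P x + d. Proof. by rewrite ltr_wpDl// dens_ge0. Qed.

Lemma fdens_ge0 x : 0 <= fdens x.
Proof. by rewrite /fdens divr_ge0 ?sqr_ge0// ltW. Qed.

Lemma continuous_fdens : continuous fdens.
Proof.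
move=> x; apply: cvgM.
  have h : (P1 z * P1 z) @[z --> x] --> (P1 x * P1 x).
    by apply: cvgM; exact: continuous_ddens.
  by have -> : (fun z => P1 z ^+ 2) = (fun z => P1 z * P1 z) by apply/funext => z; rewrite expr2.
apply: cvgV; first by rewrite gt_eqF.
by apply: cvgD; [exact: continuous_dens|exact: cvg_cst].
Qed.

Lemma measurable_fdens : measurable_fun setT fdens.
Proof. by apply: continuous_measurable_fun; exact: continuous_fdens. Qed.

(** This bound grows with b; it makes the integrals finite before the uniform estimate is
    available. *)
Lemma fdens_le x : fdens x <= 4 * b ^+ 2 * P x.
Proof.
rewrite /fdens ler_pdivrMr//.
have h := ddens_le gam b0 x; have p0 := dens_ge0 gam b0 x.
have : P1 x ^+ 2 <= (2 * b * P x) ^+ 2.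
  rewrite -[leLHS]real_normK ?num_real// ler_pXn2r// nnegrE ?normr_ge0// (le_trans _ h)//.
have : 0 <= 4 * b ^+ 2 * P x * d by rewrite !mulr_ge0 ?sqr_ge0// ltW.
by move=> h1 h2; apply: (le_trans h2); rewrite exprMn; nra.
Qed.

Lemma intg_fdens : intg leb setT fdens.
Proof.
apply: (@intg_le _ (measurableTypeR R) _ _ _ _ (fun x => 4 * b ^+ 2 * P x)) => //; first exact: measurable_fdens.
  by apply: intgZ => //; exact: intg_dens.
by move=> x _; rewrite ger0_norm ?fdens_ge0// fdens_le.
Qed.

Lemma intg_cont_seg (f : R -> R) (u v : R) : continuous f -> intg leb `[u, v] f.
Proof.
move=> cf; apply: continuous_compact_integrable; first exact: segment_compact.
exact: continuous_subspaceT.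
Qed.

Lemma lebesgue_seg (u v : R) : u <= v -> leb `[u, v]%classic = (v - u)%:E.
Proof.
rewrite lebesgue_measure_itv /= lte_fin le_eqVlt => /orP[/eqP->|->].
  by rewrite ltxx subrr.
by rewrite EFinB.
Qed.

Lemma Rint_cst_seg (u v c : R) : u <= v -> \int[leb]_(z in `[u, v]) (cst c z) = c * (v - u).
Proof.
move=> uv; transitivity (c * fine (leb `[u, v]%classic)); first exact: Rintegral_cst.
by rewrite lebesgue_seg.
Qed.

(** For z in the window P(x) <= P(z) + E, with E the integral of |P1|. Averaging over z gives P(x)
    <= eta / l + E, and Cauchy-Schwarz with weight P + d, of mass at most eta + d l, bounds E^2 by
    the information in the window. *)
Lemma dens_sqr_le (l eta : R) x : 0 < l -> (forall z, U (z + l) - U z <= eta) ->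
  P x ^+ 2 <= 2 * (eta / l) ^+ 2 + 2 * (eta + d * l) / 1 * \int[leb]_(z in `[x, x + l]) fdens z.
Proof.
move=> l0 hU; have le1 : x <= x + l by lra.
set I := (`[x, x + l]%classic : set (measurableTypeR R)).
have mI : measurable I by exact: measurable_itv.
have lI : leb I = l%:E by rewrite lebesgue_seg//; congr EFin; ring.
have iw : intg leb I (fun z => P z + d).
  by apply: intg_cont_seg => z; apply: cvgD; [exact: continuous_dens|exact: cvg_cst].
have ckw : continuous (fun z => `|P1 z|).
  by move=> z; apply: cvg_norm; exact: continuous_ddens.
have cq : continuous (fun z => `|P1 z| / (P z + d)).
  move=> z; apply: cvgM; first exact: ckw.
  apply: cvgV; first by rewrite gt_eqF.
  by apply: cvgD; [exact: continuous_dens|exact: cvg_cst].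
have E2 z : (`|P1 z| / (P z + d)) ^+ 2 * (P z + d) = fdens z.
  rewrite /fdens expr_div_n real_normK ?num_real//; field; rewrite gt_eqF//.
have E1 z : (`|P1 z| / (P z + d)) * (P z + d) = `|P1 z| by rewrite divfK// gt_eqF.
have := @weighted_CS _ _ R leb I (fun z => `|P1 z| / (P z + d)) (fun z => P z + d) mI.
have mk : measurable_fun I (fun z => `|P1 z| / (P z + d)).
  by apply: measurable_funTS; apply: continuous_measurable_fun.
move=> /(_ mk (fun z _ => ltW (Pd z)) iw).
under [X in intg _ _ X -> _]eq_fun do rewrite E2.
move=> /(_ (intgS measurableT mI (@subsetT _ _) intg_fdens)) [_].
under eq_Rintegral do rewrite E1.
under [X in _ <= _ * X]eq_Rintegral do rewrite E2.
set E := \int[leb]_(z in I) `|P1 z|; set q := \int[leb]_(z in I) fdens z.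
have q0 : 0 <= q by apply: Rintegral_ge0 => z _; exact: fdens_ge0.
have ->: \int[leb]_(z in I) (P z + d) = \int[leb]_(z in I) P z + d * l.
  rewrite RintegralD//; last 2 first.
  - by apply: intg_cont_seg; exact: continuous_dens.
  - by apply: intg_cont_seg => z; exact: cvg_cst.
  by rewrite (Rint_cst_seg _ le1); congr (_ + _ * _); ring.
have Wd := @window_dens _ gam b b0 l eta x (ltW l0) hU.
rewrite -/I in Wd.
have W0 : 0 <= \int[leb]_(z in I) P z by apply: Rintegral_ge0 => z _; exact: dens_ge0.
move=> hE.
have {}hE : E ^+ 2 <= (eta + d * l) * q by apply: (le_trans hE); rewrite ler_wpM2r// lerD2r.
have E0 : 0 <= E by apply: Rintegral_ge0 => z _.
have hP : l * P x <= eta + l * E.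
  have h1 z : I z -> P x <= P z + E.
    rewrite /I /= in_itv /= => /andP[xz zl].
    have [i e] := FTC_seg (is_derive_dens gam b0) (@continuous_ddens _ gam b b0) xz.
    have : `|P z - P x| <= E.
      rewrite -e; apply: (le_trans (le_normr_Rintegral _ i)) => //.
      rewrite -lee_fin /E EFin_Rint//; last by apply: intg_norm.
      rewrite EFin_Rint//; last by apply: intg_cont_seg.
      apply: ge0_subset_integral => //.
      - by apply/measurable_EFinP; apply: measurable_funTS; apply: continuous_measurable_fun.
      - by rewrite /I; apply: subset_itvl; rewrite bnd_simp.
    by move: (P z) (P x) (E) => u v w; rewrite ler_norml lerNl opprB lerBlDl => /andP[].
  have iP : intg leb I P by apply: intg_cont_seg; exact: continuous_dens.
  have iE c : intg leb I (cst c) by apply: intg_cont_seg => z; exact: cvg_cst.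
  have hc c : \int[leb]_(z in I) cst c z = c * l.
    by rewrite /I (Rint_cst_seg c le1); congr (_ * _); ring.
  have h2 : P x * l <= \int[leb]_(z in I) P z + E * l.
    rewrite -(hc (P x)) -(hc E) -(RintegralD mI iP (iE E)).
    exact: (le_Rintegral mI (iE (P x)) (intgD mI iP (iE E)) h1).
  by rewrite mulrC (le_trans h2)// (mulrC l) lerD2r.
have hP2 : P x <= eta / l + E.
  by rewrite -(ler_pM2l l0) mulrDr mulrCA mulfV ?gt_eqF// mulr1.
have p0 := dens_ge0 gam b0 x.
have := sqr_le_of_le_sum p0 hP2 hE.
by rewrite divr1 -mulrA.
Qed.

(* The bound that makes the critical cubic term absorbable: small mass on windows of length l. *)
Lemma dens_cube_le (l eta : R) : 0 < l -> (forall z, U (z + l) - U z <= eta) ->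
  intg leb setT (fun x => P x ^+ 3) /\
  \int[leb]_x (P x ^+ 3) <= 2 * (eta / l) ^+ 2 + 2 * (eta + d * l) * eta * \int[leb]_x fdens x.
Proof.
move=> l0 hU.
have eta0 : 0 <= eta by apply: le_trans (hU 0); rewrite subr_ge0 distfun_nd// lerDl ltW.
have c0 : 0 <= 2 * (eta + d * l) by rewrite mulr_ge0// addr_ge0// mulr_ge0// ltW.
have mP : measurable_fun setT P by apply: continuous_measurable_fun; exact: continuous_dens.
apply: Rint_ge0_le => //.
- exact: measurable_funX.
- by move=> x _; rewrite exprn_ge0// dens_ge0.
have f0 (xz : measurableTypeR R * measurableTypeR R) :
    (0 <= (P xz.1 * (if (xz.1 <= xz.2) && (xz.2 <= xz.1 + l) then fdens xz.2 else 0))%:E)%E.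
  by rewrite lee_fin mulr_ge0 ?dens_ge0//; case: ifP => // _; exact: fdens_ge0.
have mf : measurable_fun setT (fun xz : measurableTypeR R * measurableTypeR R =>
   (P xz.1 * (if (xz.1 <= xz.2) && (xz.2 <= xz.1 + l) then fdens xz.2 else 0))%:E).
  apply/measurable_EFinP; apply: measurable_funM.
    by apply: measurableT_comp => //; exact: measurable_fst.
  apply: measurable_fun_if => //.
  - apply: measurable_and.
      by apply: measurable_fun_ler; [exact: measurable_fst|exact: measurable_snd].
    apply: measurable_fun_ler; first exact: measurable_snd.
    by apply: measurable_funD => //; exact: measurable_fst.
  - apply: measurable_funTS; apply: measurableT_comp; last exact: measurable_snd.
    exact: measurable_fdens.
have iS x : intg leb `[x, x + l] fdens by apply: intg_cont_seg; exact: continuous_fdens.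
have If x : (\int[leb]_z (P x * (if (x <= z) && (z <= x + l) then fdens z else 0))%:E)%E
   = (P x * \int[leb]_(z in `[x, x + l]) fdens z)%:E.
  under eq_integral do rewrite EFinM.
  rewrite ge0_integralZl_EFin ?dens_ge0//.
  - rewrite EFinM (EFin_Rint _ (iS x))//.
    congr (_ * _)%E; rewrite [RHS]integral_mkcond; apply: eq_integral => z _.
    by rewrite /patch mem_setE in_itv /=; case: ifP.
  - by move=> z _; rewrite lee_fin; case: ifP => // _; exact: fdens_ge0.
  - by have := measurable_fun_pair2 x mf; move=> _; apply/measurable_EFinP; apply: measurable_fun_if => //;
      [apply: measurable_and; apply: measurable_fun_ler => //|apply: measurable_funTS; exact: measurable_fdens].
(* Multiply [dens_sqr_le] by P(x) and integrate. The first term uses total mass one; in the second,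
   after Tonelli, the information at z is weighted by the mass of [z - l, z], which is the second
   factor eta. *)
apply: (@le_trans _ _ (\int[leb]_x ((2 * (eta / l) ^+ 2)%:E * (P x)%:E +
   (2 * (eta + d * l))%:E * \int[leb]_z (P x * (if (x <= z) && (z <= x + l) then fdens z else 0))%:E))%E).
  apply: ge0_le_integral => //.
  - by move=> x _; rewrite lee_fin exprn_ge0// dens_ge0.
  - by apply/measurable_EFinP; exact: measurable_funX.
  - apply: emeasurable_funD.
      by apply: measurable_funeM; exact/measurable_EFinP.
    apply: measurable_funeM; exact: (measurable_fun_fubini_tonelli_F _ mf f0).
  move=> x _; rewrite If -!EFinM -EFinD lee_fin.
  have h := dens_sqr_le x l0 hU; rewrite divr1 in h.
  have p0 := dens_ge0 gam b0 x.
  have := ler_wpM2l p0 h; lra.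
rewrite ge0_integralD//; last 4 first.
- by move=> x _; rewrite -EFinM lee_fin mulr_ge0 ?dens_ge0// mulr_ge0// sqr_ge0.
- by apply: measurable_funeM; exact/measurable_EFinP.
- move=> x _; apply: mule_ge0; rewrite ?lee_fin//; apply: integral_ge0 => z _; exact: (f0 (x, z)).
- by apply: measurable_funeM; exact: (measurable_fun_fubini_tonelli_F _ mf f0).
rewrite !ge0_integralZl_EFin//; last 5 first.
- by move=> x _; apply: integral_ge0 => z _; exact: (f0 (x, z)).
- exact: (measurable_fun_fubini_tonelli_F _ mf f0).
- by move=> x _; rewrite lee_fin dens_ge0.
- exact/measurable_EFinP.
- by rewrite mulr_ge0// sqr_ge0.
rewrite int_dens// mule1 EFinD leeD2l// -mulrA [X in (_ <= X)%E]EFinM lee_wpmul2l ?lee_fin//.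
rewrite (@fubini_tonelli _ _ _ _ R leb leb _ mf f0) /=.
rewrite EFinM EFin_Rint//; last exact: intg_fdens.
rewrite -ge0_integralZl_EFin//; last 2 first.
- by move=> x _; rewrite lee_fin fdens_ge0.
- by apply/measurable_EFinP; exact: measurable_fdens.
apply: ge0_le_integral => //.
- by move=> z _; apply: integral_ge0 => x _; exact: (f0 (x, z)).
- exact: (measurable_fun_fubini_tonelli_G _ mf f0).
- by apply: measurable_funeM; apply/measurable_EFinP; exact: measurable_fdens.
move=> z _.
pose I : set (measurableTypeR R) := `[z - l, z]%classic.
have mI : measurable I by exact: measurable_itv.
rewrite (_ : (\int[leb]_x _)%E = (\int[leb]_(x in I) ((fdens z)%:E * (P x)%:E))%E); last first.
  rewrite [RHS]integral_mkcond; apply: eq_integral => x _; rewrite /patch /I mem_setE in_itv /=.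
  have -> : (x <= z) && (z <= x + l) = (z - l <= x <= z).
    by rewrite andbC; congr andb; apply/idP/idP; lra.
  by case: ifP => _; rewrite ?mulr0// -EFinM mulrC.
rewrite ge0_integralZl_EFin ?fdens_ge0//; last 2 first.
- by move=> x _; rewrite lee_fin dens_ge0.
- by apply/measurable_EFinP; exact: measurable_funTS.
rewrite muleC lee_wpmul2r ?lee_fin ?fdens_ge0// -EFin_Rint//; last first.
  by apply: intg_cont_seg; exact: continuous_dens.
rewrite lee_fin; have := @window_dens _ gam b b0 l eta (z - l) (ltW l0) hU.
by rewrite subrK.
Qed.

End CubeBound.

(** * Oscillation of the distribution function over one mollification length *)

Section CommutatorBound.
Context {R : realType}.
Variable gam : probability R R.
Local Notation leb := (@lebesgue_measure R).
Local Notation U := (p_distfun gam).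
Variables (b : R) (b0 : 0 < b).
Local Notation P := (dens gam b).
Implicit Types (x y z r : R).

Lemma continuous_expN (c k : R) : continuous (fun r : R => k * expR (- (c * r))).
Proof.
move=> r; apply: cvgM; first exact: cvg_cst.
apply: (@continuous_comp _ _ _ (fun r => - (c * r)) (@expR R)); last exact: continuous_expR.
by apply: cvgN; apply: cvgM; [exact: cvg_cst|exact: cvg_id].
Qed.

(** Used as a layer-cake formula: an exponential in |x - y| is a superposition of indicators of the
    windows |x - y| < r. *)
Lemma exp_tail (c s : R) : 0 < c ->
  (\int[leb]_r (if s < r then c * expR (- (c * r)) else 0)%:E = (expR (- (c * s)))%:E)%E.
Proof.
move=> c0.
have dE r : is_derive r 1 (fun r => - expR (- (c * r))) (c * expR (- (c * r))).
  have h1 : is_derive r 1 (fun r => - (c * r)) (- c) by exact: (is_deriveN (is_derive_lin c r)).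
  have h2 : is_derive r 1 (expR \o (fun r => - (c * r))) (expR (- (c * r)) * - c).
    exact: is_derive1_comp.
  have := is_deriveN h2.
  by rewrite mulrN opprK mulrC.
have cE := @continuous_expN c c.
pose I : set (measurableTypeR R) := `]s, +oo[%classic.
rewrite (_ : (\int[leb]_r _)%E = (\int[leb]_(r in I) (c * expR (- (c * r)))%:E)%E); last first.
  rewrite [RHS]integral_mkcond; apply: eq_integral => r _; rewrite /patch /I mem_setE in_itv /= andbT.
  by case: ifP.
rewrite /I integral_itv_obnd_cbnd; last first.
  by apply/measurable_EFinP; apply: measurable_funTS; exact: continuous_measurable_fun.
rewrite (@ge0_continuous_FTC2y _ _ (fun r => - expR (- (c * r))) s 0).
- by rewrite -EFinB sub0r opprK.
- by move=> r _; rewrite mulr_ge0 ?expR_ge0 ?ltW.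
- exact: continuous_subspaceT.
- rewrite -oppr0; apply: cvgN.
  apply/cvgrPdist_le => e e0; exists (c * e)^-1; split; first exact: num_real.
  move=> r hr /=; rewrite sub0r normrN ger0_norm ?expR_ge0//.
  have r0 : 0 < r by apply: lt_trans hr; rewrite invr_gt0 mulr_gt0.
  have h : 1 <= e * (c * r).
    have := hr; rewrite -div1r ltr_pdivrMr ?mulr_gt0// => /ltW.
    by rewrite (_ : r * (c * e) = e * (c * r))//; ring.
  rewrite expRN invf_ple ?posrE ?expR_gt0//.
  have := expR_ge1Dx (c * r).
  have : e^-1 <= c * r by rewrite -[e^-1]mul1r ler_pdivrMr// mulrC.
  lra.
- by move=> r _; have [] := dE r.
- by apply: cvg_at_right_filter; exact: (is_derive_cont dE).
- by move=> r _; exact: is_derive_derive1.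
Qed.

Local Notation M x r := (U (x + r) - U (x - r)).
Local Notation kap r := (2 * b * (2 * b * expR (- (2 * b * r)))).

(** [om] is at most the integral of [kap] over r > |x - y|. For fixed r, each point y of the window
    contributes (U x - U y)^2 <= M^2, and these points have total mass at most M, whence the
    cube. *)
Lemma oscillation_le x :
  (\int[gam]_y ((U x - U y) ^+ 2 * om b (x - y))%:E <=
   \int[leb]_r (if (0 : R) < r then kap r * M x r ^+ 3 else 0)%:E)%E.
Proof.
have b20 : 0 < 2 * b by rewrite mulr_gt0.
have kap0 r : 0 <= kap r by rewrite !mulr_ge0 ?expR_ge0 ?ltW.
have f0 (yr : R * measurableTypeR R) :
    (0 <= ((U x - U yr.1) ^+ 2 * (if `|x - yr.1| < yr.2 then kap yr.2 else 0))%:E)%E.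
  by rewrite lee_fin mulr_ge0 ?sqr_ge0//; case: ifP.
have mexp : measurable_fun setT (fun r : R => kap r).
  by apply: measurable_funM => //; apply: continuous_measurable_fun; exact: continuous_expN.
have mf : measurable_fun setT (fun yr : R * measurableTypeR R =>
   ((U x - U yr.1) ^+ 2 * (if `|x - yr.1| < yr.2 then kap yr.2 else 0))%:E).
  apply/measurable_EFinP; apply: measurable_funM.
    apply: measurable_funX; apply: measurable_funB => //.
    by apply: measurableT_comp; [exact: measurable_distfun|exact: measurable_fst].
  apply: measurable_fun_if => //.
  - apply: measurable_fun_ltr; last exact: measurable_snd.
    apply: measurableT_comp => //; apply: measurable_funB => //; exact: measurable_fst.
  - by apply: measurable_funTS; exact: (measurableT_comp mexp measurable_snd).
apply: (@le_trans _ _ (\int[gam]_y \int[leb]_r ((U x - U y) ^+ 2 * (if `|x - y| < r then kap r else 0))%:E)%E).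
  apply: ge0_le_integral => //.
  - by move=> y _; rewrite lee_fin mulr_ge0 ?sqr_ge0// ltW// om_gt0.
  - apply/measurable_EFinP; apply: measurable_funM.
      by apply: measurable_funX; apply: measurable_funB => //; exact: measurable_distfun.
    by apply: continuous_measurable_fun; apply: continuous_reflect; exact: continuous_om.
  - exact: (measurable_fun_fubini_tonelli_F _ mf f0).
  move=> y _.
  under eq_integral do rewrite EFinM.
  rewrite ge0_integralZl_EFin ?sqr_ge0//; last 2 first.
  - by move=> r _; rewrite lee_fin; case: ifP.
  - by apply/measurable_EFinP; apply: measurable_fun_if => //;
      [exact: measurable_fun_ltr|exact: measurable_funTS].
  rewrite EFinM lee_wpmul2l ?lee_fin ?sqr_ge0//.
  rewrite (_ : (\int[leb]_r _)%E = ((2 * b)%:E * \int[leb]_r (if `|x - y| < r then (2 * b) * expR (- (2 * b * r)) else 0)%:E)%E).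
    by rewrite exp_tail// -EFinM lee_fin om_le_exp.
  rewrite -ge0_integralZl_EFin//.
  - apply: eq_integral => r _; rewrite -EFinM; congr EFin.
    by case: ifP => _; rewrite ?mulr0.
  - by move=> r _; rewrite lee_fin; case: ifP => // _; rewrite mulr_ge0 ?expR_ge0 ?ltW.
  - apply/measurable_EFinP; apply: measurable_fun_if => //; first exact: measurable_fun_ltr.
    apply: measurable_funTS.
    have -> : (fun r : R => 2 * b * expR (- (2 * b * r))) = (fun r => (2 * b)^-1 * kap r).
      by apply/funext => r; rewrite [RHS]mulrA mulVf ?mul1r// gt_eqF.
    by apply: measurable_funM.
  - exact: ltW.
rewrite (@fubini_tonelli _ _ _ _ R gam leb _ mf f0) /=.
have mM : measurable_fun setT (fun r : measurableTypeR R => M x r).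
  apply: measurable_funB.
    by apply: (measurableT_comp (measurable_distfun gam)); apply: measurable_funD.
  by apply: (measurableT_comp (measurable_distfun gam)); apply: measurable_funB.
apply: ge0_le_integral => //.
- by move=> r _; apply: integral_ge0 => y _; exact: (f0 (y, r)).
- exact: (measurable_fun_fubini_tonelli_G _ mf f0).
- apply/measurable_EFinP; apply: measurable_fun_if => //; first exact: measurable_fun_ltr.
  by apply: measurable_funTS; apply: measurable_funM => //; exact: measurable_funX.
move=> r _; case: ifPn => [r0|]; last first.
  rewrite -leNgt => r0; rewrite integral0_eq// => y _.
  rewrite ifF ?mulr0//; apply/negbTE; rewrite -leNgt; exact: le_trans r0 _.
pose I : set R := `]x - r, x + r]%classic.
have mI : measurable I by exact: measurable_itv.
have gI : gam I = (M x r)%:E by apply: distfun_itv; lra.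
have M0 : 0 <= M x r by rewrite subr_ge0 distfun_nd//; lra.
apply: (@le_trans _ _ (\int[gam]_(y in I) cst (kap r * M x r ^+ 2)%:E y)%E); last first.
  rewrite integral_cst//.
  rewrite -[X in (_ * X <= _)%E]/(gam I) gI -EFinM lee_fin.
  by rewrite le_eqVlt; apply/orP; left; apply/eqP; ring.
rewrite [leRHS]integral_mkcond; apply: ge0_le_integral => //.
- by move=> y _; exact: (f0 (y, r)).
- apply/measurable_EFinP; apply: measurable_funM.
    by apply: measurable_funX; apply: measurable_funB => //; exact: measurable_distfun.
  apply: measurable_fun_if => //; apply: measurable_fun_ltr => //.
  by apply: measurableT_comp => //; exact: measurable_funB.
- exact: ((measurable_restrictT _ mI).1 (measurable_cst _)).
move=> y _; rewrite /patch /I mem_setE in_itv /=.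
case: ifPn => [hy|_]; last by rewrite mulr0; case: ifP => // _; rewrite lee_fin mulr_ge0 ?sqr_ge0.
have [h1 h2] : x - r < y /\ y < x + r by move: hy; rewrite ltr_norml => /andP[]; lra.
rewrite h1 (ltW h2) /= lee_fin mulrC ler_wpM2l//.
have u1 := distfun_nd gam (ltW h1); have u2 := distfun_nd gam (ltW h2).
have u3 : U (x - r) <= U x by apply: distfun_nd; lra.
have u4 : U x <= U (x + r) by apply: distfun_nd; lra.
rewrite -[(U x - U y) ^+ 2]real_normK ?num_real// ler_pXn2r// ?nnegrE//.
by rewrite ler_norml; apply/andP; split; lra.
Qed.

(** [mass_le_dens] gives (e^2)^3 = e^6, Jensen on a window of length 2 rho gives (2 rho)^2, and
    Tonelli in x gives another 2 rho. *)
Lemma window_cube_le (I3 r : R) : 0 < r -> intg leb setT (fun x => P x ^+ 3) ->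
  \int[leb]_x (P x ^+ 3) = I3 ->
  (\int[leb]_x (M x r ^+ 3)%:E <= (8 * expR 6 * (r + b^-1) ^+ 3 * I3)%:E)%E.
Proof.
move=> r0 i3 e3; have bV : 0 < b^-1 by rewrite invr_gt0.
set rho := r + b^-1; have rho0 : 0 < rho by rewrite addr_gt0.
have cP := @continuous_dens _ gam b b0.
have cP3 : continuous (fun x => P x ^+ 3).
  have -> : (fun x => P x ^+ 3) = (fun x => P x * (P x * P x)) by apply/funext => x; rewrite exprS expr2.
  by move=> x; apply: cvgM; [exact: cP|apply: cvgM; exact: cP].
have P0 x := dens_ge0 gam b0 x.
have f0 (xz : measurableTypeR R * measurableTypeR R) :
    (0 <= (if (xz.1 - rho <= xz.2) && (xz.2 <= xz.1 + rho) then P xz.2 ^+ 3 else 0)%:E)%E.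
  by rewrite lee_fin; case: ifP => // _; rewrite exprn_ge0.
have mf : measurable_fun setT (fun xz : measurableTypeR R * measurableTypeR R =>
   (if (xz.1 - rho <= xz.2) && (xz.2 <= xz.1 + rho) then P xz.2 ^+ 3 else 0)%:E).
  apply/measurable_EFinP; apply: measurable_fun_if => //.
  - apply: measurable_and; apply: measurable_fun_ler; try exact: measurable_snd.
      by apply: measurable_funB => //; exact: measurable_fst.
    by apply: measurable_funD => //; exact: measurable_fst.
  - apply: measurable_funTS.
    by exact: (measurableT_comp (continuous_measurable_fun cP3) measurable_snd).
have e8 : 0 <= 4 * expR 6 * rho ^+ 2 by rewrite !mulr_ge0 ?expR_ge0 ?exprn_ge0 ?ltW.
have mM : measurable_fun setT (fun x : measurableTypeR R => M x r).
  apply: measurable_funB.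
    by apply: (measurableT_comp (measurable_distfun gam)); apply: measurable_funD.
  by apply: (measurableT_comp (measurable_distfun gam)); apply: measurable_funB.
have M0 x : 0 <= M x r by rewrite subr_ge0 distfun_nd//; lra.
apply: (@le_trans _ _ (\int[leb]_x ((4 * expR 6 * rho ^+ 2)%:E *
    \int[leb]_z (if (x - rho <= z) && (z <= x + rho) then P z ^+ 3 else 0)%:E))%E).
  apply: ge0_le_integral => //.
  - by move=> x _; rewrite lee_fin exprn_ge0.
  - by apply/measurable_EFinP; exact: measurable_funX.
  - by apply: measurable_funeM; exact: (measurable_fun_fubini_tonelli_F _ mf f0).
  move=> x _.
  have le1 : x - rho <= x + rho by lra.
  pose I : set (measurableTypeR R) := `[x - rho, x + rho]%classic.
  have mI : measurable I by exact: measurable_itv.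
  have iP3 : intg leb I (fun z => P z ^+ 3) by exact: intg_cont_seg.
  have iP : intg leb I P by exact: intg_cont_seg.
  rewrite (_ : (\int[leb]_z _)%E = (\int[leb]_(z in I) P z ^+ 3)%:E); last first.
    rewrite EFin_Rint// [RHS]integral_mkcond; apply: eq_integral => z _.
    by rewrite /patch /I mem_setE in_itv /=; case: ifP.
  rewrite -EFinM lee_fin.
  have h1 := mass_le_dens gam b0 x (ltW r0); rewrite -/rho in h1.
  have lI : leb I = (2 * rho)%:E by rewrite lebesgue_seg//; congr EFin; ring.
  have r20 : 0 < 2 * rho by rewrite mulr_gt0.
  have h2 := Jensen_cube mI r20 lI (fun z _ => P0 z) iP iP3.
  set q := \int[leb]_(z in I) P z in h1 h2 *.
  have q0 : 0 <= q by apply: Rintegral_ge0.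
  have h3 : M x r ^+ 3 <= (expR 2 * q) ^+ 3.
    by rewrite ler_pXn2r// nnegrE// mulr_ge0 ?expR_ge0.
  apply: (le_trans h3); rewrite exprMn -expRM_natl.
  have -> : 3%:R * 2 = 6 :> R by lra.
  apply: (le_trans (ler_wpM2l (expR_ge0 _) h2)).
  by rewrite le_eqVlt; apply/orP; left; apply/eqP; ring.
rewrite ge0_integralZl_EFin//; last 2 first.
- by move=> x _; apply: integral_ge0 => z _; exact: (f0 (x, z)).
- exact: (measurable_fun_fubini_tonelli_F _ mf f0).
rewrite (@fubini_tonelli _ _ _ _ R leb leb _ mf f0) /=.
rewrite (_ : (\int[leb]_z _)%E = (\int[leb]_z ((2 * rho)%:E * (P z ^+ 3)%:E))%E); last first.
  apply: eq_integral => z _.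
  pose I : set (measurableTypeR R) := `[z - rho, z + rho]%classic.
  have mI : measurable I by exact: measurable_itv.
  have lI : leb I = (2 * rho)%:E by rewrite lebesgue_seg; [congr EFin; ring|lra].
  rewrite (_ : (\int[leb]_x _)%E = (\int[leb]_(x in I) cst (P z ^+ 3)%:E x)%E); last first.
    rewrite [RHS]integral_mkcond; apply: eq_integral => x _; rewrite /patch /I mem_setE in_itv /=.
    have -> : (x - rho <= z) && (z <= x + rho) = (z - rho <= x <= z + rho).
      by rewrite andbC; congr andb; apply/idP/idP; lra.
    by case: ifP.
  by rewrite integral_cst// -[X in (_ * X = _)%E]/(leb I) lI muleC.
rewrite ge0_integralZl_EFin//; last 3 first.
- by move=> z _; rewrite lee_fin exprn_ge0.
- by apply/measurable_EFinP; exact: continuous_measurable_fun.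
- by rewrite mulr_ge0// ltW.
rewrite -EFin_Rint// e3 -!EFinM lee_fin.
by rewrite le_eqVlt; apply/orP; left; apply/eqP; ring.
Qed.

Definition osc x : R := \int[gam]_y ((U x - U y) ^+ 2 * om b (x - y)).

Lemma intg_osc x : intg gam setT (fun y => (U x - U y) ^+ 2 * om b (x - y)).
Proof.
apply: (@intg_le _ _ _ _ _ _ (fun y => om b (x - y))) => //.
- apply: measurable_funM.
    by apply: measurable_funX; apply: measurable_funB => //; exact: measurable_distfun.
  by apply: continuous_measurable_fun; apply: continuous_reflect; exact: continuous_om.
- exact: intg_om.
move=> y _; rewrite ger0_norm; last by rewrite mulr_ge0 ?sqr_ge0// ltW// om_gt0.
rewrite ler_piMl ?(ltW (om_gt0 _ b0))//.
have := distfun_ge0 gam x; have := distfun_ge0 gam y.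
have := distfun_le1 gam x; have := distfun_le1 gam y; nra.
Qed.

(** The gain b^-2 compensates exactly the b^2 lost when [om1] is compared with [om]. Half of the
    exponential in [kap] absorbs (1 + b r)^3 <= 6 e^(1 + b r), so the constant is 4 * 8 * 6 = 192,
    with e^6 e = e^7. *)
Lemma osc_integral (I3 : R) : intg leb setT (fun x => P x ^+ 3) ->
  \int[leb]_x (P x ^+ 3) = I3 ->
  intg leb setT osc /\ \int[leb]_x osc x <= 192 * expR 7 * b ^- 2 * I3.
Proof.
move=> i3 e3.
have I30 : 0 <= I3 by rewrite -e3; apply: Rintegral_ge0 => x _; rewrite exprn_ge0// dens_ge0.
have osc0 x : 0 <= osc x.
  by apply: Rintegral_ge0 => y _; rewrite mulr_ge0 ?sqr_ge0// ltW// om_gt0.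
have oscE x : (osc x)%:E = (\int[gam]_y ((U x - U y) ^+ 2 * om b (x - y))%:E)%E.
  by rewrite EFin_Rint//; exact: intg_osc.
have mosc : measurable_fun setT osc.
  apply/measurable_EFinP; rewrite (_ : EFin \o osc = fun x => (\int[gam]_y ((U x - U y) ^+ 2 * om b (x - y))%:E)%E); last first.
    by apply/funext => x; rewrite /= oscE.
  have mf : measurable_fun setT (fun xy : measurableTypeR R * R => ((U xy.1 - U xy.2) ^+ 2 * om b (xy.1 - xy.2))%:E).
    apply/measurable_EFinP; apply: measurable_funM.
      apply: measurable_funX; apply: measurable_funB.
        by apply: (measurableT_comp (measurable_distfun gam)); exact: measurable_fst.
      by apply: (measurableT_comp (measurable_distfun gam)); exact: measurable_snd.
    apply: measurableT_comp; first by apply: continuous_measurable_fun; exact: continuous_om.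
    by apply: measurable_funB; [exact: measurable_fst|exact: measurable_snd].
  have f0 (xy : measurableTypeR R * R) : (0 <= ((U xy.1 - U xy.2) ^+ 2 * om b (xy.1 - xy.2))%:E)%E.
    by rewrite lee_fin mulr_ge0 ?sqr_ge0// ltW// om_gt0.
  exact: (measurable_fun_fubini_tonelli_F _ mf f0).
have kap0 r : 0 <= kap r by rewrite !mulr_ge0 ?expR_ge0 ?ltW.
apply: Rint_ge0_le => //.
have M0 x r : 0 < r -> 0 <= M x r by move=> r0; rewrite subr_ge0 distfun_nd//; lra.
have f0 (xr : measurableTypeR R * measurableTypeR R) :
    (0 <= (if (0 : R) < xr.2 then kap xr.2 * M xr.1 xr.2 ^+ 3 else 0)%:E)%E.
  by rewrite lee_fin; case: ifP => // h; rewrite mulr_ge0// exprn_ge0// M0.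
have mexp : measurable_fun setT (fun r : R => kap r).
  by apply: measurable_funM => //; apply: continuous_measurable_fun; exact: continuous_expN.
have mf : measurable_fun setT (fun xr : measurableTypeR R * measurableTypeR R =>
    (if (0 : R) < xr.2 then kap xr.2 * M xr.1 xr.2 ^+ 3 else 0)%:E).
  apply/measurable_EFinP; apply: measurable_fun_if => //.
    by apply: measurable_fun_ltr => //; exact: measurable_snd.
  apply: measurable_funTS; apply: measurable_funM.
    by exact: (measurableT_comp mexp measurable_snd).
  apply: measurable_funX; apply: measurable_funB.
    apply: (measurableT_comp (measurable_distfun gam)).
    by apply: measurable_funD; [exact: measurable_fst|exact: measurable_snd].
  apply: (measurableT_comp (measurable_distfun gam)).
  by apply: measurable_funB; [exact: measurable_fst|exact: measurable_snd].
apply: (@le_trans _ _ (\int[leb]_x \int[leb]_r (if (0 : R) < r then kap r * M x r ^+ 3 else 0)%:E)%E).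
  apply: ge0_le_integral => //.
  - by move=> x _; rewrite lee_fin.
  - exact/measurable_EFinP.
  - exact: (measurable_fun_fubini_tonelli_F _ mf f0).
  - by move=> x _; rewrite oscE; exact: oscillation_le.
rewrite (@fubini_tonelli _ _ _ _ R leb leb _ mf f0) /=.
set K := 192 * expR 7 * b^-1 * I3.
have K0 : 0 <= K by rewrite !mulr_ge0 ?expR_ge0// invr_ge0 ltW.
apply: (@le_trans _ _ (\int[leb]_r ((K / b)%:E * (if (0 : R) < r then b * expR (- (b * r)) else 0)%:E))%E); last first.
  rewrite ge0_integralZl_EFin//; last 3 first.
  - by move=> r _; rewrite lee_fin; case: ifP => // _; rewrite mulr_ge0 ?expR_ge0 ?ltW.
  - apply/measurable_EFinP; apply: measurable_fun_if => //; first exact: measurable_fun_ltr.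
    apply: measurable_funTS; by apply: continuous_measurable_fun; exact: continuous_expN.
  - by rewrite divr_ge0// ltW.
  rewrite exp_tail// mulr0 oppr0 expR0 mule1 lee_fin /K.
  by rewrite le_eqVlt; apply/orP; left; apply/eqP; field; rewrite gt_eqF.
apply: ge0_le_integral => //.
- by move=> r _; apply: integral_ge0 => x _; exact: (f0 (x, r)).
- exact: (measurable_fun_fubini_tonelli_G _ mf f0).
- apply: measurable_funeM; apply/measurable_EFinP; apply: measurable_fun_if => //; first exact: measurable_fun_ltr.
  apply: measurable_funTS; by apply: continuous_measurable_fun; exact: continuous_expN.
move=> r _; case: ifPn => [r0|_]; last by rewrite mule0 integral0_eq.
under eq_integral do rewrite EFinM.
rewrite ge0_integralZl_EFin//; last 2 first.
- by move=> x _; rewrite lee_fin exprn_ge0// M0.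
- apply/measurable_EFinP; apply: measurable_funX; apply: measurable_funB.
    by apply: (measurableT_comp (measurable_distfun gam)); apply: measurable_funD.
  by apply: (measurableT_comp (measurable_distfun gam)); apply: measurable_funB.
apply: (@le_trans _ _ ((kap r)%:E * (8 * expR 6 * (r + b^-1) ^+ 3 * I3)%:E)%E).
  by rewrite lee_wpmul2l ?lee_fin//; exact: window_cube_le.
rewrite -!EFinM lee_fin.
have br : 0 <= 1 + b * r by rewrite addr_ge0// mulr_ge0 ?ltW.
have h := pow_le_expR 3 br.
have -> : (r + b^-1) ^+ 3 = b ^- 3 * (1 + b * r) ^+ 3.
  by field; rewrite gt_eqF.
have e67 : expR 7 = expR 6 * expR 1 :> R by rewrite -expRD; congr expR; lra.
have e2 : expR (- (2 * b * r)) * expR (1 + b * r) = expR 1 * expR (- (b * r)).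
  by rewrite -!expRD; congr expR; lra.
rewrite /K e67.
have -> : 192 * (expR 6 * expR 1) * b^-1 * I3 / b * (b * expR (- (b * r)))
   = 32 * expR 6 * b^-1 * I3 * (6 * (expR 1 * expR (- (b * r)))) by field; rewrite gt_eqF.
rewrite -e2.
have -> : 2 * b * (2 * b * expR (- (2 * b * r))) * (8 * expR 6 * (b ^- 3 * (1 + b * r) ^+ 3) * I3)
  = 32 * expR 6 * b^-1 * I3 * (expR (- (2 * b * r)) * (1 + b * r) ^+ 3) by field; rewrite gt_eqF.
have K1 : 0 <= 32 * expR 6 * b^-1 * I3 by rewrite !mulr_ge0 ?expR_ge0// invr_ge0 ltW.
rewrite (ler_wpM2l K1)// [leRHS]mulrCA (ler_wpM2l (expR_ge0 _))//.
Qed.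

End CommutatorBound.

(** * Dissipation at a fixed time *)

Section Dissipation.
Context {R : realType}.
Variable gam : probability R R.
Local Notation leb := (@lebesgue_measure R).
Local Notation U := (p_distfun gam).
Variables (b d : R) (b0 : 0 < b) (d0 : 0 < d).
Variables (a k : R -> R) (a0 a1 L : R).
Hypothesis a0p : 0 < a0.
Hypothesis ma : measurable_fun setT a.
Hypothesis mk : measurable_fun setT k.
Hypothesis a_ge : forall y, a0 <= a y.
Hypothesis a_le : forall y, a y <= a1.
Hypothesis a_lip : forall x y, `|a y - a x| <= L * `|U y - U x|.
Hypothesis ik2 : intg gam setT (fun y => k y ^+ 2).
Local Notation P := (dens gam b).
Local Notation P1 := (ddens gam b).
Local Notation W := (conv gam a (om1 b)).
Local Notation F := (conv gam k (om b)).
Implicit Types (x y : R).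

Let Pd x : 0 < P x + d. Proof. by rewrite ltr_wpDl// dens_ge0. Qed.

Lemma intg_a : intg gam setT a.
Proof.
apply: (@intg_le _ _ _ _ _ _ (cst a1)) => //; first exact: intg_cst.
by move=> y _; rewrite ger0_norm ?a_le// (le_trans _ (a_ge y))// ltW.
Qed.

Lemma intg_k : intg gam setT k.
Proof.
apply: (@intg_le _ _ _ _ _ _ (fun y => 1 + k y ^+ 2)) => //.
  by apply: intgD => //; exact: intg_cst.
move=> y _; rewrite -[k y ^+ 2]real_normK ?num_real//.
have := normr_ge0 (k y); nra.
Qed.

Lemma om1E u : om1 b u = - 2 * b * th (b * u) * om b u.
Proof. by rewrite /om1 /om; field. Qed.

Lemma measurable_om_refl x : measurable_fun setT (fun y => om b (x - y)).
Proof. by apply: continuous_measurable_fun; apply: continuous_reflect; exact: continuous_om. Qed.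

(** W - a P1 is the integral of (a y - a x) om1(x - y). The kernel [om1] is [om] times a factor of
    size at most 2 b, a is Lipschitz as a function of U, and Cauchy-Schwarz is taken with weight
    [om]. *)
Lemma commutator_le x : (W x - a x * P1 x) ^+ 2 <= 4 * b ^+ 2 * L ^+ 2 * (P x * osc gam b x).
Proof.
have iW : intg gam setT (fun y => a y * om1 b (x - y)).
  by apply: (@intg_conv _ _ _ _ (2 * b ^+ 2)) => //; [exact: intg_a|exact: continuous_om1|move=> u; exact: om1_bd].
have iP1 := intg_om1 gam b0 x.
have iom := intg_om gam b0 x.
pose kk y := - 2 * b * th (b * (x - y)) * (a y - a x).
have E : W x - a x * P1 x = \int[gam]_y (kk y * om b (x - y)).
  rewrite ddensE -RintegralZl// /conv -RintegralB//; last exact: intgZ.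
  by apply: eq_Rintegral => y _; rewrite !om1E /kk; ring.
have mth : measurable_fun setT (fun y => th (b * (x - y))).
  by apply: continuous_measurable_fun; apply: (continuous_reflect (f := fun u => th (b * u))); exact: continuous_thb.
have mkk : measurable_fun setT kk.
  by apply: measurable_funM; [apply: measurable_funM|apply: measurable_funB].
have kkle y : kk y ^+ 2 * om b (x - y) <= 4 * b ^+ 2 * L ^+ 2 * ((U x - U y) ^+ 2 * om b (x - y)).
  rewrite [leRHS]mulrA ler_wpM2r ?(ltW (om_gt0 _ b0))//.
  have t1 := ltW (th_sqr_lt1 (b * (x - y))).
  have hL : (a y - a x) ^+ 2 <= L ^+ 2 * (U x - U y) ^+ 2.
    have := a_lip x y; rewrite -[(a y - a x) ^+ 2]real_normK ?num_real// => h.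
    have : `|a y - a x| ^+ 2 <= (L * `|U y - U x|) ^+ 2.
      by rewrite ler_pXn2r// nnegrE ?normr_ge0// (le_trans _ h).
    by rewrite exprMn (distrC (U y)) [`|_ - _| ^+ 2 in X in _ <= X -> _]real_normK ?num_real.
  have -> : kk y ^+ 2 = (4 * b ^+ 2) * (th (b * (x - y)) ^+ 2 * (a y - a x) ^+ 2) by rewrite /kk; ring.
  have c4 : 0 <= 4 * b ^+ 2 by rewrite mulr_ge0 ?sqr_ge0.
  rewrite -[leRHS]mulrA (ler_wpM2l c4)//.
  rewrite -[leRHS]mul1r; apply: ler_pM => //; exact: sqr_ge0.
have iosc := intg_osc gam b0 x.
have ikk : intg gam setT (fun y => kk y ^+ 2 * om b (x - y)).
  apply: (@intg_le _ _ _ _ _ _ (fun y => 4 * b ^+ 2 * L ^+ 2 * ((U x - U y) ^+ 2 * om b (x - y)))) => //.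
  - by apply: measurable_funM; [exact: measurable_funX|exact: measurable_om_refl].
  - exact: intgZ.
  - by move=> y _; rewrite ger0_norm// mulr_ge0 ?sqr_ge0// ltW// om_gt0.
have [_ h] := weighted_CS measurableT mkk (fun y _ => ltW (om_gt0 (x - y) b0)) iom ikk.
rewrite E (le_trans h)// -densE mulrCA ler_wpM2l ?dens_ge0//.
rewrite /osc -RintegralZl//; apply: le_Rintegral => //; exact: intgZ.
Qed.

Definition mean2 x : R := \int[gam]_y (k y ^+ 2 * om b (x - y)).

Lemma intg_mean2 x : intg gam setT (fun y => k y ^+ 2 * om b (x - y)).
Proof. by apply: (@intg_conv _ _ _ _ b) => //; [exact: continuous_om|exact: om_bd]. Qed.

Lemma drift_le x : F x ^+ 2 <= P x * mean2 x.
Proof.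
have [_ h] := weighted_CS measurableT mk (fun y _ => ltW (om_gt0 (x - y) b0)) (intg_om gam b0 x) (intg_mean2 x).
by rewrite [in X in _ <= X]densE.
Qed.

Lemma conv_tonelli (f : R -> R) : measurable_fun setT f -> (forall y, 0 <= f y) ->
  intg gam setT f ->
  intg leb setT (conv gam f (om b)) /\ \int[leb]_x (conv gam f (om b) x) = \int[gam]_y f y.
Proof.
move=> mf f0 fi.
have i x : intg gam setT (fun y => f y * om b (x - y)).
  by apply: (@intg_conv _ _ _ _ b) => //; [exact: continuous_om|exact: om_bd].
have E : (\int[leb]_x (conv gam f (om b) x)%:E = (\int[gam]_y f y)%:E)%E.
  rewrite EFin_Rint// -(tonelli_conv gam b0 mf f0).
  by apply: eq_integral => x _; rewrite /conv EFin_Rint.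
split; last by rewrite /Rintegral E.
apply: intg_ge0P => //.
- apply: continuous_measurable_fun; apply: is_derive_cont => x.
  exact: (is_derive_conv (C := b) (C' := 2 * b ^+ 2) x fi (is_derive_om b) (om_bd b0) (fun u => om1_bd u b0)).
- by move=> x _; apply: Rintegral_ge0 => y _; rewrite mulr_ge0// ltW// om_gt0.
- by rewrite E ltry.
Qed.

Lemma continuous_W : continuous W.
Proof.
apply: is_derive_cont => x.
exact: (is_derive_conv (C := 2 * b ^+ 2) (C' := 4 * b ^+ 3) x intg_a (is_derive_om1 b) (fun u => om1_bd u b0) (fun u => om2_bd u b0)).
Qed.

Lemma continuous_F : continuous F.
Proof.
apply: is_derive_cont => x.
exact: (is_derive_conv (C := b) (C' := 2 * b ^+ 2) x intg_k (is_derive_om b) (om_bd b0) (fun u => om1_bd u b0)).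
Qed.

Lemma W_le x : `|W x| <= a1 * (2 * b) * P x.
Proof.
have iW : intg gam setT (fun y => a y * om1 b (x - y)).
  by apply: (@intg_conv _ _ _ _ (2 * b ^+ 2)) => //; [exact: intg_a|exact: continuous_om1|move=> u; exact: om1_bd].
rewrite densE -RintegralZl//; last exact: intg_om.
apply: (le_trans (le_normr_Rintegral _ iW)) => //.
apply: le_Rintegral => //.
- exact: intg_norm.
- by apply: intgZ => //; exact: intg_om.
move=> y _; rewrite normrM -mulrA.
apply: ler_pM => //; last exact: om1_le.
by rewrite ger0_norm ?a_le// (le_trans _ (a_ge y))// ltW.
Qed.

Lemma F_le x : `|F x| <= conv gam (fun y => `|k y|) (om b) x.
Proof.
have iF : intg gam setT (fun y => k y * om b (x - y)).
  by apply: (@intg_conv _ _ _ _ b) => //; [exact: intg_k|exact: continuous_om|exact: om_bd].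
apply: (le_trans (le_normr_Rintegral _ iF)) => //.
rewrite /conv; apply: (@le_trans _ _ (\int[gam]_y `|k y * om b (x - y)|)) => //.
rewrite le_eqVlt; apply/orP; left; apply/eqP.
by apply: eq_Rintegral => y _; rewrite normrM (ger0_norm (ltW (om_gt0 (x - y) b0))).
Qed.

Lemma intg_WF : intg leb setT (fun x => a1 * (2 * b) * P x + conv gam (fun y => `|k y|) (om b) x).
Proof.
apply: intgD => //; first by apply: intgZ => //; exact: intg_dens.
have [] := @conv_tonelli (fun y => `|k y|) => //; first exact: measurableT_comp.
by apply: intg_norm => //; exact: intg_k.
Qed.

Lemma intg_dissip : intg leb setT (fun x => P1 x * (W x + F x) / (P x + d)).
Proof.
apply: (@intg_le _ (measurableTypeR R) _ _ _ _ (fun x => (2 * b) * (a1 * (2 * b) * P x + conv gam (fun y => `|k y|) (om b) x))) => //.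
- apply: continuous_measurable_fun => x; apply: cvgM.
    apply: cvgM; first exact: continuous_ddens.
    by apply: cvgD; [exact: continuous_W|exact: continuous_F].
  apply: cvgV; first by rewrite gt_eqF.
  by apply: cvgD; [exact: continuous_dens|exact: cvg_cst].
- by apply: intgZ => //; exact: intg_WF.
move=> x _; rewrite mulrAC normrM; apply: ler_pM => //.
  rewrite normrM normfV [`|P x + d|]gtr0_norm// ler_pdivrMr//.
  apply: (le_trans (ddens_le gam b0 x)).
  by rewrite ler_wpM2l ?mulr_ge0 ?(ltW b0)// lerDl ltW.
by apply: (le_trans (ler_normD _ _)); rewrite lerD ?W_le ?F_le.
Qed.

(** With w = aa p1 + (w - aa p1), the square is completed once against the commutator and once
    against the drift; each costs a0/4 of the dissipation, leaving a0/2. *)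
Lemma dissip_pointwise (p1 p v w f aa S G : R) : 0 <= p -> p <= v -> 0 < v -> a0 <= aa ->
  (w - aa * p1) ^+ 2 <= p * S -> f ^+ 2 <= p * G -> 0 <= S -> 0 <= G ->
  - (p1 * (w + f) / v) <= - (a0 / 2) * (p1 ^+ 2 / v) + a0^-1 * (S + G).
Proof.
move=> p_0 pv v0 aa0 hc hf S0 G0.
have hS : (w - aa * p1) ^+ 2 / v <= S by rewrite ler_pdivrMr// (le_trans hc)// mulrC ler_wpM2l.
have hG : f ^+ 2 / v <= G by rewrite ler_pdivrMr// (le_trans hf)// mulrC ler_wpM2l.
apply: (@le_trans _ _ (- (a0 / 2) * (p1 ^+ 2 / v) + a0^-1 * ((w - aa * p1) ^+ 2 / v + f ^+ 2 / v))); last first.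
  by rewrite lerD2l ler_wpM2l ?lerD// invr_ge0 ltW.
rewrite -subr_ge0.
have -> : - (a0 / 2) * (p1 ^+ 2 / v) + a0^-1 * ((w - aa * p1) ^+ 2 / v + f ^+ 2 / v) - - (p1 * (w + f) / v)
  = ((aa - a0) * p1 ^+ 2 + (a0 / 2 * p1 + (w - aa * p1)) ^+ 2 / a0 + (a0 / 2 * p1 + f) ^+ 2 / a0) / v.
  by field; rewrite !gt_eqF.
rewrite divr_ge0 ?(ltW v0)// !addr_ge0// ?divr_ge0 ?sqr_ge0 ?(ltW a0p)//.
by rewrite mulr_ge0 ?sqr_ge0// subr_ge0.
Qed.

(** 768 = 4 * 192: the factor 4 b^2 of [commutator_le] meets b^-2 in [osc_integral], and the error
    no longer depends on b. *)
Lemma dissipation (I3 : R) : intg leb setT (fun x => P x ^+ 3) -> \int[leb]_x (P x ^+ 3) = I3 ->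
  - (\int[leb]_x (P1 x * (W x + F x) / (P x + d))) <=
  - (a0 / 2) * (\int[leb]_x fdens gam b d x) +
    a0^-1 * (768 * expR 7 * L ^+ 2 * I3 + \int[gam]_y (k y ^+ 2)).
Proof.
move=> i3 e3.
have osc0 x : 0 <= osc gam b x.
  by apply: Rintegral_ge0 => y _; rewrite mulr_ge0 ?sqr_ge0// ltW// om_gt0.
have [iosc hosc] := osc_integral b0 i3 e3.
have [iG eG] := conv_tonelli (measurable_funX 2 mk) (fun y => sqr_ge0 (k y)) ik2.
have c0 : 0 <= 4 * b ^+ 2 * L ^+ 2 by rewrite mulr_ge0 ?sqr_ge0// mulr_ge0 ?sqr_ge0.
have iS : intg leb setT (fun x => 4 * b ^+ 2 * L ^+ 2 * osc gam b x) by exact: intgZ.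
have iSG : intg leb setT (fun x => 4 * b ^+ 2 * L ^+ 2 * osc gam b x + conv gam (fun y => k y ^+ 2) (om b) x).
  exact: intgD.
have ifd := intg_fdens gam b0 d0.
have iR : intg leb setT (fun x => - (a0 / 2) * fdens gam b d x +
   a0^-1 * (4 * b ^+ 2 * L ^+ 2 * osc gam b x + conv gam (fun y => k y ^+ 2) (om b) x)).
  by apply: intgD => //; exact: intgZ.
have iD := intg_dissip.
have -> : - (\int[leb]_x (P1 x * (W x + F x) / (P x + d))) = \int[leb]_x (- 1 * (P1 x * (W x + F x) / (P x + d))).
  by rewrite RintegralZl// mulN1r.
apply: (@le_trans _ _ (\int[leb]_x (- (a0 / 2) * fdens gam b d x +
   a0^-1 * (4 * b ^+ 2 * L ^+ 2 * osc gam b x + conv gam (fun y => k y ^+ 2) (om b) x)))).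
  apply: le_Rintegral => //; first exact: intgZ.
  move=> x _; rewrite mulN1r.
  apply: (@dissip_pointwise _ (P x) _ _ _ (a x)); rewrite ?dens_ge0 ?a_ge//.
  - by rewrite lerDl ltW.
  - by apply: (le_trans (commutator_le x)); rewrite mulrCA.
  - exact: drift_le.
  - by rewrite mulr_ge0.
  - by apply: Rintegral_ge0 => y _; rewrite mulr_ge0 ?sqr_ge0// ltW// om_gt0.
rewrite RintegralD//; [|exact: intgZ..].
rewrite !RintegralZl// RintegralD// RintegralZl// eG lerD2l ler_wpM2l ?invr_ge0 ?(ltW a0p)// lerD2r.
apply: (le_trans (ler_wpM2l c0 hosc)).
by rewrite le_eqVlt; apply/orP; left; apply/eqP; field; rewrite gt_eqF.
Qed.

End Dissipation.

(** * The chain inequality and the entropy function *)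

Section FamilyMeasurability.
Context d (X : measurableType d) {R : realType}.
Variable g : X -> probability R R.
Hypothesis mg : forall B : set R, measurable B -> measurable_fun [set: X] (fun t => g t B).

(** Reading the family as a probability kernel makes measurability of parametrized integrals
    available. *)
Definition fam_kernel : X -> {measure set R -> \bar R} := g.
HB.instance Definition _ := isKernel.Build _ _ X R R fam_kernel mg.
HB.instance Definition _ := Kernel_isProbability.Build _ _ X R R fam_kernel
  (fun x => probability_setT (g x)).

Lemma measurable_int_fam (f : X * R -> \bar R) : measurable_fun setT f ->
  (forall z, (0 <= f z)%E) -> measurable_fun setT (fun x => (\int[g x]_y f (x, y))%E).
Proof.
by move=> mf f0; exact: (@measurable_fun_integral_finite_kernel _ _ _ _ _ f fam_kernel f0 mf).
Qed.

(** [fine] of the difference of the two one-signed integrals is measurable, also at the parameters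
    where it is a default value. *)
Lemma measurable_Rint_fam (f : X * R -> R) : measurable_fun setT f ->
  measurable_fun setT (fun x => \int[g x]_y f (x, y)).
Proof.
move=> mf; rewrite /Rintegral.
apply: (measurableT_comp (f := fine)) => //.
have -> : (fun x => \int[g x]_y (f (x, y))%:E)%E =
  (fun x => \int[g x]_y ((EFin \o f)^\+ (x, y)) - \int[g x]_y ((EFin \o f)^\- (x, y)))%E.
  apply/funext => x; rewrite integralE.
  by congr (_ - _)%E; apply: eq_integral => y _; rewrite ?(funeposE, funenegE).
have mf' : measurable_fun setT (EFin \o f) by exact/measurable_EFinP.
apply: emeasurable_funB; apply: measurable_int_fam => //.
- exact: measurable_funepos.
- exact: measurable_funeneg.
Qed.

End FamilyMeasurability.

(** * A convex function along an absolutely continuous curve *)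

Section ChainInequality.
Context {R : realType}.
Local Notation leb := (@lebesgue_measure R).
Variables (T c : R) (P Q F phi : R -> R).
Hypothesis T0 : 0 <= T.
Hypothesis c0 : 0 <= c.
Hypothesis iQ : intg leb `[0, T] Q.
Hypothesis PQ : forall t, 0 <= t <= T -> P t - P 0 = \int[leb]_(s in `[0, t]) Q s.
Hypothesis FP : forall s t, 0 <= s <= T -> 0 <= t <= T -> F (P t) - F (P s) <= phi (P t) * (P t - P s).
Hypothesis phiL : forall s t, 0 <= s <= T -> 0 <= t <= T -> `|phi (P t) - phi (P s)| <= c * `|P t - P s|.
Hypothesis mP : measurable_fun `[0, T] (fun s => phi (P s)).

Lemma Rint_split (f : R -> R) (s t : R) : intg leb `[0, T] f -> 0 <= s -> s <= t -> t <= T ->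
  intg leb `]s, t] f /\
  \int[leb]_(r in `]s, t]) f r = \int[leb]_(r in `[0, t]) f r - \int[leb]_(r in `[0, s]) f r.
Proof.
move=> fi s0 st tT.
have mI b1 b2 : measurable ([set` Interval b1 b2] : set (measurableTypeR R)) by exact: measurable_itv.
have i1 : intg leb `[0, t] f.
  apply: (intgS (mI _ _) (mI _ _) _ fi).
  by apply: subset_itvl; rewrite bnd_simp.
split.
  apply: (intgS (mI _ _) (mI _ _) _ i1).
  by apply: subset_itvr; rewrite bnd_simp.
by rewrite (Rintegral_itvB (x := s)) // bnd_simp.
Qed.

Let H t := \int[leb]_(s in `[0, t]) `|Q s|.
Let K t := \int[leb]_(s in `[0, t]) (phi (P s) * Q s).

Let mT : measurable (`[0, T]%classic : set (measurableTypeR R)).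
Proof. exact: measurable_itv. Qed.

Let iH : intg leb `[0, T] (fun s => `|Q s|). Proof. exact: intg_norm. Qed.

Let H_nd s t : 0 <= s -> s <= t -> t <= T -> H s <= H t.
Proof.
move=> s0 st tT; rewrite -subr_ge0.
by have [_ <-] := Rint_split iH s0 st tT; apply: Rintegral_ge0.
Qed.

Let P_le s t : 0 <= s -> s <= t -> t <= T -> `|P t - P s| <= H t - H s.
Proof.
move=> s0 st tT.
have -> : P t - P s = (P t - P 0) - (P s - P 0) by ring.
rewrite !PQ; [|by apply/andP; split; lra..].
have [i <-] := Rint_split iQ s0 st tT.
have [_ <-] := Rint_split iH s0 st tT.
by apply: le_normr_Rintegral => //; exact: measurable_itv.
Qed.

Lemma intg_phiQ : intg leb `[0, T] (fun s => phi (P s) * Q s).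
Proof.
have := @intgM _ _ R leb `[0, T] Q (fun s => phi (P s)) (`|phi (P 0)| + c * H T) mT iQ mP.
have E : (fun x => Q x * phi (P x)) = (fun s => phi (P s) * Q s) by apply/funext => s; rewrite mulrC.
rewrite E; apply => s /=; rewrite in_itv /= => /andP[s0 sT].
have h1 := @phiL 0 s; rewrite lexx T0 s0 sT /= in h1.
have h2 : `|P s - P 0| <= H T.
  have h3 := P_le (lexx 0) s0 sT.
  have h4 := H_nd s0 sT (lexx T).
  have h5 : 0 <= H 0 by apply: Rintegral_ge0.
  lra.
have h6 := ler_wpM2l c0 h2.
have := ler_normD (phi (P 0)) (phi (P s) - phi (P 0)); rewrite addrCA subrr addr0.
by have := h1 isT isT; lra.
Qed.

Let D s t := F (P t) - F (P s) - (K t - K s).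

Let D_base s t : 0 <= s -> s <= t -> t <= T -> D s t <= c * (H t - H s) ^+ 2.
Proof.
move=> s0 st tT; rewrite /D.
have s1 : 0 <= s <= T by apply/andP; split; lra.
have t1 : 0 <= t <= T by apply/andP; split; lra.
have [i1 e1] := Rint_split iQ s0 st tT.
have [i2 e2] := Rint_split intg_phiQ s0 st tT.
have [i3 e3] := Rint_split iH s0 st tT.
have mI : measurable (`]s, t]%classic : set (measurableTypeR R)) by exact: measurable_itv.
have PE : P t - P s = \int[leb]_(r in `]s, t]) Q r.
  have -> : P t - P s = (P t - P 0) - (P s - P 0) by ring.
  by rewrite !PQ// -e1.
rewrite -e2.
apply: (@le_trans _ _ (phi (P t) * (P t - P s) - \int[leb]_(r in `]s, t]) (phi (P r) * Q r))).
  by rewrite lerD2r FP.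
rewrite PE -RintegralZl// -RintegralB//; last exact: intgZ.
apply: (@le_trans _ _ (\int[leb]_(r in `]s, t]) (c * (H t - H s) * `|Q r|))).
  apply: le_Rintegral => //.
  - by apply: intgB => //; exact: intgZ.
  - exact: intgZ.
  move=> r /=; rewrite in_itv /= => /andP[sr rt].
  rewrite -mulrBl (le_trans (ler_norm _))// normrM ler_wpM2r//.
  have r1 : 0 <= r <= T by rewrite (le_trans s0 (ltW sr)) (le_trans rt tT).
  apply: (le_trans (phiL r1 t1)); rewrite ler_wpM2l//.
  have r0 : 0 <= r by case/andP: r1.
  apply: (le_trans (P_le r0 rt tT)); rewrite lerB//; exact: (H_nd s0 (ltW sr) (le_trans rt tT)).
rewrite RintegralZl// e3 -/(H t) -/(H s).
by rewrite le_eqVlt; apply/orP; left; apply/eqP; ring.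
Qed.

(** The cut is made where the continuous function H takes the mean of its end values, not at the
    middle of the time interval; both halves then contribute a quarter of the square. *)
Let D_half n s t : 0 <= s -> s <= t -> t <= T -> D s t <= c * (H t - H s) ^+ 2 / 2 ^+ n.
Proof.
elim: n s t => [|n IH] s t s0 st tT; first by rewrite expr0 divr1 D_base.
have cH : {within `[s, t], continuous H}.
  apply: (@continuous_subspaceW _ _ _ `[0, T]).
    by apply: subset_itv; rewrite bnd_simp.
  exact: parameterized_integral_continuous.
have hst := H_nd s0 st tT.
have [m] : exists2 m, m \in `[s, t] & H m = (H s + H t) / 2.
  apply: IVT => //; rewrite (min_idPl hst) (max_idPr hst); apply/andP; split; lra.
rewrite in_itv /= => /andP[sm mt] Hm.
have m0 : 0 <= m by lra.
have mT' : m <= T by lra.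
have h1 := IH s m s0 sm mT'; have h2 := IH m t m0 mt tT.
have -> : D s t = D s m + D m t by rewrite /D; ring.
apply: (le_trans (lerD h1 h2)); rewrite Hm [2 ^+ n.+1]exprS [(2 * _)^-1]invfM.
rewrite le_eqVlt; apply/orP; left; apply/eqP.
set z := (2 ^+ n)^-1; set z2 := 2^-1.
have : z2 * 2 = 1 by rewrite mulVf.
move: (H s) (H t) => u v e.
have -> : c * ((u + v) * z2 - u) ^+ 2 * z + c * (v - (u + v) * z2) ^+ 2 * z =
  c * z * (((u + v) * z2 - u * (z2 * 2)) ^+ 2 + (v * (z2 * 2) - (u + v) * z2) ^+ 2) by rewrite e; ring.
rewrite [RHS](_ : _ = c * z * (v - u) ^+ 2 * z2 * (z2 * 2)); last by rewrite e; ring.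
ring.
Qed.

(* On [s, t] convexity and the Lipschitz bound give the inequality up to the error c (H t - H s)^2,
   H being a primitive of |Q|; halving the interval repeatedly halves the total error. *)
Lemma chain_ineq : F (P T) - F (P 0) <= \int[leb]_(s in `[0, T]) (phi (P s) * Q s).
Proof.
have K0 : K 0 = 0 by rewrite /K set_itv1 Rintegral_set1.
rewrite -subr_le0.
have -> : F (P T) - F (P 0) - \int[leb]_(s in `[0, T]) (phi (P s) * Q s) = D 0 T by rewrite /D K0 subr0.
rewrite leNgt; apply/negP => DT.
set C := c * (H T - H 0) ^+ 2.
have C0 : 0 <= C by rewrite mulr_ge0 ?sqr_ge0.
(* With n > C / D 0 T and n <= 2^n, the bound C / 2^n falls below D 0 T. *)
have h := D_half (Num.bound (C / D 0 T)) (lexx 0) T0 (lexx T).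
have := archi_boundP (divr_ge0 C0 (ltW DT)).
set n := Num.bound _ in h *.
rewrite ltr_pdivrMr// => h2.
have n2 : (n%:R : R) <= 2 ^+ n by rewrite -natrX ler_nat ltnW// ltn_expl.
have n0 : (0 : R) < 2 ^+ n by rewrite exprn_gt0.
rewrite ler_pdivlMr// -/C in h.
have : n%:R * D 0 T <= 2 ^+ n * D 0 T by rewrite ler_wpM2r// ltW.
rewrite mulrC in h => h3.
by have := le_lt_trans (le_trans h3 h) h2; rewrite ltxx.
Qed.

End ChainInequality.

(** * The regularized entropy function *)

Section Entropy.
Context {R : realType}.
Variable d : R.
Hypothesis d0 : 0 < d.
Implicit Types (u v : R).

(** The primitive of [dent] vanishing at 0. Its second derivative 1/(u + d) is the weight in
    [fdens], and d > 0 keeps [dent] Lipschitz, as the chain inequality requires. *)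
Definition ent u : R := (u + d) * ln ((u + d) / d) - u.
Definition dent u : R := ln ((u + d) / d).

Lemma ln_le_subr1 (x : R) : 0 < x -> ln x <= x - 1.
Proof. by move=> x0; have := @le_ln1Dx R (x - 1); rewrite addrCA subrr addr0; apply; lra. Qed.

(** Tangent inequality at v, from ln y <= y - 1 with y = (v + d)/(u + d). *)
Lemma ent_convex u v : 0 <= u -> 0 <= v -> ent v - ent u <= dent v * (v - u).
Proof.
move=> u0 v0; rewrite /ent /dent.
have ud : 0 < u + d by rewrite ltr_wpDl.
have vd : 0 < v + d by rewrite ltr_wpDl.
have h := @ln_le_subr1 ((v + d) / (u + d)) (divr_gt0 vd ud).
have e : ln ((v + d) / d) = ln ((u + d) / d) + ln ((v + d) / (u + d)).
  rewrite -lnM ?posrE ?divr_gt0//; congr ln; field; rewrite !gt_eqF//.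
have h2 : (u + d) * ln ((v + d) / (u + d)) <= v - u.
  apply: (le_trans (ler_wpM2l (ltW ud) h)).
  by rewrite le_eqVlt; apply/orP; left; apply/eqP; field; rewrite gt_eqF.
rewrite e; move: h2; set l1 := ln _; set l2 := ln _; lra.
Qed.

Lemma dent_ge0 u : 0 <= u -> 0 <= dent u.
Proof. by move=> u0; rewrite /dent ln_ge0// ler_pdivlMr// mul1r lerDr. Qed.

Lemma dent_lip_le u v : 0 <= u -> u <= v -> `|dent v - dent u| <= d^-1 * `|v - u|.
Proof.
move=> u0 uv; have ud : 0 < u + d by rewrite ltr_wpDl.
have vd : 0 < v + d by rewrite ltr_wpDl// (le_trans u0).
have -> : dent v - dent u = ln ((v + d) / (u + d)).
  rewrite /dent -ln_div ?posrE ?divr_gt0//; congr ln; field; rewrite !gt_eqF//.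
have l0 : 0 <= ln ((v + d) / (u + d)) by rewrite ln_ge0// ler_pdivlMr// mul1r lerD2r.
rewrite (ger0_norm l0) ger0_norm ?subr_ge0//.
apply: (le_trans (ln_le_subr1 (divr_gt0 vd ud))).
have -> : (v + d) / (u + d) - 1 = (v - u) / (u + d) by field; rewrite gt_eqF.
by rewrite mulrC ler_wpM2r ?subr_ge0// lef_pV2 ?posrE// lerDr.
Qed.

Lemma dent_lip u v : 0 <= u -> 0 <= v -> `|dent v - dent u| <= d^-1 * `|v - u|.
Proof.
move=> u0 v0; have [uv|/ltW vu] := leP u v; first exact: dent_lip_le.
by rewrite distrC (distrC v); exact: dent_lip_le.
Qed.

Lemma dent0 : dent 0 = 0.
Proof. by rewrite /dent add0r divff ?gt_eqF// ln1. Qed.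

Lemma dent_le u : 0 <= u -> dent u <= d^-1 * u.
Proof.
by move=> u0; have := dent_lip (lexx 0) u0; rewrite dent0 !subr0 !ger0_norm ?dent_ge0.
Qed.

Lemma ent_ge0 u : 0 <= u -> 0 <= ent u.
Proof.
move=> u0; have := ent_convex u0 (lexx 0).
by rewrite dent0 mul0r {1}/ent add0r divff ?gt_eqF// ln1 mulr0 subrr sub0r oppr_le0.
Qed.

Lemma ent_le u : 0 <= u -> ent u <= d^-1 * u ^+ 2.
Proof.
move=> u0; have := ent_convex (lexx 0) u0.
rewrite [X in _ - X]/ent add0r divff ?gt_eqF// ln1 mulr0 subrr !subr0 => h.
by apply: (le_trans h); rewrite expr2 mulrA ler_wpM2r// dent_le.
Qed.

Lemma is_derive_dent u : 0 <= u -> is_derive u 1 dent (u + d)^-1.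
Proof.
move=> u0; have ud : 0 < (u + d) / d by rewrite divr_gt0// ltr_wpDl.
have h1 : is_derive u 1 (fun u => (u + d) / d) d^-1.
  have : is_derive u 1 (d^-1 *: ((id : R -> R) + cst d)) d^-1.
    by apply: is_derive_eq; rewrite /GRing.scale /= addr0 mulr1.
  by rewrite (_ : d^-1 *: _ = (fun u => (u + d) / d))//; apply/funext => v; rewrite /= mulrC.
have h2 := is_derive1_ln ud.
have -> : (u + d)^-1 = ((u + d) / d)^-1 * d^-1.
  by field; rewrite !gt_eqF// ltr_wpDl.
exact: (@is_derive1_comp _ (@ln R) (fun u => (u + d) / d) u).
Qed.

(* With [s = |x|], this bounds the entropy from below by the first moment. *)
Lemma ent_lower u (s : R) : 0 <= u -> - (u * s) - expR (- s) <= ent u + u * (1 + ln d).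
Proof.
move=> u0; have ud : 0 < u + d by rewrite ltr_wpDl.
have e : ent u + u * (1 + ln d) = u * ln (u + d) + d * ln ((u + d) / d).
  by rewrite /ent ln_div ?posrE//; ring.
rewrite e; have l0 := dent_ge0 u0.
have h : - (u * s) - expR (- s) <= u * ln (u + d).
  move: u0; rewrite le_eqVlt => /orP[/eqP<-|up].
    by rewrite !mul0r oppr0 sub0r oppr_le0 expR_ge0.
  have h1 : ln u <= ln (u + d) by rewrite ler_ln ?posrE// lerDl ltW.
  have h2 := @ln_le_subr1 (expR (- s) / u) (divr_gt0 (expR_gt0 _) up).
  rewrite ln_div ?posrE ?expR_gt0// expRK in h2.
  have h3 := ler_wpM2l (ltW up) h2; have h4 := ler_wpM2l (ltW up) h1.
  have e2 : u * (expR (- s) / u - 1) = expR (- s) - u by field; rewrite gt_eqF.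
  rewrite e2 in h3; lra.
have : 0 <= d * ln ((u + d) / d) by rewrite mulr_ge0// ltW.
lra.
Qed.

(** The correction u (1 + ln d) integrates to 1 + ln d against a density of mass one, at every time.
    It therefore cancels in the difference of two entropies and makes the upper and lower bounds
    independent of d. *)
Lemma ent_upper u : d <= 1 -> 0 <= u -> ent u + u * (1 + ln d) <= u ^+ 2 + u.
Proof.
move=> d1 u0; have ud : 0 < u + d by rewrite ltr_wpDl.
have e : ent u + u * (1 + ln d) = u * ln (u + d) + d * ln ((u + d) / d).
  by rewrite /ent ln_div ?posrE//; ring.
rewrite e.
have h1 := ler_wpM2l u0 (ln_le_subr1 ud).
have h2 := ler_wpM2l (ltW d0) (dent_le u0); rewrite mulrA mulfV ?gt_eqF// mul1r in h2.
rewrite /dent in h2.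
have : u * (u + d - 1) <= u ^+ 2 by rewrite expr2 ler_wpM2l//; lra.
lra.
Qed.

Lemma measurable_dent : measurable_fun setT dent.
Proof.
apply: (measurableT_comp (f := @ln R)); first exact: measurable_ln.
by apply: measurable_funM => //; apply: measurable_funD.
Qed.

Lemma measurable_ent : measurable_fun setT ent.
Proof.
apply: measurable_funB => //; apply: measurable_funM; last exact: measurable_dent.
exact: measurable_funD.
Qed.

End Entropy.

(** * Borel sets of the plane and families of probability measures *)

Section PlaneBorel.
Context {R : realType}.
Implicit Types O K : set (R * R).

Let box (i : rat * rat * nat) : set (R * R) :=
  ball (ratr i.1.1 : R) (i.2.+1%:R^-1) `*` ball (ratr i.1.2 : R) (i.2.+1%:R^-1).

Let mbox i : measurable (box i).
Proof. by apply: measurableX; exact: measurable_ball. Qed.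

(** An open set is the union of the countably many boxes with rational centres and radii 1/(n+1)
    that it contains. *)
Lemma plane_open_measurable O : open O -> measurable O.
Proof.
move=> oO.
have -> : O = \bigcup_(i in [set: rat * rat * nat]) (if `[< box i `<=` O >] then box i else set0).
  apply/seteqP; split => [[x y] Oxy|z [i _]]; last by case: asboolP => // h /h.
  have := oO; rewrite openE => /(_ _ Oxy) /= -[[/= A B] [/nbhs_ballP[e1 /= e10 h1] /nbhs_ballP[e2 /= e20 h2]] AB].
  have e0 : 0 < Num.min e1 e2 / 2 by rewrite divr_gt0// lt_min e10 e20.
  have [n _ hn] := near_infty_natSinv_lt (PosNum e0).
  have {}hn := hn n (leqnn n).
  have n0 : (0 : R) < n.+1%:R^-1 by rewrite invr_gt0.
  have rat_near (u : R) : exists q : rat, `|ratr q - u| < n.+1%:R^-1.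
    have un : u < u + n.+1%:R^-1 by rewrite ltrDl.
    have [q] := rat_in_itvoo un.
    rewrite in_itv /= => /andP[h3 h4]; exists q.
    by rewrite ger0_norm ?subr_ge0 ?(ltW h3)// ltrBlDl.
  have [q1 hq1] := rat_near x; have [q2 hq2] := rat_near y.
  have e1le : Num.min e1 e2 <= e1 by rewrite ge_min lexx.
  have e2le : Num.min e1 e2 <= e2 by rewrite ge_min lexx orbT.
  exists (q1, q2, n) => //.
  rewrite asboolT => [|[u v] [/= hu hv]]; first by split.
  have {}hu : `|ratr q1 - u| < n.+1%:R^-1 := hu.
  have {}hv : `|ratr q2 - v| < n.+1%:R^-1 := hv.
  have {}hn : n.+1%:R^-1 < Num.min e1 e2 / 2 := hn.
  move: (Num.min _ _) (n.+1%:R^-1) hn hu hv hq1 hq2 e1le e2le => m r hn hu hv hq1 hq2 e1le e2le.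
  apply: AB; split; [apply: h1|apply: h2]; rewrite /ball /=.
    by apply: (le_lt_trans (ler_distD (ratr q1) x u)); rewrite (distrC x); lra.
  by apply: (le_lt_trans (ler_distD (ratr q2) y v)); rewrite (distrC y); lra.
apply: countable_bigcupT_measurable => [|i]; first exact: countableP.
by case: asboolP.
Qed.

Lemma plane_continuous_measurable (f : R * R -> R) : continuous f -> measurable_fun setT f.
Proof.
move=> /continuousP cf.
apply: (measurability (@RGenOInfty.G R)); first exact: RGenOInfty.measurableE.
by move=> _ [_ [a ->] <-]; rewrite setTI; apply: plane_open_measurable; apply: cf; exact: interval_open.
Qed.

Lemma plane_compact_measurable K : compact K -> measurable K.
Proof.
move=> cK; rewrite -[K]setCK; apply: measurableC; apply: plane_open_measurable.
by apply: closed_openC; apply: compact_closed => //; exact: Rhausdorff.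
Qed.

Lemma plane_compact_bounded K : compact K -> exists M : R, 0 < M /\ forall p, K p -> `|p.1| <= M /\ `|p.2| <= M.
Proof.
move=> cK; have [M [_ hM]] := compact_bounded (V := (R^o * R^o)%type) cK.
exists (Num.max 0 M + 1); split; first by rewrite ltr_pwDr// le_max lexx.
move=> p Kp.
have := hM (Num.max 0 M + 1) _ p Kp.
rewrite /= prod_normE ge_max => h.
by apply/andP/h; rewrite ltr_pwDr// le_max lexx orbT.
Qed.

End PlaneBorel.

Section Measures.
Import HBNNSimple.
Context {R : realType}.
Local Notation leb := (@lebesgue_measure R).

Lemma probability_eq (m1 m2 : probability R R) :
  (forall x y : R, x <= y -> m1 `]x, y]%classic = m2 `]x, y]%classic) ->
  forall B, measurable B -> m1 B = m2 B.
Proof.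
move=> h B mB.
apply: (measure_unique (@ocitv R) (fun n => `](- n%:R), n%:R]%classic)) => //.
- exact: ocitvI.
- by move=> n; exact: is_ocitv.
- by rewrite bigcup_itvT.
- move=> _ [[a b] _ <-] /=; have [ab|ba] := leP a b; first exact: h.
  by rewrite set_itv_ge ?measure0// bnd_simp -leNgt ltW.
- by move=> n; rewrite (le_lt_trans (probability_le1 _ _)) ?ltry.
Qed.

(** Half-open intervals generate and are stable under intersection, and the sets whose mass is a
    measurable function of the parameter form a Dynkin class. *)
Lemma measurable_family d (X : measurableType d) (g : X -> probability R R) :
  (forall x : R, measurable_fun setT (fun t => p_distfun (g t) x)) ->
  forall B : set R, measurable B -> measurable_fun setT (fun t => g t B).
Proof.
move=> mg B mB.
apply: (@dynkin_induction _ R (@ocitv R) (fun B => measurable_fun setT (fun t => g t B))) => //.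
- exact: ocitvI.
- by apply: (eq_measurable_fun (cst 1%E)) => [t _|]; [rewrite /= probability_setT|].
- move=> _ [[a b] _ <-] /=; have [ab|ba] := leP a b; last first.
    rewrite set_itv_ge ?bnd_simp -?leNgt ?(ltW ba)//.
    by apply: (eq_measurable_fun (cst 0%E)) => [t _|]; rewrite //= measure0.
  apply: (eq_measurable_fun (fun t => (p_distfun (g t) b - p_distfun (g t) a)%:E)).
    by move=> t _; rewrite distfun_itv.
  by apply/measurable_EFinP; exact: measurable_funB.
- move=> S mS h; apply: (eq_measurable_fun (fun t => 1 - g t S)%E).
    by move=> t _; rewrite /= probability_setC.
  exact: emeasurable_funB.
- move=> F mF tF h.
  apply: (eq_measurable_fun (fun t => \sum_(0 <= k <oo) g t (F k))%E).
    move=> t _; rewrite measure_semi_bigcup//; exact: bigcup_measurable.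
  exact: ge0_emeasurable_sum.
Qed.

Lemma density_integral (gam : probability R R) (p f : R -> R) :
  measurable_fun setT p -> (forall x, 0 <= p x) ->
  (forall B, measurable B -> gam B = (\int[leb]_(x in B) (p x)%:E)%E) ->
  measurable_fun setT f -> (forall x, 0 <= f x) ->
  (\int[gam]_x (f x)%:E = \int[leb]_x (f x * p x)%:E)%E.
Proof.
move=> mp p0 gp mf f0.
have mf' : measurable_fun setT (EFin \o f) by exact/measurable_EFinP.
pose h := nnsfun_approx measurableT mf'.
have mh n : measurable_fun setT (h n : R -> R) by exact: measurable_funP.
have ndh (x : R) a b : (a <= b)%N -> h a x <= h b x by move=> ab; exact/lefP/nd_nnsfun_approx.
have cvgh x : ((h n x)%:E @[n --> \oo] --> (f x)%:E)%E.
  by apply: (cvg_nnsfun_approx measurableT mf') => // y _; rewrite lee_fin.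
have -> : (\int[gam]_x (f x)%:E = lim (\int[gam]_x (EFin \o h n) x @[n --> \oo]))%E.
  under eq_integral => x _ do rewrite -(cvg_lim _ (cvgh x))//.
  apply: monotone_convergence => //.
  - by move=> n; apply/measurable_EFinP; exact/measurable_funP.
  - by move=> n x _ /=; rewrite lee_fin.
  - by move=> x _ a b ab; rewrite lee_fin; exact: ndh.
have -> : (\int[leb]_x (f x * p x)%:E = lim (\int[leb]_x (h n x * p x)%:E @[n --> \oo]))%E.
  have cvghp x : ((h n x * p x)%:E @[n --> \oo] --> (f x * p x)%:E)%E.
    rewrite EFinM; under eq_fun do rewrite EFinM.
    by apply: cvgeZr => //; exact: cvgh.
  under eq_integral => x _ do rewrite -(cvg_lim _ (cvghp x))//.
  apply: (@monotone_convergence _ (measurableTypeR R)) => //.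
  - move=> n; apply/measurable_EFinP; apply: measurable_funM; [exact: mh|exact: mp].
  - by move=> n x _ /=; rewrite lee_fin mulr_ge0.
  - move=> x _ a b ab; rewrite lee_fin ler_wpM2r//; exact: ndh.
suff E n : (\int[gam]_x (EFin \o h n) x = \int[leb]_x (h n x * p x)%:E)%E by under eq_fun do rewrite E.
transitivity (\sum_(y \in range (h n)) (y%:E * gam (h n @^-1` [set y])))%E.
  by rewrite integralT_nnsfun sintegralE.
transitivity (\int[leb]_x (\sum_(y \in range (h n)) (y * \1_(h n @^-1` [set y]) x * p x)%:E))%E.
  rewrite (@ge0_integral_fsum _ (measurableTypeR R))//; last 2 first.
  - move=> y; apply/measurable_EFinP; apply: measurable_funM; [apply: measurable_funM => //|exact: mp].
    by apply: measurable_indic; rewrite -[_ @^-1` _]setTI; exact: (mh n measurableT _ (measurable_set1 y)).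
  - move=> y x _; rewrite lee_fin mulr_ge0//.
    by have := nnfun_muleindic_ge0 (h n) y x; rewrite -EFinM lee_fin.
  apply: eq_fsbigr => y; rewrite inE => -[x0 _ hy].
  have y0 : 0 <= y by rewrite -hy.
  have my : measurable (h n @^-1` [set y]) by rewrite -[_ @^-1` _]setTI; exact: (mh n measurableT _ (measurable_set1 y)).
  rewrite gp// -ge0_integralZl//; last 2 first.
  - by apply/measurable_EFinP; exact: measurable_funTS.
  - by move=> x _; rewrite lee_fin.
  rewrite [LHS]integral_mkcond.
  apply: eq_integral => x _; rewrite patchE indicE; case: ifP => _.
    by rewrite mulr1 EFinM.
  by rewrite mulr0 mul0r.
apply: eq_integral => x _; rewrite fsumEFin//; congr EFin.
by rewrite [in RHS](fimfunE (h n) x) mulr_fsuml.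
Qed.

End Measures.

(** * Representation of bounded functionals on subspaces of L2 *)

Lemma measurable_mem d (T : measurableType d) (E : set T) : measurable E ->
  measurable_fun setT (fun x => x \in E).
Proof.
move=> mE; apply: (measurable_fun_bool true); rewrite setTI (_ : _ @^-1` _ = E)//.
by apply/seteqP; split => x /=; [exact: set_mem|exact: mem_set].
Qed.

Section Riesz.
Context d (T : measurableType d) {R : realType}.
Variable mu : {measure set T -> \bar R}.
Implicit Types f g : T -> R.

Lemma L2_CS f g : measurable_fun setT f -> measurable_fun setT g ->
  intg mu setT (fun x => f x ^+ 2) -> intg mu setT (fun x => g x ^+ 2) ->
  intg mu setT (fun x => f x * g x) /\
  (\int[mu]_x (f x * g x)) ^+ 2 <= (\int[mu]_x (f x ^+ 2)) * (\int[mu]_x (g x ^+ 2)).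
Proof.
move=> mf mg f2 g2.
have ifg : intg mu setT (fun x => f x * g x).
  apply: (intg_le _ _ (intgD _ f2 g2)) => //; first exact: measurable_funM.
  move=> x _; rewrite normrM -(real_normK (num_real (f x))) -(real_normK (num_real (g x))).
  by have := sqr_ge0 (`|f x| - `|g x|); have := sqr_ge0 (`|f x| + `|g x|); nra.
split => //; apply: quad_disc => [|c]; first by apply: Rintegral_ge0 => x _; exact: sqr_ge0.
have -> : \int[mu]_x (g x ^+ 2) - 2 * c * \int[mu]_x (f x * g x) + c ^+ 2 * \int[mu]_x (f x ^+ 2) =
    \int[mu]_x (g x ^+ 2 - 2 * c * (f x * g x) + c ^+ 2 * f x ^+ 2).
  rewrite RintegralD ?RintegralB ?RintegralZl//; try exact: intgZ.
  by apply: intgB => //; exact: intgZ.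
apply: Rintegral_ge0 => x _.
have -> : g x ^+ 2 - 2 * c * (f x * g x) + c ^+ 2 * f x ^+ 2 = (g x - c * f x) ^+ 2 by ring.
exact: sqr_ge0.
Qed.

Variables (W : (T -> R) -> R -> Prop) (C : R).
Hypothesis W0 : W (cst 0) 0.
Hypothesis WD : forall f g l m (c : R), W f l -> W g m -> W (fun x => f x + c * g x) (l + c * m).
Hypothesis Wm : forall f l, W f l -> measurable_fun setT f.
Hypothesis Wi : forall f l, W f l -> intg mu setT (fun x => f x ^+ 2).
Hypothesis C0 : 0 <= C.
Hypothesis WC : forall f l, W f l -> l ^+ 2 <= C * \int[mu]_x (f x ^+ 2).

Let Phi f l := \int[mu]_x (f x ^+ 2) - 2 * l.
Let V : set R := [set v | exists f l, W f l /\ v = Phi f l].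

(** From (2 l)^2 <= 4 C S <= (S + C)^2, where S is the integral of f^2. *)
Let V_lb v : V v -> - C <= v.
Proof.
move=> [f [l [w ->]]]; rewrite /Phi; have := WC w.
have : 0 <= \int[mu]_x (f x ^+ 2) by apply: Rintegral_ge0 => x _; exact: sqr_ge0.
have := C0; move: (\int[mu]_x _) => S C0' S0 h.
rewrite leNgt; apply/negP => h2.
have h3 : 0 <= S + C by rewrite addr_ge0.
have h4 : S + C < 2 * l by lra.
have : (S + C) ^+ 2 < (2 * l) ^+ 2 by rewrite ltr_sqr ?nnegrE//; lra.
by have := sqr_ge0 (S - C); nra.
Qed.

Let hiV : has_inf V.
Proof. by split; [exists (Phi (cst 0) 0), (cst 0), 0|exists (- C) => v; exact: V_lb]. Qed.

Let near_min (e : R) : 0 < e -> exists fl : (T -> R) * R, W fl.1 fl.2 /\ Phi fl.1 fl.2 <= inf V + e.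
Proof.
move=> e0; have [v [f [l [w ->]]] h] := inf_adherent e0 hiV.
by exists (f, l); split => //; exact: ltW.
Qed.

(** A near minimizer satisfies the Euler equation up to an error of order sqrt e: moving from f to f
    - c g cannot lower the functional by more than e, and the discriminant in c gives the bound. *)
Let variation f l g m e : W f l -> W g m -> Phi f l <= inf V + e ->
  intg mu setT (fun x => f x * g x) /\
  (\int[mu]_x (f x * g x) - m) ^+ 2 <= \int[mu]_x (g x ^+ 2) * e.
Proof.
move=> wf wg h.
have [ifg _] := L2_CS (Wm wf) (Wm wg) (Wi wf) (Wi wg).
split => //; apply: quad_disc => [|c]; first by apply: Rintegral_ge0 => x _; exact: sqr_ge0.
have : inf V <= Phi (fun x => f x + (- c) * g x) (l + (- c) * m).
  by apply: ge_inf; [case: hiV|exists (fun x => f x + (- c) * g x), (l + (- c) * m); split => //; exact: WD].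
have -> : Phi (fun x => f x + (- c) * g x) (l + (- c) * m) =
    Phi f l - 2 * c * (\int[mu]_x (f x * g x) - m) + c ^+ 2 * \int[mu]_x (g x ^+ 2).
  rewrite /Phi.
  have -> : \int[mu]_x ((f x + (- c) * g x) ^+ 2) =
      \int[mu]_x (f x ^+ 2 - 2 * c * (f x * g x) + c ^+ 2 * g x ^+ 2).
    by apply: eq_Rintegral => x _; ring.
  have i1 := Wi wf; have i2 := Wi wg.
  have i3 := intgZ (c ^+ 2) measurableT i2; have i4 := intgZ (2 * c) measurableT ifg.
  have i5 := intgB measurableT i1 i4.
  by rewrite RintegralD// RintegralB// !RintegralZl//; ring.
by move: h; move: (Phi f l) (inf V) (\int[mu]_x (g x ^+ 2)) (\int[mu]_x (f x * g x)) => ????; lra.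
Qed.

(* The functional is given by its graph [W], which avoids quotienting by null sets; z is obtained as
   the limit of a minimizing sequence of int f^2 - 2 l. *)
Lemma Riesz_representation : exists z : T -> R, [/\ measurable_fun setT z,
  intg mu setT (fun x => z x ^+ 2) &
  forall f l, W f l -> intg mu setT (fun x => f x * z x) /\ \int[mu]_x (f x * z x) = l].
Proof.
(* Increments of the minimizing sequence then have squared norm at most 4 / 16^n. This leaves room
   for the weight 4^n in [S], whose integral stays finite and which forces geometric convergence
   wherever it is finite. *)
pose e n : R := (16 ^+ n)^-1.
have e0 n : 0 < e n by rewrite invr_gt0 exprn_gt0.
have [FL hFL] := choice (fun n => near_min (e0 n)).
pose F n := (FL n).1; pose L n := (FL n).2.
have wF n : W (F n) (L n) by case: (hFL n).
have pF n : Phi (F n) (L n) <= inf V + e n by case: (hFL n).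
pose D n x := F n.+1 x + (-1) * F n x.
have wD n : W (D n) (L n.+1 + (-1) * L n) by exact: WD.
pose Q n := \int[mu]_x (D n x ^+ 2).
have Q0 n : 0 <= Q n by apply: Rintegral_ge0 => x _; exact: sqr_ge0.
have Qle n : Q n <= 4 * e n.
  (* The increment is tested against both [F n] and [F n.+1], which reproduce the same value up to
     their respective errors. *)
  have [i1 h1] := variation (wF n) (wD n) (pF n).
  have [i2 h2] := variation (wF n.+1) (wD n) (pF n.+1).
  have E : Q n = \int[mu]_x (F n.+1 x * D n x) - \int[mu]_x (F n x * D n x).
    by rewrite -RintegralB//; apply: eq_Rintegral => x _; rewrite /D; ring.
  have e1 : e n.+1 <= e n by rewrite lef_pV2 ?posrE ?exprn_gt0// exprS ler_peMl ?exprn_ge0// ler1n.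
  have := Q0 n; rewrite le_eqVlt => /orP[/eqP <-|Qp]; first by rewrite mulr_ge0 ?(ltW (e0 n)).
  rewrite -/(Q n) in h1 h2.
  have h3 : Q n ^+ 2 <= Q n * (4 * e n).
    have h4 := ler_wpM2l (Q0 n) e1.
    move: E h1 h2; set a := (\int[mu]_x _); set b := (\int[mu]_x _); set m := (_ + _ * _).
    move=> E h1 h2.
    have -> : Q n ^+ 2 = ((a - m) - (b - m)) ^+ 2 by rewrite E; congr (_ ^+ 2); ring.
    have := sqr_ge0 ((a - m) + (b - m)); move: h1 h2 h4; rewrite mulrCA.
    by move: (a - m) (b - m) (Q n * e n) (Q n * e n.+1) => a' b' X Y; nra.
  by rewrite expr2 ler_pM2l in h3.
pose S x : \bar R := (\sum_(0 <= n <oo) (4 ^+ n * D n x ^+ 2)%:E)%E.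
have mD n : measurable_fun setT (D n) by exact: Wm (wD n).
have mS : measurable_fun setT S.
  apply: ge0_emeasurable_sum => [n x _ _|n _]; first by rewrite lee_fin mulr_ge0 ?sqr_ge0// exprn_ge0.
  by apply/measurable_EFinP; apply: measurable_funM => //; exact: measurable_funX.
have S0 x : (0 <= S x)%E.
  by apply: nneseries_ge0 => n _ _; rewrite lee_fin mulr_ge0 ?sqr_ge0// exprn_ge0.
have iS : (\int[mu]_x S x <= 8%:E)%E.
  rewrite /S integral_nneseries//; last 2 first.
  - by move=> n; apply/measurable_EFinP; apply: measurable_funM => //; exact: measurable_funX.
  - by move=> n x _; rewrite lee_fin mulr_ge0 ?sqr_ge0// exprn_ge0.
  have hn n : (\int[mu]_x (4 ^+ n * D n x ^+ 2)%:E <= (4 / 4 ^+ n)%:E)%E.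
    rewrite -EFin_Rint//; last by apply: intgZ => //; exact: Wi (wD n).
    rewrite lee_fin RintegralZl//; last exact: Wi (wD n).
    apply: (le_trans (ler_wpM2l (exprn_ge0 n _) (Qle n))) => //.
    rewrite /e (_ : 16 = 4 * 4 :> R); last by ring.
    rewrite exprMn le_eqVlt; apply/orP; left; apply/eqP; field.
    by rewrite expf_neq0.
  apply: lime_le.
    by apply: is_cvg_nneseries => n _ _; apply: integral_ge0 => x _; rewrite lee_fin mulr_ge0 ?sqr_ge0// exprn_ge0.
  apply: nearW => N.
  apply: (@le_trans _ _ (\sum_(0 <= n < N) (4 / 4 ^+ n)%:E)%E); first exact: lee_sum.
  rewrite sumEFin lee_fin.
  suff -> : \sum_(0 <= n < N) (4 / 4 ^+ n : R) = 16 / 3 * (1 - (4 ^+ N)^-1).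
    have : (0 : R) <= (4 ^+ N)^-1 by rewrite invr_ge0 exprn_ge0.
    lra.
  elim: N => [|N IH]; first by rewrite big_geq// expr0 invr1 subrr mulr0.
  by rewrite big_nat_recr//= IH exprS; field; rewrite expf_neq0.
pose E := [set x | (S x < +oo)%E].
have mE : measurable E by rewrite -[E]setTI; exact: emeasurable_fun_infty_o.
have nE : {ae mu, forall x, E x}.
  have : mu.-integrable setT S.
    apply/integrableP; split => //; under eq_integral do rewrite gee0_abs//.
    by rewrite (le_lt_trans iS) ?ltry.
  move=> /(integrable_ae measurableT); apply: filterS => x /(_ I).
  by rewrite ge0_fin_numE.
pose s x := if x \in E then fine (S x) else 0.
have s0 x : 0 <= s x by rewrite /s; case: ifP => // _; rewrite fine_ge0.
have msE : measurable_fun setT (fun x => x \in E) by exact: measurable_mem.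
have ms : measurable_fun setT s.
  apply: measurable_fun_ifT => //.
  by apply: measurableT_comp mS => //.
have is_ : intg mu setT s.
  apply: intg_ge0P => //.
  apply: (@le_lt_trans _ _ (\int[mu]_x S x)%E); last by rewrite (le_lt_trans iS) ?ltry.
  apply: ge0_le_integral => //; [by move=> x _; rewrite lee_fin|exact/measurable_EFinP|].
  move=> x _; rewrite /s; case: ifPn => [/set_mem Ex|_]; last by [].
  by rewrite fineK// ge0_fin_numE.
have ds n x : x \in E -> `|D n x| <= Num.sqrt (s x) / 2 ^+ n.
  move=> xE; rewrite ler_pdivlMr ?exprn_gt0//.
  have -> : `|D n x| * 2 ^+ n = Num.sqrt (4 ^+ n * D n x ^+ 2).
    rewrite (_ : 4 ^+ n * _ = (D n x * 2 ^+ n) ^+ 2); last first.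
      by rewrite exprMn mulrC -exprM mulnC exprM; congr (_ * _ ^+ n); ring.
    by rewrite sqrtr_sqr normrM (ger0_norm (exprn_ge0 _ _)).
  apply: ler_wsqrtr.
  rewrite /s xE -lee_fin fineK ?ge0_fin_numE//; last by move: xE => /set_mem.
  have t0 k : (0 <= (4 ^+ k * D k x ^+ 2)%:E)%E by rewrite lee_fin mulr_ge0 ?sqr_ge0// exprn_ge0.
  apply: (@le_trans _ _ (\sum_(0 <= k < n.+1) (4 ^+ k * D k x ^+ 2)%:E)%E).
    by rewrite big_nat_recr//= leeDr// sume_ge0.
  by apply: nneseries_lim_ge => k _ _; exact: t0.
(* Zeroing the sequence off the full-measure set [E] makes it converge everywhere, so that its limit
   is measurable. *)
pose G n x := if x \in E then F n x else 0.
have mG n : measurable_fun setT (G n) by apply: measurable_fun_ifT => //; exact: Wm (wF n).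
have dG n k x : `|G (n + k)%N x - G n x| <= 2 * Num.sqrt (s x) / 2 ^+ n * (1 - (2 ^+ k)^-1).
  elim: k => [|k IH]; first by rewrite addn0 subrr normr0 expr0 invr1 subrr mulr0.
  have h : `|G (n + k.+1)%N x - G (n + k)%N x| <= Num.sqrt (s x) / 2 ^+ (n + k).
    rewrite /G addnS; case: ifP => xE; last by rewrite subrr normr0 divr_ge0 ?sqrtr_ge0 ?exprn_ge0.
    by have := ds (n + k)%N x xE; rewrite /D mulN1r.
  have -> : G (n + k.+1)%N x - G n x = (G (n + k.+1)%N x - G (n + k)%N x) + (G (n + k)%N x - G n x) by ring.
  apply: (le_trans (ler_normD _ _)); apply: (le_trans (lerD h IH)).
  rewrite exprD exprS le_eqVlt; apply/orP; left; apply/eqP; field.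
  by rewrite !expf_neq0.
have dG' n k x : `|G (n + k)%N x - G n x| <= 2 * Num.sqrt (s x) / 2 ^+ n.
  apply: (le_trans (dG n k x)); rewrite ler_piMr ?divr_ge0 ?mulr_ge0 ?sqrtr_ge0 ?exprn_ge0//.
have half0 (c : R) : (c / 2 ^+ n) @[n --> \oo] --> 0.
  rewrite -[X in _ --> X](mulr0 c); apply: cvgM; first exact: cvg_cst.
  under eq_fun do rewrite -exprVn.
  by apply: cvg_expr; rewrite ger0_norm//; lra.
have cG x : cvgn (G ^~ x).
  apply/cauchy_cvgP/cauchyP => eps eps0.
  have /cvgrPdist_lt/(_ _ eps0) [N _ hN] := half0 (2 * Num.sqrt (s x)).
  exists (G N x); exists N => // k /= Nk; rewrite /ball /= distrC -(subnKC Nk).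
  apply: (le_lt_trans (dG' N (k - N)%N x)); have := hN N (leqnn N); rewrite /= sub0r normrN.
  exact/le_lt_trans/ler_norm.
pose z x := limn (G ^~ x).
have zG n x : `|z x - G n x| <= 2 * Num.sqrt (s x) / 2 ^+ n.
  have c1 : `|G k x - G n x| @[k --> \oo] --> `|z x - G n x|.
    by apply: cvg_norm; apply: cvgB; [exact: cG|exact: cvg_cst].
  rewrite -(cvg_lim _ c1)//; apply: limr_le; first by apply/cvg_ex; eexists; exact: c1.
  by exists n => // k /= nk; rewrite -(subnKC nk); exact: dG'.
have mz : measurable_fun setT z by apply: (measurable_fun_cvg mG) => x _; exact: cG.
have zG2 n x : (z x - G n x) ^+ 2 <= 4 / 4 ^+ n * s x.
  rewrite -real_normK ?num_real//.
  have -> : 4 / 4 ^+ n * s x = (2 * Num.sqrt (s x) / 2 ^+ n) ^+ 2.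
    rewrite !exprMn sqr_sqrtr// exprVn -exprM mulnC exprM (_ : 2 ^+ 2 = 4 :> R); last by ring.
    by rewrite mulrAC.
  by rewrite ler_sqr ?nnegrE ?divr_ge0 ?mulr_ge0 ?sqrtr_ge0 ?exprn_ge0.
have mzG n : measurable_fun setT (fun x => z x - G n x) by exact: measurable_funB.
have izG n : intg mu setT (fun x => (z x - G n x) ^+ 2).
  apply: (intg_le _ _ (intgZ (4 / 4 ^+ n) _ is_)) => //; first exact: measurable_funX.
  by move=> x _; rewrite ger0_norm ?sqr_ge0.
have iG n : intg mu setT (fun x => G n x ^+ 2).
  apply: (intg_le _ _ (Wi (wF n))) => //; first exact: measurable_funX.
  by move=> x _; rewrite ger0_norm ?sqr_ge0// /G; case: ifP => // _; rewrite expr0n sqr_ge0.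
have iz : intg mu setT (fun x => z x ^+ 2).
  apply: (intg_le _ _ (intgD _ (intgZ 2 _ (izG 0%N)) (intgZ 2 _ (iG 0%N)))) => //; first exact: measurable_funX.
  move=> x _; rewrite ger0_norm ?sqr_ge0//.
  by have := sqr_ge0 (z x - 2 * G 0%N x); nra.
exists z; split => // f l wf.
have [ifz _] := L2_CS (Wm wf) mz (Wi wf) iz.
split => //.
set S2 := \int[mu]_x (f x ^+ 2).
have S20 : 0 <= S2 by apply: Rintegral_ge0 => x _; exact: sqr_ge0.
set s2 := \int[mu]_x s x.
have s20 : 0 <= s2 by apply: Rintegral_ge0.
have key n : (\int[mu]_x (f x * z x) - l) ^+ 2 <= (2 * S2 * (4 * s2 + 1)) / 4 ^+ n.
  have [i1 h1] := L2_CS (Wm wf) (mzG n) (Wi wf) (izG n).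
  have [i2 h2] := variation (wF n) wf (pF n).
  have [i3 _] := L2_CS (Wm wf) (mG n) (Wi wf) (iG n).
  have eG : \int[mu]_x (F n x * f x) = \int[mu]_x (f x * G n x).
    rewrite /Rintegral; congr fine; apply: ae_eq_integral => //.
    - by apply/measurable_EFinP; have := Wm (wF n); have := Wm wf => m1 m2; exact: measurable_funM.
    - by apply/measurable_EFinP; apply: measurable_funM => //; exact: Wm wf.
    by apply: filterS nE => x /mem_set Ex _; rewrite /G Ex mulrC.
  have -> : \int[mu]_x (f x * z x) - l =
      \int[mu]_x (f x * (z x - G n x)) + (\int[mu]_x (F n x * f x) - l).
    rewrite eG addrA -RintegralD//; congr (_ - _); apply: eq_Rintegral => x _; ring.
  have h3 : \int[mu]_x ((z x - G n x) ^+ 2) <= 4 / 4 ^+ n * s2.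
    have i4 := intgZ (4 / 4 ^+ n) measurableT is_.
    rewrite -RintegralZl//; apply: le_Rintegral; [by []|exact: izG|exact: i4|by move=> x _; exact: zG2].
  have h4 : (\int[mu]_x (f x * (z x - G n x))) ^+ 2 <= S2 * (4 / 4 ^+ n * s2).
    by apply: (le_trans h1); rewrite ler_wpM2l.
  have h5 : S2 * e n <= S2 / 4 ^+ n.
    rewrite ler_wpM2l// lef_pV2 ?posrE ?exprn_gt0//; by rewrite lerXn2r ?nnegrE//; lra.
  have h6 := le_trans h2 h5.
  move: h4 h6; set a := (\int[mu]_x _); set b := (_ - l) => h4 h6.
  apply: (@le_trans _ _ (2 * (S2 * (4 / 4 ^+ n * s2)) + 2 * (S2 / 4 ^+ n))).
    by have := sqr_ge0 (a - b); nra.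
  by rewrite le_eqVlt; apply/orP; left; apply/eqP; ring.
apply/eqP; rewrite -subr_eq0 -sqrf_eq0 eq_le sqr_ge0 andbT.
set c := 2 * S2 * (4 * s2 + 1) in key.
have c4 : c / 4 ^+ n @[n --> \oo] --> (0 : R).
  rewrite -[X in _ --> X](mulr0 c); apply: cvgM; first exact: cvg_cst.
  under eq_fun do rewrite -exprVn.
  by apply: cvg_expr; rewrite ger0_norm//; lra.
rewrite -(cvg_lim _ c4)//; apply: limr_ge; [by apply/cvg_ex; exists 0|exact: nearW].
Qed.

End Riesz.

(** * Extension of the coefficient *)

Section Calculus.
Context {R : realType}.
Local Notation leb := (@lebesgue_measure R).

Lemma is_derive_dist (f : R -> R) (x l : R) :
  (forall e, 0 < e -> exists2 dl : R, 0 < dl & forall z, `|z - x| < dl ->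
     `|f z - f x - l * (z - x)| <= e * `|z - x|) -> is_derive x 1 f l.
Proof.
move=> h.
have c : h^-1 *: (f (h *: (1 : R) + x) - f x) @[h --> 0^'] --> l.
  apply/cvgrPdist_le => e e0; have [dl dl0 hd] := h e e0.
  exists dl => //= z; rewrite /ball /= sub0r normrN => zd z0.
  have := hd (z + x); rewrite addrK => /(_ zd) h2.
  have zp : 0 < `|z| by rewrite normr_gt0.
  rewrite -(ler_pM2r zp); apply: le_trans h2.
  rewrite -normrM -normrN; rewrite le_eqVlt; apply/orP; left; apply/eqP; congr (`|_|).
  by rewrite /GRing.scale /= mulr1; field.
by apply: DeriveDef; [apply/cvg_ex; exists l|exact: cvg_lim].
Qed.

Lemma is_derive_shift_cst (F : R -> R) (c e x l : R) : is_derive x 1 F l ->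
  is_derive x 1 (fun y : R => c + (F y - e)) l.
Proof.
move=> h; have -> : (fun y : R => c + (F y - e)) = cst c + (F + cst (- e)) by [].
have := is_deriveD (is_derive_cst c x 1) (is_deriveD h (is_derive_cst (- e) x 1)).
by rewrite addr0 add0r.
Qed.

Lemma segment_bounded (f : R -> R) (a b : R) : a <= b -> {within `[a, b], continuous f} ->
  exists m M : R, [/\ exists2 c, c \in `[a, b] & m = f c & forall x, a <= x <= b -> m <= f x <= M].
Proof.
move=> ab cf.
have [c cI hc] := EVT_min ab cf; have [c' _ hc'] := EVT_max ab cf.
exists (f c), (f c'); split; first by exists c.
by move=> x xab; apply/andP; split; [apply: hc|apply: hc']; rewrite in_itv.
Qed.

End Calculus.

Section Coefficient.
Context {R : realType}.
Local Notation leb := (@lebesgue_measure R).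
Variables (A A' : R -> R) (L0 : R).
Hypothesis Apos : forall y, 0 <= y <= 1 -> 0 < A y.
Hypothesis Ader : forall y, 0 <= y <= 1 ->
  (fun z => (A z - A y) / (z - y)) @ within [set z | 0 <= z <= 1 /\ z != y] (nbhs y) --> A' y.
Hypothesis Alip : forall y z, 0 <= y <= 1 -> 0 <= z <= 1 -> `|A' y - A' z| <= L0 * `|y - z|.

Let clip (y : R) : R := Num.max 0 (Num.min y 1).

Let clip01 y : 0 <= clip y <= 1.
Proof. by rewrite le_max lexx /= ge_max ler01 ge_min lexx orbT. Qed.

Let clip_id y : 0 <= y <= 1 -> clip y = y.
Proof. by move=> /andP[y0 y1]; rewrite /clip (min_idPl y1) (max_idPr y0). Qed.

Let clip_lip y z : `|clip y - clip z| <= `|y - z|.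
Proof.
have aux (u v w1 w2 : R) : - (u - v) <= w1 - w2 -> w1 - w2 <= u - v -> `|w1 - w2| <= `|u - v|.
  by move=> h1 h2; rewrite ler_norml (le_trans _ h1) ?lerN2 ?ler_norm// (le_trans h2) ?ler_norm.
have mx (u v : R) : `|Num.max 0 u - Num.max 0 v| <= `|u - v|.
  wlog uv : u v / v <= u => [h|].
    by have [/h//|/ltW/h] := leP v u; rewrite distrC (distrC v).
  by rewrite /Num.max; case: (ltP 0 u) => ?; case: (ltP 0 v) => ?; apply: aux; lra.
have mn (u v : R) : `|Num.min u 1 - Num.min v 1| <= `|u - v|.
  wlog uv : u v / v <= u => [h|].
    by have [/h//|/ltW/h] := leP v u; rewrite distrC (distrC v).
  by rewrite /Num.min; case: (ltP u 1) => ?; case: (ltP v 1) => ?; apply: aux; lra.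
exact: le_trans (mx _ _) (mn _ _).
Qed.

Let A'c y := A' (clip y).

Let L00 : 0 <= L0.
Proof.
have z01 : 0 <= (0 : R) <= 1 by rewrite lexx ler01.
have o01 : 0 <= (1 : R) <= 1 by rewrite lexx ler01.
have := Alip z01 o01.
by rewrite sub0r normrN normr1 mulr1; apply: le_trans; exact: normr_ge0.
Qed.

Let A'c_lip y z : `|A'c y - A'c z| <= L0 * `|y - z|.
Proof. by apply: (le_trans (Alip (clip01 y) (clip01 z))); rewrite ler_wpM2l. Qed.

Let cA'c : continuous A'c.
Proof.
move=> y; apply/cvgrPdist_le => e e0; exists (e / (L0 + 1)) => /=; first by rewrite divr_gt0// ltr_wpDl.
move=> z /= yz; apply: (le_trans (A'c_lip y z)).
have L1 : 0 < L0 + 1 by rewrite ltr_wpDl.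
have := ltW yz; rewrite ler_pdivlMr// => h; apply: le_trans h.
by rewrite mulrC ler_wpM2l// lerDl.
Qed.

(** At 0 and 1 only one-sided difference quotients of A are known. Integrating the clipped A' from
    -1 gives a function that agrees with A on [0, 1] and is differentiable from both sides at the
    end points. *)
Let B y : R := A 0 + (\int[leb]_(x in `[-1, y]) A'c x - \int[leb]_(x in `[-1, 0]) A'c x).

Let dB (y : R) : 0 <= y <= 1 -> is_derive y 1 B (A'c y).
Proof.
move=> /andP[y0 y1].
have i2 : intg leb `[-1, 2] A'c by exact: intg_cont_seg.
have y2 : y < 2 by rewrite (le_lt_trans y1)// ltr1n.
have ym : -1 < y by rewrite (lt_le_trans _ y0)// oppr_lt0.
have cy : {for y, continuous A'c} by exact: cA'c.
have [h1 h2] := continuous_FTC1_closed y2 i2 ym cy.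
have h3 : is_derive y 1 (fun y : R => \int[leb]_(x in `[-1, y]) A'c x) (A'c y).
  by rewrite -h2; exact: derivable_is_derive1.
exact: is_derive_shift_cst.
Qed.

Let Adist y e : 0 <= y <= 1 -> 0 < e -> exists2 dl : R, 0 < dl & forall z, 0 <= z <= 1 ->
  `|z - y| < dl -> `|A z - A y - A' y * (z - y)| <= e * `|z - y|.
Proof.
move=> y01 e0; have /cvgrPdist_le /(_ _ e0) := Ader y01.
move=> [dl /= dl0 h]; exists dl => // z z01 zy.
have [->|zny] := eqVneq z y; first by rewrite !subrr mulr0 subr0 normr0 mulr0.
have := h z; rewrite /ball /= distrC => /(_ zy (conj z01 zny)) h2.
have zp : 0 < `|z - y| by rewrite normr_gt0 subr_eq0.
move: h2; rewrite -(ler_pM2r zp); apply: le_trans.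
rewrite -normrM -normrN le_eqVlt; apply/orP; left; apply/eqP; congr (`|_|).
by field; rewrite subr_eq0.
Qed.

Let cA : {within `[0, 1], continuous A}.
Proof.
apply/subspace_continuousP => y /=; rewrite in_itv /= => y01.
apply/cvgrPdist_le => e e0.
have [dl dl0 h] := Adist y01 (ltr01 : 0 < 1 :> R).
pose c := 1 + `|A' y|; have c0 : 0 < c by rewrite ltr_wpDr.
exists (Num.min dl (e / c)) => /=; first by rewrite lt_min dl0 divr_gt0.
move=> z /=; rewrite lt_min => /andP[z1 z2] /=; rewrite in_itv /= => z01.
rewrite distrC in z1 z2; have h2 := h z z01 z1; rewrite distrC.
have -> : A z - A y = (A z - A y - A' y * (z - y)) + A' y * (z - y) by ring.
apply: (le_trans (ler_normD _ _)); rewrite normrM.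
apply: (@le_trans _ _ (c * `|z - y|)); first by rewrite mulrDl lerD.
by rewrite mulrC -ler_pdivlMr// ltW.
Qed.

Let cB : {within `[0, 1], continuous B}.
Proof.
apply/subspace_continuousP => y /=; rewrite in_itv /= => y01.
apply: cvg_within_filter.
by apply: differentiable_continuous; apply/derivable1_diffP; case: (dB y01).
Qed.

(** Both functions have derivative A' inside (0, y) and the same value at 0; continuity up to the
    end points allows the mean value theorem. *)
Let BA y : 0 <= y <= 1 -> B y = A y.
Proof.
move=> /andP[]; rewrite le_eqVlt => /orP[/eqP <- _|y0 y1]; first by rewrite /B subrr addr0.
have d0 x : x \in `]0, y[ -> is_derive x 1 (B - A) 0.
  rewrite in_itv /= => /andP[x0 xy].
  have x01 : 0 <= x <= 1 by apply/andP; split; lra.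
  have h : is_derive x 1 A (A' x).
    apply: is_derive_dist => e e0; have [dl dl0 h] := Adist x01 e0.
    exists (Num.min dl (Num.min x (1 - x))); first by rewrite !lt_min dl0 x0 /=; lra.
    move=> z; rewrite !lt_min => /and3P[z1 z2 z3]; apply: h => //.
    by move: z2 z3; rewrite !ltr_norml => /andP[? ?] /andP[? ?]; apply/andP; split; lra.
  have := dB x01; rewrite /A'c clip_id// => h2.
  by apply: is_derive_eq; rewrite subrr.
have cBA : {within `[0, y], continuous (B - A)}.
  have sub : `[0, y] `<=` `[(0 : R), 1] by apply: subset_itvl; rewrite bnd_simp.
  have c1 := continuous_subspaceW sub cB; have c2 := continuous_subspaceW sub cA.
  by move=> x; apply: cvgB; [exact: c1|exact: c2].
have [c _] := MVT y0 d0 cBA; rewrite mul0r => /eqP.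
have -> : (B - A) y = B y - A y by [].
have -> : (B - A) 0 = 0 by rewrite [LHS](_ : _ = B 0 - A 0)// /B (subrr (Rintegral _ _ _)) addr0 subrr.
by rewrite subr0 subr_eq0 => /eqP.
Qed.

Lemma coefficient_extension : exists (B B' : R -> R) (a0 a1 L : R),
  [/\ 0 < a0, 0 <= L, (forall y, 0 <= y <= 1 -> B y = A y /\ a0 <= B y <= a1) & continuous B'] /\
  [/\ (forall y : R, 0 <= y <= 1 -> is_derive y 1 B (B' y)), (forall y, `|B' y| <= L) &
    forall y z, 0 <= y <= 1 -> 0 <= z <= 1 -> `|B y - B z| <= L * `|y - z|].
Proof.
(* The minimum over [0, 1] is attained, hence positive: it is the ellipticity constant a0. *)
have [m [M [[c cI mE] hmM]]] := segment_bounded ler01 cB.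
pose L := `|A' 0| + L0.
have bd y : `|A'c y| <= L.
  have -> : A'c y = A' 0 + (A'c y - A'c 0) by rewrite [A'c 0]/A'c clip_id ?lexx ?ler01// addrC subrK.
  apply: (le_trans (ler_normD _ _)); rewrite /L lerD2l.
  have z01 : 0 <= (0 : R) <= 1 by rewrite lexx ler01.
  apply: (le_trans (Alip (clip01 y) (clip01 0))); rewrite ler_piMr// (clip_id z01) subr0.
  by have /andP[h1 h2] := clip01 y; rewrite ger0_norm.
have lip y z : 0 <= y -> y <= z -> z <= 1 -> `|B z - B y| <= L * `|z - y|.
  move=> y0; rewrite le_eqVlt => /orP[/eqP ->|yz z1]; first by rewrite !subrr normr0 mulr0.
  have d x : x \in `]y, z[ -> is_derive x 1 B (A'c x).
    by rewrite in_itv /= => /andP[? ?]; apply: dB; apply/andP; split; lra.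
  have cb : {within `[y, z], continuous B}.
    by apply: continuous_subspaceW cB; apply: subset_itv; rewrite bnd_simp.
  have [x _ ->] := MVT yz d cb.
  by rewrite normrM ler_wpM2r.
exists B, A'c, m, M, L; split; split => //.
- by rewrite mE BA ?Apos.
- by rewrite addr_ge0.
- by move=> y y01; split; [exact: BA|exact: hmM].
- move=> y z /andP[y0 y1] /andP[z0 z1]; have [yz|/ltW zy] := leP y z.
    by rewrite distrC (distrC y); exact: lip.
  exact: lip.
Qed.

End Coefficient.

(** * Passage to the limit at a fixed time *)

Section DensityMeasure.
Context {R : realType}.
Local Notation leb := (@lebesgue_measure R).
Variable p : R -> R.
Hypothesis mp : measurable_fun setT p.
Hypothesis p0 : forall x, 0 <= p x.

(** Packaged as a measure so that agreement with gam on half-open intervals extends to all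
    measurable sets. *)
Definition density_mu (B : set R) : \bar R := (\int[leb]_(x in B) (p x)%:E)%E.

Let density0 : density_mu set0 = 0%E.
Proof. by rewrite /density_mu integral_set0. Qed.

Let density_ge0 B : (0 <= density_mu B)%E.
Proof. by apply: integral_ge0 => x _; rewrite lee_fin. Qed.

Let density_sigma_additive : semi_sigma_additive density_mu.
Proof.
move=> /= F mF tF mUF; rewrite /density_mu ge0_integral_bigcup//.
- by apply: is_cvg_ereal_nneg_natsum_cond => n _ _; exact: density_ge0.
- by apply/measurable_EFinP; exact: measurable_funTS.
- by move=> x _; rewrite lee_fin.
Qed.

HB.instance Definition _ := isMeasure.Build _ _ _ density_mu density0 density_ge0 density_sigma_additive.

Lemma density_measure (gam : probability R R) :
  (forall x y : R, x <= y -> gam `]x, y]%classic = (\int[leb]_(x in `]x, y]) (p x)%:E)%E) ->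
  forall B, measurable B -> gam B = (\int[leb]_(x in B) (p x)%:E)%E.
Proof.
move=> h B mB.
apply: (measure_unique (@ocitv R) (fun n => `](- n%:R), n%:R]%classic) _ _ _ _ gam density_mu) => //.
- exact: ocitvI.
- by move=> n; exact: is_ocitv.
- by rewrite bigcup_itvT.
- move=> _ [[a b] _ <-] /=; have [ab|ba] := leP a b; first exact: h.
  by rewrite set_itv_ge ?measure0// bnd_simp -leNgt ltW.
- by move=> n; rewrite (le_lt_trans (probability_le1 _ _)) ?ltry.
Qed.

End DensityMeasure.

Section CdensLimit.
Context {R : realType}.
Variable gam : probability R R.
Local Notation U := (p_distfun gam).
Hypothesis cU : continuous U.
Variable b : nat -> R.
Hypothesis b_ge : forall n, n.+1%:R <= b n.

Let b0 n : 0 < b n. Proof. exact: lt_le_trans (b_ge n). Qed.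

Lemma atom0 x : gam [set x] = 0%E.
Proof.
apply/eqP; rewrite eq_le measure_ge0 andbT; apply/lee_addgt0Pr => e e0; rewrite add0e.
have cx : U z @[z --> x] --> U x by exact: cU.
move: cx => /cvgrPdist_lt /(_ e e0) [dl /= dl0 h].
have hd := h (x - dl / 2).
have {}hd : `|U x - U (x - dl / 2)| < e.
  by apply: hd; rewrite /ball /= opprB addrCA subrr addr0 gtr0_norm; lra.
have le1 : x - dl / 2 <= x by lra.
apply: (@le_trans _ _ (gam `]x - dl / 2, x]%classic)).
  by apply: le_measure; rewrite ?inE// => _ ->; rewrite /= in_itv /= lexx andbT; lra.
by rewrite distfun_itv// lee_fin (le_trans (ler_norm _))// ltW.
Qed.

(** Half the sign of c, the pointwise limit of [omI]. The value 0 at c = 0 comes from th 0 = 0, and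
    continuity of U makes the corresponding point a null set. *)
Let jump (c : R) : R := if 0 < c then 1 / 2 else if c < 0 then - (1 / 2) else 0.

Let omI_jump (c : R) : omI (b n) c @[n --> \oo] --> jump c.
Proof.
have pos (u : R) : 0 < u -> th (b n * u) @[n --> \oo] --> (1 : R).
  move=> u0; apply/cvgrPdist_le => e e0.
  exists (Num.bound (e * u)^-1) => // n /= hn.
  have bn : 0 < b n * u by rewrite mulr_gt0.
  apply: (le_trans (th_lim bn)); rewrite -[e]invrK lef_pV2 ?posrE ?invr_gt0//.
  have h := archi_boundP (ltW (_ : 0 < (e * u)^-1)); rewrite invr_gt0 mulr_gt0// in h.
  have h1 : (e * u)^-1 <= b n.
    apply: (le_trans (ltW (h isT))); apply: le_trans (b_ge n).
    by rewrite ler_nat (leq_trans hn).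
  by have := ler_wpM2r (ltW u0) h1; rewrite invfM -mulrA mulVf ?gt_eqF// mulr1.
rewrite /omI /jump; case: (ltgtP 0 c) => c0.
- by apply: cvgM; [exact: pos|exact: cvg_cst].
- have := pos (- c); rewrite oppr_gt0 => /(_ c0) h.
  have -> : - (1 / 2) = - (1 : R) / 2 by rewrite mulNr.
  apply: cvgM; last exact: cvg_cst.
  have -> : (fun n => th (b n * c)) = (fun n => - th (b n * - c)).
    by apply/funext => n; rewrite mulrN th_odd opprK.
  exact: cvgN.
- rewrite -c0; have -> : (fun n => th (b n * 0) / 2) = cst (0 : R); last exact: cvg_cst.
  by apply/funext => n; rewrite mulr0 /th oppr0 subrr !mul0r.
Qed.

Lemma cdens_cvg x : cdens gam (b n) x @[n --> \oo] --> U x - 1 / 2.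
Proof.
have ib (n : nat) (c : R) : `|omI (b n) c| <= 1 by exact: omI_bd.
have mo n (c : R) : measurable_fun setT (fun z : R => omI (b n) (c - z)).
  by apply: intg_meas; exact: intg_omI.
have mj (c : R) : measurable_fun setT (fun z : R => jump (c - z)).
  have mc : measurable_fun setT (fun z : R => c - z) by exact: measurable_funB.
  apply: measurable_fun_ifT => //; first exact: measurable_fun_ltr.
  by apply: measurable_fun_ifT => //; exact: measurable_fun_ltr.
have := @Rdominated _ _ R gam setT (fun n z => omI (b n) (x - z)) (fun z => jump (x - z)) (cst 1) measurableT.
move=> /(_ (fun n => mo n x) (mj x)).
have cj z : setT z -> omI (b n) (x - z) @[n --> \oo] --> jump (x - z) by move=> _; exact: omI_jump.
move=> /(_ cj (intg_cst gam 1)) [|_]; first by move=> n z _ /=; exact: ib.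
rewrite (_ : (fun n => cdens gam (b n) x) = (fun n => \int[gam]_z omI (b n) (x - z))); last first.
  by apply/funext => n; apply: eq_Rintegral => z _; exact: mul1r.
suff -> : \int[gam]_z jump (x - z) = U x - 1 / 2 by [].
pose I : set R := [set y | y <= x].
have mI : measurable I.
  have -> : I = `]-oo, x]%classic by apply/seteqP; split => z /=; rewrite in_itv.
  exact: measurable_itv.
have e : (\int[gam]_z (jump (x - z))%:E = \int[gam]_z ((\1_I z)%:E - (1 / 2)%:E))%E.
  apply: ae_eq_integral => //.
  - by apply/measurable_EFinP; exact: mj.
  - apply/measurable_EFinP; apply: measurable_funB => //; exact: measurable_indic.
  exists [set x]; split => //; first exact: atom0.
  move=> z /= h; apply: contrapT => zx; apply: h => _.
  rewrite -EFinB; congr EFin; rewrite indicE /jump !subr_gt0 !subr_lt0.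
  have -> : (z \in I) = (z <= x) by apply/idP/idP => [/set_mem|/mem_set].
  case: (ltgtP x z) => [xz|zx'|xz]; last by case: zx.
  - by rewrite /= sub0r.
  - by rewrite /=; field.
rewrite /Rintegral e; apply: EFin_inj.
have ii : gam.-integrable setT (EFin \o \1_I).
  apply: (@intg_le _ _ _ _ _ _ (cst 1)) => //.
    exact: intg_cst.
  by move=> z _; rewrite indicE; case: (_ \in _); rewrite /= ?normr0 ?normr1.
rewrite integralB//; last exact: (intg_cst gam (1 / 2)).
rewrite integral_indic// setIT integral_cst// [X in (_ - _ * X)%E](_ : _ = 1%E); last exact: probability_setT.
rewrite mule1 [X in fine (X - _)%E](_ : _ = (U x)%:E)//.
exact/esym/distfunE.
Qed.

End CdensLimit.

(** * The limit density under a bound on the Fisher information *)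

Section Regularity.
Context {R : realType}.
Local Notation leb := (@lebesgue_measure R).
Variable gam : probability R R.
Local Notation U := (p_distfun gam).
Hypothesis cU : continuous U.
Variables (K : R) (b d : nat -> R).
Hypothesis K0 : 0 <= K.
Hypothesis b_ge : forall n, n.+1%:R <= b n.
Hypothesis d_le : forall n, 0 < d n <= n.+1%:R^-1.
Hypothesis fK : forall n, \int[leb]_x fdens gam (b n) (d n) x <= K.
Local Notation P n := (dens gam (b n)).
Local Notation P1 n := (ddens gam (b n)).

Let b0 n : 0 < b n. Proof. exact: lt_le_trans (b_ge n). Qed.
Let d0 n : 0 < d n. Proof. by case/andP: (d_le n). Qed.
Let d1 n : d n <= 1.
Proof. by case/andP: (d_le n) => _ h; apply: (le_trans h); rewrite invf_le1 ?ler1n. Qed.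

(** Window length 1 and mass bound 1 in [dens_sqr_le] give P^2 <= 2 + 4 K, hence P <= 3 + 4 K. *)
Let C : R := 3 + 4 * K.

Let fseg n x y : \int[leb]_(z in `[x, y]) fdens gam (b n) (d n) z <= K.
Proof.
apply: le_trans (fK n).
have mI : measurable (`[x, y]%classic : set (measurableTypeR R)) by exact: measurable_itv.
have i1 := intg_fdens gam (b0 n) (d0 n).
have i2 := intgS measurableT mI (@subsetT _ _) i1.
rewrite -lee_fin !EFin_Rint//; apply: ge0_subset_integral => //.
- by apply/measurable_EFinP; exact: intg_meas i1.
- by move=> z _; rewrite lee_fin fdens_ge0.
Qed.

Let U1 z : U (z + 1) - U z <= 1.
Proof. by rewrite lerBlDr (le_trans (distfun_le1 _ _)) ?lerDl ?distfun_ge0. Qed.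

Let P_le n x : P n x <= C.
Proof.
have h := dens_sqr_le (b0 n) (d0 n) x ltr01 U1.
have q0 : 0 <= \int[leb]_(z in `[x, x + 1]) fdens gam (b n) (d n) z.
  by apply: Rintegral_ge0 => z _; exact: fdens_ge0.
have h2 : P n x ^+ 2 <= 2 + 4 * K.
  apply: (le_trans h); rewrite divr1 expr1n mulr1 !divr1 mulr1.
  have := fseg n x (x + 1); have := d1 n; move: q0; move: (\int[leb]_(z in _) _) => q q0 dn qK.
  have := d0 n; have := K0; nra.
have := dens_ge0 gam (b0 n) x; rewrite /C; have := K0; nra.
Qed.

Let Kd : R := K * (C + 1).

Let Kd0 : 0 <= Kd.
Proof. by rewrite mulr_ge0// /C; have := K0; lra. Qed.

(** Cauchy-Schwarz with weight P + d <= C + 1: continuity of exponent 1/2, with the same constant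
    for all n. *)
Let P_osc_le n x y : x <= y -> (P n y - P n x) ^+ 2 <= Kd * (y - x).
Proof.
move=> xy; set I := (`[x, y]%classic : set (measurableTypeR R)).
have mI : measurable I by exact: measurable_itv.
have Pd z : 0 < P n z + d n by rewrite ltr_wpDl// dens_ge0.
have cP : continuous (fun z => P n z + d n).
  by move=> z; apply: cvgD; [exact: continuous_dens|exact: cvg_cst].
have iw : intg leb I (fun z => P n z + d n) by exact: intg_cont_seg.
have cq : continuous (fun z => P1 n z / (P n z + d n)).
  move=> z; apply: cvgM; first exact: continuous_ddens.
  by apply: cvgV; [rewrite gt_eqF|exact: cP].
have E2 z : (P1 n z / (P n z + d n)) ^+ 2 * (P n z + d n) = fdens gam (b n) (d n) z.
  by rewrite /fdens expr_div_n; field; rewrite gt_eqF.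
have E1 z : (P1 n z / (P n z + d n)) * (P n z + d n) = P1 n z by rewrite divfK// gt_eqF.
have mk : measurable_fun I (fun z => P1 n z / (P n z + d n)).
  by apply: measurable_funTS; apply: continuous_measurable_fun.
have := @weighted_CS _ _ R leb I (fun z => P1 n z / (P n z + d n)) (fun z => P n z + d n) mI mk (fun z _ => ltW (Pd z)) iw.
under [X in intg _ _ X -> _]eq_fun do rewrite E2.
move=> /(_ (intgS measurableT mI (@subsetT _ _) (intg_fdens gam (b0 n) (d0 n)))) [_].
under eq_Rintegral do rewrite E1.
under [X in _ <= _ * X]eq_Rintegral do rewrite E2.
have [_ ->] := FTC_seg (is_derive_dens gam (b0 n)) (@continuous_ddens _ gam _ (b0 n)) xy.
move=> h; apply: (le_trans h).
have q0 : 0 <= \int[leb]_(z in I) fdens gam (b n) (d n) z by apply: Rintegral_ge0 => z _; exact: fdens_ge0.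
have w1 : \int[leb]_(z in I) (P n z + d n) <= (C + 1) * (y - x).
  rewrite -(Rint_cst_seg _ xy); apply: le_Rintegral => //; first by apply: intg_cont_seg => z; exact: cvg_cst.
  by move=> z _; rewrite lerD.
have w0 : 0 <= \int[leb]_(z in I) (P n z + d n) by apply: Rintegral_ge0 => z _; exact: ltW.
by rewrite /Kd -mulrA mulrC ler_pM// fseg.
Qed.

Let P_osc n x y : (P n y - P n x) ^+ 2 <= Kd * `|y - x|.
Proof.
have [xy|/ltW yx] := leP x y; first by rewrite ger0_norm ?subr_ge0// P_osc_le.
by rewrite -sqrrN opprB distrC ger0_norm ?subr_ge0// P_osc_le.
Qed.

Let H (s : R) : R := Num.sqrt (Kd * `|s|).

Let P_H n x y : `|P n y - P n x| <= H (y - x).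
Proof. by rewrite -sqrtr_sqr ler_wsqrtr// P_osc. Qed.

Let cdens_diff_cvg x y : cdens gam (b n) y - cdens gam (b n) x @[n --> \oo] --> U y - U x.
Proof.
have -> : U y - U x = (U y - 1 / 2) - (U x - 1 / 2) by ring.
by apply: cvgB; exact: cdens_cvg.
Qed.

Let cvg_pow (k : nat) (u : nat -> R) (l : R) : u n @[n --> \oo] --> l -> u n ^+ k @[n --> \oo] --> l ^+ k.
Proof. move=> h; elim: k => [|k IH]; first by rewrite expr0; exact: cvg_cst.
by rewrite exprS; under eq_fun do rewrite exprS; exact: cvgM. Qed.

Let dd n x s := cdens gam (b n) (x + s) - cdens gam (b n) x.

Let dd_cvg x s : dd n x s @[n --> \oo] --> U (x + s) - U x.
Proof. exact: cdens_diff_cvg. Qed.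

Let dd_P n x s : `|dd n x s - P n x * s| <= H s * `|s|.
Proof.
have H_mono (u v : R) : `|u| <= `|v| -> H u <= H v by move=> uv; rewrite ler_wsqrtr// ler_wpM2l.
have cc (u v : R) : {within `[u, v], continuous (cdens gam (b n))}.
  by apply: continuous_subspaceT; exact: is_derive_cont (is_derive_cdens gam (b0 n)).
have [s0|/ltW s0] := leP 0 s.
  have le1 : x <= x + s by rewrite lerDl.
  have [c] := MVT_segment le1 (fun z _ => is_derive_cdens gam (b0 n) z) (cc _ _).
  rewrite in_itv /= => /andP[xc cs] e; rewrite /dd e.
  have -> : P n c * (x + s - x) - P n x * s = (P n c - P n x) * s by move: (P n c) (P n x) => u v; ring.
  rewrite normrM ler_wpM2r//; apply: (le_trans (P_H _ _ _)); apply: H_mono.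
  by rewrite !ger0_norm ?subr_ge0// lerBlDl.
have le1 : x + s <= x by rewrite gerDl.
have [c] := MVT_segment le1 (fun z _ => is_derive_cdens gam (b0 n) z) (cc _ _).
rewrite in_itv /= => /andP[xc cs] e.
have -> : dd n x s = - (cdens gam (b n) x - cdens gam (b n) (x + s)) by rewrite opprB.
rewrite e.
have -> : - (P n c * (x - (x + s))) - P n x * s = (P n c - P n x) * s by move: (P n c) (P n x) => u v; ring.
rewrite normrM ler_wpM2r//; apply: (le_trans (P_H _ _ _)); apply: H_mono.
by rewrite !ler0_norm ?subr_le0// lerN2 lerBrDl.
Qed.

Let H_small (e : R) : 0 < e -> exists2 dl : R, 0 < dl & forall s, `|s| <= dl -> H s <= e.
Proof.
move=> e0; exists (e ^+ 2 / (Kd + 1)); first by rewrite divr_gt0 ?exprn_gt0// ltr_wpDl.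
move=> s hs; rewrite -[e in _ <= e]ger0_norm ?(ltW e0)// -sqrtr_sqr ler_wsqrtr//.
apply: (le_trans (ler_wpM2l Kd0 hs)).
have K1 : 0 < Kd + 1 by rewrite ltr_wpDl.
by rewrite mulrCA ler_piMr ?sqr_ge0// ler_pdivrMr// mul1r lerDl.
Qed.

(** P n x is within H(dl) / 1 of the difference quotient of [cdens] over the step dl, and that
    quotient converges because U is continuous; so the whole sequence is Cauchy, without
    extraction. *)
Let cvgP x : cvgn (fun n => P n x).
Proof.
apply/cauchy_cvgP/cauchyP => e e0.
have e4 : 0 < e / 4 by rewrite divr_gt0.
have [dl dl0 hd] := H_small e4.
have Hs : H dl <= e / 4 by apply: hd; rewrite gtr0_norm.
pose q := (U (x + dl) - U x) / dl.
have dc : dd n x dl @[n --> \oo] --> U (x + dl) - U x by exact: dd_cvg.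
move: dc => /cvgrPdist_lt /(_ (e / 4 * dl)) [|N _ hN]; first by rewrite mulr_gt0.
have key n : (N <= n)%N -> `|P n x - q| < e / 2.
  move=> nN; have h1 := hN n nN; have h2 := dd_P n x dl.
  rewrite -(ltr_pM2r dl0) -[X in `|_| * X](gtr0_norm dl0) -normrM.
  have -> : (P n x - q) * dl = - (dd n x dl - P n x * dl) - (U (x + dl) - U x - dd n x dl).
    by rewrite /q; field; rewrite gt_eqF.
  apply: (le_lt_trans (ler_normB _ _)); rewrite normrN.
  rewrite (gtr0_norm dl0) in h2; have h3 := ler_wpM2r (ltW dl0) Hs.
  have -> : e / 2 * dl = e / 4 * dl + e / 4 * dl by field.
  by apply: ler_ltD h1; exact: le_trans h3.
exists (P N x); exists N => // n /= nN; rewrite /ball /=.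
have -> : P N x - P n x = (P N x - q) - (P n x - q) by move: (P N x) (P n x) => u v; ring.
apply: (le_lt_trans (ler_normB _ _)); rewrite (splitr e).
by apply: ltrD; apply: key.
Qed.

Let p x := limn (fun n => P n x).

Let cvgp x : P n x @[n --> \oo] --> p x. Proof. exact: cvgP. Qed.

Let lim_le (u : nat -> R) (l c : R) : u n @[n --> \oo] --> l -> (forall n, u n <= c) -> l <= c.
Proof.
move=> cu h; rewrite -(cvg_lim _ cu)//; apply: limr_le; last exact: nearW.
by apply/cvg_ex; exists l.
Qed.

(** The first-order expansion [dd_P] has an error uniform in n and passes to the limit. *)
Let dU (x : R) : is_derive x 1 U (p x).
Proof.
apply: is_derive_dist => e e0; have [dl dl0 hd] := H_small e0.
exists dl => // z zx; set s := z - x.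
have -> : z = x + s by rewrite /s addrC subrK.
apply: (@le_trans _ _ (H s * `|s|)); last by rewrite ler_wpM2r// hd// ltW.
apply: (@lim_le (fun n => `|dd n x s - P n x * s|)) => [|n]; last exact: dd_P.
apply: cvg_norm; apply: cvgB; first exact: dd_cvg.
by apply: cvgM; [exact: cvgp|exact: cvg_cst].
Qed.

Let p0 x : 0 <= p x.
Proof.
rewrite -oppr_le0; apply: (@lim_le (fun n => - P n x)); first by apply: cvgN; exact: cvgp.
by move=> n; rewrite oppr_le0 dens_ge0.
Qed.

Let cp : continuous p.
Proof.
move=> x; apply/cvgrPdist_le => e e0; have [dl dl0 hd] := H_small e0.
exists dl => // y /= xy; apply: (@le_trans _ _ (H (x - y))); last by apply: hd; exact: ltW.
apply: (@lim_le (fun n => `|P n x - P n y|)); last by move=> n; exact: P_H.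
by apply: cvg_norm; apply: cvgB; exact: cvgp.
Qed.

(** Fatou, with the constants of [dens_cube_le] for l = eta = 1 and d <= 1. *)
Let p_cube : (\int[leb]_x (p x ^+ 3)%:E <= (2 + 4 * K)%:E)%E.
Proof.
have mP n : measurable_fun setT (fun x => (P n x ^+ 3)%:E).
  apply/measurable_EFinP; apply: measurable_funX; apply: continuous_measurable_fun.
  exact: continuous_dens.
have := @fatou _ (measurableTypeR R) _ leb setT measurableT (fun n x => (P n x ^+ 3)%:E) mP
  (fun n x _ => (_ : (0 <= (P n x ^+ 3)%:E)%E)).
rewrite (_ : (fun x : measurableTypeR R => limn_einf _) = (fun x => (p x ^+ 3)%:E)); last first.
  apply/funext => x; apply: (cvg_limn_einf_sup _).1.
  apply: cvg_EFin; first exact: nearW.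
  by apply: cvg_pow; exact: cvgp.
have P3 n (x : R) : (0 <= (P n x ^+ 3)%:E)%E by rewrite lee_fin exprn_ge0// dens_ge0.
move=> /(_ P3) h; apply: (le_trans h).
rewrite limn_einf_lim; apply: lime_le; first exact: is_cvg_einfs.
apply: nearW => n; apply: (@le_trans _ _ (\int[leb]_x (P n x ^+ 3)%:E)%E).
  by apply: ereal_inf_lbound; exists n => //=.
have [i3 h3] := dens_cube_le (b0 n) (d0 n) ltr01 U1.
rewrite -EFin_Rint// lee_fin (le_trans h3)// divr1 expr1n mulr1 mulr1 mulr1.
have q0 : 0 <= \int[leb]_z fdens gam (b n) (d n) z by apply: Rintegral_ge0 => z _; exact: fdens_ge0.
have := fK n; have := d1 n; have := d0 n; move: q0; move: (\int[leb]_z _) => q q0 dn dn1 qK.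
have := K0; nra.
Qed.

(** For each n, integration by parts and Cauchy-Schwarz against P1^2/(P + d) leave the information
    only through its bound K, so that no limit of the derivatives P1 has to be taken. *)
Lemma density_by_parts (M : R) (ps ps' : R -> R) : 0 <= M ->
  (forall x : R, is_derive x 1 ps (ps' x)) -> continuous ps' -> ps M = 0 -> ps (- M) = 0 ->
  (\int[leb]_(x in `[- M, M]) (ps' x * p x)) ^+ 2 <= K * \int[leb]_(x in `[- M, M]) (ps x ^+ 2 * p x).
Proof.
move=> M0 dps cps' psM psNM; set I := (`[- M, M]%classic : set (measurableTypeR R)).
have mI : measurable I by exact: measurable_itv.
have MM : - M <= M by lra.
have cps := is_derive_cont dps.
have ci f : continuous f -> intg leb I f by move=> cf; exact: intg_cont_seg.
have cP n : continuous (P n) by exact: continuous_dens.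
have cP1 n : continuous (P1 n) by exact: continuous_ddens.
have cMul (f g : R -> R) : continuous f -> continuous g -> continuous (fun x => f x * g x).
  by move=> cf cg x; apply: cvgM; [exact: cf|exact: cg].
have key n : (\int[leb]_(x in I) (ps' x * P n x)) ^+ 2 <= K * \int[leb]_(x in I) (ps x ^+ 2 * (P n x + d n)).
  have cPd : continuous (fun z => P n z + d n).
    by move=> z; apply: cvgD; [exact: cP|exact: cvg_cst].
  have Pd z : 0 < P n z + d n by rewrite ltr_wpDl// dens_ge0.
  have e : \int[leb]_(x in I) (ps' x * P n x) = - \int[leb]_(x in I) (ps x * P1 n x).
    have dpP (x : R) : is_derive x 1 (fun x => ps x * P n x) (ps x * P1 n x + ps' x * P n x).
      have := is_deriveM (dps x) (is_derive_dens gam (b0 n) x).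
      by rewrite /GRing.scale /= [P n x * ps' x]mulrC.
    have cd : continuous (fun x => ps x * P1 n x + ps' x * P n x).
      by move=> x; apply: cvgD; [exact: cMul|exact: cMul].
    have [_] := FTC_seg dpP cd MM.
    have ia : intg leb I (fun x => ps x * P1 n x) by apply: ci; exact: cMul.
    have ib : intg leb I (fun x => ps' x * P n x) by apply: ci; exact: cMul.
    rewrite psM psNM !mul0r subrr (RintegralD mI ia ib).
    by move/eqP; rewrite addrC addr_eq0 => /eqP.
  rewrite e sqrrN.
  have f0 := fdens_ge0 gam (b0 n) (d0 n).
  apply: (@le_trans _ _ ((\int[leb]_(x in I) fdens gam (b n) (d n) x) * \int[leb]_(x in I) (ps x ^+ 2 * (P n x + d n)))).
    apply: quad_disc => [|l]; first by apply: Rintegral_ge0 => x _; exact: f0.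
    have i1 : intg leb I (fun x => ps x ^+ 2 * (P n x + d n)).
      by apply: ci; apply: cMul => // x; exact: (cvg_comp _ _ (cps x) (@exprn_continuous _ 2 _)).
    have i2 : intg leb I (fun x => 2 * l * (ps x * P1 n x)).
      by apply: intgZ => //; apply: ci; exact: cMul.
    have i3 : intg leb I (fun x => l ^+ 2 * fdens gam (b n) (d n) x).
      by apply: intgZ => //; apply: ci; exact: continuous_fdens.
    rewrite -RintegralZl//; last by apply: ci; exact: cMul.
    rewrite -[l ^+ 2 * _]RintegralZl//; last by apply: ci; exact: continuous_fdens.
    have i4 := intgB mI i1 i2.
    rewrite -RintegralB// -RintegralD//; apply: Rintegral_ge0 => x _.
    have -> : ps x ^+ 2 * (P n x + d n) - 2 * l * (ps x * P1 n x) + l ^+ 2 * fdens gam (b n) (d n) x =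
       (ps x * (P n x + d n) - l * P1 n x) ^+ 2 / (P n x + d n).
      by rewrite /fdens; field; rewrite gt_eqF.
    by rewrite divr_ge0 ?sqr_ge0// ltW.
  rewrite ler_wpM2r ?fseg//; apply: Rintegral_ge0 => x _.
  by rewrite mulr_ge0 ?sqr_ge0// ltW.
have mc (f : R -> R) : continuous f -> measurable_fun I f.
  by move=> cf; apply: measurable_funTS; exact: continuous_measurable_fun.
have dn0 : d n @[n --> \oo] --> (0 : R).
  apply/cvgrPdist_le => e e0; exists (Num.bound e^-1) => // n /= hn.
  rewrite sub0r normrN gtr0_norm//; case/andP: (d_le n) => _ h; apply: (le_trans h).
  rewrite -[e]invrK lef_pV2 ?posrE ?invr_gt0//.
  have h2 := archi_boundP (ltW (_ : 0 < e^-1)); rewrite invr_gt0 in h2.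
  by apply: (le_trans (ltW (h2 e0))); rewrite ler_nat (leq_trans hn).
have L1 : \int[leb]_(x in I) (ps' x * P n x) @[n --> \oo] --> \int[leb]_(x in I) (ps' x * p x).
  have [//|||||_ //] := @Rdominated _ _ R leb I (fun n x => ps' x * P n x) (fun x => ps' x * p x) (fun x => C * `|ps' x|) mI.
  - by move=> n; apply: mc; exact: cMul.
  - by apply: mc; exact: cMul.
  - by move=> x _; apply: cvgM; [exact: cvg_cst|exact: cvgp].
  - by apply: intgZ => //; apply: ci => x; apply: cvg_norm; exact: cps'.
  - move=> n x _; rewrite normrM mulrC ler_wpM2r// ger0_norm ?P_le// dens_ge0//.
have L2 : \int[leb]_(x in I) (ps x ^+ 2 * (P n x + d n)) @[n --> \oo] --> \int[leb]_(x in I) (ps x ^+ 2 * p x).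
  have cps2 : continuous (fun x => ps x ^+ 2) by move=> x; exact: (cvg_comp _ _ (cps x) (@exprn_continuous _ 2 _)).
  have [//|||||_ //] := @Rdominated _ _ R leb I (fun n x => ps x ^+ 2 * (P n x + d n)) (fun x => ps x ^+ 2 * p x) (fun x => (C + 1) * ps x ^+ 2) mI.
  - move=> n; apply: mc; apply: cMul => // x.
    by apply: cvgD; [exact: cP|exact: cvg_cst].
  - by apply: mc; exact: cMul.
  - move=> x _; apply: cvgM; first exact: cvg_cst.
    by rewrite -[p x]addr0; apply: cvgD; [exact: cvgp|exact: dn0].
  - by apply: intgZ => //; exact: ci.
  - move=> n x _; have Pd : 0 <= P n x + d n by rewrite addr_ge0 ?dens_ge0// ltW.
    by rewrite normrM (ger0_norm (sqr_ge0 _)) (ger0_norm Pd) mulrC ler_wpM2r ?sqr_ge0// lerD.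
have L3 : (\int[leb]_(x in I) (ps' x * P n x)) ^+ 2 - K * \int[leb]_(x in I) (ps x ^+ 2 * (P n x + d n)) @[n --> \oo] -->
   (\int[leb]_(x in I) (ps' x * p x)) ^+ 2 - K * \int[leb]_(x in I) (ps x ^+ 2 * p x).
  by apply: cvgB; [exact: cvg_pow|apply: cvgM => //; exact: cvg_cst].
rewrite -subr_le0; apply: (lim_le L3) => n.
by rewrite subr_le0; exact: key.
Qed.

Lemma regular_density : exists p : R -> R,
  [/\ continuous p, (forall x, 0 <= p x), (forall x : R, is_derive x 1 U (p x)),
    (forall B, measurable B -> gam B = (\int[leb]_(x in B) (p x)%:E)%E) &
    (\int[leb]_x (p x ^+ 3)%:E <= (2 + 4 * K)%:E)%E] /\
  forall (M : R) (ps ps' : R -> R), 0 <= M ->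
    (forall x : R, is_derive x 1 ps (ps' x)) -> continuous ps' -> ps M = 0 -> ps (- M) = 0 ->
    (\int[leb]_(x in `[- M, M]) (ps' x * p x)) ^+ 2 <= K * \int[leb]_(x in `[- M, M]) (ps x ^+ 2 * p x).
Proof.
exists p; split; last exact: density_by_parts.
split; [exact: cp|exact: p0|exact: dU| |exact: p_cube].
apply: (@density_measure _ p) => //.
  exact: continuous_measurable_fun.
move=> x y xy; rewrite distfun_itv//.
have [i e] := FTC_seg dU cp xy.
rewrite integral_itv_obnd_cbnd; last first.
  by apply/measurable_EFinP; apply: measurable_funTS; exact: continuous_measurable_fun.
by rewrite -EFin_Rint// e.
Qed.

End Regularity.

(** * Fubini for real-valued integrals *)

Section RealFubini.
Context d1 d2 (T1 : measurableType d1) (T2 : measurableType d2) (R : realType).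
Variable m1 : {sigma_finite_measure set T1 -> \bar R}.
Variable m2 : {sigma_finite_measure set T2 -> \bar R}.
Implicit Type f : T1 * T2 -> R.

(** Section integrals may be infinite for a null set of parameters, where [fine] returns 0; [key]
    shows that this affects neither integrability nor the value. *)
Lemma Rfubini f : intg (m1 \x m2)%E setT f ->
  [/\ intg m1 setT (fun x => \int[m2]_y f (x, y)), intg m2 setT (fun y => \int[m1]_x f (x, y)),
    \int[m1]_x \int[m2]_y f (x, y) = \int[(m1 \x m2)%E]_z f z &
    \int[m2]_y \int[m1]_x f (x, y) = \int[(m1 \x m2)%E]_z f z].
Proof.
move=> fi.
have iF := integrable_fubini_F fi.
have mf : measurable_fun setT (EFin \o f) by exact: measurable_int fi.
have iG : m2.-integrable setT (fubini_G m1 (EFin \o f)).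
  apply/integrableP; split; first exact: measurable_fubini_G fi.
  have h21 := (integrable21ltyP m1 m2 mf).1 fi.
  apply: le_lt_trans h21; apply: ge0_le_integral => //.
  - by apply: measurableT_comp => //; exact: measurable_fubini_G fi.
  - have mf' : measurable_fun setT (abse \o (EFin \o f)) by exact: measurableT_comp.
    by apply: (measurable_fun_fubini_tonelli_G _ mf') => z; exact: abse_ge0.
  - move=> y _; apply: le_abse_integral => //.
    exact: (measurableT_comp mf (measurable_pair2 y)).
have eF := integral12_prod_meas1 fi; have eG := integral21_prod_meas1 fi.
have key d (X : measurableType d) (m : {measure set X -> \bar R}) (H : X -> \bar R) :
    m.-integrable setT H -> intg m setT (fun x => fine (H x)) /\
    (\int[m]_x (fine (H x))%:E = \int[m]_x H x)%E.
  move=> iH; have mH := measurable_int _ iH.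
  have mfH : measurable_fun setT (fun x => fine (H x)) by exact: measurableT_comp.
  split.
    apply: intgP => //; apply: le_lt_trans (integrableP _ _ _ iH).2.
    apply: ge0_le_integral => //.
    - by apply/measurable_EFinP; exact: measurableT_comp.
    - exact: measurableT_comp.
    - by move=> x _; case: (H x) => [r| |] /=; rewrite ?normr0 ?leey.
  apply: ae_eq_integral => //; first exact/measurable_EFinP.
  move: (integrable_ae measurableT iH); apply: filterS => x /(_ I) hx _.
  by rewrite fineK.
have [h1 h2] := key _ _ m1 _ iF; have [h3 h4] := key _ _ m2 _ iG.
split => //.
- by rewrite /Rintegral; congr fine; rewrite [LHS]h2 eF.
- by rewrite /Rintegral; congr fine; rewrite [LHS]h4 eG.
Qed.

(** The indicator of the time set is built into the integrand, so that later arguments live on the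
    whole plane. *)
Lemma prod_intgP f (D : set T1) (G : T1 -> R) : measurable D -> measurable_fun setT f ->
  intg m1 D G -> (forall x, D x -> (\int[m2]_y (`|f (x, y)|)%:E <= (G x)%:E)%E) ->
  intg (m1 \x m2)%E setT (fun z => \1_D z.1 * f z).
Proof.
move=> mD mf iG hG.
have mg : measurable_fun setT (fun z : T1 * T2 => \1_D z.1 * f z).
  apply: measurable_funM => //; apply: measurableT_comp => //; exact: measurable_fst.
apply/integrable12ltyP; first exact/measurable_EFinP.
apply: (@le_lt_trans _ _ (\int[m1]_(x in D) (`|G x|)%:E)%E); last exact: intg_lty.
rewrite [X in (_ <= X)%E]integral_mkcond; apply: ge0_le_integral => //.
- by move=> x _; apply: integral_ge0.
- have mg' : measurable_fun setT (fun z : T1 * T2 => (`|\1_D z.1 * f z|)%:E).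
    by apply/measurable_EFinP; exact: measurableT_comp.
  by apply: (measurable_fun_fubini_tonelli_F _ mg') => z; rewrite lee_fin.
- by apply/(measurable_restrictT _ mD).1; apply/measurable_EFinP; apply: measurableT_comp => //; exact: intg_meas iG.
move=> x _; rewrite patchE /= indicE; case: ifPn => xD.
  under eq_integral do rewrite mul1r.
  by apply: (le_trans (hG x (set_mem xD))); rewrite lee_fin ler_norm.
by under eq_integral do rewrite mul0r normr0; rewrite integral0.
Qed.

Lemma Rfubini_on f (D : set T1) (G : T1 -> R) : measurable D -> measurable_fun setT f ->
  intg m1 D G -> (forall x, D x -> (\int[m2]_y (`|f (x, y)|)%:E <= (G x)%:E)%E) ->
  [/\ intg m1 D (fun x => \int[m2]_y f (x, y)), intg m2 setT (fun y => \int[m1]_(x in D) f (x, y)) &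
    \int[m1]_(x in D) \int[m2]_y f (x, y) = \int[m2]_y \int[m1]_(x in D) f (x, y)].
Proof.
move=> mD mf iG hG; have [i1 i2 e1 e2] := Rfubini (prod_intgP mD mf iG hG).
have E1 : (fun x => \int[m2]_y (\1_D x * f (x, y))) = (fun x => \int[m2]_y f (x, y)) \_ D.
  apply/funext => x; rewrite patchE indicE; case: ifPn => xD.
    by apply: eq_Rintegral => y _; rewrite mul1r.
  by under eq_Rintegral do rewrite mul0r; rewrite /Rintegral integral0.
have E2 y : \int[m1]_x (\1_D x * f (x, y)) = \int[m1]_(x in D) f (x, y).
  rewrite [RHS]Rintegral_mkcond; apply: eq_Rintegral => x _; rewrite patchE indicE; case: ifP => _.
    by rewrite mul1r.
  by rewrite mul0r.
split.
- have := i1; rewrite /= E1 /intg => i3; apply/(integrable_mkcond _ mD).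
  rewrite (_ : _ \_ D = EFin \o ((fun x => \int[m2]_y f (x, y)) \_ D))//.
  by apply/funext => x; rewrite /= !patchE; case: ifP.
- by have := i2; under eq_fun do rewrite /= E2.
rewrite [LHS]Rintegral_mkcond -E1 [LHS]e1 -e2; apply: eq_Rintegral => y _; exact: E2.
Qed.

End RealFubini.

(** * The evolution of mollified densities and the entropy estimate *)

Lemma continuous_conv {R : realType} (gam : probability R R) (k ph : R -> R) (C : R) :
  intg gam setT k -> continuous ph -> (forall u, `|ph u| <= C) -> continuous (conv gam k ph).
Proof.
move=> ik cph hC x.
have C0 : 0 <= C by apply: le_trans (hC 0).
have xI : x \in [set` `]x - 1, x + 1[ ] by rewrite inE /= in_itv /=; apply/andP; split; lra.
apply: (@continuity_under_integral R _ _ gam (fun x y => k y * ph (x - y)) setT measurableT (x - 1) (x + 1) _ _ (fun y => C * `|k y|)) => //.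
- by move=> z _; exact: intg_conv.
- apply: aeW => y _ z _; apply: cvgM; first exact: cvg_cst.
  exact: continuous_shift.
- by apply: intgZ => //; exact: intg_norm.
- by move=> z _; apply: aeW => y _; rewrite normrM mulrC ler_wpM2r.
Qed.

(** * First moments of mollified densities *)

Section Moments.
Context {R : realType}.
Local Notation leb := (@lebesgue_measure R).
Variables (gam : probability R R) (b : R).
Hypothesis b0 : 0 < b.

(** Half of the exponential decay absorbs the factor b |u|; the remaining half is dominated by the
    kernel of twice the width. *)
Lemma om_moment (u : R) : `|u| * om b u <= 8 / b * om (b / 2) u.
Proof.
have h1 := om_le_exp u b0.
have h2 : b / 4 * expR (- (b * `|u|)) <= om (b / 2) u.
  have b2 : 0 < b / 2 by rewrite divr_gt0.
  have -> : om (b / 2) u = b / 4 * expR (- (2 * lch (b / 2 * u))).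
    by rewrite expR_lch /om; field.
  rewrite ler_wpM2l ?divr_ge0 ?(ltW b0)// ler_expR lerN2.
  have := lch_le (b / 2 * u); rewrite normrM gtr0_norm//; lra.
have h3 : b * `|u| * expR (- (b * `|u|)) <= 1.
  rewrite -(@expRxMexpNx_1 R (b * `|u|)) ler_wpM2r ?expR_ge0//.
  by apply: le_trans (expR_ge1Dx _); rewrite lerDr.
apply: (@le_trans _ _ (8 / b * (b / 4 * expR (- (b * `|u|))))); last first.
  by rewrite ler_wpM2l// divr_ge0// ltW.
apply: (le_trans (ler_wpM2l (normr_ge0 u) h1)).
have -> : expR (- (2 * b * `|u|)) = expR (- (b * `|u|)) * expR (- (b * `|u|)).
  by rewrite -expRD; congr expR; ring.
have h4 := ler_wpM2r (expR_ge0 (- (b * `|u|))) h3.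
have -> : 8 / b * (b / 4 * expR (- (b * `|u|))) = 2 * (1 * expR (- (b * `|u|))) by field; rewrite gt_eqF.
have -> : `|u| * (2 * b * (expR (- (b * `|u|)) * expR (- (b * `|u|)))) =
  2 * (b * `|u| * expR (- (b * `|u|)) * expR (- (b * `|u|))) by ring.
by rewrite ler_wpM2l.
Qed.

Lemma dens_moment : intg gam setT (fun y => `|y|) ->
  intg leb setT (fun x => `|x| * dens gam b x) /\
  \int[leb]_x (`|x| * dens gam b x) <= \int[gam]_y `|y| + 8 / b.
Proof.
move=> im; have b2 : 0 < b / 2 by rewrite divr_gt0.
have mn : measurable_fun setT (fun y : R => `|y|) by [].
have [i1 e1] := conv_tonelli b0 mn (fun y => normr_ge0 y) im.
have i2 : intg leb setT (dens gam (b / 2)) by exact: intg_dens.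
have c8 : 0 <= 8 / b by rewrite divr_ge0// ltW.
have i3 : intg leb setT (fun x => conv gam (fun y => `|y|) (om b) x + 8 / b * dens gam (b / 2) x).
  by apply: intgD; [exact: measurableT|exact: i1|apply: intgZ; [exact: measurableT|exact: i2]].
have hx x : `|x| * dens gam b x <= conv gam (fun y => `|y|) (om b) x + 8 / b * dens gam (b / 2) x.
  have j1 := intg_om gam b0 x; have j2 := intg_om gam b2 x.
  have j3 := intg_conv x im (@continuous_om _ b) (om_bd b0).
  rewrite !densE -!RintegralZl// -RintegralD//; last exact: intgZ.
  apply: le_Rintegral; [exact: measurableT|exact: intgZ|by apply: intgD => //; exact: intgZ|].
  move=> y _; apply: le_trans (_ : (`|y| + `|x - y|) * om b (x - y) <= _).
    rewrite ler_wpM2r ?(ltW (om_gt0 _ b0))//.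
    by rewrite -{1}(subrK y x) addrC ler_normD.
  by rewrite mulrDl lerD2l om_moment.
have i4 : intg leb setT (fun x => `|x| * dens gam b x).
  apply: (intg_le measurableT _ i3) => [|x _].
    apply: measurable_funM => //; apply: continuous_measurable_fun.
    exact: continuous_dens.
  by rewrite ger0_norm ?mulr_ge0 ?dens_ge0.
split => //; apply: (le_trans (le_Rintegral measurableT i4 i3 (fun x _ => hx x))).
have i5 := intgZ (8 / b) measurableT i2.
rewrite (RintegralD measurableT i1 i5) e1 (RintegralZl _ measurableT i2).
by rewrite (Rint_dens gam b2) mulr1.
Qed.

End Moments.

(** * Mollification tested against Lipschitz functions *)

Section Approximation.
Context {R : realType}.
Local Notation leb := (@lebesgue_measure R).
Variables (gam : probability R R).

Lemma cdens_cvgN b : 0 < b -> cdens gam b (- n%:R) @[n --> \oo] --> (- (1 / 2) : R).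
Proof.
move=> b0.
have := @Rdominated _ _ R gam setT (fun n z => omI b (- n%:R - z)) (cst (- (1 / 2))) (cst 1) measurableT.
move=> /(_ (fun n => intg_meas (intg_omI gam b (- n%:R))) (@measurable_cst _ _ _ _ _ _)).
have cj z : setT z -> omI b (- n%:R - z) @[n --> \oo] --> (cst (- (1 / 2)) z : R).
  move=> _; rewrite /omI /= -mulNr; apply: cvgM; last exact: cvg_cst.
  exact: cvg_thbN.
move=> /(_ cj (intg_cst gam 1)) [|_]; first by move=> n z _ /=; exact: omI_bd.
rewrite (_ : (fun n => cdens gam b (- n%:R)) = (fun n => \int[gam]_z omI b (- n%:R - z))); last first.
  by apply/funext => n; apply: eq_Rintegral => z _; exact: mul1r.
suff -> : \int[gam]_z cst (- (1 / 2)) z = - (1 / 2) by [].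
transitivity (- (1 / 2) * fine (gam setT)); first exact: Rintegral_cst.
by rewrite [X in fine X](_ : _ = 1%E) ?mulr1//; exact: probability_setT.
Qed.

(** The signed case reduces to [conv_tonelli] through f = (|f| + f) - |f|. *)
Lemma conv_total b (f : R -> R) : 0 < b -> intg gam setT f ->
  intg leb setT (conv gam f (om b)) /\ \int[leb]_x conv gam f (om b) x = \int[gam]_y f y.
Proof.
move=> b0 fi; have mf := intg_meas fi; have ifn := intg_norm measurableT fi.
have mn : measurable_fun setT (fun y => `|f y|) by exact: measurableT_comp.
pose g y := `|f y| + f y.
have ig : intg gam setT g by exact: intgD.
have g0 y : 0 <= g y by rewrite /g -lerBlDr sub0r -normrN ler_norm.
have [i1 e1] := conv_tonelli b0 (measurable_funD mn mf) g0 ig.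
have [i2 e2] := conv_tonelli b0 mn (fun y => normr_ge0 _) ifn.
have E x : conv gam f (om b) x = conv gam g (om b) x - conv gam (fun y => `|f y|) (om b) x.
  have j1 := intg_conv x ig (@continuous_om _ b) (om_bd b0).
  have j2 := intg_conv x ifn (@continuous_om _ b) (om_bd b0).
  by rewrite /conv -(RintegralB measurableT j1 j2); apply: eq_Rintegral => y _; rewrite /g; ring.
rewrite (_ : conv gam f (om b) = (fun x => conv gam g (om b) x - conv gam (fun y => `|f y|) (om b) x)); last exact/funext.
split; first exact: (intgB measurableT i1 i2).
rewrite (RintegralB measurableT i1 i2) e1 e2 (RintegralD measurableT ifn fi); ring.
Qed.

(** Compare ps(x) with ps(y) under the integral: |ps x - ps y| om <= Lp |x - y| om, and [om_moment]
    trades the factor |x - y| for 8 / b. *)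
Lemma conv_approx b (f ps : R -> R) (C Lp : R) : 0 < b -> intg gam setT f ->
  measurable_fun setT ps -> (forall x, `|ps x| <= C) -> 0 <= Lp ->
  (forall x y, `|ps x - ps y| <= Lp * `|x - y|) ->
  intg leb setT (fun x => conv gam f (om b) x * ps x) /\
  `|\int[leb]_x (conv gam f (om b) x * ps x) - \int[gam]_y (f y * ps y)| <=
    8 * Lp / b * \int[gam]_y `|f y|.
Proof.
move=> b0 fi mps psC Lp0 psL; have b2 : 0 < b / 2 by rewrite divr_gt0.
have [i1 e1] := conv_total b0 fi.
have ifp : intg gam setT (fun y => f y * ps y) by apply: (intgM measurableT fi mps (C := C)).
have [i2 e2] := conv_total b0 ifp.
have ifn := intg_norm measurableT fi.
have [i3 e3] := conv_total b2 ifn.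
have i4 : intg leb setT (fun x => conv gam f (om b) x * ps x).
  by apply: (@intgM _ (measurableTypeR R) R leb setT _ ps C measurableT i1 mps).
split => //; rewrite -e2 -(RintegralB measurableT i4 i2).
have i5 := intgB measurableT i4 i2.
apply: (le_trans (le_normr_Rintegral measurableT i5)).
rewrite -e3 -(RintegralZl _ measurableT i3).
apply: (le_Rintegral measurableT (intg_norm measurableT i5) (intgZ _ measurableT i3)) => x _.
have j1 := intg_conv x fi (@continuous_om _ b) (om_bd b0).
have j2 := intg_conv x ifp (@continuous_om _ b) (om_bd b0).
have j3 := intg_conv x ifn (@continuous_om _ (b / 2)) (om_bd b2).
have j4 := intgB measurableT (intgZ (ps x) measurableT j1) j2.
have -> : conv gam f (om b) x * ps x - conv gam (fun y => f y * ps y) (om b) x =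
    \int[gam]_y (ps x * (f y * om b (x - y)) - f y * ps y * om b (x - y)).
  by rewrite (RintegralB measurableT (intgZ (ps x) measurableT j1) j2) (RintegralZl _ measurableT j1) mulrC.
apply: (le_trans (le_normr_Rintegral measurableT j4)).
rewrite -(RintegralZl _ measurableT j3).
apply: (le_Rintegral measurableT (intg_norm measurableT j4) (intgZ _ measurableT j3)) => y _.
have -> : ps x * (f y * om b (x - y)) - f y * ps y * om b (x - y) = f y * ((ps x - ps y) * om b (x - y)) by ring.
rewrite normrM [X in _ <= X]mulrCA; apply: ler_wpM2l => //.
rewrite normrM (ger0_norm (ltW (om_gt0 (x - y) b0))).
apply: (le_trans (ler_wpM2r (ltW (om_gt0 (x - y) b0)) (psL x y))).
rewrite -[X in X <= _]mulrA; apply: (le_trans (ler_wpM2l Lp0 (om_moment b0 (x - y)))).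
by rewrite le_eqVlt; apply/orP; left; apply/eqP; ring.
Qed.

End Approximation.

(** * Integration by parts in time *)

Section AbsolutelyContinuousParts.
Context {R : realType}.
Local Notation leb := (@lebesgue_measure R).

(** Write P t - P 0 as the integral of Q over s <= t and exchange the order on this triangle; f T =
    0 turns the integral of f' over [s, T] into -f(s). *)
Lemma parts_absolutely_continuous (T C : R) (P Q f f' : R -> R) : 0 < T ->
  intg leb `[0, T] Q -> (forall t, 0 <= t <= T -> P t - P 0 = \int[leb]_(s in `[0, t]) Q s) ->
  (forall t : R, is_derive t 1 f (f' t)) -> continuous f' -> (forall t, `|f' t| <= C) ->
  f 0 = 0 -> f T = 0 ->
  intg leb `[0, T] (fun t => P t * f' t) /\
  \int[leb]_(t in `[0, T]) (P t * f' t) = - \int[leb]_(t in `[0, T]) (Q t * f t).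
Proof.
move=> T0 iQ PQ df cf' f'C f0 fT.
have lo (m M v : R) : m <= v -> - (`|m| + `|M|) <= v.
  by have := ler_norm (- m); have := normr_ge0 M; rewrite normrN; lra.
have up (m M v : R) : v <= M -> v <= `|m| + `|M|.
  by have := ler_norm M; have := normr_ge0 m; lra.
have mT : measurable (`[0, T]%classic : set (measurableTypeR R)) by exact: measurable_itv.
pose I : set (measurableTypeR R) := `[0, T]%classic.
pose Qe : R -> R := Q \_ I.
have mQe : measurable_fun setT Qe by exact: ((measurable_restrictT _ mT).1 (intg_meas iQ)).
have iQe : intg leb setT Qe.
  apply/integrableP; split; first exact/measurable_EFinP.
  apply: le_lt_trans (intg_lty iQ); rewrite [X in (_ <= X)%E]integral_mkcond.
  rewrite le_eqVlt; apply/orP; left; apply/eqP; apply: eq_integral => x _.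
  by rewrite /Qe /= !patchE; case: ifP => // _; rewrite normr0.
pose g (z : R * R) := f' z.1 * (if z.2 <= z.1 then Qe z.2 else 0).
have mg : measurable_fun setT g.
  apply: measurable_funM.
    by apply: (measurableT_comp (continuous_measurable_fun cf')); exact: measurable_fst.
  apply: measurable_fun_ifT => //; last by apply: (measurableT_comp mQe); exact: measurable_snd.
  by apply: measurable_fun_ler; [exact: measurable_snd|exact: measurable_fst].
have iC : intg leb `[0, T] (cst (C * \int[leb]_s `|Qe s|)) by apply: intg_cont_seg => z; exact: cvg_cst.
have iQn := intg_norm measurableT iQe.
have C0 : 0 <= C by apply: le_trans (f'C 0).
have hG t : `[0, T]%classic t -> (\int[leb]_s (`|g (t, s)|)%:E <= (cst (C * \int[leb]_s `|Qe s|) t)%:E)%E.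
  move=> _; rewrite [cst _ _]/= -(RintegralZl _ measurableT iQn) (EFin_Rint measurableT (intgZ _ measurableT iQn)).
  apply: ge0_le_integral => //.
  - apply/measurable_EFinP; apply: measurableT_comp => //.
    exact: (measurableT_comp mg (measurable_pair1 t)).
  - by apply/measurable_EFinP; exact: intg_meas (intgZ C measurableT iQn).
  move=> s _; rewrite lee_fin normrM; apply: ler_pM => //.
  by case: ifP => // _; rewrite normr0.
have [i1 i2 e] := @Rfubini_on _ _ (measurableTypeR R) (measurableTypeR R) R leb leb g _ _ mT mg iC hG.
have E1 t : I t -> \int[leb]_s g (t, s) = (P t - P 0) * f' t.
  rewrite /I /= in_itv /= => /andP[t0 tT].
  have mt : measurable (`[0, t]%classic : set (measurableTypeR R)) by exact: measurable_itv.
  have iq : intg leb `[0, t] Q.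
    by apply: (intgS mT mt _ iQ); apply: subset_itvl; rewrite bnd_simp.
  rewrite (PQ t (introT andP (conj t0 tT))) mulrC -(RintegralZl _ mt iq).
  rewrite [RHS]Rintegral_mkcond; apply: eq_Rintegral => s _.
  rewrite /g /= patchE mem_setE /Qe patchE mem_setE /= !in_itv /=.
  case: (leP s t) => st; last by rewrite mulr0 andbF.
  by rewrite (le_trans st tT) !andbT; case: (0 <= s); [|rewrite mulr0].
have E2 s : \int[leb]_(t in I) g (t, s) = - (Qe s * f s).
  rewrite /Qe patchE mem_setE /I /= in_itv /=; case: ifPn => [/andP[s0 sT]|nsT]; last first.
    rewrite mul0r oppr0; transitivity (\int[leb]_(t in I) (0 : R)); last by rewrite /Rintegral integral0.
    apply: eq_Rintegral => t _; rewrite /g /Qe patchE mem_setE /I /= in_itv /= (negbTE nsT).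
    by rewrite if_same mulr0.
  have [j1 j2] := FTC_seg df cf' sT.
  have ms : measurable (`[s, T]%classic : set (measurableTypeR R)) by exact: measurable_itv.
  rewrite fT sub0r in j2; rewrite -mulrN -j2 -(RintegralZl _ ms j1).
  rewrite [LHS]Rintegral_mkcond [RHS]Rintegral_mkcond; apply: eq_Rintegral => t _.
  rewrite /g /= /Qe !patchE !mem_setE /= !in_itv /= s0 sT /=.
  case: (leP s t) => st; last by rewrite /= mulr0 if_same.
  by rewrite (le_trans s0 st) /=; case: (t <= T); [rewrite mulrC|].
have iPm : intg leb I (fun t => (P t - P 0) * f' t).
  apply: (eq_integrable mT _ _ _ i1).
  by move=> t /set_mem It /=; congr EFin; exact: E1.
have [j1 j2] := FTC_seg df cf' (ltW T0).
have iP0 := intgZ (P 0) mT j1.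
have EP : (fun t => P t * f' t) = (fun t => (P t - P 0) * f' t + P 0 * f' t).
  by apply/funext => t; ring.
rewrite EP; split; first exact: (intgD mT iPm iP0).
rewrite (RintegralD mT iPm iP0) (RintegralZl _ mT j1) j2 f0 fT subrr mulr0 addr0.
rewrite -[LHS](eq_Rintegral _ (fun t It => E1 t (set_mem It))) [LHS]e.
transitivity (\int[leb]_s (- (Qe s * f s))); first by apply: eq_Rintegral => s _; exact: E2.
have cf := is_derive_cont df.
have [m [M [_ hmM]]] := segment_bounded (ltW T0) (continuous_subspaceT cf : {within `[0, T], continuous f}).
have iQf : intg leb I (fun s => Q s * f s).
  apply: (@intgM _ _ _ leb I Q f (`|m| + `|M|) mT iQ).
    by apply: measurable_funTS; exact: continuous_measurable_fun.
  move=> t; rewrite /I /= in_itv /= => /hmM /andP[h1 h2].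
  by rewrite ler_norml; apply/andP; split; [exact: lo|exact: up].
have -> : (fun s => - (Qe s * f s)) = (fun s => - 1 * (Q s * f s)) \_ I.
  by apply/funext => s; rewrite /Qe !patchE; case: ifP => _; rewrite ?mulN1r ?mul0r ?oppr0.
by rewrite -Rintegral_mkcond (RintegralZl _ mT iQf) mulN1r.
Qed.

End AbsolutelyContinuousParts.

(** * The mollified equation *)

Section Evolution.
Context {R : realType}.
Local Notation leb := (@lebesgue_measure R).
Variables (T : R) (gam : R -> probability R R) (a k : R -> R -> R) (a0 a1 L : R).
Local Notation U t := (p_distfun (gam t)).
Hypothesis T0 : 0 < T.
Hypothesis mgam : forall B : set R, measurable B -> measurable_fun setT (fun t => gam t B).
Hypothesis a0p : 0 < a0.
Hypothesis ma : measurable_fun setT (fun z : R * R => a z.1 z.2).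
Hypothesis mk : measurable_fun setT (fun z : R * R => k z.1 z.2).
Hypothesis a_ge : forall t y, a0 <= a t y.
Hypothesis a_le : forall t y, a t y <= a1.
Hypothesis a_lip : forall t x y, `|a t y - a t x| <= L * `|U t y - U t x|.
Hypothesis ik2 : forall t, intg (gam t) setT (fun y => k t y ^+ 2).
Definition drift_energy t : R := \int[gam t]_y (k t y ^+ 2).
Local Notation N := drift_energy.
Hypothesis iN : intg leb `[0, T] N.
Hypothesis evo : forall (al : R) (P : {poly R}) (b x : R) (g g1 g2 : R -> R), 0 < al -> 0 < b ->
  (forall y, g y = ker al P (b * (x - y))) ->
  (forall y : R, is_derive y 1 g (g1 y)) -> (forall y : R, is_derive y 1 g1 (g2 y)) ->
  forall t, 0 <= t <= T -> \int[gam t]_y g y - \int[gam 0]_y g y =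
    \int[leb]_(s in `[0, t]) (\int[gam s]_y (a s y * g2 y) - \int[gam s]_y (k s y * g1 y)).

Local Notation W b s := (conv (gam s) (a s) (om1 b)).
Local Notation F b s := (conv (gam s) (k s) (om b)).
(** The x-derivative of the flux W + F, and so the time derivative of the mollified density in
    integrated form. *)
Definition flux_dx b s x : R := conv (gam s) (a s) (om2 b) x + conv (gam s) (k s) (om1 b) x.
Local Notation q := flux_dx.

Lemma mats s : measurable_fun setT (a s).
Proof. exact: (measurableT_comp ma (measurable_pair1 s)). Qed.

Lemma mkts s : measurable_fun setT (k s).
Proof. exact: (measurableT_comp mk (measurable_pair1 s)). Qed.

Let N0 s : 0 <= N s. Proof. by apply: Rintegral_ge0 => y _; exact: sqr_ge0. Qed.

Let mT : measurable (`[0, T]%classic : set (measurableTypeR R)). Proof. exact: measurable_itv. Qed.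

(** The function y |-> om b (x - y) is tested. Differentiating in y instead of x changes the sign of
    [om1] but not that of [om2], which accounts for the plus sign in [flux_dx]. *)
Lemma evo_dens b x t : 0 < b -> 0 <= t <= T ->
  dens (gam t) b x - dens (gam 0) b x = \int[leb]_(s in `[0, t]) q b s x.
Proof.
move=> b0 t0; rewrite !densE.
have d1 (y : R) : is_derive y 1 (fun y : R => om b (x - y)) (- om1 b (x - y)).
  have := is_derive_aff 1 x y (is_derive_om b); rewrite mulN1r mul1r.
  by under [X in is_derive _ _ X _]eq_fun do rewrite mul1r.
have d2 (y : R) : is_derive y 1 (fun y : R => - om1 b (x - y)) (om2 b (x - y)).
  have := is_deriveN (is_derive_aff 1 x y (is_derive_om1 b)); rewrite mulN1r mul1r opprK.
  rewrite (_ : - _ = (fun y : R => - om1 b (x - y)))//.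
  by apply/funext => z; rewrite /= -[LHS]/(- om1 b (1 * (x - z))) mul1r.
rewrite (@evo 2 (b / 2)%:P b x _ _ _ _ b0 _ d1 d2 t t0)//; last first.
  move=> y; have := om_kt b x => /(congr1 (fun f => f (0, y))) /= ->.
  by [].
apply: eq_Rintegral => s _; rewrite /q; congr (_ + _).
rewrite -[RHS]opprK; congr (- _); rewrite -mulN1r -RintegralZl//.
  by apply: eq_Rintegral => y _; ring.
apply: (@intg_conv _ _ _ _ (2 * b ^+ 2)); first exact: (intg_k (mkts s) (ik2 s)).
  exact: continuous_om1.
by move=> u; exact: om1_bd.
Qed.

Lemma measurable_conv (f : R * R -> R) (ph : R -> R) : measurable_fun setT f -> continuous ph ->
  measurable_fun setT (fun z : R * R => conv (gam z.1) (fun y => f (z.1, y)) ph z.2).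
Proof.
move=> mf cph.
have mg (B : set R) : measurable B -> measurable_fun setT (fun z : R * R => gam z.1 B).
  by move=> mB; apply: (measurableT_comp (mgam mB)); exact: measurable_fst.
apply: (measurable_Rint_fam mg (f := fun w : (R * R) * R => f (w.1.1, w.2) * ph (w.1.2 - w.2))).
apply: measurable_funM.
  apply: (measurableT_comp mf); apply: measurable_fun_pair; last exact: measurable_snd.
  by apply: measurableT_comp; [exact: measurable_fst|exact: measurable_fst].
apply: measurableT_comp; first exact: continuous_measurable_fun.
apply: measurable_funB; last exact: measurable_snd.
by apply: measurableT_comp; [exact: measurable_snd|exact: measurable_fst].
Qed.

Let mdens b : 0 < b -> measurable_fun setT (fun z : R * R => dens (gam z.1) b z.2).
Proof. by move=> b0; apply: (@measurable_conv (cst 1)) => //; exact: continuous_om. Qed.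

Let mddens b : 0 < b -> measurable_fun setT (fun z : R * R => ddens (gam z.1) b z.2).
Proof. by move=> b0; apply: (@measurable_conv (cst 1)) => //; exact: continuous_om1. Qed.

Let mW b : measurable_fun setT (fun z : R * R => W b z.1 z.2).
Proof. by apply: (@measurable_conv (fun z => a z.1 z.2)) => //; exact: continuous_om1. Qed.

Let mF b : measurable_fun setT (fun z : R * R => F b z.1 z.2).
Proof. by apply: (@measurable_conv (fun z => k z.1 z.2)) => //; exact: continuous_om. Qed.

Let mq b : measurable_fun setT (fun z : R * R => q b z.1 z.2).
Proof.
apply: measurable_funD.
  by apply: (@measurable_conv (fun z => a z.1 z.2)) => //; exact: continuous_om2.
by apply: (@measurable_conv (fun z => k z.1 z.2)) => //; exact: continuous_om1.
Qed.

Let ia s : intg (gam s) setT (a s).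
Proof. exact: (@intg_a R (gam s) (a s) a0 a1 a0p (mats s) (a_ge s) (a_le s)). Qed.

Let ik s : intg (gam s) setT (k s).
Proof. exact: (intg_k (mkts s) (ik2 s)). Qed.

Let a_norm s y : `|a s y| <= a1.
Proof. by rewrite ger0_norm ?a_le// (le_trans (ltW a0p)). Qed.

Let a1_0 : 0 <= a1. Proof. exact: le_trans (a_norm 0 0). Qed.

Lemma int_absk s : \int[gam s]_y `|k s y| <= 1 + N s.
Proof.
have i1 : intg (gam s) setT (fun y => 1 + k s y ^+ 2) by apply: intgD => //; exact: intg_cst.
apply: (@le_trans _ _ (\int[gam s]_y (1 + k s y ^+ 2))).
  apply: le_Rintegral => //; first exact: intg_norm.
  by move=> y _; rewrite -(real_normK (num_real (k s y))); have := sqr_ge0 (`|k s y| - 1); nra.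
rewrite (RintegralD _ (intg_cst (gam s) 1) (ik2 s))//.
by rewrite [X in X + _](Rint1 (gam s)).
Qed.

Lemma conv_bd (f : R -> R) (ph : R -> R) (C x s : R) : intg (gam s) setT f -> continuous ph ->
  (forall u, `|ph u| <= C) -> `|conv (gam s) f ph x| <= C * \int[gam s]_y `|f y|.
Proof.
move=> fi cph hC; have i1 := intg_conv x fi cph hC.
apply: (le_trans (le_normr_Rintegral _ i1)) => //.
rewrite -RintegralZl//; last exact: intg_norm.
apply: le_Rintegral => //; first exact: intg_norm.
  by apply: intgZ => //; exact: intg_norm.
by move=> y _; rewrite normrM mulrC ler_wpM2r.
Qed.

Lemma int_absa s : \int[gam s]_y `|a s y| <= a1.
Proof.
have ic := intg_cst (gam s) 1.
rewrite -[X in _ <= X]mulr1 -(Rint1 (gam s)) -RintegralZl//.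
apply: (le_Rintegral measurableT (intg_norm measurableT (ia s)) (intgZ a1 measurableT ic)).
by move=> y _; rewrite mulr1.
Qed.

Let q_bd b s x : 0 < b -> `|q b s x| <= 4 * b ^+ 3 * a1 + 2 * b ^+ 2 * (1 + N s).
Proof.
move=> b0; apply: (le_trans (ler_normD _ _)); apply: lerD.
  apply: (le_trans (conv_bd x (ia s) (@continuous_om2 _ b) (fun u => om2_bd u b0))).
  by rewrite ler_wpM2l ?int_absa// mulr_ge0// exprn_ge0// ltW.
apply: (le_trans (conv_bd x (ik s) (@continuous_om1 _ b) (fun u => om1_bd u b0))).
by rewrite ler_wpM2l ?int_absk// mulr_ge0// exprn_ge0// ltW.
Qed.

Let iaffN (c c' : R) : intg leb `[0, T] (fun s => c + c' * (1 + N s)).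
Proof.
have i1 (r : R) : intg leb `[0, T] (cst r) by apply: intg_cont_seg => z; exact: cvg_cst.
exact: (intgD mT (i1 c) (intgZ c' mT (intgD mT (i1 1) iN))).
Qed.

Let msec (f : R * R -> R) x : measurable_fun setT f -> measurable_fun setT (fun s => f (s, x)).
Proof. by move=> mf; exact: (measurableT_comp mf (measurable_pair2 x)). Qed.

Let iq b x : 0 < b -> intg leb `[0, T] (fun s => q b s x).
Proof.
move=> b0; apply: (intg_le _ _ (iaffN (4 * b ^+ 3 * a1) (2 * b ^+ 2))) => //.
  by apply: measurable_funTS; exact: msec (mq b).
by move=> s _; exact: q_bd.
Qed.

Section FixedScale.
Variables (b d : R) (b0 : 0 < b) (d0 : 0 < d).

Lemma chain_at x : ent d (dens (gam T) b x) - ent d (dens (gam 0) b x) <=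
  \int[leb]_(s in `[0, T]) (dent d (dens (gam s) b x) * q b s x).
Proof.
apply: (@chain_ineq _ T d^-1 (fun s => dens (gam s) b x) (fun s => q b s x) (ent d) (dent d)) => //.
- exact: ltW.
- by rewrite invr_ge0 ltW.
- exact: iq.
- by move=> t t0; exact: evo_dens.
- by move=> s t _ _; apply: ent_convex => //; exact: dens_ge0.
- by move=> s t _ _; apply: dent_lip => //; exact: dens_ge0.
- apply: measurable_funTS; apply: (measurableT_comp (measurable_dent d)).
  exact: msec (mdens b0).
Qed.

Let Z s x := dent d (dens (gam s) b x) * q b s x.

Let mZ : measurable_fun setT (fun z : R * R => Z z.1 z.2).
Proof.
apply: measurable_funM => //; apply: (measurableT_comp (measurable_dent d)).
exact: mdens.
Qed.

Let dent_bd s x : 0 <= dent d (dens (gam s) b x) <= d^-1 * b.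
Proof.
rewrite dent_ge0 ?dens_ge0//= (le_trans (dent_le d0 _)) ?dens_ge0// ler_wpM2l ?dens_le//.
by rewrite invr_ge0 ltW.
Qed.

Let Zmaj s x : R := d^-1 * b * (4 * b ^+ 2 * conv (gam s) (a s) (om b) x +
    2 * b * conv (gam s) (fun y => `|k s y|) (om b) x).

Let Z_maj s x : `|Z s x| <= Zmaj s x.
Proof.
have /andP[h1 h2] := dent_bd s x.
rewrite /Z normrM (ger0_norm h1) /Zmaj; apply: ler_pM => //.
have om0 u := ltW (om_gt0 u b0).
have b1 : 0 <= b := ltW b0.
apply: (le_trans (ler_normD _ _)); apply: lerD.
  have i1 := intg_conv x (ia s) (@continuous_om2 _ b) (fun u => om2_bd u b0).
  apply: (le_trans (le_normr_Rintegral _ i1)) => //.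
  have i2 := intg_conv x (ia s) (@continuous_om _ b) (om_bd b0).
  rewrite -RintegralZl//; apply: le_Rintegral => //; [exact: intg_norm|exact: intgZ|].
  move=> y _; rewrite normrM ger0_norm ?(le_trans (ltW a0p))// mulrCA.
  by rewrite ler_wpM2l ?(le_trans (ltW a0p))// om2_le.
have i1 := intg_conv x (ik s) (@continuous_om1 _ b) (fun u => om1_bd u b0).
apply: (le_trans (le_normr_Rintegral _ i1)) => //.
have i2 := intg_conv x (intg_norm measurableT (ik s)) (@continuous_om _ b) (om_bd b0).
rewrite -RintegralZl//; apply: le_Rintegral => //; [exact: intg_norm|exact: intgZ|].
by move=> y _; rewrite normrM mulrCA ler_wpM2l// om1_le.
Qed.

Let iZmaj s : intg leb setT (Zmaj s) /\ \int[leb]_x Zmaj s x =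
  d^-1 * b * (4 * b ^+ 2 * \int[gam s]_y a s y + 2 * b * \int[gam s]_y `|k s y|).
Proof.
have [i1 e1] := conv_tonelli b0 (mats s) (fun y => le_trans (ltW a0p) (a_ge s y)) (ia s).
have mk' : measurable_fun setT (fun y => `|k s y|) by apply: measurableT_comp => //; exact: mkts.
have [i2 e2] := conv_tonelli b0 mk' (fun y => normr_ge0 _) (intg_norm measurableT (ik s)).
have i3 : intg leb setT (fun x => 4 * b ^+ 2 * conv (gam s) (a s) (om b) x) by exact: intgZ.
have i4 : intg leb setT (fun x => 2 * b * conv (gam s) (fun y => `|k s y|) (om b) x) by exact: intgZ.
have i5 := intgD measurableT i3 i4.
split; first exact: intgZ.
by rewrite RintegralZl// RintegralD// !RintegralZl// e1 e2.
Qed.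

Let iZ s : intg leb setT (Z s).
Proof.
have [i1 _] := iZmaj s; apply: (intg_le _ _ i1) => //.
  exact: (measurableT_comp mZ (measurable_pair1 s)).
Qed.

(** The boundary terms vanish: [dent] of the density is bounded, while W and F tend to 0 at both
    infinities. *)
Lemma dissipation_by_parts s : \int[leb]_x Z s x =
  - \int[leb]_x (ddens (gam s) b x * (W b s x + F b s x) / (dens (gam s) b x + d)).
Proof.
set D := (fun x => ddens (gam s) b x * (W b s x + F b s x) / (dens (gam s) b x + d)).
have iD : intg leb setT D.
  by apply: (intg_dissip b0 d0 a0p (mats s) (mkts s) (a_ge s) (a_le s) (ik2 s)).
have Pd x : dens (gam s) b x + d != 0 by rewrite gt_eqF// ltr_wpDl// dens_ge0.
have dW (x : R) : is_derive x 1 (W b s) (conv (gam s) (a s) (om2 b) x).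
  exact: (is_derive_conv x (ia s) (is_derive_om1 b) (fun u => om1_bd u b0) (fun u => om2_bd u b0)).
have dF (x : R) : is_derive x 1 (F b s) (conv (gam s) (k s) (om1 b) x).
  exact: (is_derive_conv x (ik s) (is_derive_om b) (om_bd b0) (fun u => om1_bd u b0)).
pose f x := dent d (dens (gam s) b x) * (W b s x + F b s x).
have df (x : R) : is_derive x 1 f (Z s x + D x).
  have h1 : is_derive x 1 (fun x => dent d (dens (gam s) b x)) ((dens (gam s) b x + d)^-1 * ddens (gam s) b x).
    exact: (is_derive1_comp (is_derive_dent d0 (dens_ge0 (gam s) b0 x)) (is_derive_dens (gam s) b0 x)).
  have := is_deriveM h1 (is_deriveD (dW x) (dF x)).
  move=> h; apply: (is_derive_eq h).
  by rewrite /GRing.scale /= /Z /D /q -[(W b s + F b s) x]/(W b s x + F b s x); field.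
have cdent : continuous (fun x => dent d (dens (gam s) b x)).
  apply: is_derive_cont => x.
  exact: (is_derive1_comp (is_derive_dent d0 (dens_ge0 (gam s) b0 x)) (is_derive_dens (gam s) b0 x)).
have cf' : continuous (fun x => Z s x + D x).
  move=> x; apply: cvgD.
    apply: cvgM; first exact: cdent.
    apply: cvgD.
      exact: (continuous_conv (ia s) (@continuous_om2 _ b) (fun u => om2_bd u b0)).
    exact: (continuous_conv (ik s) (@continuous_om1 _ b) (fun u => om1_bd u b0)).
  apply: cvgM; last first.
    by apply: cvgV => //; apply: cvgD; [exact: continuous_dens|exact: cvg_cst].
  apply: cvgM; first exact: continuous_ddens.
  apply: cvgD; [exact: (is_derive_cont dW)|exact: (is_derive_cont dF)].
have lim0 (u : nat -> R) : (forall y, om b (u n - y) @[n --> \oo] --> (0 : R)) ->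
    (forall y, om1 b (u n - y) @[n --> \oo] --> (0 : R)) -> f (u n) @[n --> \oo] --> (0 : R).
  move=> h1 h2.
  have l1 := conv_cvg (ia s) (@continuous_om1 _ b) (fun v => om1_bd v b0) h2.
  have l2 := conv_cvg (ik s) (@continuous_om _ b) (om_bd b0) h1.
  have l3 : W b s (u n) + F b s (u n) @[n --> \oo] --> (0 : R).
    by rewrite -[X in _ --> X]addr0; apply: cvgD.
  apply/cvgrPdist_le => e e0.
  have c0 : 0 < d^-1 * b by rewrite mulr_gt0 ?invr_gt0.
  move/cvgrPdist_le: l3 => /(_ _ (divr_gt0 e0 c0)); apply: filterS => n.
  rewrite !sub0r !normrN /f normrM => h.
  have /andP[p1 p2] := dent_bd s (u n).
  rewrite (ger0_norm p1); apply: (le_trans (ler_pM _ _ p2 h)) => //.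
  by rewrite mulrC divfK// gt_eqF.
have := int_line df cf' (intgD measurableT (iZ s) iD)
  (lim0 (fun n => n%:R) (fun y => cvg_om y b0) (fun y => cvg_om1 y b0))
  (lim0 (fun n => - n%:R) (fun y => cvg_omN y b0) (fun y => cvg_om1N y b0)).
rewrite (RintegralD measurableT (iZ s) iD) subr0 => /eqP.
by rewrite addr_eq0 => /eqP.
Qed.

Lemma intg_ent s : intg leb setT (fun x => ent d (dens (gam s) b x)).
Proof.
  apply: (@intg_le _ (measurableTypeR R) _ _ _ _ (fun x => d^-1 * b * dens (gam s) b x)).
  - exact: measurableT.
  - apply: (measurableT_comp (measurable_ent d)); apply: continuous_measurable_fun.
    exact: continuous_dens.
  - by apply: intgZ; [exact: measurableT|exact: intg_dens].
  move=> x _; have p0 := dens_ge0 (gam s) b0 x.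
  rewrite (ger0_norm (ent_ge0 d0 p0)); apply: (le_trans (ent_le d0 p0)).
  have d1 : 0 <= d^-1 by rewrite invr_ge0 ltW.
  by have := ler_wpM2l d1 (ler_wpM2r p0 (dens_le (gam s) b0 x)); rewrite -expr2 mulrA.
Qed.

(** The chain inequality holds for each x. Integrating it in x and exchanging the order needs a
    majorant integrable over the strip, which exists because b and d are fixed. *)
Lemma entropy_chain : intg leb `[0, T] (fun s => \int[leb]_x Z s x) /\
  \int[leb]_x ent d (dens (gam T) b x) - \int[leb]_x ent d (dens (gam 0) b x) <=
  \int[leb]_(s in `[0, T]) \int[leb]_x Z s x.
Proof.
pose G s := d^-1 * b * (4 * b ^+ 2 * a1) + d^-1 * b * (2 * b) * (1 + N s).
have hG s : `[0, T]%classic s -> (\int[leb]_x (`|Z s x|)%:E <= (G s)%:E)%E.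
  move=> _; have [i1 e1] := iZmaj s.
  apply: (@le_trans _ _ (\int[leb]_x (Zmaj s x)%:E)%E).
    apply: ge0_le_integral => //.
    - apply/measurable_EFinP; apply: measurableT_comp => //.
      exact: (measurableT_comp mZ (measurable_pair1 s)).
    - by apply/measurable_EFinP; exact: intg_meas i1.
    - by move=> x _; rewrite lee_fin; exact: Z_maj.
  rewrite -EFin_Rint// e1 lee_fin /G -[X in _ <= _ + X]mulrA -mulrDr ler_wpM2l ?mulr_ge0 ?invr_ge0 ?(ltW d0) ?(ltW b0)//.
  apply: lerD; rewrite ler_wpM2l ?mulr_ge0 ?exprn_ge0 ?(ltW b0)//; last exact: int_absk.
  apply: le_trans (int_absa s).
  apply: (le_Rintegral measurableT (ia s) (intg_norm measurableT (ia s))).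
  by move=> y _; exact: ler_norm.
have [i1 i2 e] := @Rfubini_on _ _ (measurableTypeR R) (measurableTypeR R) R leb leb (fun z => Z z.1 z.2) _ G mT mZ (iaffN _ _) hG.
split; first exact: i1.
rewrite [X in _ <= X]e.
have ie s := intg_ent s.
rewrite -(RintegralB measurableT (ie T) (ie 0)).
apply: (le_Rintegral measurableT (intgB measurableT (ie T) (ie 0)) i2).
by move=> x _; exact: chain_at.
Qed.

End FixedScale.

Lemma measurable_fdens_fam b d : 0 < b -> 0 < d ->
  measurable_fun setT (fun z : R * R => fdens (gam z.1) b d z.2).
Proof.
move=> b0 d0.
(* The quotient is written with exp(-ln) so that measurability follows by composition. *)
have -> : (fun z : R * R => fdens (gam z.1) b d z.2) =
    (fun z : R * R => ddens (gam z.1) b z.2 ^+ 2 * expR (- ln (dens (gam z.1) b z.2 + d))).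
  by apply/funext => z; rewrite expRN lnK// posrE ltr_wpDl// dens_ge0.
apply: measurable_funM; first by apply: measurable_funX; exact: mddens.
apply: measurableT_comp; first exact: measurable_expR.
apply: measurableT_comp; first exact: oppr_measurable.
apply: measurableT_comp; first exact: measurable_ln.
by apply: measurable_funD; [exact: mdens|exact: measurable_cst].
Qed.

Lemma intg_fdens_time b d : 0 < b -> 0 < d ->
  intg leb `[0, T] (fun s => \int[leb]_x fdens (gam s) b d x).
Proof.
move=> b0 d0.
have ic : intg leb `[0, T] (cst (4 * b ^+ 2)) by apply: intg_cont_seg => z; exact: cvg_cst.
have hG s : `[0, T]%classic s -> (\int[leb]_x (`|fdens (gam s) b d x|)%:E <= (cst (4 * b ^+ 2) s)%:E)%E.
  move=> _; have i1 := intg_dens (gam s) b0.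
  have -> : cst (4 * b ^+ 2) s = \int[leb]_x (4 * b ^+ 2 * dens (gam s) b x).
    by rewrite RintegralZl// Rint_dens// mulr1.
  have i2 := intgZ (4 * b ^+ 2) measurableT i1.
  rewrite EFin_Rint//; apply: ge0_le_integral => //.
  - by apply/measurable_EFinP; apply: measurableT_comp => //; exact: measurable_fdens.
  - by apply/measurable_EFinP; exact: intg_meas i2.
  by move=> x _; rewrite lee_fin ger0_norm ?fdens_ge0// fdens_le.
have mf := measurable_fdens_fam b0 d0.
have [i1 _ _] := @Rfubini_on _ _ (measurableTypeR R) (measurableTypeR R) R leb leb
  (fun z => fdens (gam z.1) b d z.2) _ (cst (4 * b ^+ 2)) mT mf ic hG.
exact: i1.
Qed.

Let flux b s x := W b s x + F b s x.

Let mflux b : measurable_fun setT (fun z : R * R => flux b z.1 z.2).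
Proof. exact: measurable_funD. Qed.

Let flux_bd b s x : 0 < b -> `|flux b s x| <= 2 * b ^+ 2 * a1 + b * (1 + N s).
Proof.
move=> b0; apply: (le_trans (ler_normD _ _)); apply: lerD.
  apply: (le_trans (conv_bd x (ia s) (@continuous_om1 _ b) (fun u => om1_bd u b0))).
  by rewrite ler_wpM2l ?int_absa// mulr_ge0// exprn_ge0// ltW.
apply: (le_trans (conv_bd x (ik s) (@continuous_om _ b) (om_bd b0))).
by rewrite ler_wpM2l ?int_absk// ltW.
Qed.

Let iflux b x : 0 < b -> intg leb `[0, T] (fun s => flux b s x).
Proof.
move=> b0; apply: (intg_le mT _ (iaffN (2 * b ^+ 2 * a1) b)).
  by apply: measurable_funTS; exact: msec (mflux b).
by move=> s _; exact: flux_bd.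
Qed.

Let dflux b s (x : R) : 0 < b -> is_derive x 1 (flux b s) (q b s x).
Proof.
move=> b0.
have dW := is_derive_conv x (ia s) (is_derive_om1 b) (fun u => om1_bd u b0) (fun u => om2_bd u b0).
have dF := is_derive_conv x (ik s) (is_derive_om b) (om_bd b0) (fun u => om1_bd u b0).
exact: (is_deriveD dW dF).
Qed.

(** The primitive [omI] does not decay, so it cannot be tested directly. Both sides have equal
    x-derivatives by [evo_dens], and their difference tends to 0 at minus infinity. *)
Lemma cdens_evo b x t : 0 < b -> 0 <= t <= T ->
  cdens (gam t) b x - cdens (gam 0) b x = \int[leb]_(s in `[0, t]) flux b s x.
Proof.
move=> b0 /andP[t0 tT].
have mt : measurable (`[0, t]%classic : set (measurableTypeR R)) by exact: measurable_itv.
have sub : `[0, t] `<=` `[(0 : R), T] by apply: subset_itvl; rewrite bnd_simp.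
have i1 y : intg leb `[0, t] (fun s => flux b s y) by exact: (intgS mT mt sub (iflux y b0)).
have iaff (c c' : R) : intg leb `[0, t] (fun s => c + c' * (1 + N s)) by exact: (intgS mT mt sub (iaffN c c')).
have dM (y : R) : is_derive y 1 (fun y : R => \int[leb]_(s in `[0, t]) flux b s y) (\int[leb]_(s in `[0, t]) q b s y).
  have yI : y \in `](y - 1), (y + 1)[ by rewrite in_itv /=; apply/andP; split; lra.
  pose G s := 4 * b ^+ 3 * a1 + 2 * b ^+ 2 * (1 + N s).
  have H1 (z : R) : z \in `](y - 1), (y + 1)[ -> leb.-integrable `[0, t] (EFin \o (fun s => flux b s z)).
    by move=> _; exact: i1.
  have H2 (z : R) (s : measurableTypeR R) : z \in `](y - 1), (y + 1)[ -> `[0, t]%classic s -> derivable (fun z : R => flux b s z) z 1.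
    by move=> _ _; have [] := dflux s z b0.
  have H3 (s : measurableTypeR R) : 0 <= G s.
    by apply: le_trans (q_bd s 0 b0).
  have H4 : leb.-integrable `[0, t] (EFin \o G) by exact: iaff.
  have H5 (z : R) (s : measurableTypeR R) : z \in `](y - 1), (y + 1)[ -> `[0, t]%classic s ->
      `|partial1of2 (fun z s => flux b s z) z s| <= G s.
    by move=> _ _; rewrite /partial1of2 (is_derive_derive1 (dflux s z b0)); exact: q_bd.
  apply: (@DeriveDef).
    exact: (derivable_under_integral mt yI H1 H2 H3 H4 H5).
  rewrite -derive1E (differentiation_under_integral mt yI H1 H2 H3 H4 H5).
  apply: eq_Rintegral => s _.
  by rewrite /partial1of2 (is_derive_derive1 (dflux s y b0)).
pose D y := cdens (gam t) b y - cdens (gam 0) b y - \int[leb]_(s in `[0, t]) flux b s y.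
have dD (y : R) : is_derive y 1 D 0.
  have := is_deriveB (is_deriveB (is_derive_cdens (gam t) b0 y) (is_derive_cdens (gam 0) b0 y)) (dM y).
  by rewrite -(evo_dens y b0) ?t0// subrr.
have Dc y : D x = D y by exact: is_derive_0_is_cst.
have D0 : D (- n%:R) @[n --> \oo] --> (0 : R).
  rewrite -[X in _ --> X](subrr (0 : R)); apply: cvgB.
    rewrite -[X in _ --> X](subrr (- (1 / 2) : R)).
    by apply: cvgB; exact: cdens_cvgN.
  have := @Rdominated _ (measurableTypeR R) R leb `[0, t]%classic (fun n s => flux b s (- n%:R)) (cst 0)
     (fun s => 2 * b ^+ 2 * a1 + b * (1 + N s)) mt
     (fun n => intg_meas (i1 (- n%:R))) (@measurable_cst _ _ _ _ _ _).
  have c0 (s : R) : `[0, t]%classic s -> flux b s (- n%:R) @[n --> \oo] --> (0 : R).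
    move=> _; rewrite -[X in _ --> X](addr0 (0 : R)); apply: cvgD.
      exact: (conv_cvg (ia s) (@continuous_om1 _ b) (fun v => om1_bd v b0) (fun y => cvg_om1N y b0)).
    exact: (conv_cvg (ik s) (@continuous_om _ b) (om_bd b0) (fun y => cvg_omN y b0)).
  move=> /(_ c0 (iaff _ _) (fun n s _ => flux_bd s _ b0))[_].
  by rewrite (_ : \int[leb]_(s in `[0, t]) cst 0 s = 0)// /Rintegral integral0.
have : D x = 0.
  have h : (fun n : nat => D (- n%:R)) = cst (D x) by apply/funext => n; rewrite -Dc.
  rewrite h in D0; have c1 : cst (D x) n @[n --> \oo] --> D x by exact: cvg_cst.
  exact: (cvg_unique _ c1 D0).
by rewrite /D => /eqP; rewrite subr_eq0 => /eqP.
Qed.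

(** * Weak form of the equation for the distribution function *)

Section TestFunction.
Hypothesis cU : forall t, continuous (U t).
Hypothesis mU : measurable_fun setT (fun z : R * R => U z.1 z.2).
Variables (ph pt px : R * R -> R) (C M : R).
Hypotheses (cph : continuous ph) (cpt : continuous pt) (cpx : continuous px).
Hypothesis ph_bd : forall z, `|ph z| <= C.
Hypothesis pt_bd : forall z, `|pt z| <= C.
Hypothesis px_bd : forall z, `|px z| <= C.
Hypothesis dpt : forall t x : R, is_derive t 1 (fun s : R => ph (s, x)) (pt (t, x)).
Hypothesis dpx : forall t x : R, is_derive x 1 (fun y : R => ph (t, y)) (px (t, x)).
Hypothesis ph_lip : forall t x y, `|ph (t, x) - ph (t, y)| <= C * `|x - y|.
Hypothesis px_lip : forall t x y, `|px (t, x) - px (t, y)| <= C * `|x - y|.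
Hypothesis M0 : 0 <= M.
Hypothesis supp : forall t x, M < `|x| -> [/\ ph (t, x) = 0, pt (t, x) = 0 & px (t, x) = 0].
Hypotheses (ph0 : forall x, ph (0, x) = 0) (phT : forall x, ph (T, x) = 0).

Let C0 : 0 <= C. Proof. exact: le_trans (ph_bd (0, 0)). Qed.

Let J : set (measurableTypeR R) := `[- M, M]%classic.

Let maj (x : R) : R := C * \1_J x.

Let imaj (c : R) : intg leb setT (fun x => c * maj x) /\ \int[leb]_x (c * maj x) = c * (C * (M + M)).
Proof.
have mJ : measurable J by exact: measurable_itv.
have M2 : - M <= M by apply: (@le_trans _ _ 0); rewrite ?oppr_le0.
have e : (\int[leb]_x (\1_J x)%:E = (M + M)%:E)%E.
  by rewrite integral_indic// setIT [LHS](lebesgue_seg M2) opprK.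
have i1 : intg leb setT (\1_J : R -> R).
  apply: intg_ge0P => //; rewrite e; exact: ltry.
have i2 := intgZ C measurableT i1.
split; first exact: (intgZ c measurableT i2).
rewrite (RintegralZl _ measurableT i2) (RintegralZl _ measurableT i1).
by rewrite [X in C * X](_ : _ = M + M)// /Rintegral e.
Qed.

Let maj_le (f : R * R -> R) (c s x : R) : (forall z, `|f z| <= C) -> (M < `|x| -> f (s, x) = 0) ->
  forall g, `|g| <= c -> `|g * f (s, x)| <= c * maj x.
Proof.
move=> fC f0 g gc; rewrite normrM /maj.
have c0 : 0 <= c by exact: le_trans gc.
have [xM|Mx] := leP `|x| M; last first.
  by rewrite f0// normr0 mulr0 !mulr_ge0.
rewrite indicE mem_set /=; first by rewrite mulr1; apply: ler_pM.
by rewrite /J /= in_itv /= -ler_norml.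
Qed.

Let csec (g : R * R -> R) (t : R) : continuous g -> continuous (fun y : R => g (t, y)).
Proof.
move=> cg y; have h : (fun z : R => (t, z)) z @[z --> y] --> (t, y).
  exact: (cvg_pair (cvg_cst t) cvg_id).
exact: (cvg_comp _ _ h (cg (t, y))).
Qed.

Let csec2 (g : R * R -> R) (x : R) : continuous g -> continuous (fun s : R => g (s, x)).
Proof.
move=> cg y; have h : (fun z : R => (z, x)) z @[z --> y] --> (y, x).
  exact: (cvg_pair cvg_id (cvg_cst x)).
exact: (cvg_comp _ _ h (cg (y, x))).
Qed.

Let mph : measurable_fun setT ph. Proof. exact: plane_continuous_measurable. Qed.
Let mpt : measurable_fun setT pt. Proof. exact: plane_continuous_measurable. Qed.
Let mpx : measurable_fun setT px. Proof. exact: plane_continuous_measurable. Qed.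

Let mcdens b : measurable_fun setT (fun z : R * R => cdens (gam z.1) b z.2).
Proof. apply: (@measurable_conv (cst 1)) => //; exact: is_derive_cont (is_derive_omI b). Qed.

Let cdens_bd s b x : 0 < b -> `|cdens (gam s) b x| <= 1.
Proof.
move=> b0; have h := conv_bd x (intg_cst (gam s) 1) (is_derive_cont (is_derive_omI b)) (omI_bd b).
apply: (le_trans h); rewrite mul1r le_eqVlt; apply/orP; left; apply/eqP.
by rewrite -[RHS](Rint1 (gam s)); apply: eq_Rintegral => y _; rewrite normr1.
Qed.

(** The common Fubini step: g is bounded by an integrable function of time, and h is bounded with
    bounded support in space. *)
Let fub (g : R -> R -> R) (G : R -> R) (h : R * R -> R) :
  measurable_fun setT (fun z : R * R => g z.1 z.2) -> measurable_fun setT h ->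
  intg leb `[0, T] G -> (forall z, `|h z| <= C) -> (forall s x, M < `|x| -> h (s, x) = 0) ->
  (forall s x, `|g s x| <= G s) ->
  [/\ intg leb `[0, T] (fun s => \int[leb]_x (g s x * h (s, x))),
     intg leb setT (fun x => \int[leb]_(s in `[0, T]) (g s x * h (s, x))),
     (forall s, intg leb setT (fun x => g s x * h (s, x))) &
   \int[leb]_(s in `[0, T]) \int[leb]_x (g s x * h (s, x)) = \int[leb]_x \int[leb]_(s in `[0, T]) (g s x * h (s, x))].
Proof.
move=> mg mh iG hC h0 gG.
have mgh : measurable_fun setT (fun z : R * R => g z.1 z.2 * h z) by exact: measurable_funM.
have mgs s : measurable_fun setT (fun x => g s x * h (s, x)) by exact: (measurableT_comp mgh (measurable_pair1 s)).
have bd s x : `|g s x * h (s, x)| <= G s * maj x by apply: maj_le => //; exact: h0.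
have is_ s : intg leb setT (fun x => g s x * h (s, x)).
  exact: (@intg_le _ (measurableTypeR R) R leb setT _ _ measurableT (mgs s) (imaj (G s)).1 (fun x _ => bd s x)).
have iG' : intg leb `[0, T] (fun s => (C * (M + M)) * G s) by exact: intgZ.
have hG s : `[0, T]%classic s -> (\int[leb]_x (`|g s x * h (s, x)|)%:E <= (C * (M + M) * G s)%:E)%E.
  move=> _; rewrite mulrC -(imaj (G s)).2 (EFin_Rint measurableT (imaj (G s)).1).
  apply: ge0_le_integral => //.
  - apply/measurable_EFinP; apply: measurableT_comp => //; exact: mgs.
  - by apply/measurable_EFinP; exact: intg_meas (imaj (G s)).1.
  by move=> x _; rewrite lee_fin.
have [j1 j2 e] := @Rfubini_on _ _ (measurableTypeR R) (measurableTypeR R) R leb leb (fun z => g z.1 z.2 * h z) _ _ mT mgh iG' hG.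
by split.
Qed.

Let icst (c : R) : intg leb `[0, T] (cst c).
Proof. by apply: intg_cont_seg => z; exact: cvg_cst. Qed.

Let weak_b b : 0 < b ->
  \int[leb]_(s in `[0, T]) \int[leb]_x (cdens (gam s) b x * pt (s, x)) =
  - \int[leb]_(s in `[0, T]) \int[leb]_x (flux b s x * ph (s, x)).
Proof.
move=> b0.
have [i1 i2 _ ->] := fub (mcdens b) mpt (icst 1) pt_bd (fun s x h => let: And3 _ e _ := supp s h in e) (fun s x => cdens_bd s x b0).
have [i3 i4 _ ->] := fub (mflux b) mph (iaffN (2 * b ^+ 2 * a1) b) ph_bd (fun s x h => let: And3 e _ _ := supp s h in e) (fun s x => flux_bd s x b0).
have -> : - (\int[leb]_x \int[leb]_(s in `[0, T]) (flux b s x * ph (s, x))) =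
  \int[leb]_x (- 1 * \int[leb]_(s in `[0, T]) (flux b s x * ph (s, x))).
  by rewrite (RintegralZl _ measurableT i4) mulN1r.
apply: eq_Rintegral => x _; rewrite mulN1r.
have := @parts_absolutely_continuous R T C (fun s => cdens (gam s) b x) (fun s => flux b s x)
  (fun s => ph (s, x)) (fun s => pt (s, x)) T0 (iflux x b0) (fun t t0 => cdens_evo x b0 t0)
  (fun t => dpt t x) (csec2 (x := x) cpt) (fun t => pt_bd _) (ph0 x) (phT x).
by case.
Qed.

Let lim_rhs s := \int[gam s]_y (k s y * ph (s, y)) - \int[gam s]_y (a s y * px (s, y)).

(** The derivative in [om1] is first moved onto [ph]; both parts are then mollifications with [om],
    and [conv_approx] applies with an error of order 1/b. *)
Let flux_approx b s : 0 < b ->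
  `|\int[leb]_x (flux b s x * ph (s, x)) - lim_rhs s| <= 8 * C / b * (a1 + (1 + N s)).
Proof.
move=> b0.
have ms (g : R * R -> R) : continuous g -> measurable_fun setT (fun x => g (s, x)).
  by move=> cg; apply: continuous_measurable_fun; exact: csec.
have [i1 h1] := conv_approx b0 (ik s) (ms ph cph) (fun x => ph_bd (s, x)) C0 (ph_lip s).
have [i2 h2] := conv_approx b0 (ia s) (ms px cpx) (fun x => px_bd (s, x)) C0 (px_lip s).
have iW : intg leb setT (fun x => W b s x * ph (s, x)).
  apply: (@intg_le _ (measurableTypeR R) R leb setT _ _ measurableT _ (imaj (2 * b ^+ 2 * a1)).1).
    apply: measurable_funM; last exact: ms.
    exact: (measurableT_comp (mW b) (measurable_pair1 s)).
  move=> x _; apply: maj_le => //; first by move=> h; case: (supp s h).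
  apply: (le_trans (conv_bd x (ia s) (@continuous_om1 _ b) (fun u => om1_bd u b0))).
  by rewrite ler_wpM2l ?int_absa// mulr_ge0// exprn_ge0// ltW.
have E : \int[leb]_x (W b s x * ph (s, x)) = - \int[leb]_x (conv (gam s) (a s) (om b) x * px (s, x)).
  have da (x : R) : is_derive x 1 (conv (gam s) (a s) (om b)) (W b s x).
    exact: (is_derive_conv x (ia s) (is_derive_om b) (om_bd b0) (fun u => om1_bd u b0)).
  have df (x : R) : is_derive x 1 (fun x => conv (gam s) (a s) (om b) x * ph (s, x))
     (W b s x * ph (s, x) + conv (gam s) (a s) (om b) x * px (s, x)).
    have := is_deriveM (da x) (dpx s x).
    by rewrite /GRing.scale /= addrC [ph (s, x) * _]mulrC.
  have cf : continuous (fun x => W b s x * ph (s, x) + conv (gam s) (a s) (om b) x * px (s, x)).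
    move=> x; apply: cvgD; apply: cvgM.
    - exact: (continuous_conv (ia s) (@continuous_om1 _ b) (fun u => om1_bd u b0)).
    - exact: csec.
    - exact: (is_derive_cont da).
    - exact: csec.
  have lim0 (u : nat -> R) : (forall n, `|u n| = n%:R) ->
      conv (gam s) (a s) (om b) (u n) * ph (s, u n) @[n --> \oo] --> (0 : R).
    move=> hu; apply: (@cvg_eventually _ _ _ (Num.bound M).+1) => n hn.
    suff h : M < `|u n| by have [-> _ _] := supp s h; rewrite mulr0.
    rewrite hu (lt_le_trans (archi_boundP M0))// ler_nat.
    exact: leq_trans hn.
  have l1 := lim0 (fun n => n%:R) (fun n => ger0_norm (ler0n R n)).
  have l2 := lim0 (fun n => - n%:R) (fun n => etrans (normrN _) (ger0_norm (ler0n R n))).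
  have := int_line df cf (intgD measurableT iW i2) l1 l2.
  rewrite (RintegralD measurableT iW i2) subrr => /eqP.
  by rewrite addr_eq0 => /eqP.
have -> : \int[leb]_x (flux b s x * ph (s, x)) =
   \int[leb]_x (F b s x * ph (s, x)) - \int[leb]_x (conv (gam s) (a s) (om b) x * px (s, x)).
  rewrite -E addrC -(RintegralD measurableT iW i1); apply: eq_Rintegral => x _.
  by rewrite -mulrDl.
rewrite /lim_rhs; have -> (u v u' v' : R) : u - v - (u' - v') = (u - u') - (v - v') by ring.
apply: (le_trans (ler_normB _ _)); rewrite mulrDr addrC.
have c8 : 0 <= 8 * C / b by rewrite divr_ge0 ?mulr_ge0// ltW.
apply: lerD; [apply: (le_trans h2)|apply: (le_trans h1)]; apply: ler_wpM2l => //.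
  exact: int_absa.
exact: int_absk.
Qed.

Let mlim_rhs : measurable_fun setT lim_rhs.
Proof.
apply: measurable_funB.
  by apply: (measurable_Rint_fam mgam (f := fun z => k z.1 z.2 * ph z)); exact: measurable_funM.
by apply: (measurable_Rint_fam mgam (f := fun z => a z.1 z.2 * px z)); exact: measurable_funM.
Qed.

Let lim_rhs_bd s : `|lim_rhs s| <= C * a1 + C * (1 + N s).
Proof.
have ms (g : R * R -> R) : continuous g -> measurable_fun setT (fun x => g (s, x)).
  by move=> cg; apply: continuous_measurable_fun; exact: csec.
have bd (f : R -> R) (g : R * R -> R) : continuous g -> (forall z, `|g z| <= C) -> intg (gam s) setT f ->
    `|\int[gam s]_y (f y * g (s, y))| <= C * \int[gam s]_y `|f y|.
  move=> cg gC fi; have i1 := intgM measurableT fi (ms g cg) (fun y _ => gC (s, y)).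
  apply: (le_trans (le_normr_Rintegral measurableT i1)).
  have i2 := intg_norm measurableT fi.
  rewrite -(RintegralZl _ measurableT i2); apply: (le_Rintegral measurableT (intg_norm measurableT i1) (intgZ C measurableT i2)).
  by move=> y _; rewrite normrM mulrC; apply: ler_wpM2r.
apply: (le_trans (ler_normB _ _)); rewrite addrC; apply: lerD.
  by apply: (le_trans (bd _ _ cpx px_bd (ia s))); rewrite ler_wpM2l// int_absa.
by apply: (le_trans (bd _ _ cph ph_bd (ik s))); rewrite ler_wpM2l// int_absk.
Qed.

Let ilim_rhs : intg leb `[0, T] lim_rhs.
Proof.
apply: (intg_le mT _ (iaffN (C * a1) C)); first exact: measurable_funTS.
by move=> s _; exact: lim_rhs_bd.
Qed.

(** Limit b -> oo of [weak_b]: the left side by dominated convergence, first in x and then in s, the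
    right side with the rate of [flux_approx]. *)
Lemma weak_time : \int[leb]_(s in `[0, T]) \int[leb]_x (U s x * pt (s, x)) =
  \int[leb]_(s in `[0, T]) (\int[gam s]_y (a s y * px (s, y)) - \int[gam s]_y (k s y * ph (s, y))).
Proof.
pose bn n : R := n.+1%:R.
have b0 n : 0 < bn n by rewrite ltr0n.
have p0 s x : M < `|x| -> pt (s, x) = 0 by case/(supp s).
have h0 s x : M < `|x| -> ph (s, x) = 0 by case/(supp s).
have U2 s x : `|U s x - 1 / 2| <= 1.
  have := distfun_ge0 (gam s) x; have := distfun_le1 (gam s) x => h1 h2.
  by rewrite ler_norml; apply/andP; split; lra.
have mU2 : measurable_fun setT (fun z : R * R => U z.1 z.2 - 1 / 2) by exact: measurable_funB.
have [iU2 _ iU2s _] := fub mU2 mpt (icst 1) pt_bd p0 U2.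
have lhs : \int[leb]_(s in `[0, T]) \int[leb]_x (cdens (gam s) (bn n) x * pt (s, x)) @[n --> \oo] -->
    \int[leb]_(s in `[0, T]) \int[leb]_x ((U s x - 1 / 2) * pt (s, x)).
  have fn n := fub (mcdens (bn n)) mpt (icst 1) pt_bd p0 (fun s x => cdens_bd s x (b0 n)).
  have inner s : \int[leb]_x (cdens (gam s) (bn n) x * pt (s, x)) @[n --> \oo] -->
      \int[leb]_x ((U s x - 1 / 2) * pt (s, x)).
    have := @Rdominated _ (measurableTypeR R) R leb setT (fun n x => cdens (gam s) (bn n) x * pt (s, x))
      (fun x => (U s x - 1 / 2) * pt (s, x)) (fun x => 1 * maj x) measurableT.
    move=> /(_ (fun n => let: And4 _ _ i _ := fn n in intg_meas (i s)) (intg_meas (iU2s s))).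
    have c1 (x : R) : setT x -> cdens (gam s) (bn n) x * pt (s, x) @[n --> \oo] --> (U s x - 1 / 2) * pt (s, x).
      move=> _; apply: cvgM; last exact: cvg_cst.
      by apply: cdens_cvg => //; exact: cU.
    move=> /(_ c1 (imaj 1).1) [|_ //].
    by move=> n x _; apply: maj_le => //; [exact: p0|exact: cdens_bd].
  have := @Rdominated _ (measurableTypeR R) R leb `[0, T]%classic (fun n s => \int[leb]_x (cdens (gam s) (bn n) x * pt (s, x)))
    (fun s => \int[leb]_x ((U s x - 1 / 2) * pt (s, x))) (cst (1 * (C * (M + M)))) mT.
  move=> /(_ (fun n => let: And4 i _ _ _ := fn n in intg_meas i) (intg_meas iU2) (fun s _ => inner s) (icst _)) [|_ //].
  move=> n s _ /=; have [_ _ i _] := fn n.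
  apply: (le_trans (le_normr_Rintegral measurableT (i s))); rewrite -(imaj 1).2.
  apply: (le_Rintegral measurableT (intg_norm measurableT (i s)) (imaj 1).1).
  by move=> x _; apply: maj_le => //; [exact: p0|exact: cdens_bd].
have rhs : \int[leb]_(s in `[0, T]) \int[leb]_x (cdens (gam s) (bn n) x * pt (s, x)) @[n --> \oo] -->
    - \int[leb]_(s in `[0, T]) lim_rhs s.
  under eq_fun do rewrite weak_b//.
  apply: cvgN; apply/cvgrPdist_le => e e0.
  pose c := \int[leb]_(s in `[0, T]) (a1 + (1 + N s)).
  have ic : intg leb `[0, T] (fun s => a1 + (1 + N s)).
    exact: (intgD mT (icst a1) (intgD mT (icst 1) iN)).
  have c0 : 0 <= c.
    by apply: Rintegral_ge0 => s _; rewrite addr_ge0// addr_ge0.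
  exists (Num.bound (8 * C * c / e)) => // n /= hn.
  have [i1 _ _ _] := fub (mflux (bn n)) mph (iaffN (2 * bn n ^+ 2 * a1) (bn n)) ph_bd h0 (fun s x => flux_bd s x (b0 n)).
  rewrite distrC -(RintegralB mT i1 ilim_rhs).
  have i2 := intgB mT i1 ilim_rhs.
  apply: (le_trans (le_normr_Rintegral mT i2)).
  apply: (@le_trans _ _ (\int[leb]_(s in `[0, T]) (8 * C / bn n * (a1 + (1 + N s))))).
    apply: (le_Rintegral mT (intg_norm mT i2) (intgZ _ mT ic)) => s _.
    exact: flux_approx.
  rewrite (RintegralZl _ mT ic) -/c mulrAC ler_pdivrMr// [X in _ <= X]mulrC -ler_pdivrMr//.
  have d0 : 0 <= 8 * C * c / e by rewrite divr_ge0 ?mulr_ge0// ltW.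
  apply: (le_trans (ltW (archi_boundP d0))).
  by rewrite /bn ler_nat (leq_trans hn).
have h1 := cvg_unique (@Rhausdorff R) lhs rhs.
(* [cdens] converges to U - 1/2; the constant drops out because [pt] has zero integral over
   [0, T]. *)
have half1 : `|1 / 2| <= 1 :> R by rewrite ger0_norm; lra.
have [ih ih2 ihs eh] := fub (g := fun _ _ => 1 / 2) (@measurable_cst _ _ _ _ _ _) mpt (icst 1) pt_bd p0
  (fun s x => half1).
have h2 : \int[leb]_(s in `[0, T]) \int[leb]_x (1 / 2 * pt (s, x)) = 0.
  rewrite eh; transitivity (\int[leb]_x (cst (0 : R) x)); last by rewrite /Rintegral integral0.
  apply: eq_Rintegral => x _.
  have [j1 j2] := FTC_seg (fun t => dpt t x) (csec2 (x := x) cpt) (ltW T0).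
  by rewrite (RintegralZl _ mT j1) j2 ph0 phT subrr mulr0.
transitivity (\int[leb]_(s in `[0, T]) (\int[leb]_x ((U s x - 1 / 2) * pt (s, x)) + \int[leb]_x (1 / 2 * pt (s, x)))).
  apply: eq_Rintegral => s _; rewrite -(RintegralD measurableT (iU2s s) (ihs s)).
  by apply: eq_Rintegral => x _; ring.
rewrite (RintegralD mT iU2 ih) h2 addr0 h1.
rewrite -mulN1r -(RintegralZl _ mT ilim_rhs); apply: eq_Rintegral => s _.
by rewrite /lim_rhs; ring.
Qed.

End TestFunction.

Variables (Th : R).
Hypothesis small : forall eta, 0 < eta -> exists2 l : R, 0 < l &
  forall t z, 0 <= t <= T -> U t (z + l) - U t z <= eta.
Hypothesis init : forall b, 0 < b -> intg leb setT (fun x => dens (gam 0) b x ^+ 2) /\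
  \int[leb]_x (dens (gam 0) b x ^+ 2) <= Th.
Hypothesis moment : intg (gam T) setT (fun y => `|y|).

(** Adding c = 1 + ln d to both entropies leaves the gap unchanged and removes the dependence on d.
    The moment enters with an error 8 / b <= 8, and 20 collects the numerical constants. *)
Lemma entropy_gap b d : 1 <= b -> 0 < d -> d <= 1 ->
  \int[leb]_x ent d (dens (gam 0) b x) - \int[leb]_x ent d (dens (gam T) b x) <=
  Th + 2 * \int[gam T]_y `|y| + 20.
Proof.
move=> b1 d0 d1; have b0 : 0 < b by exact: lt_le_trans b1.
have gap (x y c th m e : R) : x + c <= th + 1 -> - (2 * (m + e) + 1) - 1 <= y + c -> e <= 8 ->
    x - y <= th + 2 * m + 20 by lra.
pose c : R := 1 + ln d.
have iP s : intg leb setT (dens (gam s) b) by exact: intg_dens.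
have iE s : intg leb setT (fun x => ent d (dens (gam s) b x)) by exact: intg_ent.
have icP s : intg leb setT (fun x => dens (gam s) b x * c).
  by have := intgZ c measurableT (iP s); under eq_fun do rewrite mulrC.
have ecP s : \int[leb]_x (dens (gam s) b x * c) = c.
  transitivity (\int[leb]_x (c * dens (gam s) b x)).
    by apply: eq_Rintegral => x _; exact: mulrC.
  by rewrite (RintegralZl c measurableT (iP s)) (Rint_dens (gam s) b0) mulr1.
have up : \int[leb]_x ent d (dens (gam 0) b x) + c <= Th + 1.
  have [i2 h2] := init b0.
  rewrite -(ecP 0) -(RintegralD measurableT (iE 0) (icP 0)) -[X in _ <= _ + X](Rint_dens (gam 0) b0).
  apply: (le_trans _ (_ : \int[leb]_x (dens (gam 0) b x ^+ 2 + dens (gam 0) b x) <= _)); last first.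
    by rewrite (RintegralD measurableT i2 (iP 0)) lerD2r.
  apply: (le_Rintegral measurableT (intgD measurableT (iE 0) (icP 0)) (intgD measurableT i2 (iP 0))).
  by move=> x _; apply: ent_upper => //; exact: dens_ge0.
have lo : - (2 * (\int[gam T]_y `|y| + 8 / b) + 1) - 1 <= \int[leb]_x ent d (dens (gam T) b x) + c.
  have [i2 h2] := dens_moment b0 moment.
  have eo' : (\int[leb]_x (om 1 x)%:E = 1%:E)%E.
    by rewrite -(int_om 0 (@ltr01 R)); apply: eq_integral => x _; rewrite subr0.
  have io : intg leb setT (om 1).
    apply: intg_ge0P => //; first by apply: continuous_measurable_fun; exact: continuous_om.
    - by move=> x _; exact/ltW/om_gt0.
    - by rewrite eo' ltry.
  have eo : \int[leb]_x om 1 x = 1 by rewrite /Rintegral eo'.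
  have i3 : intg leb setT (fun x => 2 * (`|x| * dens (gam T) b x) + dens (gam T) b x).
    by apply: intgD => //; exact: intgZ.
  have i4 := intgD measurableT i3 io.
  have i5 : intg leb setT (fun x => - (2 * (`|x| * dens (gam T) b x) + dens (gam T) b x + om 1 x)).
    by have := intgZ (- 1) measurableT i4; under eq_fun do rewrite mulN1r.
  have e5 : \int[leb]_x (- (2 * (`|x| * dens (gam T) b x) + dens (gam T) b x + om 1 x)) =
     - (2 * \int[leb]_x (`|x| * dens (gam T) b x) + 1 + 1).
    under eq_Rintegral do rewrite -mulN1r.
    by rewrite (RintegralZl _ measurableT i4) mulN1r (RintegralD measurableT i3 io) (RintegralD measurableT (intgZ 2 measurableT i2) (iP T)) (RintegralZl _ measurableT i2) Rint_dens// eo.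
  apply: (@le_trans _ _ (- (2 * \int[leb]_x (`|x| * dens (gam T) b x) + 1 + 1))); first by lra.
  rewrite -e5 -(ecP T) -(RintegralD measurableT (iE T) (icP T)).
  apply: (le_Rintegral measurableT i5 (intgD measurableT (iE T) (icP T))).
  move=> x _; have p0 := dens_ge0 (gam T) b0 x.
  have ln2 : ln 2 <= 1 :> R by apply: (le_trans (ln_le_subr1 _)) => //; lra.
  (* This choice of s makes exp(-s) equal to om 1 x, which has integral 1, while s <= 2 |x| + 1. *)
  have h := ent_lower d0 (2 * lch x + ln 2) p0.
  apply: le_trans h.
  have -> : expR (- (2 * lch x + ln 2)) = om 1 x.
    by rewrite opprD expRD expR_lch expRN lnK ?posrE// /om !mul1r mulrC.
  rewrite opprD lerD2r lerN2.
  have hl := ler_wpM2l p0 (lch_le x); have h2' := ler_wpM2l p0 ln2.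
  by rewrite mulrDr; move: hl h2'; rewrite mulr1 [`|x| * _]mulrC; lra.
have b8 : 8 / b <= 8 by rewrite ler_pdivrMr// ler_peMr.
exact: gap up lo b8.
Qed.

(** After absorption of the cubic term the dissipation still contains -(a0/4) times the information;
    integrating in time and comparing with the entropy gap bounds it. *)
Lemma energy_bound : exists C : R, forall b d, 1 <= b -> 0 < d -> d <= 1 ->
  \int[leb]_(s in `[0, T]) \int[leb]_x fdens (gam s) b d x <= C.
Proof.
have [c [c0 cE]] : exists c : R, 0 <= c /\ 768 * expR 7 * L ^+ 2 = c.
  eexists; split; last reflexivity.
  by apply: mulr_ge0; [apply: mulr_ge0; [exact: ler0n|exact: expR_ge0]|exact: sqr_ge0].
have absorb (e r j n i3 : R) : e = a0 / (4 * (c + 1)) -> 0 <= j -> i3 <= 2 * r + 4 * e ^+ 2 * j ->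
    - (a0 / 2) * j + a0^-1 * (c * i3 + n) <= - (a0 / 4) * j + (a0^-1 * (c * (2 * r)) + a0^-1 * n).
  move=> -> j0 h4; have a00 := a0p; have c10 : 0 < c + 1 by rewrite ltr_wpDl.
  have aV : 0 <= a0^-1 by rewrite invr_ge0 ltW.
  have h6 : 16 * c * (a0 / (4 * (c + 1))) ^+ 2 <= a0 ^+ 2.
    rewrite expr_div_n exprMn mulrA ler_pdivrMr ?mulr_gt0 ?exprn_gt0//.
    rewrite [X in _ <= X]mulrC ler_wpM2r ?sqr_ge0//.
    by have := c0; nra.
  have h7 : a0^-1 * (c * (4 * (a0 / (4 * (c + 1))) ^+ 2)) <= a0 / 4.
    by rewrite mulrC ler_pdivrMr//; move: h6; rewrite (expr2 a0); lra.
  have h8 := ler_wpM2r j0 h7.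
  have h9 := ler_wpM2l aV (lerD (ler_wpM2l c0 h4) (lexx n)).
  by move: h8 h9; rewrite !(mulrDr, mulrDl) !mulrA; lra.
(* Chosen so that a0^-1 c 4 eta^2 <= a0 / 4: the cubic term takes at most half of the available a0 /
   2. *)
pose eta := a0 / (4 * (c + 1)).
have c1 : 0 < c + 1 by rewrite ltr_wpDl.
have eta0 : 0 < eta by rewrite divr_gt0// mulr_gt0.
have [l' l'0 hl'] := small eta0.
(* With d <= 1 this gives d l <= eta, so that eta + d l <= 2 eta uniformly in d. *)
pose l := Num.min l' eta.
have l0 : 0 < l by rewrite lt_min l'0 eta0.
have leta : l <= eta by rewrite ge_min lexx orbT.
have hl t z : 0 <= t <= T -> U t (z + l) - U t z <= eta.
  move=> t0; apply: le_trans (hl' t z t0); rewrite lerB// distfun_nd// lerD2l.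
  by rewrite ge_min lexx.
pose K1 := a0^-1 * (c * (2 * (eta / l) ^+ 2)).
pose C0 := Th + 2 * \int[gam T]_y `|y| + 20.
exists (4 / a0 * (C0 + (K1 * T + a0^-1 * \int[leb]_(s in `[0, T]) N s))).
move=> b d b1 d0 d1; have b0 : 0 < b by exact: lt_le_trans b1.
set J := fun s => \int[leb]_x fdens (gam s) b d x.
have iJ : intg leb `[0, T] J by exact: intg_fdens_time.
have J0 s : 0 <= J s by apply: Rintegral_ge0 => x _; exact: fdens_ge0.
have [iZ hZ] := entropy_chain b0 d0.
have gap := entropy_gap b1 d0 d1.
have a0V : 0 <= a0^-1 by rewrite invr_ge0 ltW.
have key s : `[0, T]%classic s ->
    \int[leb]_x (dent d (dens (gam s) b x) * q b s x) <= - (a0 / 4) * J s + (K1 + a0^-1 * N s).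
  rewrite /= in_itv /= => s0T.
  rewrite dissipation_by_parts//.
  have [i3 h3] := dens_cube_le b0 d0 l0 (fun z => hl s z s0T).
  have h := dissipation b0 d0 a0p (mats s) (mkts s) (a_ge s) (a_le s) (a_lip s) (ik2 s) i3 erefl.
  rewrite cE in h; apply: (le_trans h); rewrite -/(J s) -/(N s).
  have h4 : \int[leb]_x dens (gam s) b x ^+ 3 <= 2 * (eta / l) ^+ 2 + 4 * eta ^+ 2 * J s.
    have dl : d * l <= eta by apply: le_trans leta; rewrite ler_piMl// ltW.
    have hh : 2 * (eta + d * l) * eta <= 4 * eta ^+ 2.
      have -> : 4 * eta ^+ 2 = 2 * (eta + eta) * eta by ring.
      by apply: ler_wpM2r; [exact: ltW|apply: ler_wpM2l => //; rewrite lerD2l].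
    by apply: (le_trans h3); rewrite lerD2l; exact: (ler_wpM2r (J0 s) hh).
  exact: (absorb eta ((eta / l) ^+ 2) (J s) (N s) _ erefl (J0 s) h4).
have iK : intg leb `[0, T] (cst K1) by apply: intg_cont_seg => z; exact: cvg_cst.
have iN1 : intg leb `[0, T] (fun s => K1 + a0^-1 * N s).
  exact: (intgD mT iK (intgZ _ mT iN)).
have iR : intg leb `[0, T] (fun s => - (a0 / 4) * J s + (K1 + a0^-1 * N s)).
  exact: (intgD mT (intgZ _ mT iJ) iN1).
have := le_Rintegral mT iZ iR key.
rewrite (RintegralD mT (intgZ _ mT iJ) iN1) (RintegralZl _ mT iJ).
rewrite (RintegralD mT iK (intgZ _ mT iN)) (RintegralZl _ mT iN).
have -> : \int[leb]_(x in `[0, T]) K1 = K1 * T.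
  by rewrite -[in RHS](subr0 T); exact: (Rint_cst_seg K1 (ltW T0)).
move=> h.
set X := \int[leb]_(s in `[0, T]) J s in h *.
have h2 : a0 / 4 * X <= C0 + (K1 * T + a0^-1 * \int[leb]_(s in `[0, T]) N s).
  move: h hZ gap; rewrite -/C0 mulNr.
  by move: (\int[leb]_x ent _ _) (\int[leb]_x ent _ _) (\int[leb]_(s in _) _) (K1 * T) => e1 e2 e3 e4; lra.
have := ler_wpM2l (_ : 0 <= 4 / a0) h2; rewrite divr_ge0 ?(ltW a0p)// => /(_ isT).
by rewrite (_ : 4 / a0 * (a0 / 4 * X) = X)//; field; rewrite gt_eqF.
Qed.

End Evolution.

(** * Uniform smallness of mass and the first moment *)

Section Tails.
Context {R : realType}.
Local Notation leb := (@lebesgue_measure R).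

Lemma distfun_Rint (gam : probability R R) x :
  p_distfun gam x = \int[gam]_y (if y <= x then 1 else 0).
Proof.
pose I : set R := [set y | y <= x].
have mI : measurable I.
  have -> : I = `]-oo, x]%classic by apply/seteqP; split => z /=; rewrite in_itv.
  exact: measurable_itv.
have e : (\int[gam]_y (if y <= x then 1 else 0)%:E = gam I)%E.
  rewrite -[in RHS](setIT I) -(integral_indic gam measurableT mI).
  apply: eq_integral => y _; rewrite indicE.
  have -> : (y \in I) = (y <= x) by apply/idP/idP => [/set_mem|/mem_set].
  by case: ifP.
by rewrite /Rintegral e.
Qed.

Let mind (x : R) : measurable_fun setT (fun y : R => if y <= x then 1 else 0 : R).
Proof. by apply: measurable_fun_ifT => //; exact: measurable_fun_ler. Qed.

Lemma distfun_cvg1 (gam : probability R R) : p_distfun gam n%:R @[n --> \oo] --> (1 : R).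
Proof.
have := @Rdominated _ _ R gam setT (fun n y => if y <= n%:R then 1 else 0) (cst 1) (cst 1) measurableT.
move=> /(_ (fun n => mind n%:R) (@measurable_cst _ _ _ _ _ _)).
have c (y : R) : setT y -> (if y <= n%:R then 1 else 0) @[n --> \oo] --> (1 : R).
  move=> _; apply: (@cvg_eventually _ _ _ (Num.bound `|y|)) => n hn.
  rewrite ifT// (le_trans (ler_norm y))// (le_trans (ltW (archi_boundP (normr_ge0 y))))// ler_nat//.
move=> /(_ c (intg_cst gam 1)) [|_].
  by move=> n y _ /=; case: ifP; rewrite ?normr1 ?normr0.
rewrite Rint1; under eq_fun do rewrite -distfun_Rint; exact.
Qed.

Lemma distfun_cvg0 (gam : probability R R) : p_distfun gam (- n%:R) @[n --> \oo] --> (0 : R).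
Proof.
have := @Rdominated _ _ R gam setT (fun n y => if y <= - n%:R then 1 else 0) (cst 0) (cst 1) measurableT.
move=> /(_ (fun n => mind (- n%:R)) (@measurable_cst _ _ _ _ _ _)).
have c (y : R) : setT y -> (if y <= - n%:R then 1 else 0) @[n --> \oo] --> (0 : R).
  move=> _; apply: (@cvg_eventually _ _ _ (Num.bound `|y|)) => n hn.
  rewrite ifF//; apply/negbTE; rewrite -ltNge.
  have h : `|y| < n%:R by rewrite (lt_le_trans (archi_boundP (normr_ge0 y)))// ler_nat.
  by move: h; rewrite ltr_norml => /andP[].
move=> /(_ c (intg_cst gam 1)) [|_].
  by move=> n y _ /=; case: ifP; rewrite ?normr1 ?normr0.
rewrite (_ : \int[gam]_y cst 0 y = 0); last by rewrite /Rintegral integral0.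
by under eq_fun do rewrite -distfun_Rint; exact.
Qed.

(** The tails beyond n are uniformly small by compactness of [0, T], the conditions at n and -n
    being open in t and monotone in n; continuity on a compact rectangle settles the rest. *)
Lemma uniform_small_mass (T : R) (gam : R -> probability R R) :
  continuous (fun z : R * R => p_distfun (gam z.1) z.2) ->
  forall eta, 0 < eta -> exists2 l : R, 0 < l &
    forall t z, 0 <= t <= T -> p_distfun (gam t) (z + l) - p_distfun (gam t) z <= eta.
Proof.
move=> cV eta eta0.
have csec x : continuous (fun t : R => p_distfun (gam t) x).
  move=> t; have h : (fun s : R => (s, x)) s @[s --> t] --> (t, x).
    exact: (cvg_pair cvg_id (cvg_cst x)).
  exact: (cvg_comp _ _ h (cV (t, x))).
have cI : compact (`[0, T]%classic : set R) by exact: segment_compact.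
have tails : \forall n \near \oo, (`[0, T]%classic : set R) `<=`
    [set t | 1 - eta < p_distfun (gam t) n%:R /\ p_distfun (gam t) (- n%:R) < eta].
  have nc := (compact_near_coveringP _).1 cI.
  apply: (nc nat \oo (fun n t => 1 - eta < p_distfun (gam t) n%:R /\ p_distfun (gam t) (- n%:R) < eta)).
  move=> t _.
  have h1 : 1 - eta < 1 by rewrite ltrBlDr ltrDl.
  have [n1 _ hn1] := cvgr_gt _ (distfun_cvg1 (gam t)) _ h1.
  have [n2 _ hn2] := cvgr_lt _ (distfun_cvg0 (gam t)) _ eta0.
  pose n := maxn n1 n2.
  have k1 := hn1 n (leq_maxl _ _); have k2 := hn2 n (leq_maxr _ _).
  have c1 := cvgr_gt _ (csec n%:R t) _ k1; have c2 := cvgr_lt _ (csec (- n%:R) t) _ k2.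
  exists ([set s | 1 - eta < p_distfun (gam s) n%:R /\ p_distfun (gam s) (- n%:R) < eta], [set m | (n <= m)%N]).
    split => /=; last by exists n.
    by apply: filterI; [exact: c1|exact: c2].
  move=> [s m] /= [[s1 s2] nm]; split.
    by apply: (lt_le_trans s1); apply: distfun_nd; rewrite ler_nat.
  by apply: le_lt_trans s2; apply: distfun_nd; rewrite lerN2 ler_nat.
have [n _ /(_ n (leqnn n)) hn] := tails.
pose K : R := n%:R.
(* The extra unit leaves room for a shift l <= 1: when z lies to the left of the rectangle, z + l is
   still below -n. *)
pose S : set (R * R) := `[0, T]%classic `*` `[- (K + 1), K + 1]%classic.
have cS : compact S by apply: compact_setX => //; exact: segment_compact.
have unif : \forall m \near \oo, S `<=`
    [set z | p_distfun (gam z.1) (z.2 + m.+1%:R^-1) - p_distfun (gam z.1) z.2 <= eta].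
  have nc := (compact_near_coveringP _).1 cS.
  apply: (nc nat \oo (fun m z => p_distfun (gam z.1) (z.2 + m.+1%:R^-1) - p_distfun (gam z.1) z.2 <= eta)).
  move=> [t z] _.
  have e2 : 0 < eta / 2 by rewrite divr_gt0.
  have /cvgrPdist_lt /(_ _ e2) := cV (t, z).
  move=> /nbhs_ballP [dl /= dl0 hb].
  have dl2 : 0 < dl / 2 by rewrite divr_gt0.
  have [m0 _ hm0] := near_infty_natSinv_lt (PosNum dl2).
  exists (ball (t, z) (dl / 2), [set m | (m0 <= m)%N]).
    by split => /=; [exact: nbhsx_ballx|exists m0].
  move=> [[s w] m] /= [[/= b1 b2] mm].
  have hm : m.+1%:R^-1 < dl / 2 := hm0 m mm.
  have {}b1 : `|t - s| < dl / 2 := b1; have {}b2 : `|z - w| < dl / 2 := b2.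
  have q1 := hb (s, w); have q2 := hb (s, w + m.+1%:R^-1).
  have m0' : 0 < m.+1%:R^-1 :> R by rewrite invr_gt0.
  have {}q1 : `|p_distfun (gam t) z - p_distfun (gam s) w| < eta / 2.
    by apply: q1; split => /=; rewrite /ball /=; [apply: (lt_trans b1)|apply: (lt_trans b2)]; lra.
  have {}q2 : `|p_distfun (gam t) z - p_distfun (gam s) (w + m.+1%:R^-1)| < eta / 2.
    apply: q2; split => /=; rewrite /ball /=; first by apply: (lt_trans b1); lra.
    have -> : z - (w + m.+1%:R^-1) = (z - w) - m.+1%:R^-1 by ring.
    apply: (le_lt_trans (ler_normB _ _)); rewrite (ger0_norm (ltW m0')) (splitr dl).
    exact: ltrD.
  move: q1 q2; rewrite !ltr_norml => /andP[? ?] /andP[? ?]; lra.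
have [m _ /(_ m (leqnn m)) hm] := unif.
have l0 : 0 < m.+1%:R^-1 :> R by rewrite invr_gt0.
have l1 : m.+1%:R^-1 <= 1 :> R by rewrite invf_le1 ?ler1n.
exists m.+1%:R^-1 => // t z t0.
have [u1 u2] := hn t t0.
have [zK|Kz] := ltP K z.
  have := distfun_le1 (gam t) (z + m.+1%:R^-1).
  have := distfun_nd (gam t) (ltW zK); rewrite /K; lra.
have [zK|Kz'] := ltP z (- (K + 1)).
  have := distfun_ge0 (gam t) z.
  have h : z + m.+1%:R^-1 <= - n%:R.
    by move: l1 zK; rewrite /K; move: (m.+1%:R^-1) (n%:R) => l N; lra.
  have := distfun_nd (gam t) h; lra.
have := hm (t, z); apply; split => //=; rewrite in_itv /= Kz'/=; lra.
Unshelve. all: by end_near.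
Qed.

End Tails.

(** * Propagation of the first moment *)

Section TailMoment.
Context {R : realType}.
Local Notation leb := (@lebesgue_measure R).
Variables (T : R) (gam : R -> probability R R) (a k : R -> R -> R) (a1 : R) (N : R -> R).
Hypothesis T0 : 0 < T.
Hypothesis mgam : forall B : set R, measurable B -> measurable_fun setT (fun t => gam t B).
Hypothesis ma : measurable_fun setT (fun z : R * R => a z.1 z.2).
Hypothesis mk : measurable_fun setT (fun z : R * R => k z.1 z.2).
Hypothesis a_bd : forall t y, `|a t y| <= a1.
Hypothesis ik : forall s, intg (gam s) setT (k s).
Hypothesis kN : forall s, \int[gam s]_y `|k s y| <= N s.
Hypothesis iN : intg leb `[0, T] N.
Hypothesis evo : forall (al : R) (P : {poly R}) (b x : R) (g g1 g2 : R -> R), 0 < al -> 0 < b ->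
  (forall y, g y = ker al P (b * (x - y))) ->
  (forall y : R, is_derive y 1 g (g1 y)) -> (forall y : R, is_derive y 1 g1 (g2 y)) ->
  forall t, 0 <= t <= T -> \int[gam t]_y g y - \int[gam 0]_y g y =
    \int[leb]_(s in `[0, t]) (\int[gam s]_y (a s y * g2 y) - \int[gam s]_y (k s y * g1 y)).
Hypothesis m0 : intg (gam 0) setT (fun y => `|y|).

(** An admissible kernel, [ker] with P = 1 and a = 1/(n+1). The function (n+1)(1 - cut) approximates
    lch from below and has first and second derivatives bounded independently of n. *)
Let cut (n : nat) (y : R) : R := expR (- (n.+1%:R^-1 * lch y)).

Let cut1 n y : R := - (n.+1%:R^-1 * (th y * cut n y)).
Let cut2 n y : R := - (n.+1%:R^-1 * ((1 - th y ^+ 2) * cut n y - n.+1%:R^-1 * (th y ^+ 2 * cut n y))).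

Let d1 n (y : R) : is_derive y 1 (cut n) (cut1 n y).
Proof.
have E : cut n = ker n.+1%:R^-1 1 by apply/funext => z; rewrite /ker hornerC mul1r.
rewrite [X in is_derive _ _ X _]E; have h := is_derive_ker n.+1%:R^-1 1 y.
apply: (is_derive_eq h).
by rewrite /ker /dker derivC mulr0 sub0r hornerN hornerZ mulr1 hornerX /cut1 /cut; ring.
Qed.

Let d2 n (y : R) : is_derive y 1 (cut1 n) (cut2 n y).
Proof.
have := is_deriveN (is_deriveZ (n.+1%:R^-1) (is_deriveM (is_derive_th y) (d1 n y))).
move=> h; apply: (is_derive_eq h).
by rewrite /cut2 /cut1 /GRing.scale /=; ring.
Qed.

Let cut01 n y : 0 <= cut n y <= 1.
Proof. by rewrite expR_ge0 /= expR_le1 oppr_le0 mulr_ge0 ?invr_ge0 ?lch_ge0. Qed.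

Lemma moment_bound : intg (gam T) setT (fun y => `|y|).
Proof.
pose K := \int[gam 0]_y `|y| + \int[leb]_(s in `[0, T]) (2 * a1 + N s).
have mT : measurable (`[0, T]%classic : set (measurableTypeR R)) by exact: measurable_itv.
have a10 : 0 <= a1 by apply: le_trans (a_bd 0 0).
have icst (c : R) : intg leb `[0, T] (cst c) by apply: intg_cont_seg => z; exact: cvg_cst.
have iM : intg leb `[0, T] (fun s => 2 * a1 + N s) by exact: (intgD mT (icst _) iN).
have ccut n : continuous (cut n) by exact: (is_derive_cont (d1 n)).
have ccut1 n : continuous (cut1 n) by exact: (is_derive_cont (d2 n)).
have mcut n : measurable_fun setT (cut n) by exact: continuous_measurable_fun.
have icut n s : intg (gam s) setT (cut n).
  apply: (intg_le measurableT (mcut n) (intg_cst (gam s) 1)) => y _.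
  by have /andP[h1 h2] := cut01 n y; rewrite ger0_norm.
pose f n y : R := n.+1%:R * (1 - cut n y).
have n0 n : 0 < n.+1%:R :> R by [].
have nn n : n.+1%:R != 0 :> R by [].
have f_le n y : f n y <= `|y|.
  apply: le_trans (lch_le y).
  have := expR_ge1Dx (- (n.+1%:R^-1 * lch y)); rewrite -/(cut n y) => h.
  have h2 := ler_wpM2l (ltW (n0 n)) h; rewrite mulrDr mulr1 mulrN mulrA mulfV// mul1r in h2.
  by rewrite /f mulrBr mulr1; lra.
have f0 n y : 0 <= f n y.
  by have /andP[_ h] := cut01 n y; rewrite mulr_ge0// subr_ge0.
have if_ n s : intg (gam s) setT (f n).
  apply: intgZ => //; apply: intgB => //; exact: intg_cst.
have ef n s : \int[gam s]_y f n y = n.+1%:R * (1 - \int[gam s]_y cut n y).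
  have ic := intg_cst (gam s) 1.
  by rewrite (RintegralZl _ measurableT (intgB measurableT ic (icut n s))) (RintegralB measurableT ic (icut n s)) Rint1.
have fK n : \int[gam T]_y f n y <= K.
  have hT : 0 <= T <= T by rewrite lexx ltW.
  have e := @evo n.+1%:R^-1 1 1 0 (cut n) (cut1 n) (cut2 n) _ ltr01 _ (d1 n) (d2 n) T hT.
  have {}e : \int[gam T]_y cut n y - \int[gam 0]_y cut n y =
    \int[leb]_(s in `[0, T]) (\int[gam s]_y (a s y * cut2 n y) - \int[gam s]_y (k s y * cut1 n y)).
    apply: e; first by rewrite invr_gt0.
    move=> y; rewrite /ker hornerC mul1r mul1r sub0r /cut; congr (expR (- (_ * _))).
    by rewrite /lch /ch opprK addrC.
  have b1 y : n.+1%:R * `|cut1 n y| <= 1.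
    rewrite normrN normrM gtr0_norm ?invr_gt0// mulrA mulfV// mul1r normrM.
    have /andP[h1 h2] := cut01 n y; rewrite (ger0_norm h1).
    by rewrite mulr_ile1// ltW// th_norm_lt1.
  have b2 y : n.+1%:R * `|cut2 n y| <= 2.
    rewrite normrN normrM gtr0_norm ?invr_gt0// mulrA mulfV// mul1r.
    apply: (le_trans (ler_normB _ _)).
    have /andP[h1 h2] := cut01 n y; have h3 := ltW (th_sqr_lt1 y); have h4 := sqr_ge0 (th y).
    have i1 : n.+1%:R^-1 <= 1 :> R by rewrite invf_le1 ?ler1n.
    have i0 : 0 <= n.+1%:R^-1 :> R by rewrite invr_ge0.
    have -> : 2 = 1 + 1 :> R by ring.
    have t1 : 0 <= 1 - th y ^+ 2 by rewrite subr_ge0.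
    have t2 : 1 - th y ^+ 2 <= 1 by rewrite lerBlDr lerDl.
    rewrite (ger0_norm (mulr_ge0 t1 h1)) (ger0_norm (mulr_ge0 i0 (mulr_ge0 h4 h1))).
    apply: lerD; first exact: mulr_ile1.
    by apply: mulr_ile1 => //; [exact: mulr_ge0|exact: mulr_ile1].
  rewrite ef.
  have -> : n.+1%:R * (1 - \int[gam T]_y cut n y) = \int[gam 0]_y f n y -
     n.+1%:R * (\int[gam T]_y cut n y - \int[gam 0]_y cut n y) by rewrite ef; ring.
  rewrite /K; apply: lerD.
    by apply: (le_Rintegral measurableT (if_ n 0) m0) => y _; exact: f_le.
  rewrite e; apply: (le_trans (ler_norm _)); rewrite normrN normrM gtr0_norm//.
  set D := fun s => _ - _.
  have bd s (g u : R -> R) (c : R) : intg (gam s) setT g -> measurable_fun setT u ->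
      (forall y, n.+1%:R * `|u y| <= c) -> n.+1%:R * `|\int[gam s]_y (g y * u y)| <= c * \int[gam s]_y `|g y|.
    move=> ig mu uc.
    have uc1 y : `|u y| <= c by apply: le_trans (uc y); rewrite ler_peMl// ler1n.
    have i1 := intgM measurableT ig mu (fun y _ => uc1 y).
    have i2 := intg_norm measurableT ig.
    apply: (le_trans (ler_wpM2l (ltW (n0 n)) (le_normr_Rintegral measurableT i1))).
    have i3 := intg_norm measurableT i1.
    rewrite -(RintegralZl _ measurableT i3) -(RintegralZl _ measurableT i2).
    apply: (le_Rintegral measurableT (intgZ _ measurableT i3) (intgZ _ measurableT i2)) => y _.
    by rewrite normrM mulrCA mulrC; apply: ler_wpM2r.
  have cth : continuous (th : R -> R) by exact: (is_derive_cont is_derive_th).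
  have ccut2 : continuous (cut2 n).
    move=> y; apply: cvgN; apply: cvgM; first exact: cvg_cst.
    have c2 : (fun y : R => th y ^+ 2) z @[z --> y] --> th y ^+ 2.
      by under eq_fun do rewrite expr2; rewrite expr2; apply: cvgM; exact: cth.
    apply: cvgB; first by apply: cvgM; [apply: cvgB; [exact: cvg_cst|exact: c2]|exact: ccut].
    by apply: cvgM; [exact: cvg_cst|apply: cvgM; [exact: c2|exact: ccut]].
  have mats s : measurable_fun setT (a s) by exact: (measurableT_comp ma (measurable_pair1 s)).
  have ia s : intg (gam s) setT (a s).
    by apply: (intg_le measurableT (mats s) (intg_cst (gam s) a1)) => y _; exact: a_bd.
  have Ia s : \int[gam s]_y `|a s y| <= a1.
    have ic := intg_cst (gam s) 1.
    rewrite -[X in _ <= X]mulr1 -(Rint1 (gam s)) -(RintegralZl _ measurableT ic).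
    apply: (le_Rintegral measurableT (intg_norm measurableT (ia s)) (intgZ a1 measurableT ic)).
    by move=> y _; rewrite mulr1.
  have Db s : n.+1%:R * `|D s| <= 2 * a1 + N s.
    rewrite /D; apply: (le_trans (ler_wpM2l (ltW (n0 n)) (ler_normB _ _))); rewrite mulrDr; apply: lerD.
      apply: (le_trans (bd s _ _ 2 (ia s) (continuous_measurable_fun ccut2) b2)).
      by rewrite ler_wpM2l.
    apply: (le_trans (bd s _ _ 1 (ik s) (continuous_measurable_fun (ccut1 n)) b1)).
    by rewrite mul1r.
  have snd_meas (g : R -> R) : continuous g -> measurable_fun setT (fun z : R * R => g z.2).
    by move=> cg; apply: (measurableT_comp (continuous_measurable_fun cg)); exact: measurable_snd.
  have mD : measurable_fun setT D.
    apply: measurable_funB.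
      apply: (measurable_Rint_fam mgam (f := fun z => a z.1 z.2 * cut2 n z.2)).
      by apply: measurable_funM => //; exact: snd_meas.
    apply: (measurable_Rint_fam mgam (f := fun z => k z.1 z.2 * cut1 n z.2)).
    by apply: measurable_funM => //; exact: snd_meas.
  have iD : intg leb `[0, T] D.
    apply: (intg_le mT _ iM); first exact: measurable_funTS.
    by move=> s _; apply: le_trans (Db s); rewrite ler_peMl// ler1n.
  apply: (le_trans (ler_wpM2l (ltW (n0 n)) (le_normr_Rintegral mT iD))).
  rewrite -(RintegralZl _ mT (intg_norm mT iD)).
  by apply: (le_Rintegral mT (intgZ _ mT (intg_norm mT iD)) iM) => s _; exact: Db.
have mlch : measurable_fun setT (lch : R -> R) by apply: continuous_measurable_fun; exact: (is_derive_cont is_derive_lch).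
(* For v = lch y / (n+1) <= 1 one has 1 - exp(-v) >= v / 2, so this truncation is at most 2 f. Fatou
   then bounds the integral of lch, which differs from |y| by at most ln 2. *)
pose g n y : R := if lch y <= n.+1%:R then lch y else 0.
have mg n : measurable_fun setT (g n) by apply: measurable_fun_ifT => //; exact: measurable_fun_ler.
have g0 n y : 0 <= g n y by rewrite /g; case: ifP => // _; exact: lch_ge0.
have gf n y : g n y <= 2 * f n y.
  rewrite /g; case: ifP => [hl|_]; last by rewrite mulr_ge0.
  pose v := n.+1%:R^-1 * lch y.
  have v0 : 0 <= v by rewrite mulr_ge0 ?invr_ge0 ?lch_ge0.
  have v1 : v <= 1 by rewrite /v mulrC ler_pdivrMr// mul1r.
  have ev := expR_ge1Dx v.
  have e1 : expR v * cut n y = 1 by rewrite /cut -/v expRxMexpNx_1.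
  have /andP[c0 c1] := cut01 n y.
  have h : (1 + v) * cut n y <= 1 by rewrite -[X in _ <= X]e1 ler_wpM2r.
  have h2 : v / 2 <= 1 - cut n y by nra.
  have -> : lch y = n.+1%:R * v by rewrite /v mulrA mulfV// mul1r.
  have h3 := ler_wpM2l (ltW (n0 n)) h2; rewrite /f; apply: le_trans (ler_wpM2l _ h3) => //.
  by rewrite le_eqVlt; apply/orP; left; apply/eqP; field.
have gK n : (\int[gam T]_y (g n y)%:E <= (2 * K)%:E)%E.
  have i2 := intgZ 2 measurableT (if_ n T).
  apply: (@le_trans _ _ (\int[gam T]_y (2 * f n y)%:E)%E).
    apply: ge0_le_integral => //.
    - by move=> y _; rewrite lee_fin.
    - exact/measurable_EFinP.
    - by apply/measurable_EFinP; exact: intg_meas i2.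
    - by move=> y _; rewrite lee_fin.
  by rewrite -(EFin_Rint measurableT i2) lee_fin (RintegralZl _ measurableT (if_ n T)) ler_wpM2l.
have il : intg (gam T) setT (lch : R -> R).
  apply: intg_ge0P => //; first by move=> y _; exact: lch_ge0.
  apply: (@le_lt_trans _ _ (2 * K)%:E); last exact: ltry.
  have mg' n : measurable_fun setT (fun y => (g n y)%:E) by exact/measurable_EFinP.
  have g0' n (y : R) : setT y -> (0 <= (g n y)%:E)%E by rewrite lee_fin.
  have := @fatou _ _ _ (gam T) setT measurableT (fun n y => (g n y)%:E) mg' g0'.
  rewrite (_ : (fun y : R => limn_einf _) = (fun y => (lch y)%:E)); last first.
    apply/funext => y; apply: (cvg_limn_einf_sup _).1.
    apply: cvg_EFin; first exact: nearW.
    apply: (@cvg_eventually _ _ _ (Num.bound (lch y))) => m hm.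
    rewrite /g ifT// (le_trans (ltW (archi_boundP (lch_ge0 y))))// ler_nat (leq_trans hm)//.
  move=> h; apply: (le_trans h).
  rewrite limn_einf_lim; apply: lime_le; first exact: is_cvg_einfs.
  apply: nearW => m; apply: le_trans (gK m).
  by apply: ereal_inf_lbound; exists m => //=.
apply: (intg_le measurableT _ (intgD measurableT il (intg_cst (gam T) (ln 2)))) => //.
by move=> y _; rewrite normr_id -lerBlDr lch_ge.
Qed.

End TailMoment.

(** * Times of finite limiting energy *)

Section RegularTimes.
Context {R : realType}.
Local Notation leb := (@lebesgue_measure R).
Variables (T C : R) (gam : R -> probability R R).
Local Notation U t := (p_distfun (gam t)).
Hypothesis T0 : 0 < T.
Hypothesis cV : continuous (fun z : R * R => U z.1 z.2).
Local Notation En n t := (\int[leb]_x fdens (gam t) n.+1%:R n.+1%:R^-1 x).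
Hypothesis iEn : forall n, intg leb `[0, T] (fun t => En n t).
Hypothesis EnC : forall n, \int[leb]_(t in `[0, T]) En n t <= C.

Let I : set (measurableTypeR R) := `[0, T]%classic.
Let mI : measurable I. Proof. exact: measurable_itv. Qed.

Let En0 n t : 0 <= En n t. Proof. by apply: Rintegral_ge0 => x _; apply: fdens_ge0. Qed.

Let liminf_energy t : \bar R := limn_einf (fun n => (En n t)%:E).

Let mliminf : measurable_fun I liminf_energy.
Proof.
rewrite /liminf_energy /limn_einf.
apply: measurableT_comp => //; apply: measurable_fun_limn_esup => n.
apply: measurableT_comp => //; apply/measurable_EFinP; exact: intg_meas (iEn n).
Qed.

Let liminf_ge0 t : (0 <= liminf_energy t)%E.
Proof.
rewrite /liminf_energy limn_einf_lim; apply: lime_ge; first exact: is_cvg_einfs.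
apply: nearW => n; apply: le_ereal_inf_tmp => _ [m _ <-]; exact: (En0 m t).
Qed.

Let int_liminf : (\int[leb]_(t in I) liminf_energy t <= C%:E)%E.
Proof.
have mE n : measurable_fun I (fun t => (En n t)%:E) by apply/measurable_EFinP; exact: intg_meas (iEn n).
have E0 n (t : measurableTypeR R) : I t -> (0 <= (En n t)%:E)%E by move=> _; rewrite lee_fin En0.
apply: (le_trans (@fatou _ _ _ leb I mI (fun n t => (En n t)%:E) mE E0)).
rewrite limn_einf_lim; apply: lime_le; first exact: is_cvg_einfs.
apply: nearW => m; apply: (@le_trans _ _ (\int[leb]_(t in I) (En m t)%:E)%E).
  by apply: ereal_inf_lbound; exists m => //=.
by rewrite -(EFin_Rint mI (iEn m)) lee_fin EnC.
Qed.

Let G : set (measurableTypeR R) := I `&` [set t | (liminf_energy t < +oo)%E].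

Let mG : measurable G. Proof. exact: (emeasurable_fun_infty_o mI mliminf). Qed.

(** The added 1 makes K t strictly larger than the lower limit, so arbitrarily large indices satisfy
    En <= K t; 0 is the default off [G]. *)
Let K t : R := if t \in G then fine (liminf_energy t) + 1 else 0.

Let good_subseq t : G t -> exists w : nat -> nat, forall n, (n <= w n)%N /\ En (w n) t <= K t.
Proof.
move=> Gt; have [It Jt] := Gt.
have h n : exists m, (n <= m)%N /\ En m t <= K t; last first.
  by have [w hw] := choice h; exists w.
apply: contrapT => /forallNP h.
have : ((K t)%:E <= liminf_energy t)%E.
  rewrite /liminf_energy limn_einf_lim; apply: lime_ge; first exact: is_cvg_einfs.
  exists n => // m nm; apply: le_ereal_inf_tmp => _ [j /= mj <-]; rewrite lee_fin.
  have := h j; move/not_andP => [|/negP]; first by rewrite (leq_trans nm mj).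
  by rewrite -ltNge => /ltW.
rewrite /K mem_set// EFinD fineK ?ge0_fin_numE//.
have f : liminf_energy t \is a fin_num by rewrite ge0_fin_numE.
by rewrite -{2}(fineK f) -{1}(fineK f) -EFinD lee_fin gerDl ler10.
Qed.

Let K0 t : 0 <= K t.
Proof. by rewrite /K; case: ifP => // _; rewrite addr_ge0// fine_ge0// liminf_ge0. Qed.

(** The subsequence, and with it the density, is obtained separately for each t; measurability in t
    is recovered through [dq]. *)
Let density_at t : G t -> exists p : R -> R,
  [/\ continuous p, (forall x, 0 <= p x), (forall x : R, is_derive x 1 (U t) (p x)),
    (forall B, measurable B -> gam t B = (\int[leb]_(x in B) (p x)%:E)%E) &
    (\int[leb]_x (p x ^+ 3)%:E <= (2 + 4 * K t)%:E)%E] /\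
  forall (M : R) (ps ps' : R -> R), 0 <= M ->
    (forall x : R, is_derive x 1 ps (ps' x)) -> continuous ps' -> ps M = 0 -> ps (- M) = 0 ->
    (\int[leb]_(x in `[- M, M]) (ps' x * p x)) ^+ 2 <= K t * \int[leb]_(x in `[- M, M]) (ps x ^+ 2 * p x).
Proof.
move=> Gt; have [w hw] := good_subseq Gt.
have cU : continuous (U t).
  move=> x; have h : (fun z : R => (t, z)) z @[z --> x] --> (t, x) by exact: (cvg_pair (cvg_cst t) cvg_id).
  pose V (z : R * R) := U z.1 z.2; have cV' : continuous V by exact: cV.
  exact: (cvg_comp _ _ h (cV' (t, x))).
apply: (@regular_density R (gam t) cU (K t) (fun n => (w n).+1%:R) (fun n => (w n).+1%:R^-1)) => //.
- by move=> n; rewrite ler_nat ltnS; case: (hw n).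
- move=> n; rewrite invr_gt0 ltr0n /=; rewrite lef_pV2 ?posrE// ler_nat ltnS; by case: (hw n).
- by move=> n; case: (hw n).
Qed.

(** Difference quotients of the distribution function are jointly measurable and converge to the
    densities found time by time, which makes the limit jointly measurable. *)
Let dq n (z : R * R) : R := if z.1 \in G then n.+1%:R * (U z.1 (z.2 + n.+1%:R^-1) - U z.1 z.2) else 0.

Let mdq n : measurable_fun setT (dq n).
Proof.
apply: measurable_fun_ifT => //.
  by apply: (measurableT_comp (measurable_mem mG)); exact: measurable_fst.
have mV := plane_continuous_measurable cV.
apply: measurable_funM => //; apply: measurable_funB => //.
rewrite (_ : (fun z => _) = (fun z : R * R => U z.1 z.2) \o (fun z : R * R => (z.1, z.2 + n.+1%:R^-1)))//.
apply: (measurableT_comp mV); apply: measurable_fun_pair; first exact: measurable_fst.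
by apply: measurable_funD => //; exact: measurable_snd.
Qed.

Let p z : R := limn (dq ^~ z).

Let dq_cvg t (x l : R) : G t -> is_derive x 1 (U t) l -> dq n (t, x) @[n --> \oo] --> l.
Proof.
move=> Gt dU; have [dv <-] := dU.
have cU : (fun h => h^-1 *: (U t (h *: (1 : R) + x) - U t x)) @ 0^' --> 'D_1 (U t) x by exact: dv.
have hc : (fun n : nat => n.+1%:R^-1 : R) @ \oo --> (0 : R)^'.
  move=> S hS; have : \forall n \near \oo, (n.+1%:R^-1 : R) != 0 -> S n.+1%:R^-1 := @cvg_harmonic R _ hS.
  by apply: filterS => n; apply; rewrite invr_eq0.
rewrite (_ : (fun n => dq n (t, x)) = (fun n => n.+1%:R^-1^-1 *: (U t (n.+1%:R^-1 *: (1 : R) + x) - U t x))).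
  exact: (cvg_comp _ _ hc cU).
by apply/funext => n; rewrite /dq /= mem_set// invrK /GRing.scale /= mulr1 [_ + x]addrC.
Qed.

Let dq_bad t x : ~ G t -> forall n, dq n (t, x) = 0.
Proof. by move=> nG n; rewrite /dq /= memNset. Qed.

Let pE t (x l : R) : G t -> is_derive x 1 (U t) l -> p (t, x) = l.
Proof. by move=> Gt dU; apply/cvg_lim => //; exact: dq_cvg. Qed.

(** By Fatou the lower limit of the energies is integrable, so it is finite at almost every time,
    and K is integrable. *)
Lemma regular_family : exists (p : R * R -> R) (G : set (measurableTypeR R)) (K : R -> R),
  [/\ measurable_fun setT p, (forall z, 0 <= p z), measurable G & G `<=` `[0, T]%classic] /\
  [/\ leb (`[0, T]%classic `\` G) = 0%E, (forall t x, ~ G t -> p (t, x) = 0), (forall t, 0 <= K t) &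
     intg leb `[0, T] K] /\
  forall t, G t ->
  [/\ continuous (fun x => p (t, x)), (forall x : R, is_derive x 1 (U t) (p (t, x))),
    (forall B, measurable B -> gam t B = (\int[leb]_(x in B) (p (t, x))%:E)%E) &
    (\int[leb]_x (p (t, x) ^+ 3)%:E <= (2 + 4 * K t)%:E)%E] /\
  forall (M : R) (ps ps' : R -> R), 0 <= M ->
    (forall x : R, is_derive x 1 ps (ps' x)) -> continuous ps' -> ps M = 0 -> ps (- M) = 0 ->
    (\int[leb]_(x in `[- M, M]) (ps' x * p (t, x))) ^+ 2 <= K t * \int[leb]_(x in `[- M, M]) (ps x ^+ 2 * p (t, x)).
Proof.
exists p, G, K.
have fam t : G t -> exists2 q : R -> R, (forall x, p (t, x) = q x) & (forall x, 0 <= q x) /\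
  [/\ continuous q, (forall x : R, is_derive x 1 (U t) (q x)),
    (forall B, measurable B -> gam t B = (\int[leb]_(x in B) (q x)%:E)%E) &
    (\int[leb]_x (q x ^+ 3)%:E <= (2 + 4 * K t)%:E)%E] /\
  forall (M : R) (ps ps' : R -> R), 0 <= M ->
    (forall x : R, is_derive x 1 ps (ps' x)) -> continuous ps' -> ps M = 0 -> ps (- M) = 0 ->
    (\int[leb]_(x in `[- M, M]) (ps' x * q x)) ^+ 2 <= K t * \int[leb]_(x in `[- M, M]) (ps x ^+ 2 * q x).
  move=> Gt; have [q [[q1 q2 q3 q4 q5] q6]] := density_at Gt.
  by exists q => [x|]; [exact: pE|].
have pbad t x : ~ G t -> p (t, x) = 0.
  move=> nG; apply/cvg_lim => //; under eq_fun do rewrite (dq_bad _ nG); exact: cvg_cst.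
split; [split|split; [split|]].
- apply: (measurable_fun_cvg mdq) => -[t x] _.
  have [Gt|nG] := pselect (G t).
    have [q e [_ [[_ d _ _] _]]] := fam t Gt.
    by apply/cvg_ex; exists (q x); exact: dq_cvg.
  by apply/cvg_ex; exists 0; under eq_fun do rewrite (dq_bad _ nG); exact: cvg_cst.
- move=> [t x]; have [Gt|nG] := pselect (G t); last by rewrite pbad.
  by have [q -> [h _]] := fam t Gt.
- exact: mG.
- by move=> t [].
- have iJ : leb.-integrable I liminf_energy.
    apply/integrableP; split; first exact: mliminf.
    apply: (@le_lt_trans _ _ C%:E); last exact: ltry.
    apply: le_trans int_liminf; rewrite le_eqVlt; apply/orP; left; apply/eqP.
    by apply: eq_integral => t _; rewrite gee0_abs.
  have [Z [mZ Z0 hZ]] := integrable_ae mI iJ.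
  apply: (@subset_measure0 _ _ _ leb _ Z) => //; first exact: measurableD.
  move=> t [It nG]; apply: hZ => /= h; apply: nG; split => //=.
  by rewrite -ge0_fin_numE//; exact: h.
- exact: pbad.
- exact: K0.
- have mK : measurable_fun I K.
    apply: measurable_fun_if => //.
    + by apply: measurable_funTS; exact: measurable_mem.
    + apply: measurable_funD => //; apply: measurableT_comp => //.
      by apply: measurable_funS mliminf => // t [].
  apply: intg_ge0P => //.
  apply: (@le_lt_trans _ _ (\int[leb]_(t in I) (liminf_energy t + 1%:E))%E).
    apply: ge0_le_integral => //.
    + by move=> t _; rewrite lee_fin K0.
    + exact/measurable_EFinP.
    + exact: (emeasurable_funD mliminf).
    move=> t _; rewrite /K; case: ifPn => [/set_mem [_ Jt]|_]; last by rewrite adde_ge0.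
    by rewrite EFinD fineK// ge0_fin_numE.
  rewrite ge0_integralD//; apply: lte_add_pinfty; first by rewrite (le_lt_trans int_liminf) ?ltry.
  rewrite integral_cst// mul1e; have := ltry (T - 0); rewrite -(lebesgue_seg (ltW T0)); exact.
move=> t Gt; have [q e [_ [[q1 q3 q4 q5] q6]]] := fam t Gt.
have E : (fun x => p (t, x)) = q by apply/funext.
split; last first.
  move=> M ps ps' M0 d c h1 h2; have := q6 M ps ps' M0 d c h1 h2.
  by under eq_Rintegral do rewrite -e; under [X in _ <= _ * X -> _]eq_Rintegral do rewrite -e.
split; first by rewrite E.
- by move=> x; rewrite e.
- by move=> B mB; rewrite q4//; apply: eq_integral => x _; rewrite e.
- by apply: le_trans q5; rewrite le_eqVlt; apply/orP; left; apply/eqP; apply: eq_integral => x _; rewrite e.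
Qed.

End RegularTimes.

(** * The second derivative by duality *)

Section Support.
Context d (X : measurableType d) {R : realType} (mu : {measure set X -> \bar R}).

Lemma Rint_support (D : set X) (f : X -> R) : (forall x, ~ D x -> f x = 0) ->
  \int[mu]_(x in D) f x = \int[mu]_x f x.
Proof.
move=> f0; rewrite Rintegral_mkcond; apply: eq_Rintegral => x _.
by rewrite patchE; case: ifPn => // /negP xD; rewrite f0// => Dx; apply: xD; rewrite inE.
Qed.

Lemma intg_support (D : set X) (f : X -> R) : measurable D -> (forall x, ~ D x -> f x = 0) ->
  intg mu D f -> intg mu setT f.
Proof.
move=> mD f0 i; have : mu.-integrable setT ((EFin \o f) \_ D) by apply/(integrable_mkcond _ mD).
rewrite (_ : _ \_ D = EFin \o f)//; apply/funext => x; rewrite patchE.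
by case: ifPn => // /negP xD; rewrite /= f0// => Dx; apply: xD; rewrite inE.
Qed.

End Support.

Section SecondDerivative.
Context {R : realType}.
Local Notation leb := (@lebesgue_measure R).
Local Notation m2 := (leb \x leb)%E.
Variables (T : R) (p : R * R -> R) (G : set (measurableTypeR R)) (K : R -> R).
Hypothesis mp : measurable_fun setT p.
Hypothesis p0 : forall z, 0 <= p z.
Hypothesis mG : measurable G.
Hypothesis GI : G `<=` `[0, T]%classic.
Hypothesis pbad : forall t x, ~ G t -> p (t, x) = 0.
Hypothesis K0 : forall t, 0 <= K t.
Hypothesis iK : intg leb `[0, T] K.
Hypothesis p1 : forall t, G t -> (\int[leb]_x (p (t, x))%:E = 1)%E.
Hypothesis by_parts : forall t, G t -> forall (M : R) (ps ps' : R -> R), 0 <= M ->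
  (forall x : R, is_derive x 1 ps (ps' x)) -> continuous ps' -> ps M = 0 -> ps (- M) = 0 ->
  (\int[leb]_(x in `[- M, M]) (ps' x * p (t, x))) ^+ 2 <= K t * \int[leb]_(x in `[- M, M]) (ps x ^+ 2 * p (t, x)).

Lemma intg_by_density (f : R * R -> R) (C : R) : measurable_fun setT f -> (forall z, `|f z| <= C) ->
  intg m2 setT (fun z => f z * p z).
Proof.
move=> mf fC; have C0 : 0 <= C := le_trans (normr_ge0 _) (fC 0).
have mI : measurable (`[0, T]%classic : set (measurableTypeR R)) by exact: measurable_itv.
have mfp : measurable_fun setT (fun z => f z * p z) by exact: measurable_funM.
have iC : intg leb G (cst C).
  by apply: (intgS mI mG GI); apply: intg_cont_seg => z; exact: cvg_cst.
have h : forall t, G t -> (\int[leb]_x (`|f (t, x) * p (t, x)|)%:E <= (cst C t)%:E)%E.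
  move=> t Gt; rewrite -[leRHS]mule1 -(p1 Gt) -ge0_integralZl//.
  - apply: ge0_le_integral => //.
    + by apply/measurable_EFinP; apply: measurableT_comp => //; exact: (measurableT_comp mfp (measurable_pair1 t)).
    + by apply/measurable_EFinP; apply: measurable_funM => //; exact: (measurableT_comp mp (measurable_pair1 t)).
    by move=> x _; rewrite -EFinM lee_fin normrM [`|p _|]ger0_norm// ler_wpM2r.
  - by apply/measurable_EFinP; exact: (measurableT_comp mp (measurable_pair1 t)).
  - by move=> x _; rewrite lee_fin.
have := @prod_intgP _ _ _ _ R leb leb _ _ _ mG mfp iC h; rewrite (_ : (fun z => _) = (fun z => f z * p z))//.
apply/funext => -[t x] /=; rewrite indicE; have [Gt|nG] := pselect (G t); first by rewrite mem_set// mul1r.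
by rewrite memNset// mul0r pbad// mulr0.
Qed.

(* The functions psi = [ps] with derivative [psx] for which the by-parts bound holds; products A(R) phi
   are not smooth, hence the weak requirements. *)
Definition test_pair (ps psx : R * R -> R) := exists M C : R,
  [/\ measurable_fun setT ps, measurable_fun setT psx, intg m2 setT (fun z => psx z * p z) & 0 <= M] /\
  [/\ (forall z, `|ps z| <= C), (forall t x, M <= `|x| -> ps (t, x) = 0 /\ psx (t, x) = 0) &
   forall t, G t -> (forall x : R, is_derive x 1 (fun y => ps (t, y)) (psx (t, x))) /\
    continuous (fun x => psx (t, x))].

(** Multiplying by sqrt p turns the weighted norm of psi into the plain L2 norm on the plane;
    several pairs may give the same f, which a graph tolerates. *)
Let W f l := exists ps psx, [/\ test_pair ps psx, f = (fun z => Num.sqrt (p z) * ps z) &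
  l = - \int[m2]_z (psx z * p z)].

Let W0 : W (cst 0) 0.
Proof.
exists (cst 0), (cst 0); split.
- exists 0, 0; split; first split => //.
    by apply: (@intg_by_density _ 0) => // z; rewrite normr0.
  split => // [z|t Gt].
    by rewrite normr0.
  by split => [x|]; [exact: is_derive_cst|exact: cst_continuous].
- by apply/funext => z; rewrite /= mulr0.
- by under eq_Rintegral do rewrite mul0r; rewrite /Rintegral integral0 oppr0.
Qed.

Let WD f g l m (c : R) : W f l -> W g m -> W (fun x => f x + c * g x) (l + c * m).
Proof.
move=> [ps [psx [[M [C [[m1 mx i M0] [bd z0 d1]]]] -> ->]]] [qs [qsx [[M' [C' [[m1' mx' i' M0'] [bd' z0' d1']]]] -> ->]]].
have ic := intgZ c measurableT i'.
exists (fun z => ps z + c * qs z), (fun z => psx z + c * qsx z); split.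
- exists (Num.max M M'), (C + `|c| * C'); split; first split.
  + by apply: measurable_funD => //; apply: measurable_funM.
  + by apply: measurable_funD => //; apply: measurable_funM.
  + have := intgD measurableT i ic; congr (intg _ _ _); apply/funext => z.
    by rewrite mulrDl mulrA.
  + by rewrite le_max M0.
  split.
  + move=> z; apply: (le_trans (ler_normD _ _)); rewrite normrM.
    by apply: lerD => //; apply: ler_wpM2l.
  + move=> t x; rewrite ge_max => /andP[h h'].
    by have [-> ->] := z0 t x h; have [-> ->] := z0' t x h'; rewrite mulr0 addr0.
  move=> t Gt; have [d cd] := d1 t Gt; have [d' cd'] := d1' t Gt; split.
    by move=> x; apply: is_deriveD; apply: is_deriveZ.
  move=> x; apply: cvgD; first exact: cd.
  by apply: cvgM; [exact: cvg_cst|exact: cd'].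
- by apply/funext => z; rewrite mulrDr mulrCA.
rewrite mulrN -opprD; congr (- _).
transitivity (\int[m2]_z (psx z * p z + c * (qsx z * p z))).
  by rewrite (RintegralD measurableT i ic) (RintegralZl c measurableT i').
by apply: eq_Rintegral => z _; rewrite mulrDl mulrA.
Qed.

Let Wm f l : W f l -> measurable_fun setT f.
Proof.
move=> [ps [psx [[M [C [[m1 mx i M0] _]]] -> _]]].
apply: measurable_funM => //; apply: (measurableT_comp _ mp); exact: (continuous_measurable_fun (@sqrt_continuous R)).
Qed.

Let sqE ps z : (Num.sqrt (p z) * ps z) ^+ 2 = ps z ^+ 2 * p z.
Proof. by rewrite exprMn sqr_sqrtr// mulrC. Qed.

Let isq (ps : R * R -> R) (C : R) : measurable_fun setT ps -> (forall z, `|ps z| <= C) -> intg m2 setT (fun z => ps z ^+ 2 * p z).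
Proof.
move=> m1 bd; apply: (@intg_by_density _ (C ^+ 2)); first exact: measurable_funX.
by move=> z; rewrite normrX lerXn2r// nnegrE// (le_trans (normr_ge0 _) (bd z)).
Qed.

Let Wi f l : W f l -> intg m2 setT (fun x => f x ^+ 2).
Proof.
move=> [ps [psx [[M [C [[m1 mx i M0] [bd _ _]]]] -> _]]].
have := isq m1 bd; congr (intg _ _ _); apply/funext => z; exact/esym/sqE.
Qed.

Let Kb t := if t \in G then K t else 0.

Let iKb : intg leb setT Kb.
Proof.
have mI : measurable (`[0, T]%classic : set (measurableTypeR R)) by exact: measurable_itv.
have i : intg leb G Kb.
  have := intgS mI mG GI iK; apply: eq_integrable => // t Gt; by rewrite /= /Kb Gt.
by apply: (intg_support mG _ i) => t nG; rewrite /Kb memNset.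
Qed.

(** At each time the by-parts bound reads |u t| <= sqrt(Kb t) sqrt(v t); Cauchy-Schwarz in t then
    yields the constant, the integral of Kb. *)
Let WC f l : W f l -> l ^+ 2 <= (\int[leb]_t Kb t) * \int[m2]_x (f x ^+ 2).
Proof.
move=> [ps [psx [[M [C [[m1 mx i M0] [bd z0 d1]]]] -> ->]]].
have i2 := isq m1 bd.
have -> : \int[m2]_x ((Num.sqrt (p x) * ps x) ^+ 2) = \int[m2]_z (ps z ^+ 2 * p z).
  by apply: eq_Rintegral => z _; exact: sqE.
have [iu _ <- _] := Rfubini i; have [iv _ <- _] := Rfubini i2.
set u := (fun t => \int[leb]_y (psx (t, y) * p (t, y))) in iu *.
set v := (fun t => \int[leb]_y (ps (t, y) ^+ 2 * p (t, y))) in iv *.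
have v0 t : 0 <= v t by apply: Rintegral_ge0 => y _; rewrite mulr_ge0// sqr_ge0.
have Kb0 t : 0 <= Kb t by rewrite /Kb; case: ifP.
have uv t : u t ^+ 2 <= Kb t * v t.
  have [Gt|nG] := pselect (G t); last first.
    rewrite /Kb memNset// mul0r /u; under eq_Rintegral do rewrite pbad// mulr0.
    by rewrite /Rintegral integral0 expr0n.
  have [d cd] := d1 t Gt; rewrite /Kb mem_set//.
  have := by_parts Gt M0 d cd (z0 t M (ler_norm _)).1 (z0 t (- M) _).1.
  rewrite normrN ler_norm => /(_ isT).
  have off (x : measurableTypeR R) : ~ `[- M, M]%classic x -> M <= `|x|.
    by move=> /= /negP; rewrite in_itv/= -ler_norml -ltNge => /ltW.
  rewrite (@Rint_support _ _ _ leb `[- M, M]%classic (fun x => psx (t, x) * p (t, x))); last first.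
    by move=> x /off h; have [_ ->] := z0 t x h; rewrite mul0r.
  rewrite (@Rint_support _ _ _ leb `[- M, M]%classic (fun x => ps (t, x) ^+ 2 * p (t, x))); last first.
    by move=> x /off h; have [-> _] := z0 t x h; rewrite expr0n mul0r.
  exact.
have mK := intg_meas iKb; have mv := intg_meas iv.
have ms (g : R -> R) : measurable_fun setT g -> measurable_fun setT (fun t => Num.sqrt (g t)).
  by move=> mg; apply: (measurableT_comp _ mg); exact: (continuous_measurable_fun (@sqrt_continuous R)).
have iK' : intg leb setT (fun t => Num.sqrt (Kb t) ^+ 2).
  by move: iKb; congr (intg _ _ _); apply/funext => t; rewrite sqr_sqrtr.
have iv' : intg leb setT (fun t => Num.sqrt (v t) ^+ 2).
  by move: iv; congr (intg _ _ _); apply/funext => t; rewrite sqr_sqrtr.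
have [iKv CS] := @L2_CS _ (measurableTypeR R) R leb _ _ (ms _ mK) (ms _ mv) iK' iv'.
rewrite sqrrN (_ : \int[leb]_t Kb t = \int[leb]_t (Num.sqrt (Kb t) ^+ 2)); last first.
  by apply: eq_Rintegral => t _; rewrite sqr_sqrtr.
rewrite (_ : \int[leb]_x v x = \int[leb]_t (Num.sqrt (v t) ^+ 2)); last first.
  by apply: eq_Rintegral => t _; rewrite sqr_sqrtr.
have r0 : 0 <= \int[leb]_t (Num.sqrt (Kb t) * Num.sqrt (v t)).
  by apply: Rintegral_ge0 => t _; apply: mulr_ge0; exact: sqrtr_ge0.
apply: le_trans CS; rewrite -(ger0_norm r0) -[leRHS]real_normK ?num_real// normr_id.
rewrite -[leLHS]real_normK ?num_real//; apply: lerXn2r; rewrite ?nnegrE ?normr_ge0// (ger0_norm r0).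
apply: (le_trans (le_normr_Rintegral measurableT iu)).
apply: (le_Rintegral measurableT (intg_norm measurableT iu) iKv) => t _.
by rewrite -sqrtrM// -sqrtr_sqr ler_wsqrtr.
Qed.

Lemma second_derivative_density : exists z : R * R -> R,
  [/\ measurable_fun setT z, intg m2 setT (fun x => z x ^+ 2) &
   forall ps psx, test_pair ps psx ->
     intg m2 setT (fun x => Num.sqrt (p x) * ps x * z x) /\
     \int[m2]_x (Num.sqrt (p x) * ps x * z x) = - \int[m2]_x (psx x * p x)].
Proof.
have C0 : 0 <= \int[leb]_t Kb t by apply: Rintegral_ge0 => t _; rewrite /Kb; case: ifP.
have [z [mz iz hz]] := @Riesz_representation _ (measurableTypeR R * measurableTypeR R)%type R m2 _ _ W0 WD Wm Wi C0 WC.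
by exists z; split => // ps psx h; apply: hz; exists ps, psx.
Qed.

End SecondDerivative.

(** * The initial density *)

Section InitialDensity.
Context {R : realType}.
Local Notation leb := (@lebesgue_measure R).
Implicit Types (rho : probability R R) (q : R -> R).

(** No sign is prescribed for q, but the set where q < 0 has nonpositive, hence zero, mass. *)
Lemma positive_part_density rho (q : R -> R) : measurable_fun setT q ->
  (forall B, measurable B -> rho B = (\int[leb]_(x in B) (q x)%:E)%E) ->
  forall B, measurable B -> rho B = (\int[leb]_(x in B) (Num.max (q x) 0)%:E)%E.
Proof.
move=> mq hq B mB; pose P : set R := [set x | 0 <= q x].
have mP : measurable P.
  rewrite (_ : P = setT `&` q @^-1` `[0, +oo[%classic); first exact: mq.
  by rewrite setTI; apply/seteqP; split => x /=; rewrite in_itv/= andbT.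
have mN : measurable (~` P) by exact: measurableC.
have mBP : measurable (B `&` P) by exact: measurableI.
have mBN : measurable (B `&` ~` P) by exact: measurableI.
have N0 : rho (B `&` ~` P) = 0%E.
  apply/eqP; rewrite eq_le measure_ge0 andbT hq//.
  have q0 x : (B `&` ~` P) x -> (0 <= (- q x)%:E)%E.
    by move=> [_ /negP]; rewrite -ltNge lee_fin oppr_ge0 => /ltW.
  rewrite (_ : (\int[leb]_(x in _) _)%E = (- \int[leb]_(x in B `&` ~` P) (- q x)%:E)%E).
    by rewrite oppe_le0; exact: integral_ge0.
  by rewrite -integral_ge0N//; apply: eq_integral => x _; rewrite -EFinN opprK.
have dis : [disjoint B `&` P & B `&` ~` P].
  by apply/disj_setPS => x [[_ h] [_ h']]; exact: h'.
have BE : B = (B `&` P) `|` (B `&` ~` P) by rewrite -setIUr setUv setIT.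
have E : (rho B = rho (B `&` P) + rho (B `&` ~` P))%E.
  by rewrite {1}BE measureU//; apply/disj_set2P.
rewrite E N0 adde0 hq// integral_mkcondr; apply: eq_integral => x _.
rewrite patchE; case: ifPn => [/set_mem Px|/negP nP]; first by congr (_ %:E); apply/esym/max_idPl.
congr (_ %:E); apply/esym/max_idPr; have /negP : ~ P x by move=> Px; apply: nP; rewrite inE.
by rewrite -ltNge => /ltW.
Qed.

(** Jensen for the kernel om(x - y): the square of the mollified density is at most the
    mollification of q^2, and q is in L2 because q^2 <= q + q^3. *)
Lemma dens_square_bound rho q : measurable_fun setT q -> (forall x, 0 <= q x) ->
  (forall B, measurable B -> rho B = (\int[leb]_(x in B) (q x)%:E)%E) ->
  (\int[leb]_x (q x ^+ 3)%:E < +oo)%E ->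
  exists Th : R, forall b : R, 0 < b -> intg leb setT (fun x => dens rho b x ^+ 2) /\
    \int[leb]_x (dens rho b x ^+ 2) <= Th.
Proof.
move=> mq q0 hq q3.
have mT : measurable (setT : set (measurableTypeR R)) by exact: measurableT.
have iq : intg leb setT q.
  by apply: intg_ge0P => //; rewrite -hq// probability_setT ltry.
have iq3 : intg leb setT (fun x => q x ^+ 3).
  by apply: intg_ge0P => //; [exact: measurable_funX|move=> x _; exact: exprn_ge0].
have iq2 : intg leb setT (fun x => q x ^+ 2).
  apply: (intg_le mT _ (intgD mT iq iq3)); first exact: measurable_funX.
  move=> x _; have := q0 x; move: (q x) => r r0.
  rewrite !ger0_norm ?addr_ge0 ?exprn_ge0//.
  have : 0 <= r * (r - 1) ^+ 2 by rewrite mulr_ge0 ?sqr_ge0.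
  nra.
exists (\int[leb]_x (q x ^+ 2)) => b b0.
have mom x : measurable_fun setT (fun y : R => om b (x - y)).
  by apply: continuous_measurable_fun; apply: continuous_reflect; exact: continuous_om.
have om0 u : 0 <= om b u by exact/ltW/om_gt0.
have iom (x : R) : intg leb setT (fun y => om b (x - y)).
  apply: intg_ge0P => //; first exact: mom.
  rewrite (_ : (fun y => _) = (fun y => (om b (y - x))%:E)); first by rewrite int_om// ltry.
  by apply/funext => y; rewrite -opprB om_even.
have Iom (x : R) : \int[leb]_y om b (x - y) = 1.
  rewrite /Rintegral (_ : (fun y => _) = (fun y => (om b (y - x))%:E)); first by rewrite int_om.
  by apply/funext => y; rewrite -opprB om_even.
have iqom (f : R -> R) x : intg leb setT f -> intg leb setT (fun y => f y * om b (x - y)).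
  move=> i; apply: (intgM mT i (mom x) (C := b)) => y _; exact: om_bd.
have intq (f : R -> R) x : measurable_fun setT f -> (forall y, 0 <= f y) ->
    (\int[rho]_y (f y * om b (x - y))%:E = \int[leb]_y (f y * om b (x - y) * q y)%:E)%E.
  move=> mf f0; apply: density_integral => //; first exact: measurable_funM.
  by move=> y; rewrite mulr_ge0.
have dE x : dens rho b x = \int[leb]_y (q y * om b (x - y)).
  rewrite densE// /Rintegral; congr fine.
  have := intq (cst 1) x (measurable_cst _) (fun=> ler01).
  rewrite (_ : (fun y => (cst 1 y * om b (x - y))%:E) = (fun y => (om b (x - y))%:E)).
    move=> ->; apply: eq_integral => y _; by rewrite mul1r mulrC.
  by apply/funext => y; rewrite mul1r.
have le x : ((dens rho b x ^+ 2)%:E <= \int[rho]_y (q y * om b (x - y))%:E)%E.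
  rewrite intq// (_ : (fun y => _) = (fun y => (q y ^+ 2 * om b (x - y))%:E)); last first.
    by apply/funext => y; rewrite mulrAC -expr2.
  have i2 := iqom _ x iq2; rewrite -(EFin_Rint mT i2) lee_fin dE.
  have [_] := weighted_CS mT mq (fun y _ => om0 (x - y)) (iom x) i2.
  by rewrite Iom mul1r.
have md : measurable_fun setT (fun x => dens rho b x ^+ 2).
  by apply: measurable_funX; apply: continuous_measurable_fun; exact: continuous_dens.
have mq2 : measurable_fun setT (fun z : R * R => (q z.2 * om b (z.1 - z.2))%:E).
  apply/measurable_EFinP; apply: measurable_funM; first exact: (measurableT_comp mq measurable_snd).
  apply: (measurableT_comp (continuous_measurable_fun (@continuous_om _ b))).
  by apply: measurable_funB; [exact: measurable_fst|exact: measurable_snd].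
apply: Rint_ge0_le => //.
  by move=> x _; exact: sqr_ge0.
apply: (@le_trans _ _ (\int[leb]_x \int[rho]_y (q y * om b (x - y))%:E)%E).
  apply: ge0_le_integral => //.
  - by move=> x _; rewrite lee_fin sqr_ge0.
  - exact/measurable_EFinP.
  - by apply: (measurable_fun_fubini_tonelli_F _ mq2) => z; rewrite lee_fin mulr_ge0.
rewrite tonelli_conv// (density_integral mq q0 hq mq q0) (EFin_Rint mT iq2).
by rewrite (_ : (fun x => (q x * q x)%:E) = (fun x => (q x ^+ 2)%:E)).
Qed.

End InitialDensity.

(** * Extension of the solution to all times *)

Section Clamp.
Context {R : realType}.

(** Freezing the curve outside [0, T] extends continuity and measurability to all times, so that
    families are indexed by the whole line. *)
Definition clamp (T t : R) := Num.max 0 (Num.min t T).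

Lemma clamp_bounds T t : 0 < T -> 0 <= clamp T t <= T.
Proof. by move=> T0; rewrite /clamp le_max lexx /= ge_max (ltW T0) ge_min lexx orbT. Qed.

Lemma clamp_id T t : 0 <= t <= T -> clamp T t = t.
Proof. by move=> /andP[t0 tT]; rewrite /clamp (min_idPl tT); apply/max_idPr. Qed.

Lemma continuous_clamp T : continuous (clamp T).
Proof.
move=> t; have c0 : {for t, continuous (cst (0 : R) : R -> R^o)} by exact: cst_continuous.
have c1 : {for t, continuous (id : R -> R^o)} by exact: cvg_id.
have cT : {for t, continuous (cst T : R -> R^o)} by exact: cst_continuous.
exact: (continuous_max c0 (continuous_min c1 cT)).
Qed.

End Clamp.

Section Extension.
Context {R : realType}.
Local Notation leb := (@lebesgue_measure R).
Variables (T : R) (A : R -> R) (U : R * R -> R) (gamma : R -> probability R R) (h : R * R -> R).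
Hypothesis T0 : 0 < T.
Hypothesis cU : {within p_RT T, continuous U}.
Hypothesis UE : forall t, 0 <= t <= T -> forall x, U (t, x) = p_distfun (gamma t) x.
Hypothesis mh : measurable_fun setT h.
Hypothesis hfin : (\int[p_leb R]_(t in [set t : R | (0 <= t <= T)%R])
      \int[gamma t]_x ((h (t, x)) ^+ 2)%R%:E < +oo)%E.
Hypothesis gsol : p_gen_solution T A U gamma h.
Variables (B B' : R -> R) (a0 a1 L : R).
Hypothesis a0p : 0 < a0.
Hypothesis BA : forall y, 0 <= y <= 1 -> B y = A y /\ a0 <= B y <= a1.
Hypothesis dB : forall y : R, 0 <= y <= 1 -> is_derive y 1 B (B' y).
Hypothesis BL : forall y z, 0 <= y <= 1 -> 0 <= z <= 1 -> `|B y - B z| <= L * `|y - z|.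

Definition extended_curve t := gamma (clamp T t).
Local Notation gam := extended_curve.
Local Notation V t := (p_distfun (gam t)).

Lemma extended_distfun_cont : continuous (fun z : R * R => V z.1 z.2).
Proof.
pose c (z : R * R) : R * R := (clamp T z.1, z.2).
rewrite (_ : (fun z => _) = U \o c); last first.
  by apply/funext => -[t x]; rewrite /c /= UE// clamp_bounds.
move=> z; have cz : p_RT T (c z) by exact: clamp_bounds.
have cc : c @ z --> c z.
  have c1 : fst @ z --> z.1 by exact: cvg_fst.
  have c2 : snd @ z --> z.2 by exact: cvg_snd.
  exact: (cvg_pair (cvg_comp _ _ c1 (@continuous_clamp _ T z.1)) c2).
have Uc : U @ within (p_RT T) (nbhs (c z)) --> U (c z).
  by have /subspace_continuousP := cU; apply.
apply: (cvg_comp _ _ _ Uc).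
move=> S hS; have hn : nbhs z (fun w => p_RT T (c w) -> S (c w)) := cc _ hS.
suff : nbhs z (fun w => S (c w)) by [].
by apply: filterS hn => w; apply; exact: (clamp_bounds w.1 T0).
Qed.

Let V01 t x : 0 <= V t x <= 1. Proof. by rewrite distfun_ge0 distfun_le1. Qed.

Let mV : measurable_fun setT (fun z : R * R => V z.1 z.2).
Proof. exact: plane_continuous_measurable extended_distfun_cont. Qed.

Lemma extended_family_measurable (S : set R) : measurable S -> measurable_fun setT (fun t => gam t S).
Proof.
apply: measurable_family => x; exact: (measurableT_comp mV (measurable_pair2 x)).
Qed.

Definition coef t y := B (V t y).

Lemma coef_cont : continuous (fun z : R * R => coef z.1 z.2).
Proof.
move=> z; have [dv _] := dB (V01 z.1 z.2).
have cB : {for V z.1 z.2, continuous B} by apply/differentiable_continuous; apply/derivable1_diffP.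
pose W (w : R * R) := V w.1 w.2; have cW : {for z, continuous W} by exact: extended_distfun_cont.
exact: (continuous_comp cW cB).
Qed.

Lemma coef_measurable : measurable_fun setT (fun z : R * R => coef z.1 z.2).
Proof. exact: plane_continuous_measurable coef_cont. Qed.

Lemma coef_ge t y : a0 <= coef t y.
Proof. by have [_ /andP[]] := BA (V01 t y). Qed.

Lemma coef_le t y : coef t y <= a1.
Proof. by have [_ /andP[]] := BA (V01 t y). Qed.

Lemma coef_lip t x y : `|coef t y - coef t x| <= L * `|V t y - V t x|.
Proof. exact: BL. Qed.

Let a1p : 0 < a1. Proof. by apply: (lt_le_trans a0p); apply: le_trans (coef_ge 0 0) (coef_le 0 0). Qed.

Let hc (z : R * R) : R := h (clamp T z.1, z.2).

Let mhc : measurable_fun setT hc.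
Proof.
apply: (measurableT_comp mh); apply: measurable_fun_pair; last exact: measurable_snd.
apply: (measurableT_comp (continuous_measurable_fun (@continuous_clamp _ T))); exact: measurable_fst.
Qed.

Let H t : \bar R := (\int[gam t]_y (hc (t, y) ^+ 2)%:E)%E.

Let mH : measurable_fun setT H.
Proof.
apply: (measurable_int_fam extended_family_measurable (f := fun z => (hc z ^+ 2)%:E)).
  by apply/measurable_EFinP; exact: measurable_funX.
by move=> z; rewrite lee_fin sqr_ge0.
Qed.

Let H0 t : (0 <= H t)%E. Proof. by apply: integral_ge0 => y _; rewrite lee_fin sqr_ge0. Qed.

Let I (t : R) : set (measurableTypeR R) := `[0, t]%classic.

Let mI t : measurable (I t). Proof. exact: measurable_itv. Qed.

Let IE t : [set s : R | 0 <= s <= t] = I t.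
Proof. by apply/seteqP; split => s; rewrite /I /= in_itv. Qed.

Let IT t s : 0 <= t <= T -> I t s -> 0 <= s <= T.
Proof. by move=> /andP[_ tT]; rewrite /I /= in_itv/= => /andP[-> st]; exact: le_trans st tT. Qed.

Let Hfin : (\int[leb]_(t in I T) H t < +oo)%E.
Proof.
move: hfin; rewrite /p_leb IE; congr (_ < _)%E; apply: eq_integral => t /set_mem tI.
by rewrite /H /hc /extended_curve /= clamp_id// -in_itv.
Qed.

Let E : set (measurableTypeR R) := setT `&` [set t | (H t < +oo)%E].

Let mE : measurable E. Proof. exact: (emeasurable_fun_infty_o measurableT mH). Qed.

(* Times at which h is not square integrable against gamma(t) form a null set. Setting the drift to 0
   there makes every statement below valid at all times. *)
Definition drift t y := if t \in E then hc (t, y) * coef t y else 0.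

Lemma drift_measurable : measurable_fun setT (fun z : R * R => drift z.1 z.2).
Proof.
apply: measurable_fun_ifT => //.
  by apply: (measurableT_comp (measurable_mem mE)); exact: measurable_fst.
apply: measurable_funM; last exact: coef_measurable.
by rewrite (_ : (fun z => _) = hc)//; apply/funext => -[].
Qed.

Let mhct t : measurable_fun setT (fun y : R => hc (t, y)).
Proof. exact: (measurableT_comp mhc (measurable_pair1 t)). Qed.

Let mdt t : measurable_fun setT (drift t).
Proof. exact: (measurableT_comp drift_measurable (measurable_pair1 t)). Qed.

Let ihc t : E t -> intg (gam t) setT (fun y => hc (t, y) ^+ 2).
Proof.
move=> [_ Et]; apply: intg_ge0P => //; first exact: measurable_funX.
by move=> y _; exact: sqr_ge0.
Qed.

Let drift_sq t y : E t -> drift t y ^+ 2 <= a1 ^+ 2 * hc (t, y) ^+ 2.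
Proof.
move=> Et; rewrite /drift mem_set// exprMn mulrC ler_wpM2r ?sqr_ge0//.
by rewrite lerXn2r ?nnegrE ?coef_le ?(ltW a1p)// (le_trans (ltW a0p) (coef_ge _ _)).
Qed.

Lemma drift_square_integrable t : intg (gam t) setT (fun y => drift t y ^+ 2).
Proof.
have [Et|nE] := pselect (E t).
  apply: (intg_le measurableT _ (intgZ (a1 ^+ 2) measurableT (ihc Et))).
    exact: measurable_funX (mdt t).
  by move=> y _; rewrite ger0_norm ?sqr_ge0//; exact: drift_sq.
rewrite (_ : (fun y => _) = cst 0); first exact: intg_cst.
by apply/funext => y; rewrite /drift memNset// expr0n.
Qed.

Lemma drift_energy_integrable : intg leb (I T) (drift_energy gam drift).
Proof.
have D0 t : 0 <= drift_energy gam drift t by apply: Rintegral_ge0 => y _; exact: sqr_ge0.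
have mD : measurable_fun setT (drift_energy gam drift).
  apply: (measurable_Rint_fam extended_family_measurable (f := fun z => drift z.1 z.2 ^+ 2)).
  exact: measurable_funX drift_measurable.
have mHT : measurable_fun (I T) H by exact: measurable_funTS.
apply: intg_ge0P => //; first exact: measurable_funTS.
apply: (@le_lt_trans _ _ (\int[leb]_(t in I T) ((a1 ^+ 2)%:E * H t))%E); last first.
  by rewrite ge0_integralZl_EFin// ?sqr_ge0//; apply: lte_mul_pinfty => //; rewrite ?lee_fin ?sqr_ge0.
apply: ge0_le_integral => //.
- by move=> t _; rewrite lee_fin.
- by apply/measurable_EFinP; exact: measurable_funTS.
- exact: (measurable_funeM _ mHT).
move=> t _; have [Et|nE] := pselect (E t); last first.
  rewrite /drift_energy (_ : \int[_]_y _ = 0) ?mule_ge0 ?lee_fin ?sqr_ge0//.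
  rewrite /Rintegral; under eq_integral do rewrite /drift memNset// expr0n.
  by rewrite integral0.
have i := ihc Et; rewrite /H -(EFin_Rint measurableT i) -EFinM lee_fin.
rewrite -(RintegralZl (a1 ^+ 2) measurableT i).
apply: (le_Rintegral measurableT (drift_square_integrable t) (intgZ _ measurableT i)) => y _.
exact: drift_sq.
Qed.

Let null : leb (I T `\` E) = 0%E.
Proof.
have mHT : measurable_fun (I T) H by exact: measurable_funTS.
have iH : leb.-integrable (I T) H.
  apply/integrableP; split=> //; move: Hfin; congr (_ < _)%E.
  by apply: eq_integral => t _; rewrite gee0_abs.
have [Z [mZ Z0 hZ]] := integrable_ae (mI T) iH.
apply: (@subset_measure0 _ _ _ leb _ Z) => //; first exact: measurableD.
move=> t [It nE]; apply: hZ => /= hn; apply: nE; split => //=.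
by rewrite -ge0_fin_numE//; exact: hn.
Qed.

Lemma drift_integrable t : intg (gam t) setT (drift t).
Proof.
have i := intgD measurableT (@intg_cst _ (gam t) 1) (drift_square_integrable t).
apply: (intg_le measurableT (mdt t) i) => y _ /=; move: (drift t y) => u.
have [_|_] := ler0P u; nra.
Qed.

(** The equation comes with extended-real integrals and with h A(R). It becomes an identity of real
    integrals once h A(R) is replaced by [drift], which differs from it only at a null set of
    times. *)
Lemma extended_evolution (al : R) (P : {poly R}) (b x : R) (g g1 g2 : R -> R) : 0 < al -> 0 < b ->
  (forall y, g y = ker al P (b * (x - y))) ->
  (forall y : R, is_derive y 1 g (g1 y)) -> (forall y : R, is_derive y 1 g1 (g2 y)) ->
  forall t, 0 <= t <= T -> \int[gam t]_y g y - \int[gam 0]_y g y =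
    \int[leb]_(s in I t) (\int[gam s]_y (coef s y * g2 y) - \int[gam s]_y (drift s y * g1 y)).
Proof.
move=> al0 b0 gE d1 d2 t tT.
pose K := kt al P b x.
have Kg s : (fun y => K (s, y)) = g by apply/funext => y; rewrite gE.
have g1E s y : p_dx K (s, y) = g1 y by rewrite /p_dx Kg; exact: is_derive_derive1.
have g2E s y : p_dx (p_dx K) (s, y) = g2 y.
  rewrite {1}/p_dx (_ : (fun y => p_dx K (s, y)) = g1); first exact: is_derive_derive1.
  by apply/funext => v; exact: g1E.
have dtE s y : p_dt K (s, y) = 0 by rewrite /K p_dt_kt kt0.
have bd Q : exists C : R, forall y, `|kt al Q b x (0, y)| <= C.
  by have [C hC] := ker_bound Q al0 0; exists C => y; have := hC (b * (x - y)); rewrite expr0 mul1r.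
have [C0 hC0] := bd P.
have [C1 hC1] : exists C : R, forall y, `|g1 y| <= C.
  by have [C hC] := bd (- b *: dker al P); exists C => y; rewrite -(g1E 0) /K p_dx_kt.
have [C2 hC2] : exists C : R, forall y, `|g2 y| <= C.
  have [C hC] := bd (- b *: dker al (- b *: dker al P)); exists C => y.
  by rewrite -(g2E 0) /K !p_dx_kt.
have cg : continuous g := is_derive_cont d1.
have cg1 : continuous g1 := is_derive_cont d2.
have mg : measurable_fun setT g := continuous_measurable_fun cg.
have mg1 : measurable_fun setT g1 := continuous_measurable_fun cg1.
have mg2 : measurable_fun setT g2.
  pose k2 := kt al (- b *: dker al (- b *: dker al P)) b x.
  rewrite (_ : g2 = fun y => k2 (0, y)).
    have mk2 : measurable_fun setT k2 by apply: plane_continuous_measurable; exact: continuous_kt.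
    exact: (measurableT_comp mk2 (measurable_pair1 (0 : R))).
  by apply/funext => y; rewrite -(g2E 0) /K !p_dx_kt.
have ig s : intg (gam s) setT g.
  rewrite (_ : g = fun y => cst 1 y * g y); last by apply/funext => y; rewrite mul1r.
  by apply: (intgM measurableT (@intg_cst _ (gam s) 1) mg (C := C0)) => y _; rewrite gE; exact: hC0.
have mat s : measurable_fun setT (coef s) by exact: (measurableT_comp coef_measurable (measurable_pair1 s)).
have iag s : intg (gam s) setT (fun y => coef s y * g2 y).
  apply: (intgM measurableT _ mg2 (C := C2)) => //.
  apply: (intg_le measurableT (mat s) (@intg_cst _ (gam s) a1)) => y _ /=.
  by rewrite !ger0_norm ?coef_le ?(ltW a1p)// (le_trans (ltW a0p) (coef_ge _ _)).
have ikg s : intg (gam s) setT (fun y => drift s y * g1 y).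
  by apply: (intgM measurableT (drift_integrable s) mg1 (C := C1)) => y _; exact: hC1.
have tt : 0 <= t <= T by [].
have [t0 tT'] := andP tT.
have It : I t `<=` I T by move=> s; rewrite /I /= !in_itv/= => /andP[-> st]; exact: le_trans st tT'.
have := gsol (Sbar_kt T P x al0 b0) tt; rewrite -/K !IE !Kg /p_pairing.
have gamE s : 0 <= s <= T -> gamma s = gam s by move=> sT; rewrite /extended_curve clamp_id.
have z0 : 0 <= (0 : R) <= T by rewrite lexx (ltW T0).
rewrite (gamE t)// (gamE 0)// -!(EFin_Rint measurableT (ig _)).
have mag : measurable_fun setT (fun s => \int[gam s]_y (coef s y * g2 y)).
  apply: (measurable_Rint_fam extended_family_measurable (f := fun z => coef z.1 z.2 * g2 z.2)).
  apply: measurable_funM; first exact: coef_measurable.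
  exact: (measurableT_comp mg2 measurable_snd).
have mkg : measurable_fun setT (fun s => \int[gam s]_y (drift s y * g1 y)).
  apply: (measurable_Rint_fam extended_family_measurable (f := fun z => drift z.1 z.2 * g1 z.2)).
  apply: measurable_funM; first exact: drift_measurable.
  exact: (measurableT_comp mg1 measurable_snd).
have iS : intg leb (I t) (fun s => \int[gam s]_y (coef s y * g2 y)).
  apply: (@intg_le _ _ _ leb (I t) _ (cst (a1 * C2)) (mI t)).
  - exact: measurable_funTS.
  - by apply: intg_cont_seg => z; exact: cvg_cst.
  move=> s _; apply: (le_trans (le_normr_Rintegral measurableT (iag s))).
  have i1 := @intg_cst _ (gam s) (a1 * C2).
  have -> : cst (a1 * C2) s = \int[gam s]_y (cst (a1 * C2) y).
    rewrite -[LHS]mulr1 -(Rint1 (gam s)) -RintegralZl//; last exact: intg_cst.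
    by apply: eq_Rintegral => y _; rewrite mulr1.
  apply: (le_Rintegral measurableT (intg_norm measurableT (iag s)) i1) => y _.
  rewrite normrM ger0_norm ?(le_trans (ltW a0p) (coef_ge _ _))//=.
  by apply: ler_pM => //; [exact: (le_trans (ltW a0p) (coef_ge _ _))|exact: coef_le].
have iD : intg leb (I t) (fun s => \int[gam s]_y (drift s y * g1 y)).
  have iE := intgS (mI T) (mI t) It drift_energy_integrable.
  have i1 : intg leb (I t) (cst 1) by apply: intg_cont_seg => z; exact: cvg_cst.
  apply: (intg_le (mI t) _ (intgZ C1 (mI t) (intgD (mI t) i1 iE))); first exact: measurable_funTS.
  move=> s _; apply: (le_trans (le_normr_Rintegral measurableT (ikg s))).
  have i2 := intgD measurableT (@intg_cst _ (gam s) 1) (drift_square_integrable s).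
  have C10 : 0 <= C1 := le_trans (normr_ge0 _) (hC1 0).
  rewrite /drift_energy /= -{1}(Rint1 (gam s)).
  rewrite -(RintegralD measurableT (@intg_cst _ (gam s) 1) (drift_square_integrable s)).
  rewrite -(RintegralZl C1 measurableT i2).
  apply: (le_Rintegral measurableT (intg_norm measurableT (ikg s)) (intgZ C1 measurableT i2)) => y _ /=.
  rewrite normrM mulrC; apply: ler_pM => //.
  by move: (drift s y) => u; have [_|_] := ler0P u; nra.
have e1 : (\int[leb]_(s in I t) \int[gamma s]_y (p_dt K (s, y) + A (U (s, y)) * p_dx (p_dx K) (s, y))%:E)%E
   = (\int[leb]_(s in I t) (\int[gam s]_y (coef s y * g2 y)))%:E.
  rewrite (EFin_Rint (mI t) iS); apply: eq_integral => s /set_mem sI.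
  have sT := IT tt sI; rewrite gamE// (EFin_Rint measurableT (iag s)); apply: eq_integral => y _.
  by rewrite dtE add0r g2E UE// gamE// /coef (BA (V01 s y)).1.
have e2 : (\int[leb]_(s in I t) \int[gamma s]_y (h (s, y) * A (U (s, y)) * p_dx K (s, y))%:E)%E
   = (\int[leb]_(s in I t) (\int[gam s]_y (drift s y * g1 y)))%:E.
  pose J z : R := hc z * coef z.1 z.2 * g1 z.2.
  have mJ : measurable_fun setT J.
    apply: measurable_funM; last exact: (measurableT_comp mg1 measurable_snd).
    by apply: measurable_funM => //; exact: coef_measurable.
  rewrite (EFin_Rint (mI t) iD).
  transitivity (\int[leb]_(s in I t) \int[gam s]_y (J (s, y))%:E)%E.
    apply: eq_integral => s /set_mem sI; have sT := IT tt sI; rewrite gamE//.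
    by apply: eq_integral => y _; rewrite g1E UE// gamE// /J /hc /coef /= clamp_id// (BA (V01 s y)).1.
  have mJs : measurable_fun setT (fun s => \int[gam s]_y (J (s, y))%:E)%E.
    rewrite (_ : (fun s => _) = (fun s => \int[gam s]_y ((EFin \o J)^\+ (s, y)) - \int[gam s]_y ((EFin \o J)^\- (s, y))))%E; last first.
      by apply/funext => s; rewrite [LHS]integralE; congr (_ - _)%E; apply: eq_integral => y _; rewrite ?funeposE ?funenegE.
    have mJ' : measurable_fun setT (EFin \o J) by exact/measurable_EFinP.
    apply: emeasurable_funB.
    - apply: (measurable_int_fam extended_family_measurable (f := (EFin \o J)^\+)%E) => //.
      exact: measurable_funepos.
    - apply: (measurable_int_fam extended_family_measurable (f := (EFin \o J)^\-)%E) => //.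
      exact: measurable_funeneg.
  apply: ae_eq_integral => //.
  - exact: measurable_funTS.
  - by apply/measurable_EFinP; exact: measurable_funTS.
  exists (I T `\` E); split => //; first exact: measurableD.
  move=> s /= /not_implyP [sI ne]; split; first exact: It.
  move=> Es; apply: ne; rewrite (EFin_Rint measurableT (ikg s)).
  by apply: eq_integral => y _; rewrite /J /drift mem_set.
rewrite e1 e2 -EFinN -!EFinB => -[] e.
by rewrite (RintegralB (mI t) iS iD) -e; ring.
Qed.

End Extension.

(** * Test functions *)

Section TestFunctions.
Context {R : realType}.

Lemma bounded_derivative_lipschitz (f f' : R -> R) (C : R) : (forall x : R, is_derive x 1 f (f' x)) ->
  (forall x, `|f' x| <= C) -> forall x y, `|f x - f y| <= C * `|x - y|.
Proof.
move=> df bd; suff H x y : x <= y -> `|f x - f y| <= C * `|x - y|.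
  by move=> x y; have [/H//|/ltW/H] := leP x y; rewrite distrC [X in C * X]distrC.
move=> xy; have c : {within `[x, y], continuous f}.
  by apply: continuous_subspaceT; exact: is_derive_cont df.
have [z _] := MVT_segment xy (fun z _ => df z) c.
rewrite distrC => ->; rewrite normrM [`|y - x|]distrC; exact: ler_wpM2r.
Qed.

Lemma derive1_zero_near (f : R -> R) (x : R) : (\forall y \near x, f y = 0) -> derive1 f x = 0.
Proof.
move=> h; apply: is_derive_derive1; apply: near_eq_is_derive (is_derive_cst (0 : R) x (1 : R)).
by apply: filterS h => y ->.
Qed.

Lemma zero_off_closed (K : set (R * R)) (g : R * R -> R) (w : seq bool) : closed K ->
  (forall z, ~ K z -> g z = 0) -> forall z, ~ K z -> p_iterd w g z = 0.
Proof.
move=> cK g0; elim: w => [//|b w IH] [t x] nK.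
have nb : nbhs (t, x) (~` K) by apply: open_nbhs_nbhs; split => //; exact: closed_openC.
rewrite /p_iterd /= -/(p_iterd w g); case: b; apply: derive1_zero_near => /=.
  have c : (fun s : R => (s, x)) @ t --> (t, x) by exact: (cvg_pair cvg_id (cvg_cst x)).
  have h : \forall s \near t, (~` K) (s, x) := c _ nb.
  by apply: filterS h => s; exact: IH.
have c : (fun y : R => (t, y)) @ x --> (t, x) by exact: (cvg_pair (cvg_cst t) cvg_id).
have h : \forall y \near x, (~` K) (t, y) := c _ nb.
by apply: filterS h => y; exact: IH.
Qed.

Lemma testfun_bounds (T : R) (phi : R * R -> R) : p_testfun T phi ->
  exists2 M : R, 0 < M & forall w, [/\ continuous (p_iterd w phi),
    exists C : R, forall z, `|p_iterd w phi z| <= C,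
    forall t x, M <= `|x| -> p_iterd w phi (t, x) = 0 &
    forall t x, ~~ (0 < t < T) -> p_iterd w phi (t, x) = 0].
Proof.
move=> [sm [K [cK [KT phi0]]]].
have [M0 [M0p hM]] := plane_compact_bounded cK.
exists (M0 + 1); first exact: addr_gt0.
move=> w; have [cw _] := sm w.
have clK : closed K by apply: compact_closed => //; exact: Rhausdorff.
have off := zero_off_closed w clK phi0.
split => //.
- have cc : compact (p_iterd w phi @` K).
    by apply: continuous_compact => //; exact: continuous_subspaceT.
  have [N [_ hN]] := compact_bounded (V := R^o) cc.
  have NN : N < Num.max 0 N + 1 by rewrite ltr_pwDr// le_max lexx orbT.
  exists (Num.max 0 N + 1) => z; have [Kz|nK] := pselect (K z).
    by apply: (hN _ NN); exists z.
  by rewrite off// normr0 addr_ge0// le_max lexx.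
- move=> t x xM; apply: off => Kx; have [_ /=] := hM _ Kx.
  by apply/negP; rewrite -ltNge; apply: lt_le_trans xM; rewrite ltrDl.
- by move=> t x nt; apply: off => /KT; exact/negP.
Qed.

End TestFunctions.

(** * Weak derivatives *)

Section AlmostEverywhere.
Context d (X : measurableType d) {R : realType} (mu : {measure set X -> \bar R}).

Lemma Rint_ae (D N : set X) (f g : X -> R) : measurable D -> measurable N -> mu N = 0%E ->
  measurable_fun D f -> measurable_fun D g -> (forall x, D x -> ~ N x -> f x = g x) ->
  \int[mu]_(x in D) f x = \int[mu]_(x in D) g x.
Proof.
move=> mD mN N0 mf mg h; rewrite /Rintegral; congr fine.
apply: ae_eq_integral => //; [exact/measurable_EFinP|exact/measurable_EFinP|].
exists N; split => // x /= /not_implyP [Dx ne]; apply: contrapT => nN.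
by apply: ne; rewrite h.
Qed.

End AlmostEverywhere.

Section SignedDensity.
Context {R : realType}.
Local Notation leb := (@lebesgue_measure R).

(** The nonnegative case is applied to |f| + f and to |f|, whose difference is f. *)
Lemma density_Rintegral (g : probability R R) (p f : R -> R) : measurable_fun setT p -> (forall x, 0 <= p x) ->
  (forall B, measurable B -> g B = (\int[leb]_(x in B) (p x)%:E)%E) ->
  intg g setT f -> intg leb setT (fun x => f x * p x) /\ \int[g]_x f x = \int[leb]_x (f x * p x).
Proof.
move=> mp p0 hg i; have mf := intg_meas i.
have mn : measurable_fun setT (fun x => `|f x|) by exact: measurableT_comp.
have mT : measurable (setT : set (measurableTypeR R)) by exact: measurableT.
have en := density_integral mp p0 hg mn (fun x => normr_ge0 (f x)).
have mfp : measurable_fun setT (fun x => f x * p x) by exact: measurable_funM.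
have ifp : intg leb setT (fun x => f x * p x).
  apply: intgP => //; move: (intg_lty i); rewrite en; congr (_ < _)%E.
  by apply: eq_integral => x _; rewrite normrM [`|p x|]ger0_norm.
split => //.
have inn := intg_norm measurableT i.
have ms : measurable_fun setT (fun x => `|f x| + f x) by exact: measurable_funD.
have s0 x : 0 <= `|f x| + f x by rewrite -[X in _ + X]opprK subr_ge0 -normrN ler_norm.
have es := density_integral mp p0 hg ms s0.
have -> : \int[g]_x f x = \int[g]_x (`|f x| + f x) - \int[g]_x `|f x|.
  by rewrite (RintegralD measurableT inn i); ring.
rewrite /Rintegral es en.
have infp := intg_norm mT ifp; have isp := intgD mT infp ifp.
have -> : (\int[leb]_x ((`|f x| + f x) * p x)%:E = \int[leb]_x (`|f x * p x| + f x * p x)%:E)%E.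
  by apply: eq_integral => x _; rewrite mulrDl normrM [`|p x|]ger0_norm.
have -> : (\int[leb]_x (`|f x| * p x)%:E = \int[leb]_x (`|f x * p x|)%:E)%E.
  by apply: eq_integral => x _; rewrite normrM [`|p x|]ger0_norm.
by have := RintegralD mT infp ifp; rewrite /Rintegral => ->; ring.
Qed.

End SignedDensity.

Section WeakDerivatives.
Context {R : realType}.
Local Notation leb := (@lebesgue_measure R).
Local Notation m2 := (leb \x leb)%E.
Variable T : R.

Lemma measurable_RTo : measurable (p_RTo T : set (measurableTypeR R * measurableTypeR R)).
Proof.
rewrite (_ : p_RTo T = `]0, T[%classic `*` setT); first by apply: measurableX.
by apply/seteqP; split => -[t x]; rewrite /p_RTo /= in_itv/= => // -[].
Qed.

Lemma int_RTo (f : R * R -> R) : intg m2 setT f -> (forall z, ~ p_RTo T z -> f z = 0) ->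
  (\int[p_m2 R]_(z in p_RTo T) (f z)%:E = (\int[m2]_z f z)%:E)%E.
Proof.
move=> i f0; rewrite -(@Rint_support _ _ _ m2 (p_RTo T) _ f0).
by exact/esym/(EFin_Rint measurable_RTo (intgS measurableT measurable_RTo (@subsetT _ _) i)).
Qed.

Lemma locint_intg (f : R * R -> R) : intg m2 setT f -> p_locint T f.
Proof.
move=> i; split; first by apply: measurable_funTS; exact: intg_meas i.
move=> K cK KT; have mK : measurable (K : set (measurableTypeR R * measurableTypeR R)) := plane_compact_measurable cK.
exact: (intg_lty (intgS measurableT mK (@subsetT _ K) i)).
Qed.

Lemma locint_bounded (f : R * R -> R) (C : R) : measurable_fun (p_RTo T) f ->
  (forall z, p_RTo T z -> `|f z| <= C) -> p_locint T f.
Proof.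
move=> mf fC; split => // K cK KT; have mK : measurable (K : set (measurableTypeR R * measurableTypeR R)) := plane_compact_measurable cK.
have [M [M0 hM]] := plane_compact_bounded cK.
have mD : measurable (`[- M, M]%classic : set (measurableTypeR R)) by exact: measurable_itv.
have i1 (c : R) : intg leb `[- M, M]%classic (cst c) by apply: intg_cont_seg => z; exact: cvg_cst.
pose F (z : R * R) : R := C * \1_(`[- M, M]%classic : set (measurableTypeR R)) z.2.
have mF : measurable_fun setT F.
  apply: measurable_funM => //; apply: measurableT_comp => //; exact: measurable_snd.
have iF : intg m2 setT (fun z => \1_(`[- M, M]%classic : set (measurableTypeR R)) z.1 * F z).
  apply: (@prod_intgP _ _ _ _ R leb leb _ _ (cst (\int[leb]_(x in `[- M, M]) (cst `|C| x))) mD mF).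
    exact: i1.
  move=> x _; rewrite (EFin_Rint mD (i1 `|C|)) [leRHS]integral_mkcond.
  rewrite le_eqVlt; apply/orP; left; apply/eqP; apply: eq_integral => y _.
  rewrite patchE /F /= indicE; case: ifP => _; first by rewrite mulr1.
  by rewrite mulr0 normr0.
apply: le_lt_trans (intg_lty (intgS measurableT mK (@subsetT _ K) iF)).
apply: ge0_le_integral => //.
- apply/measurable_EFinP; apply: measurableT_comp => //; exact: (measurable_funS measurable_RTo KT mf).
- apply/measurable_EFinP; apply: measurableT_comp => //; apply: measurable_funTS.
  apply: measurable_funM => //; apply: measurableT_comp => //; exact: measurable_fst.
move=> z Kz; have [h1 h2] := hM z Kz; rewrite lee_fin /F !indicE !mem_set/= ?in_itv/= -?ler_norml//.
by rewrite mul1r mulr1; apply: le_trans (ler_norm _); exact: fC (KT _ Kz).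
Qed.

Lemma locint_test (f phi : R * R -> R) (w : seq bool) : measurable_fun setT f -> p_locint T f ->
  p_testfun T phi -> intg m2 setT (fun z => f z * p_iterd w phi z).
Proof.
move=> mf [_ lf] tphi; have [M M0 /(_ w)[cw [C hC] _ _]] := testfun_bounds tphi.
have [sm [K [cK [KT phi0]]]] := tphi.
have mK : measurable (K : set (measurableTypeR R * measurableTypeR R)) := plane_compact_measurable cK.
have clK : closed K by apply: compact_closed => //; exact: Rhausdorff.
apply: (intg_support mK).
  by move=> z nK; rewrite (zero_off_closed w clK phi0)// mulr0.
apply: (intgM mK _ _ (C := C)) => //.
  by apply: intgP; [exact: measurable_funTS|exact: lf].
by apply: measurable_funTS; exact: plane_continuous_measurable.
Qed.

Lemma testfun_off_RTo (phi : R * R -> R) (w : seq bool) (z : R * R) : p_testfun T phi ->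
  ~ p_RTo T z -> p_iterd w phi z = 0.
Proof.
move=> tphi nz; have [M M0 /(_ w)[_ _ _]] := testfun_bounds tphi.
by case: z nz => t x nz; apply; apply/negP.
Qed.

Lemma weak_dxI (f g : R * R -> R) : measurable_fun setT f -> measurable_fun setT g ->
  p_locint T f -> p_locint T g ->
  (forall phi, p_testfun T phi -> \int[m2]_z (f z * p_dx phi z) = - \int[m2]_z (g z * phi z)) ->
  p_weak_dx T f g.
Proof.
move=> mf mg lf lg h; split => //; split => // phi tphi.
rewrite (int_RTo (locint_test [:: false] mf lf tphi)); last first.
  by move=> z nz; rewrite (@testfun_off_RTo _ [:: false])// mulr0.
rewrite (int_RTo (locint_test [::] mg lg tphi)); last first.
  by move=> z nz; rewrite (@testfun_off_RTo _ [::])// mulr0.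
by rewrite -EFinN; congr (_ %:E); exact: h.
Qed.

Lemma weak_dtI (f g : R * R -> R) : measurable_fun setT f -> measurable_fun setT g ->
  p_locint T f -> p_locint T g ->
  (forall phi, p_testfun T phi -> \int[m2]_z (f z * p_dt phi z) = - \int[m2]_z (g z * phi z)) ->
  p_weak_dt T f g.
Proof.
move=> mf mg lf lg h; split => //; split => // phi tphi.
rewrite (int_RTo (locint_test [:: true] mf lf tphi)); last first.
  by move=> z nz; rewrite (@testfun_off_RTo _ [:: true])// mulr0.
rewrite (int_RTo (locint_test [::] mg lg tphi)); last first.
  by move=> z nz; rewrite (@testfun_off_RTo _ [::])// mulr0.
by rewrite -EFinN; congr (_ %:E); exact: h.
Qed.

Lemma locint_eq (f g : R * R -> R) : (forall z, p_RTo T z -> f z = g z) -> p_locint T f -> p_locint T g.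
Proof.
move=> e [mf lf]; split.
  by apply: eq_measurable_fun mf => z /set_mem Tz; exact: e.
move=> K cK KT; move: (lf K cK KT); congr (_ < _)%E; apply: eq_integral => z /set_mem Kz.
by rewrite e//; exact: KT.
Qed.

Lemma weak_dx_eq (f f' g : R * R -> R) : (forall z, p_RTo T z -> f z = f' z) ->
  p_weak_dx T f g -> p_weak_dx T f' g.
Proof.
move=> e [lf [lg h]]; split; first exact: locint_eq lf.
split=> // phi /h <-; apply: eq_integral => z /set_mem Tz; by rewrite e.
Qed.

Lemma weak_dt_eq (f f' g : R * R -> R) : (forall z, p_RTo T z -> f z = f' z) ->
  p_weak_dt T f g -> p_weak_dt T f' g.
Proof.
move=> e [lf [lg h]]; split; first exact: locint_eq lf.
split=> // phi /h <-; apply: eq_integral => z /set_mem Tz; by rewrite e.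
Qed.

End WeakDerivatives.

(** * The derivatives of the solution *)

Section Regularity.
Context {R : realType}.
Local Notation leb := (@lebesgue_measure R).
Local Notation m2 := (leb \x leb)%E.
Variables (T : R) (gam : R -> probability R R) (B B' : R -> R) (k : R -> R -> R) (a1 L : R).
Local Notation V z := (p_distfun (gam z.1) z.2).
Hypothesis cV : continuous (fun z : R * R => V z).
Hypothesis dB : forall y : R, 0 <= y <= 1 -> is_derive y 1 B (B' y).
Hypothesis cB' : continuous B'.
Hypothesis B'L : forall y, `|B' y| <= L.
Hypothesis Ba1 : forall y, 0 <= y <= 1 -> `|B y| <= a1.
Hypothesis mk : measurable_fun setT (fun z : R * R => k z.1 z.2).
Hypothesis ik : forall t, intg (gam t) setT (k t).
Hypothesis ik2 : forall t, intg (gam t) setT (fun y => k t y ^+ 2).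
Hypothesis iN : intg leb `[0, T] (drift_energy gam k).
Variables (p : R * R -> R) (G : set (measurableTypeR R)) (K : R -> R).
Hypothesis mp : measurable_fun setT p.
Hypothesis p0 : forall z, 0 <= p z.
Hypothesis mG : measurable G.
Hypothesis GI : G `<=` `[0, T]%classic.
Hypothesis null : leb (`[0, T]%classic `\` G) = 0%E.
Hypothesis pbad : forall t x, ~ G t -> p (t, x) = 0.
Hypothesis iK : intg leb `[0, T] K.
Hypothesis cp : forall t, G t -> continuous (fun x => p (t, x)).
Hypothesis dV : forall t, G t -> forall x : R, is_derive x 1 (p_distfun (gam t)) (p (t, x)).
Hypothesis densp : forall t, G t -> forall S, measurable S -> gam t S = (\int[leb]_(x in S) (p (t, x))%:E)%E.
Hypothesis cube : forall t, G t -> (\int[leb]_x (p (t, x) ^+ 3)%:E <= (2 + 4 * K t)%:E)%E.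

Let V01 z : 0 <= V z <= 1. Proof. by rewrite distfun_ge0 distfun_le1. Qed.

Let mV : measurable_fun setT (fun z : R * R => V z).
Proof. exact: plane_continuous_measurable cV. Qed.

Let mI : measurable (`[0, T]%classic : set (measurableTypeR R)).
Proof. exact: measurable_itv. Qed.

Let mT : measurable (setT : set (measurableTypeR R)).
Proof. exact: measurableT. Qed.

Lemma density_total t : G t -> (\int[leb]_x (p (t, x))%:E = 1)%E.
Proof. by move=> Gt; rewrite -densp//; exact: probability_setT. Qed.

Let mpt t : measurable_fun setT (fun x : R => p (t, x)).
Proof. exact: (measurableT_comp mp (measurable_pair1 t)). Qed.

Lemma intg_cube : intg m2 setT (fun z => p z ^+ 3).
Proof.
have i1 (c : R) : intg leb G (cst c).
  by apply: (intgS mI mG GI); apply: intg_cont_seg => z; exact: cvg_cst.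
have iKG := intgZ 4 mG (intgS mI mG GI iK).
have mp3 : measurable_fun setT (fun z => p z ^+ 3) by exact: measurable_funX.
have := @prod_intgP _ _ _ _ R leb leb _ _ _ mG mp3 (intgD mG (i1 2) iKG) _.
rewrite (_ : (fun z => _ * _) = (fun z => p z ^+ 3)).
  apply=> t Gt; apply: le_trans (cube Gt); rewrite le_eqVlt; apply/orP; left; apply/eqP.
  by apply: eq_integral => x _; rewrite ger0_norm ?exprn_ge0.
apply/funext => -[t x] /=; rewrite indicE; have [Gt|nG] := pselect (G t).
  by rewrite mem_set// mul1r.
by rewrite memNset// pbad// expr0n mulr0.
Qed.

Let byd := intg_by_density mp p0 mG GI pbad density_total.

Lemma intg_density : intg m2 setT p.
Proof.
have := @byd (cst 1) 1 (measurable_cst _) (fun=> ltac:(by rewrite normr1)).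
by under eq_fun do rewrite mul1r.
Qed.

Lemma intg_square : intg m2 setT (fun z => p z ^+ 2).
Proof.
apply: (intg_le measurableT _ (intgD measurableT intg_density intg_cube)).
  exact: measurable_funX.
move=> z _; have := p0 z; move: (p z) => r r0; rewrite ger0_norm ?sqr_ge0//.
have : 0 <= r * (r - 1) ^+ 2 by rewrite mulr_ge0 ?sqr_ge0.
nra.
Qed.

Lemma intg_drift : intg m2 setT (fun z => k z.1 z.2 ^+ 2 * p z).
Proof.
have iNG := intgS mI mG GI iN.
have mf : measurable_fun setT (fun z : R * R => k z.1 z.2 ^+ 2 * p z).
  by apply: measurable_funM => //; exact: measurable_funX mk.
have := @prod_intgP _ _ _ _ R leb leb _ _ _ mG mf iNG _.
rewrite (_ : (fun z => _ * _) = (fun z => k z.1 z.2 ^+ 2 * p z)).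
  apply=> t Gt; rewrite /drift_energy (EFin_Rint measurableT (ik2 t)).
  rewrite (density_integral (mpt t) (fun x => p0 (t, x)) (densp Gt) (intg_meas (ik2 t)) (fun x => sqr_ge0 _)).
  rewrite le_eqVlt; apply/orP; left; apply/eqP.
  by apply: eq_integral => x _; rewrite [X in X%:E = _]ger0_norm//; apply: mulr_ge0; rewrite ?sqr_ge0.
apply/funext => -[t x] /=; rewrite indicE; have [Gt|nG] := pselect (G t).
  by rewrite mem_set// mul1r.
by rewrite memNset// pbad// !mulr0.
Qed.

Let mB : measurable_fun setT (fun z : R * R => B (V z)).
Proof.
apply: plane_continuous_measurable => z; have [dv _] := dB (V01 z).
have cB : {for V z, continuous B} by apply/differentiable_continuous; apply/derivable1_diffP.
pose W (w : R * R) := V w; have cW : {for z, continuous W} by exact: cV.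
exact: (continuous_comp cW cB).
Qed.

Let mB' : measurable_fun setT (fun z : R * R => B' (V z)).
Proof. exact: (measurableT_comp (continuous_measurable_fun cB') mV). Qed.

(** At the times of [G] the density is a classical derivative and ordinary integration by parts
    applies; the other times of [0, T] form a null set, and off (0, T) the test function
    vanishes. *)
Lemma weak_dx_distfun : p_weak_dx T (fun z => V z) p.
Proof.
apply: weak_dxI => //.
- apply: (@locint_bounded _ _ _ 1); first exact: measurable_funTS.
  by move=> z _; have /andP[h1 h2] := V01 z; rewrite ger0_norm.
- exact: locint_intg intg_density.
move=> phi tphi; have [M M0 bds] := testfun_bounds tphi.
have lV : p_locint T (fun z => V z).
  apply: (@locint_bounded _ _ _ 1); first exact: measurable_funTS.
  by move=> z _; have /andP[h1 h2] := V01 z; rewrite ger0_norm.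
have i1 := locint_test [:: false] mV lV tphi.
have i2 := locint_test [::] mp (@locint_intg _ T _ intg_density) tphi.
have [_ _ <- _] := Rfubini i1; have [iF _ <- _] := Rfubini i2.
have [iE _ _ _] := Rfubini i1.
have -> : - (\int[leb]_x \int[leb]_y (p (x, y) * p_iterd [::] phi (x, y))) =
    \int[leb]_x (- (\int[leb]_y (p (x, y) * p_iterd [::] phi (x, y)))).
  by rewrite -mulN1r -(RintegralZl (-1) mT iF); apply: eq_Rintegral => x _; rewrite mulN1r.
apply: (@Rint_ae _ _ _ leb setT (`[0, T]%classic `\` G)) => //; first exact: measurableD.
- exact: intg_meas iE.
- by apply: measurableT_comp => //; exact: intg_meas iF.
move=> t _ nN; have [_ _ z0 tz] := bds [::]; have [c1 _ z1 tz1] := bds [:: false].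
have [/andP[t0 tT]|nt] := boolP (0 < t < T); last first.
  have -> : \int[leb]_y (p (t, y) * p_iterd [::] phi (t, y)) = 0.
    by under eq_Rintegral do rewrite tz// mulr0; rewrite /Rintegral integral0.
  have -> : \int[leb]_y (V (t, y) * p_iterd [:: false] phi (t, y)) = 0.
    by under eq_Rintegral do rewrite tz1// mulr0; rewrite /Rintegral integral0.
  by rewrite oppr0.
have Gt : G t.
  by apply: contrapT => nG; apply: nN; split=> //=; rewrite in_itv/= (ltW t0) (ltW tT).
have dphi (x : R) : is_derive x 1 (fun y => phi (t, y)) (p_dx phi (t, x)).
  by apply: derivable_is_derive1; have [[_ h] _] := (tphi.1 [::], I); exact: (h (t, x)).2.
have dprod (x : R) : is_derive x 1 (fun y => V (t, y) * phi (t, y)) (p (t, x) * phi (t, x) + V (t, x) * p_dx phi (t, x)).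
  have h1 := dV Gt x; have h2 := dphi x.
  apply: (is_derive_eq (is_deriveM h1 h2)); rewrite /GRing.scale /=; ring.
have sec (g : R * R -> R) : continuous g -> continuous (fun y => g (t, y)).
  move=> cg y; have h : (fun z : R => (t, z)) z @[z --> y] --> (t, y) by exact: (cvg_pair (cvg_cst t) cvg_id).
  exact: (cvg_comp _ _ h (cg (t, y))).
have [cphi _ _ _] := bds [::].
pose VV (z : R * R) := V z; have cVV : continuous VV by exact: cV.
have cd : continuous (fun x => p (t, x) * phi (t, x) + V (t, x) * p_dx phi (t, x)).
  move=> x; apply: cvgD; apply: cvgM.
  - exact: cp.
  - exact: (sec phi).
  - exact: (sec VV).
  - exact: (sec (p_dx phi)).
have MM : - M <= M by rewrite ge0_cp// ltW.
have z0' y : M <= `|y| -> phi (t, y) = 0 := z0 t y.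
have z1' y : M <= `|y| -> p_dx phi (t, y) = 0 := z1 t y.
have [_] := FTC_seg dprod cd MM.
rewrite (z0' M) ?ler_norm// (z0' (- M)) ?normrN ?ler_norm// !mulr0 subr0.
have off (x : measurableTypeR R) : ~ `[- M, M]%classic x -> M <= `|x|.
  by move=> /= /negP; rewrite in_itv/= -ler_norml -ltNge => /ltW.
rewrite (@Rint_support _ _ _ leb `[- M, M]%classic); last first.
  by move=> x /off h; rewrite (z0' x h) (z1' x h) !mulr0 addr0.
have ia : intg leb setT (fun x => p (t, x) * phi (t, x)).
  have ip : intg leb setT (fun x => p (t, x)).
    by apply: intg_ge0P => //; [exact: mpt|rewrite density_total// ltry].
  have [_ [C hC] _ _] := bds [::].
  apply: (intgM mT ip _ (C := C)) => [|x _]; last exact: hC.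
  by apply: continuous_measurable_fun; exact: (sec phi).
have ib : intg leb setT (fun x => V (t, x) * p_dx phi (t, x)).
  apply: (@intg_support _ _ _ leb `[- M, M]%classic); first exact: measurable_itv.
    by move=> x /off h; rewrite (z1' x h) mulr0.
  by apply: intg_cont_seg => x; apply: cvgM; [exact: (sec VV)|exact: (sec (p_dx phi))].
rewrite (RintegralD mT ia ib) => e.
by apply/eqP; rewrite -addr_eq0 addrC; apply/eqP.
Qed.

Variable z : R * R -> R.
Hypothesis mz : measurable_fun setT z.
Hypothesis iz : intg m2 setT (fun x => z x ^+ 2).
Hypothesis hz : forall ps psx, test_pair p G ps psx ->
     intg m2 setT (fun x => Num.sqrt (p x) * ps x * z x) /\
     \int[m2]_x (Num.sqrt (p x) * ps x * z x) = - \int[m2]_x (psx x * p x).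

Definition second_derivative w := Num.sqrt (p w) * z w.

(** The x-derivative of A(R) p, expanded, plus the drift term. *)
Definition time_derivative w :=
  B (V w) * second_derivative w + B' (V w) * p w ^+ 2 + k w.1 w.2 * p w.

Let sq w : Num.sqrt (p w) * Num.sqrt (p w) = p w.
Proof. by rewrite -expr2 sqr_sqrtr. Qed.

Let msq : measurable_fun setT (fun w => Num.sqrt (p w)).
Proof. by apply: (measurableT_comp _ mp); exact: (continuous_measurable_fun (@sqrt_continuous R)). Qed.

Let mRxx : measurable_fun setT second_derivative.
Proof. exact: measurable_funM. Qed.

Let iRxx : intg m2 setT second_derivative.
Proof.
apply: (intg_le measurableT _ (intgD measurableT intg_density iz)) => [|w _]; first exact: mRxx.
have e := sq w; have u0 := sqrtr_ge0 (p w); rewrite /second_derivative; move: (Num.sqrt (p w)) e u0 => u e u0.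
rewrite -e normrM (ger0_norm u0) -(real_normK (num_real (z w))).
have := normr_ge0 (z w); move: `|_| => v v0; have := sqr_ge0 (u - v); nra.
Qed.

Let ikp : intg m2 setT (fun w => k w.1 w.2 * p w).
Proof.
have mkp : measurable_fun setT (fun w : R * R => k w.1 w.2 * p w) by exact: measurable_funM.
apply: (intg_le measurableT _ (intgD measurableT intg_density intg_drift)) => [|w _]; first exact: mkp.
rewrite normrM (ger0_norm (p0 w)) -[X in X + _]mul1r -mulrDl ler_wpM2r//.
by move: (k _ _) => u; have [_|_] := ler0P u; nra.
Qed.

Let iBR : intg m2 setT (fun w => B (V w) * second_derivative w).
Proof.
have := intgM measurableT iRxx mB (fun w _ => Ba1 (V01 w)).
by congr (intg _ _ _); apply/funext => w; rewrite mulrC.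
Qed.

Let iBp : intg m2 setT (fun w => B' (V w) * p w ^+ 2).
Proof.
have := intgM measurableT intg_square mB' (fun w _ => B'L (V w)).
by congr (intg _ _ _); apply/funext => w; rewrite mulrC.
Qed.

Let iRt : intg m2 setT time_derivative.
Proof. exact: (intgD measurableT (intgD measurableT iBR iBp) ikp). Qed.

Let sectder (phi : R * R -> R) (t x : R) : p_testfun T phi -> is_derive x 1 (fun y => phi (t, y)) (p_dx phi (t, x)).
Proof. by move=> [sm _]; apply: derivable_is_derive1; have [_ h] := sm [::]; exact: (h (t, x)).2. Qed.

Let seccont (g : R * R -> R) (t : R) : continuous g -> continuous (fun y => g (t, y)).
Proof.
move=> cg y; have h : (fun z : R => (t, z)) z @[z --> y] --> (t, y) by exact: (cvg_pair (cvg_cst t) cvg_id).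
exact: (cvg_comp _ _ h (cg (t, y))).
Qed.

Lemma weak_dx_density : p_weak_dx T p second_derivative.
Proof.
apply: weak_dxI => //; [exact: locint_intg intg_density|exact: locint_intg iRxx|].
move=> phi tphi; have [M M0 bds] := testfun_bounds tphi.
have tp : test_pair p G phi (p_dx phi).
  have [c0 [C hC] z0 _] := bds [::]; have [c1 _ z1 _] := bds [:: false].
  exists M, C; split; split.
  - exact: plane_continuous_measurable.
  - exact: plane_continuous_measurable.
  - have := locint_test [:: false] mp (@locint_intg _ T _ intg_density) tphi.
    by congr (intg _ _ _); apply/funext => w; rewrite mulrC.
  - exact: ltW.
  - exact: hC.
  - by move=> t x h; split; [exact: z0|exact: z1].
  - move=> t Gt; split; first by move=> x; exact: sectder.
    exact: (seccont (g := p_dx phi)).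
have [_ e] := hz tp.
have -> : \int[m2]_w (second_derivative w * phi w) = \int[m2]_w (Num.sqrt (p w) * phi w * z w).
  by apply: eq_Rintegral => w _; rewrite /second_derivative mulrAC.
by rewrite e opprK; apply: eq_Rintegral => w _; rewrite mulrC.
Qed.

Hypothesis weak : forall phi, p_testfun T phi ->
  \int[leb]_(s in `[0, T]) \int[leb]_x (V (s, x) * p_dt phi (s, x)) =
  \int[leb]_(s in `[0, T]) (\int[gam s]_y (B (V (s, y)) * p_dx phi (s, y)) - \int[gam s]_y (k s y * phi (s, y))).

(** B(R) phi and its x-derivative form a [test_pair]. Its representation by z moves the derivative
    off phi in the diffusion term, and the derivative of B(R) produces the term B'(R) p^2 phi. *)
Lemma weak_dt_distfun : p_weak_dt T (fun w => V w) time_derivative.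
Proof.
have lV : p_locint T (fun z => V z).
  apply: (@locint_bounded _ _ _ 1); first exact: measurable_funTS.
  by move=> w _; have /andP[h1 h2] := V01 w; rewrite ger0_norm.
apply: weak_dtI => //; [exact: intg_meas iRt|exact: locint_intg iRt|].
move=> phi tphi; have [M M0 bds] := testfun_bounds tphi.
have i1 := locint_test [:: true] mV lV tphi.
have [c0 [C hC] z0 tz0] := bds [::]; have [c1 [C1 hC1] z1 tz1] := bds [:: false].
have [ct _ _ tzt] := bds [:: true].
have mphi : measurable_fun setT phi by exact: plane_continuous_measurable.
have mpx : measurable_fun setT (p_dx phi) := plane_continuous_measurable c1.
have [_ _ e1 _] := Rfubini i1.
rewrite (_ : \int[m2]_w (V w * p_dt phi w) = \int[m2]_w (V w * p_iterd [:: true] phi w))// -e1.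
rewrite -(@Rint_support _ _ _ leb `[0, T]%classic (fun s => \int[leb]_y (V (s, y) * p_dt phi (s, y)))); last first.
  move=> t nt; have nt' : ~~ (0 < t < T).
    by apply/negP => /andP[h1 h2]; apply: nt; rewrite /= in_itv/= (ltW h1) (ltW h2).
  have tz' y : p_dt phi (t, y) = 0 := tzt t y nt'.
  by under eq_Rintegral do rewrite tz' mulr0; rewrite /Rintegral integral0.
rewrite weak//.
pose F1 w := B (V w) * p_dx phi w * p w; pose F2 w := k w.1 w.2 * phi w * p w.
have iF1 : intg m2 setT F1.
  have := intgM measurableT (intgM measurableT intg_density mB (fun w _ => Ba1 (V01 w))) mpx (fun w _ => hC1 w).
  by congr (intg _ _ _); apply/funext => w; rewrite /F1; ring.
have iF2 : intg m2 setT F2.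
  have := intgM measurableT ikp mphi (fun w _ => hC w).
  by congr (intg _ _ _); apply/funext => w; rewrite /F2; ring.
have iF := intgB measurableT iF1 iF2.
have [iE _ e2 _] := Rfubini iF.
have mfam (f : R * R -> R) : measurable_fun setT f -> measurable_fun setT (fun s => \int[gam s]_y f (s, y)).
  move=> mf; apply: (measurable_Rint_fam _ mf) => S mS.
  apply: measurable_family mS => x; exact: (measurableT_comp mV (measurable_pair2 x)).
have mBt t : measurable_fun setT (fun y : R => B (V (t, y))) by exact: (measurableT_comp mB (measurable_pair1 t)).
have mpxt t : measurable_fun setT (fun y : R => p_dx phi (t, y)) by exact: (measurableT_comp mpx (measurable_pair1 t)).
have mphit t : measurable_fun setT (fun y : R => phi (t, y)) by exact: (measurableT_comp mphi (measurable_pair1 t)).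
have igx t : intg (gam t) setT (fun y => B (V (t, y)) * p_dx phi (t, y)).
  apply: (intgM measurableT _ (mpxt t) (fun y _ => hC1 (t, y))).
  have := intgM measurableT (@intg_cst _ (gam t) 1) (mBt t) (fun y _ => Ba1 (V01 (t, y))).
  by congr (intg _ _ _); apply/funext => y; rewrite mul1r.
have igk t : intg (gam t) setT (fun y => k t y * phi (t, y)).
  exact: (intgM measurableT (ik t) (mphit t) (fun y _ => hC (t, y))).
have e3 : \int[leb]_(s in `[0, T]) (\int[gam s]_y (B (V (s, y)) * p_dx phi (s, y)) - \int[gam s]_y (k s y * phi (s, y)))
   = \int[m2]_w (F1 w - F2 w).
  rewrite -e2 -(@Rint_support _ _ _ leb `[0, T]%classic (fun s => \int[leb]_y (F1 (s, y) - F2 (s, y)))); last first.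
    move=> t nt; have nG : ~ G t by move=> /GI.
    by under eq_Rintegral do rewrite /F1 /F2 pbad// !mulr0 subr0; rewrite /Rintegral integral0.
  apply: (@Rint_ae _ _ _ leb _ (`[0, T]%classic `\` G)) => //; first exact: measurableD.
  - apply: measurable_funTS; apply: measurable_funB.
      by apply: (mfam (fun w => B (V w) * p_dx phi w)); exact: measurable_funM.
    by apply: (mfam (fun w => k w.1 w.2 * phi w)); exact: measurable_funM.
  - by apply: measurable_funTS; exact: intg_meas iE.
  move=> t It nN; have Gt : G t by apply: contrapT => nG; apply: nN.
  have [j1 ->] := density_Rintegral (mpt t) (fun x => p0 (t, x)) (densp Gt) (igx t).
  have [j2 ->] := density_Rintegral (mpt t) (fun x => p0 (t, x)) (densp Gt) (igk t).
  by rewrite -(RintegralB mT j1 j2).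
rewrite e3 (RintegralB measurableT iF1 iF2).
pose ps w := B (V w) * phi w; pose psx w := B' (V w) * p w * phi w + B (V w) * p_dx phi w.
have iG : intg m2 setT (fun w => B' (V w) * p w ^+ 2 * phi w).
  exact: (intgM measurableT iBp mphi (fun w _ => hC w)).
have tp : test_pair p G ps psx.
  exists M, (a1 * C); split; split.
  - exact: measurable_funM.
  - by apply: measurable_funD; [apply: measurable_funM => //; exact: measurable_funM|exact: measurable_funM].
  - have := intgD measurableT iG iF1.
    by congr (intg _ _ _); apply/funext => w; rewrite /F1 /psx; ring.
  - exact: ltW.
  - by move=> w; rewrite normrM ler_pM// ?Ba1.
  - by move=> t x h; rewrite /ps /psx (z0 t x h : phi (t, x) = 0) (z1 t x h : p_dx phi (t, x) = 0) !mulr0 addr0.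
  move=> t Gt; pose VV (w : R * R) := V w; have cVV : continuous VV by exact: cV.
  have dBV (x : R) : is_derive x 1 (fun y => B (V (t, y))) (B' (V (t, x)) * p (t, x)).
    have h1 := dV Gt x; have h2 := dB (V01 (t, x)).
    exact: (@is_derive1_comp _ B (p_distfun (gam t)) x).
  split.
    move=> x; have h1 := dBV x; have h2 := sectder t x tphi.
    apply: (is_derive_eq (is_deriveM h1 h2)); rewrite /GRing.scale /psx /=; ring.
  move=> x; rewrite /psx; apply: cvgD; apply: cvgM.
  - apply: cvgM; last exact: cp.
    have cBV : continuous (B' \o (fun y => VV (t, y))).
      by move=> y; apply: continuous_comp; [exact: (seccont (g := VV))|exact: cB'].
    exact: cBV.
  - exact: (seccont (g := phi)).
  - exact: (is_derive_cont dBV).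
  - exact: (seccont (g := p_dx phi) c1).
have [j e4] := hz tp.
have e5 : \int[m2]_w (psx w * p w) = \int[m2]_w (B' (V w) * p w ^+ 2 * phi w) + \int[m2]_w F1 w.
  rewrite -(RintegralD measurableT iG iF1); apply: eq_Rintegral => w _.
  by rewrite /F1 /psx; ring.
have j' : intg m2 setT (fun w => B (V w) * second_derivative w * phi w).
  by move: j; congr (intg _ _ _); apply/funext => w; rewrite /ps /second_derivative; ring.
have e6 : \int[m2]_w (time_derivative w * phi w) =
   \int[m2]_w (B (V w) * second_derivative w * phi w) + \int[m2]_w (B' (V w) * p w ^+ 2 * phi w) + \int[m2]_w F2 w.
  rewrite -(RintegralD measurableT j' iG) -(RintegralD measurableT (intgD measurableT j' iG) iF2).
  by apply: eq_Rintegral => w _; rewrite /F2 /time_derivative; ring.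
have e7 : \int[m2]_w (B (V w) * second_derivative w * phi w) = - \int[m2]_w (psx w * p w).
  by rewrite -e4; apply: eq_Rintegral => w _; rewrite /ps /second_derivative; ring.
by rewrite e6 e7 e5; ring.
Qed.

End Regularity.

(** * Integrability of the derivatives *)

Section FinalBounds.
Context {R : realType}.
Local Notation leb := (@lebesgue_measure R).
Local Notation m2 := (leb \x leb)%E.
Variables (T : R) (p : R * R -> R).
Hypothesis mp : measurable_fun setT p.
Hypothesis p0 : forall z, 0 <= p z.

Lemma powR_le_cube (x r : R) : 0 <= x -> 1 <= r <= 3 -> x `^ r <= x + x ^+ 3.
Proof.
move=> x0 /andP[r1 r3]; have [x1|x1] := leP x 1.
  apply: (@le_trans _ _ x); last by rewrite lerDl exprn_ge0.
  have [->|xn] := eqVneq x 0; first by rewrite powR0// gt_eqF// (lt_le_trans ltr01).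
  rewrite -[leRHS](powRr1 x0); apply: ger_powR => //; by rewrite lt_def xn x0.
apply: (@le_trans _ _ (x ^+ 3)); last by rewrite lerDr.
by rewrite -powR_mulrn//; apply: ler_powR => //; exact: ltW.
Qed.

(* Compare u with c = v ^ (q / (2 (2 - q))): if u >= c, one bounds v ^ (q / 2) = c ^ (2 - q)
   by u ^ (2 - q); otherwise the left-hand side is at most c ^ 2 = v ^ (q / (2 - q)). *)
Lemma young_sqrt (q u v : R) : 6 / 5 <= q <= 3 / 2 -> 0 <= u -> 0 <= v ->
  (Num.sqrt v * u) `^ q <= u ^+ 2 + (v + v ^+ 3).
Proof.
move=> /andP[q1 q2] u0 v0.
have q0 : 0 < 2 - q by lra.
have qn : q != 0 by rewrite gt_eqF//; lra.
have q2n : 2 - q != 0 by rewrite gt_eqF.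
(* The range of q puts r in [3/2, 3]: v^r is then controlled by v and v^3, the two powers of the
   density known to be integrable. *)
pose r := q / (2 - q).
have r13 : 1 <= r <= 3.
  by rewrite /r ler_pdivlMr// ler_pdivrMr// mul1r; apply/andP; split; lra.
pose c := v `^ (r / 2).
have c0 : 0 <= c by exact: powR_ge0.
have c2 : c ^+ 2 <= v + v ^+ 3.
  by rewrite -powR_mulrn// -powRrM divfK ?pnatr_eq0//; exact: powR_le_cube.
have cE : Num.sqrt v `^ q = c `^ (2 - q).
  rewrite -powRrM /r -powR12_sqrt// -powRrM; congr (_ `^ _).
  by field; rewrite q2n.
have e2 (x : R) : 0 <= x -> x ^+ 2 = x `^ (2 - q) * x `^ q.
  by move=> x0; rewrite -powRD ?subrK ?powR_mulrn// pnatr_eq0.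
rewrite powRM ?sqrtr_ge0// cE; have [cu|uc] := leP c u.
  apply: (@le_trans _ _ (u ^+ 2)); last by rewrite lerDl addr_ge0 ?exprn_ge0.
  by rewrite e2// ler_wpM2r ?powR_ge0// ge0_ler_powR// ?nnegrE// ltW.
apply: (@le_trans _ _ (c ^+ 2)); last by apply: le_trans c2 _; rewrite lerDr exprn_ge0.
rewrite e2// ler_wpM2l ?powR_ge0// ge0_ler_powR// ?nnegrE// ?ltW//; lra.
Qed.

(** Where w = 0 the numerator vanishes too, so the convention 0/0 = 0 applies and the value +oo
    never occurs. *)
Lemma ratio_sqrt (w u : R) : 0 <= w -> p_ratio ((Num.sqrt w * u) ^+ 2) w = (if w == 0 then 0 else u ^+ 2)%:E.
Proof.
move=> w0; rewrite /p_ratio exprMn sqr_sqrtr//; case: eqVneq => [->|wn].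
  by rewrite mul0r eqxx.
by rewrite mulrAC divff// mul1r.
Qed.

Lemma sqrt_factor_bounds (z : R * R -> R) : measurable_fun setT z ->
  intg m2 setT (fun w => z w ^+ 2) -> intg m2 setT p -> intg m2 setT (fun w => p w ^+ 3) ->
  (forall q, 6 / 5 <= q <= 3 / 2 -> p_inLq T q (fun w => Num.sqrt (p w) * z w)) /\
  (\int[p_m2 R]_(w in p_RTo T) p_ratio ((Num.sqrt (p w) * z w) ^+ 2)%R (p w) < +oo)%E.
Proof.
move=> mz iz ip ip3; have mRT := @measurable_RTo R T.
have msq : measurable_fun setT (fun w => Num.sqrt (p w)).
  by apply: (measurableT_comp _ mp); exact: (continuous_measurable_fun (@sqrt_continuous R)).
have mw : measurable_fun setT (fun w => Num.sqrt (p w) * z w) by exact: measurable_funM.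
split.
  move=> q hq; split; first exact: measurable_funTS.
  have ib := intgS measurableT mRT (@subsetT _ _) (intgD measurableT iz (intgD measurableT ip ip3)).
  apply: le_lt_trans (intg_lty ib); apply: ge0_le_integral => //.
  - apply/measurable_EFinP; apply: measurable_funTS.
    apply: (measurableT_comp (measurable_powR q)).
    exact: measurableT_comp.
  - apply/measurable_EFinP; apply: measurableT_comp => //; exact: intg_meas ib.
  move=> w _; rewrite lee_fin; apply: le_trans (ler_norm _).
  rewrite normrM (ger0_norm (sqrtr_ge0 _)) -(real_normK (num_real (z w))).
  exact: young_sqrt.
have ib := intgS measurableT mRT (@subsetT _ _) iz.
apply: le_lt_trans (intg_lty ib).
apply: (@le_trans _ _ (\int[m2]_(w in p_RTo T) (if p w == 0 then 0 else z w ^+ 2)%:E)%E).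
  by rewrite le_eqVlt; apply/orP; left; apply/eqP; apply: eq_integral => w _; exact: ratio_sqrt.
apply: ge0_le_integral => //.
- by move=> w _; rewrite lee_fin; case: ifP => _; rewrite ?sqr_ge0.
- apply/measurable_EFinP; apply: measurable_funTS; apply: measurable_fun_ifT => //.
  + by apply: measurable_fun_eqr.
  + exact: measurable_funX.
- apply/measurable_EFinP; apply: measurableT_comp => //; exact: intg_meas ib.
by move=> w _; rewrite lee_fin; case: ifP => _ //; exact: ler_norm.
Qed.

(** p^2 is sqrt p times p^(3/2) and k p is sqrt p times k sqrt p; the squares of the second factors,
    p^3 and k^2 p, are integrable. *)
Lemma sqrt_factor_combination (z b c k : R * R -> R) (a L : R) : measurable_fun setT z ->
  measurable_fun setT b -> measurable_fun setT c -> measurable_fun setT k ->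
  (forall w, `|b w| <= a) -> (forall w, `|c w| <= L) ->
  intg m2 setT (fun w => z w ^+ 2) -> intg m2 setT (fun w => p w ^+ 3) ->
  intg m2 setT (fun w => k w ^+ 2 * p w) ->
  exists2 y : R * R -> R, measurable_fun setT y /\ intg m2 setT (fun w => y w ^+ 2) &
    forall w, b w * (Num.sqrt (p w) * z w) + c w * p w ^+ 2 + k w * p w = Num.sqrt (p w) * y w.
Proof.
move=> mz mb mc mk ba cL iz ip3 ik.
have msq : measurable_fun setT (fun w => Num.sqrt (p w)).
  by apply: (measurableT_comp _ mp); exact: (continuous_measurable_fun (@sqrt_continuous R)).
pose y w := b w * z w + c w * (p w * Num.sqrt (p w)) + k w * Num.sqrt (p w).
have my : measurable_fun setT y.
  apply: measurable_funD; last exact: measurable_funM.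
  by apply: measurable_funD; apply: measurable_funM => //; exact: measurable_funM.
exists y.
  split => //.
  have ib := intgD measurableT (intgD measurableT (intgZ (3 * a ^+ 2) measurableT iz)
    (intgZ (3 * L ^+ 2) measurableT ip3)) (intgZ 3 measurableT ik).
  apply: (intg_le measurableT _ ib) => [|w _]; first exact: measurable_funX.
  rewrite ger0_norm ?sqr_ge0//.
  have e : Num.sqrt (p w) ^+ 2 = p w by rewrite sqr_sqrtr.
  have b2 : b w ^+ 2 <= a ^+ 2.
    by rewrite -real_normK ?num_real// lerXn2r// nnegrE (le_trans (normr_ge0 _) (ba w)).
  have c2 : c w ^+ 2 <= L ^+ 2.
    by rewrite -real_normK ?num_real// lerXn2r// nnegrE (le_trans (normr_ge0 _) (cL w)).
  apply: (@le_trans _ _ (3 * ((b w * z w) ^+ 2 + (c w * (p w * Num.sqrt (p w))) ^+ 2 + (k w * Num.sqrt (p w)) ^+ 2))).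
    rewrite /y; move: (b w * z w) (c w * _) (k w * _) => r s t.
    have := sqr_ge0 (r - s); have := sqr_ge0 (s - t); have := sqr_ge0 (r - t); lra.
  rewrite !exprMn e !mulrDr; apply: lerD => //; apply: lerD.
    by rewrite -[leRHS]mulrA ler_pM2l// ler_wpM2r// sqr_ge0.
  by rewrite -[leRHS]mulrA ler_pM2l// -exprSr ler_wpM2r// exprn_ge0.
by move=> w; have := sqr_sqrtr (p0 w); rewrite /y; move: (Num.sqrt (p w)) => s <-; ring.
Qed.

End FinalBounds.

Lemma sum4_ge {R : realDomainType} (a b c d : R) : 0 <= a -> 0 <= b -> 0 <= c -> 0 <= d ->
  [/\ a <= a + b + c + d, b <= a + b + c + d, c <= a + b + c + d & d <= a + b + c + d].
Proof. by move=> a0 b0 c0 d0; split; lra. Qed.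

(** At times of [G] integrating against gam is integrating against p; at the others p vanishes, so
    the integral of f p can only be smaller. *)
Lemma weighted_density_integral {R : realType} (T : R) (gam : R -> probability R R)
    (p : R * R -> R) (G : set (measurableTypeR R)) (f : R -> R) :
  (forall B, measurable B -> measurable_fun setT (fun t => gam t B)) ->
  measurable_fun setT p -> (forall z, 0 <= p z) -> G `<=` `[0, T]%classic ->
  (forall t x, ~ G t -> p (t, x) = 0) ->
  (forall t, G t -> forall B, measurable B -> gam t B = (\int[@lebesgue_measure R]_(x in B) (p (t, x))%:E)%E) ->
  measurable_fun setT f -> (forall x, 0 <= f x) ->
  (\int[p_leb R]_(t in [set t : R | (0 <= t <= T)%R]) \int[gam t]_x (f x)%:E < +oo)%E ->
  (\int[p_m2 R]_(z in p_RTo T) (f z.2 * p z)%:E < +oo)%E.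
Proof.
move=> mgam mp p0 GI pbad densp mf f0.
have -> : [set t : R | 0 <= t <= T] = `[0, T]%classic by apply/seteqP; split => t; rewrite /= in_itv.
move=> fin.
have mI : measurable (`[0, T]%classic : set (measurableTypeR R)) by exact: measurable_itv.
have mh : measurable_fun setT (fun z : measurableTypeR R * measurableTypeR R => (f z.2 * p z)%:E).
  by apply/measurable_EFinP; apply: measurable_funM => //; exact: (measurableT_comp mf measurable_snd).
have h0 (z : measurableTypeR R * measurableTypeR R) : (0 <= (f z.2 * p z)%:E)%E.
  by rewrite lee_fin mulr_ge0.
apply: (@le_lt_trans _ _ (\int[p_m2 R]_z (f z.2 * p z)%:E)%E).
  by apply: ge0_subset_integral => //; exact: measurable_RTo.
rewrite /p_m2 fubini_tonelli1//; apply: le_lt_trans fin; rewrite [leRHS]integral_mkcond.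
have mfam : measurable_fun setT (fun t => \int[gam t]_x (f x)%:E)%E.
  apply: (measurable_int_fam mgam (f := fun z => (f z.2)%:E)) => [|z]; last by rewrite lee_fin.
  by apply/measurable_EFinP; exact: (measurableT_comp mf measurable_snd).
apply: ge0_le_integral => //.
- by move=> t _; apply: integral_ge0 => x _; exact: h0.
- exact: measurable_fun_fubini_tonelli_F.
- have mfI : measurable_fun (`[0, T]%classic : set (measurableTypeR R)) (fun t => \int[gam t]_x (f x)%:E)%E.
    exact: (@measurable_funTS _ _ (measurableTypeR R) _ _ _ mfam).
  exact: ((measurable_restrictT _ mI).1 mfI).
move=> t _; rewrite patchE /fubini_F; have [Gt|nG] := pselect (G t); last first.
  under eq_integral do rewrite /= pbad// mulr0.
  by rewrite integral0; case: ifP => // _; apply: integral_ge0 => x _; rewrite lee_fin.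
rewrite mem_set; last exact: GI.
have mpt : measurable_fun setT (fun x : R => p (t, x)) by exact: (measurableT_comp mp (measurable_pair1 t)).
by rewrite (density_integral mpt (fun x => p0 (t, x)) (densp _ Gt) mf f0).
Qed.

Unset Implicit Arguments.

Theorem theorem1p3 (R : realType) (T : R) (A : R -> R)
    (rho0 : probability R R) (theta : R -> R)
    (U : R * R -> R) (gamma : R -> probability R R) (h : R * R -> R) (iota : R) :
  0 < T ->
  p_assumption2 A rho0 theta ->
  {within p_RT T, continuous U} ->
  (exists M : R, forall p, p_RT T p -> `|U p| <= M) ->
  (forall t, 0 <= t <= T -> forall x, U (t, x) = p_distfun (gamma t) x) ->
  p_weak_cont T gamma ->
  (forall x, U (0, x) = p_distfun rho0 x) ->
  measurable_fun setT h ->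
  (\int[p_leb R]_(t in [set t : R | (0 <= t <= T)%R])
      \int[gamma t]_x ((h (t, x)) ^+ 2)%R%:E < +oo)%E ->
  p_gen_solution T A U gamma h ->
  0 < iota < 1 ->
  (\int[p_leb R]_(t in [set t : R | (0 <= t <= T)%R])
      \int[gamma t]_x (`|x| `^ (1 + iota))%R%:E < +oo)%E ->
  exists Rt Rx Rxx : R * R -> R,
    [/\ p_weak_dt T U Rt, p_weak_dx T U Rx & p_weak_dx T Rx Rxx] /\
    [/\ (forall q, 6 / 5 <= q <= 3 / 2 -> p_inLq T q Rt /\ p_inLq T q Rxx),
      p_inLq T 3%:R Rx,
      (\int[p_m2 R]_(p in p_RTo T) p_ratio (Rxx p ^+ 2)%R (Rx p) < +oo)%E,
      (\int[p_m2 R]_(p in p_RTo T) p_ratio (Rt p ^+ 2)%R (Rx p) < +oo)%E &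
      (\int[p_m2 R]_(p in p_RTo T) (`|p.2| `^ (1 + iota) * Rx p)%R%:E < +oo)%E].
Proof.
move=> T0 [Apos [[A' [dA [L0 A'L]]] [rhoE [dth [_ [th3 [_ [_ [_ mom0]]]]]]]]] cU _ UE _ U0 mh hfin gsol _ mom.
have [B [B' [a0 [a1 [L [[a0p LL BA cB'] [dB B'L BL]]]]]]] := coefficient_extension Apos dA A'L.
pose leb := @lebesgue_measure R.
pose gam := extended_curve T gamma; pose a := coef T gamma B; pose k := drift T gamma h B.
have cV : continuous (fun z : R * R => p_distfun (gam z.1) z.2) := extended_distfun_cont T0 cU UE.
have mgam : forall S, measurable S -> measurable_fun setT (fun t => gam t S).
  exact: extended_family_measurable T0 cU UE.
have ma : measurable_fun setT (fun z : R * R => a z.1 z.2) := coef_measurable T0 cU UE dB.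
have mk : measurable_fun setT (fun z : R * R => k z.1 z.2) := drift_measurable T0 cU UE mh dB.
have age t y : a0 <= a t y by exact: coef_ge BA t y.
have ale t y : a t y <= a1 by exact: coef_le BA t y.
have alip t x y : `|a t y - a t x| <= L * `|p_distfun (gam t) y - p_distfun (gam t) x|.
  exact: coef_lip BL t x y.
have ik2 t : intg (gam t) setT (fun y => k t y ^+ 2).
  exact: (drift_square_integrable T0 cU UE mh a0p BA dB t).
have ik t : intg (gam t) setT (k t) := drift_integrable T0 cU UE mh a0p BA dB t.
have iN : intg leb `[0, T]%classic (drift_energy gam k).
  exact: (drift_energy_integrable T0 cU UE mh hfin a0p BA dB).
have evo := @extended_evolution R T A U gamma h T0 cU UE mh hfin gsol B B' a0 a1 a0p BA dB.
(* Equality of the distribution functions at time 0 identifies the initial measure with [rho0] on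
   all measurable sets. *)
have gam0 S : measurable S -> gam 0 S = rho0 S.
  have z0 : 0 <= (0 : R) <= T by rewrite lexx ltW.
  apply: probability_eq => x y xy; rewrite !distfun_itv// /gam /extended_curve clamp_id//.
  by rewrite -!UE// !U0.
have mth : measurable_fun setT theta.
  apply: continuous_measurable_fun => x; apply/differentiable_continuous.
  by apply/derivable1_diffP; exact: dth.
(* The entropy estimates use a nonnegative density; the positive part of [theta] represents the same
   measure. *)
pose q x := Num.max (theta x) 0.
have q0 x : 0 <= q x by rewrite /q le_max lexx orbT.
have mq : measurable_fun setT q by exact: measurable_maxr.
have gamq S : measurable S -> gam 0 S = (\int[leb]_(x in S) (q x)%:E)%E.
  by move=> mS; rewrite gam0//; exact: (positive_part_density mth rhoE).
have q3 : (\int[leb]_x (q x ^+ 3)%:E < +oo)%E.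
  apply: le_lt_trans th3; apply: ge0_le_integral => //.
  - by move=> x _; rewrite lee_fin exprn_ge0.
  - by apply/measurable_EFinP; exact: measurable_funX.
  - apply/measurable_EFinP; apply: (measurableT_comp (measurable_powR _)); exact: measurableT_comp.
  move=> x _; rewrite lee_fin powR_mulrn// lerXn2r// ?nnegrE// /q ge_max ler_norm normr_ge0//.
have [Th init] := dens_square_bound mq q0 gamq q3.
have m0 : intg (gam 0) setT (fun y => `|y|).
  apply: intgP; first exact: normr_measurable.
  under eq_integral do rewrite normr_id.
  rewrite (@eq_measure_integral _ _ _ setT rho0 (gam 0) (fun y => (`|y|)%:E))// => S mS _.
  exact: gam0.
have i1 : intg leb `[0, T]%classic (cst (1 : R)) by apply: intg_cont_seg => z; exact: cvg_cst.
have mT : intg (gam T) setT (fun y => `|y|).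
  have mI : measurable (`[0, T]%classic : set (measurableTypeR R)) by exact: measurable_itv.
  have iN1 : intg leb `[0, T]%classic (fun s => 1 + drift_energy gam k s) := intgD mI i1 iN.
  have abd t y : `|a t y| <= a1 by rewrite ger0_norm// (le_trans (ltW a0p) (age t y)).
  have kN t : \int[gam t]_y `|k t y| <= 1 + drift_energy gam k t.
    exact: (int_absk mk ik2 t).
  exact: (moment_bound T0 mgam ma mk abd ik kN iN1 evo m0).
have small eta : 0 < eta -> exists2 l : R, 0 < l &
    forall t z, 0 <= t <= T -> p_distfun (gam t) (z + l) - p_distfun (gam t) z <= eta.
  exact: (uniform_small_mass T cV).
have [C hC] := energy_bound T0 mgam a0p ma mk age ale alip ik2 iN evo small init mT.
have iEn n : intg leb `[0, T]%classic (fun t => \int[leb]_x fdens (gam t) n.+1%:R n.+1%:R^-1 x).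
  by apply: intg_fdens_time => //; rewrite ?invr_gt0 ltr0n.
have EnC n : \int[leb]_(t in `[0, T]) \int[leb]_x fdens (gam t) n.+1%:R n.+1%:R^-1 x <= C.
  by apply: hC; rewrite ?ler1n ?invr_gt0 ?ltr0n// invf_le1 ?ltr0n// ler1n.
have [p [G [K [[mp p0 mG GI] [[null pbad K0 iK] reg]]]]] := regular_family T0 cV iEn EnC.
have cp t : G t -> continuous (fun x => p (t, x)) by move=> /reg[[]].
have dV t : G t -> forall x : R, is_derive x 1 (p_distfun (gam t)) (p (t, x)) by move=> /reg[[]].
have densp t : G t -> forall S, measurable S -> gam t S = (\int[leb]_(x in S) (p (t, x))%:E)%E.
  by move=> /reg[[]].
have cube t : G t -> (\int[leb]_x (p (t, x) ^+ 3)%:E <= (2 + 4 * K t)%:E)%E by move=> /reg[[]].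
have parts t : G t -> forall (M : R) (ps ps' : R -> R), 0 <= M ->
    (forall x : R, is_derive x 1 ps (ps' x)) -> continuous ps' -> ps M = 0 -> ps (- M) = 0 ->
    (\int[leb]_(x in `[- M, M]) (ps' x * p (t, x))) ^+ 2 <= K t * \int[leb]_(x in `[- M, M]) (ps x ^+ 2 * p (t, x)).
  by move=> /reg[].
have ptot t : G t -> (\int[leb]_x (p (t, x))%:E = 1)%E := density_total densp (t := t).
have [z [mz iz hz]] := second_derivative_density mp p0 mG GI pbad K0 iK ptot parts.
have mV : measurable_fun setT (fun w : R * R => p_distfun (gam w.1) w.2).
  exact: plane_continuous_measurable.
have cU' t : continuous (p_distfun (gam t)).
  move=> x; pose V w := p_distfun (gam w.1) w.2; have cV' : continuous V by exact: cV.
  have hp : (fun y : R => (t, y)) y @[y --> x] --> (t, x) by exact: (cvg_pair (cvg_cst t) cvg_id).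
  exact: (cvg_comp _ _ hp (cV' (t, x))).
have weak phi : p_testfun T phi ->
    \int[leb]_(s in `[0, T]) \int[leb]_x (p_distfun (gam s) x * p_dt phi (s, x)) =
    \int[leb]_(s in `[0, T]) (\int[gam s]_y (a s y * p_dx phi (s, y)) - \int[gam s]_y (k s y * phi (s, y))).
  move=> tphi; have [M M0 bds] := testfun_bounds tphi; have [sm _] := tphi.
  have [c0 [C0 h0] z0 t0] := bds [::]; have [ct [Ct ht] zt _] := bds [:: true].
  have [c1 [C1 h1] z1 _] := bds [:: false]; have [_ [C2 h2] _ _] := bds [:: false; false].
  have pos (g : R * R -> R) (D : R) : (forall w, `|g w| <= D) -> 0 <= D.
    by move=> /(_ 0); exact: le_trans (normr_ge0 _).
  have [p0' pt' p1' p2'] : [/\ 0 <= C0, 0 <= Ct, 0 <= C1 & 0 <= C2].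
    by split; [exact: pos h0|exact: pos ht|exact: pos h1|exact: pos h2].
  have dx (w : seq bool) (t x : R) : is_derive x 1 (fun y => p_iterd w phi (t, y)) (p_iterd (false :: w) phi (t, x)).
    by apply: derivable_is_derive1; have [_ d] := sm w; exact: (d (t, x)).2.
  (* One constant must bound phi, its first derivatives and the Lipschitz constant of phi_x; the sum
     of the four bounds serves. *)
  have leD := sum4_ge p0' pt' p1' p2'.
  have le0 w : `|phi w| <= C0 + Ct + C1 + C2 by case: leD => d _ _ _; exact: le_trans (h0 w) d.
  have le1 w : `|p_dx phi w| <= C0 + Ct + C1 + C2 by case: leD => _ _ d _; exact: le_trans (h1 w) d.
  apply: (@weak_time R T gam a k a0 a1 T0 mgam a0p ma mk age ale ik2 iN evo cU' mV phi (p_dt phi) (p_dx phi)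
    (C0 + Ct + C1 + C2) M) => //.
  - by move=> w; case: leD => _ d _ _; exact: le_trans (ht w) d.
  - move=> t x; apply: derivable_is_derive1; have [_ d] := sm [::]; exact: (d (t, x)).1.
  - move=> t x; exact: (dx [::]).
  - move=> t x y; exact: (bounded_derivative_lipschitz (dx [::] t) (fun x => le1 (t, x))).
  - move=> t x y; apply: (bounded_derivative_lipschitz (dx [:: false] t)) => v.
    by case: leD => _ _ _ d; exact: le_trans (h2 (t, v)) d.
  - exact: ltW.
  - by move=> t x /ltW xM; split; [exact: z0|exact: zt|exact: z1].
  - by move=> x; apply: t0; rewrite ltxx.
  - by move=> x; apply: t0; rewrite ltxx andbF.
have Ba1 y : 0 <= y <= 1 -> `|B y| <= a1.
  by move=> /BA[_ /andP[h1 h2]]; rewrite ger0_norm// (le_trans (ltW a0p)).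
have UV w : p_RTo T w -> p_distfun (gam w.1) w.2 = U w.
  case: w => t x /andP[/= /ltW t0 /ltW tT]; have tT' : 0 <= t <= T by rewrite t0.
  by rewrite UE// /gam /extended_curve clamp_id.
have ip := intg_density mp p0 mG GI pbad densp.
have ip3 := intg_cube mp p0 mG GI pbad iK cube.
have idr := intg_drift mk ik2 iN mp p0 mG GI pbad densp.
have mB' : measurable_fun setT (fun w : R * R => B' (p_distfun (gam w.1) w.2)).
  exact: (measurableT_comp (continuous_measurable_fun cB') mV).
have aa1 (w : R * R) : `|a w.1 w.2| <= a1 by rewrite ger0_norm// (le_trans (ltW a0p)).
(* The candidate for R_t takes the same form as R_xx, sqrt p times a function of L2, so that one
   lemma bounds both. *)
have [y [my iy] ty] := sqrt_factor_combination mp p0 mz ma mB' mk aa1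
  (fun w => B'L (p_distfun (gam w.1) w.2)) iz ip3 idr.
have [Lqz ratioz] := sqrt_factor_bounds T mp p0 mz iz ip ip3.
have [Lqy ratioy] := sqrt_factor_bounds T mp p0 my iy ip ip3.
exists (fun w => Num.sqrt (p w) * y w), p, (fun w => Num.sqrt (p w) * z w).
split; split.
- rewrite (_ : (fun w => _) = time_derivative gam B B' k p z); last first.
    by apply/funext => w; rewrite -ty.
  apply: (weak_dt_eq UV).
  exact: (weak_dt_distfun cV dB cB' B'L Ba1 mk ik ik2 iN mp p0 mG GI null pbad iK cp dV densp cube mz iz hz weak).
- exact: (weak_dx_eq UV (weak_dx_distfun cV mp p0 mG GI null pbad cp dV densp)).
- exact: (weak_dx_density mp p0 mG GI pbad densp mz iz hz).
- by move=> r hr; split; [exact: Lqy|exact: Lqz].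
- split; first exact: measurable_funTS.
  apply: le_lt_trans (intg_lty (intgS measurableT (@measurable_RTo R T) (@subsetT _ _) ip3)).
  rewrite le_eqVlt; apply/orP; left; apply/eqP; apply: eq_integral => w _.
  by rewrite powR_mulrn// normrX.
- exact: ratioz.
- exact: ratioy.
apply: (@weighted_density_integral R T gam p G (fun x => `|x| `^ (1 + iota))) => //.
- by apply: (measurableT_comp (measurable_powR _)); exact: normr_measurable.
move: mom; congr (_ < _)%E; apply: eq_integral => t /set_mem /= tT.
by rewrite /gam /extended_curve clamp_id.
Qed.
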